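(* Let $K/k$ be a finite Galois extension with group $G\simeq\operatorname{Gal}(K/k)$, and let $M$ be a decomposable $G$-lattice, i.e. $M=M_1\oplus M_2$ as $\mathbb{Z}[G]$-modules with $1\le\operatorname{rank}_{\mathbb{Z}}M_1<\operatorname{rank}_{\mathbb{Z}}M$. Then: (1) If $k$ is an infinite field, $K(M)^G$ is retract $k$-rational if and only if both $K(M_1)^G$ and $K(M_2)^G$ are retract $k$-rational. (2) If $K(M_1)^G$ and $K(M_2)^G$ are $k$-rational, then so is $K(M)^G$. (3) If $\operatorname{rank}_{\mathbb{Z}}M_i\le 3$ for $i=1,2$, then $K(M)^G$ is $k$-rational if and only if both $K(M_1)^G$ and $K(M_2)^G$ are $k$-rational.
   Context: A $G$-lattice is a finitely generated $\mathbb{Z}[G]$-module free as an abelian group. For a $G$-lattice $L=\bigoplus_{i=1}^n\mathbb{Z}z_i$ with $\sigma\cdot z_j=\sum_i a_{ij}z_i$, $K(L)$ denotes the rational function field $K(z_1,\ldots,z_n)$ on which $G$ acts through its Galois action on $K$ and by $\sigma(z_j)=\prod_i z_i^{a_{ij}}$; $K(L)^G$ is the fixed field (the function field of the algebraic $k$-torus with character lattice $L$). $k$-rational means purely transcendental over $k$. For infinite $k$, a field $F\supset k$ is retract $k$-rational if $F$ is the quotient field of a domain $A$ with $k\subset A\subset F$ such that there exist a polynomial ring $k[X_1,\ldots,X_m]$, a nonzero $f$ in it and $k$-algebra morphisms $\varphi:A\to k[X_1,\ldots,X_m][1/f]$, $\psi:k[X_1,\ldots,X_m][1/f]\to A$ with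 $\psi\circ\varphi=\mathrm{id}_A$. *)

(* Defs.v *)
From HB Require Import structures.
From mathcomp Require Import all_boot all_order all_algebra all_fingroup all_field.
From mathcomp Require Import zify mpoly.
From mathcomp Require Import boolp.

Set Implicit Arguments.
Unset Strict Implicit.
Unset Printing Implicit Defensive.

Import GRing.Theory.
Local Open Scope ring_scope.

Local Notation repr := generic_quotient.repr.

Definition subring_of (E : fieldType) (A : subringClosed E) := {x : E | x \in A}.
HB.instance Definition _ E A := SubChoice.on (@subring_of E A).
HB.instance Definition _ E A :=
  [SubChoice_isSubComNzRing of @subring_of E A by <:].

Definition subfield_of (E : fieldType) (A : divringClosed E) := {x : E | x \in A}.
HB.instance Definition _ E A := SubChoice.on (@subfield_of E A).
HB.instance Definition _ E A :=
  [SubChoice_isSubIntegralDomain of @subfield_of E A by <:].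
HB.instance Definition _ E A :=
  [SubIntegralDomain_isSubField of @subfield_of E A by <:].

Definition in_subfield (E : fieldType) (A : divringClosed E) x (Ax : x \in A) :
  subfield_of A := exist _ x Ax.

(* The extension to {fraction R} of an injective morphism from R to a field. *)
Section FracLift.
Variables (R : idomainType) (F : fieldType) (phi : {rmorphism R -> F}).

Definition fraclift (x : {fraction R}) : F :=
  phi \n_(repr x) / phi \d_(repr x).

Lemma fracE (x : {fraction R}) :
  x = tofrac \n_(repr x) / tofrac \d_(repr x).
Proof.
have d0 : \d_(repr x) != 0 by apply: denom_ratioP.
apply: (canRL (mulfK _)); first by rewrite tofrac_eq0.
rewrite -{1}[x]reprK; move: (repr x) d0 => r d0.
unlock tofrac; rewrite !piE /FracField.mulf.
apply/eqmodP; rewrite /= FracField.equivfE /= !numden_Ratio ?mulr1 ?oner_neq0 //.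
by rewrite mulrC.
Qed.

Hypothesis phi_inj : injective phi.

Lemma fraclift_frac n d : d != 0 -> fraclift (tofrac n / tofrac d) = phi n / phi d.
Proof.
move=> d0; rewrite /fraclift; set x := tofrac n / tofrac d.
have d0' : \d_(repr x) != 0 by apply: denom_ratioP.
have phi0 y : y != 0 -> phi y != 0 by rewrite -(rmorph0 phi) (inj_eq phi_inj).
apply/eqP; rewrite eqr_div ?phi0 // -!rmorphM (inj_eq phi_inj).
rewrite -tofrac_eq !rmorphM /= -eqr_div ?tofrac_eq0 //.
by rewrite -fracE.
Qed.

Lemma fracP (x : {fraction R}) :
  exists n d, d != 0 /\ x = tofrac n / tofrac d.
Proof.
exists \n_(repr x), \d_(repr x); split; first exact: denom_ratioP.
exact: fracE.
Qed.

Lemma fraclift_tofrac r : fraclift (tofrac r) = phi r.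
Proof.
by rewrite -[tofrac r]divr1 -(rmorph1 (@tofrac R)) fraclift_frac ?oner_neq0 //
  rmorph1 divr1.
Qed.

Lemma fraclift_is_zmod_morphism : zmod_morphism fraclift.
Proof.
move=> x y; have [n [d [d0 ->]]] := fracP x; have [m [e [e0 ->]]] := fracP y.
have phi0 z : z != 0 -> phi z != 0 by rewrite -(rmorph0 phi) (inj_eq phi_inj).
rewrite !fraclift_frac // -mulNr -mulNr !addf_div ?phi0 ?tofrac_eq0 //.
rewrite -!(rmorphN, rmorphM, rmorphD) /= fraclift_frac ?mulf_neq0 //.
Qed.

Lemma fraclift_is_monoid_morphism : monoid_morphism fraclift.
Proof.
split=> [|x y]; first by rewrite -(rmorph1 (@tofrac R)) fraclift_tofrac rmorph1.
have [n [d [d0 ->]]] := fracP x; have [m [e [e0 ->]]] := fracP y.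
rewrite !fraclift_frac // !mulf_div -!rmorphM /= fraclift_frac ?mulf_neq0 //.
Qed.

End FracLift.

Section MonomialInjective.
Variables (K : fieldType) (n : nat).
Local Notation F := {fraction {mpoly K[n]}}.
Local Notation X i := (tofrac ('X_i : {mpoly K[n]})).

Definition fracC : K -> F := @tofrac {mpoly K[n]} \o @mpolyC n K.
HB.instance Definition _ := GRing.RMorphism.on fracC.

Definition laurent (b : 'I_n -> int) : F := \prod_i X i ^ b i.

Definition monomial_map (s : {rmorphism K -> K}) (a : 'I_n -> 'I_n -> int) :
  {mpoly K[n]} -> F := mmap (fracC \o s) (fun j => laurent (a j)).
HB.instance Definition _ s a := GRing.RMorphism.on (monomial_map s a).

Lemma X_neq0 i : X i != 0.
Proof.
rewrite tofrac_eq0; apply/eqP=> /(congr1 (mcoeff U_(i))).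
by rewrite mcoeffX eqxx mcoeff0 => /eqP; rewrite oner_eq0.
Qed.

Lemma laurent_neq0 b : laurent b != 0.
Proof. by apply/prodf_neq0 => i _; rewrite expfz_neq0 // X_neq0. Qed.

Variables (s s' : {rmorphism K -> K}) (a a' : 'I_n -> 'I_n -> int).
Hypothesis sK : cancel s s'.
Hypothesis aK : forall j l, \sum_i a j i * a' i l = (j == l)%:R.

Lemma monomial_mapC t b c : monomial_map t b c%:MP = fracC (t c).
Proof. by rewrite /monomial_map mmapC. Qed.

Lemma monomial_mapX t b i : monomial_map t b 'X_i = laurent (b i).
Proof. by rewrite /monomial_map mmapX mmap1U. Qed.

Lemma prod_exprz (I : finType) (f : I -> F) (m : int) :
  (\prod_i f i) ^ m = \prod_i f i ^ m.
Proof.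
elim/big_rec2: _ => [|i y x _ <-]; first by rewrite exp1rz.
by rewrite expfzMl.
Qed.

Lemma exprz_sum (I : finType) (x : F) (m : I -> int) : x != 0 ->
  x ^ (\sum_i m i) = \prod_i x ^ m i.
Proof.
move=> x0; elim/big_rec2: _ => [|i y z _ <-]; first by rewrite expr0z.
by rewrite expfzDr.
Qed.

Lemma laurent_aK j : \prod_i laurent (a' i) ^ a j i = X j.
Proof.
under eq_bigr => i _ do rewrite prod_exprz.
rewrite exchange_big /=.
have XE l : \prod_i (X l ^ a' i l) ^ a j i = X l ^ Posz (j == l).
  under eq_bigr => i _ do rewrite exprz_exp mulrC.
  by rewrite -exprz_sum ?X_neq0 // aK natz.
under eq_bigr => l _ do rewrite XE.
rewrite (bigD1 j) //= eqxx expr1z big1 ?mulr1 // => l.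
by rewrite eq_sym => /negbTE->; rewrite expr0z.
Qed.

Let Phi : {rmorphism {mpoly K[n]} -> F} := monomial_map s a.
Let Phi' : {rmorphism {mpoly K[n]} -> F} := monomial_map s' a'.
Let good (p : {mpoly K[n]}) := exists (q : {mpoly K[n]}) (m : 'X_{1..n}),
  Phi p * tofrac 'X_[m] = tofrac q /\ Phi' q = tofrac p * Phi' 'X_[m].

Let Phi'X m : Phi' 'X_[m] = \prod_i laurent (a' i) ^+ m i.
Proof. by rewrite /Phi' /= /monomial_map mmapX. Qed.

Let Phi'X_neq0 m : Phi' 'X_[m] != 0.
Proof. by rewrite Phi'X; apply/prodf_neq0 => i _; rewrite expf_neq0 ?laurent_neq0. Qed.

Let goodC c : good c%:MP.
Proof.
exists (s c)%:MP, 0%MM; rewrite /Phi /Phi' mpolyX0 !rmorph1 !mulr1.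
by rewrite /= !monomial_mapC sK.
Qed.

Let goodD p q : good p -> good q -> good (p + q).
Proof.
move=> [u [m [h1 h2]]] [v [l [h3 h4]]].
exists (u * 'X_[l] + v * 'X_[m]), (m + l)%MM; split.
  rewrite mpolyXD !rmorphD !rmorphM /= -h1 -h3 mulrDl; congr (_ + _).
    by rewrite mulrA.
  by rewrite -!mulrA; congr (_ * _); rewrite mulrC.
rewrite mpolyXD !rmorphD !rmorphM /= h2 h4 mulrDl; congr (_ + _).
  by rewrite mulrA.
by rewrite -!mulrA; congr (_ * _); rewrite mulrC.
Qed.

Let goodM p q : good p -> good q -> good (p * q).
Proof.
move=> [u [m [h1 h2]]] [v [l [h3 h4]]].
exists (u * v), (m + l)%MM; rewrite mpolyXD !rmorphM /= -h1 -h3 h2 h4.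
by split; rewrite mulrACA.
Qed.

Let goodX j : good 'X_j.
Proof.
pose m : 'X_{1..n} := [multinom absz (a j i) | i < n].
pose q : 'X_{1..n} := [multinom absz (a j i + Posz (absz (a j i)))%R | i < n].
have qE i : (q i)%:Z = a j i + (m i)%:Z.
  rewrite !mnmE gez0_abs //; case: (a j i) => k; lia.
exists 'X_[q], m; rewrite !Phi'X /Phi /= monomial_mapX.
have XE l : tofrac ('X_[l] : {mpoly K[n]}) = \prod_i X i ^ (l i)%:Z.
  by rewrite mpolyXE_id rmorph_prod; apply: eq_bigr => i _; rewrite rmorphXn.
split.
  rewrite !XE -big_split /=; apply: eq_bigr => i _.
  by rewrite qE expfzDr ?X_neq0.
rewrite -laurent_aK -big_split /=; apply: eq_bigr => i _.
by rewrite -![_ ^+ _]/(_ ^ Posz _) qE expfzDr ?laurent_neq0.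
Qed.

Let good_all p : good p.
Proof.
elim/mpolyind: p => [|c m p _ _ IH]; first by rewrite -mpolyC0; apply: goodC.
apply: goodD => //; rewrite -mul_mpolyC; apply: goodM; first exact: goodC.
rewrite mpolyXE_id; elim/big_ind: _ => [||i _].
- by rewrite -mpolyC1; apply: goodC.
- exact: goodM.
elim: (m i) => [|k IHk]; first by rewrite expr0 -mpolyC1; apply: goodC.
by rewrite exprS; apply: goodM.
Qed.

Lemma monomial_map_inj : injective (monomial_map s a).
Proof.
apply: raddf_inj => p p0; have [q [m []]] := good_all p.
rewrite /Phi /= p0 mul0r => /esym/eqP; rewrite tofrac_eq0 => /eqP->.
rewrite rmorph0 => /esym/eqP; rewrite mulf_eq0 (negbTE (Phi'X_neq0 m)) orbF.
by rewrite tofrac_eq0 => /eqP.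
Qed.

End MonomialInjective.

Definition zcomb (M : zmodType) n (z : 'I_n -> M) (c : {ffun 'I_n -> int}) : M :=
  \sum_i z i *~ c i.

(* A G-lattice with a chosen Z-basis lbasis, which serves to form K(L); lbasisP
   says that the lattice is the direct sum of the Z z_i.  As everywhere in MathComp, G acts on the
   right: act x (g * h) = act (act x g) h.  This is the convention for which
   evaluation of Galois automorphisms is an action, since
   (g * h) c = h (g c) for g h : gal_of E (galM). *)
Record glattice (gT : finGroupType) (G : {group gT}) := GLattice {
  lcarrier :> zmodType;
  lact : action G lcarrier;
  rank : nat;
  lbasis : 'I_rank -> lcarrier;
  lactD : {in G, forall g, {morph lact^~ g : x y / x + y}};
  lbasisP : bijective (zcomb lbasis)
}.
Arguments lbasis {gT G} L i : rename.

Section Lattice.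
Variables (gT : finGroupType) (G : {group gT}).
Implicit Types L : glattice G.

Lemma lbasis_ex L (x : L) : exists c, zcomb (lbasis L) c == x.
Proof. by have [d _ dK] := lbasisP L; exists (d x); rewrite dK. Qed.

Definition lcoord L (x : L) : {ffun 'I_(rank L) -> int} := xchoose (lbasis_ex x).

Lemma lcoordK L (x : L) : zcomb (lbasis L) (lcoord x) = x.
Proof. exact/eqP/(xchooseP (lbasis_ex x)). Qed.

(* a_ij is lmatrix L g j i: g . z_j = \sum_i (lmatrix L g j i) z_i *)
Definition lmatrix L (g : gT) (j i : 'I_(rank L)) : int :=
  lcoord (lact L (lbasis L j) g) i.

Arguments lmatrix : clear implicits.

Lemma lmatrixK L g : g \in G ->
  forall j l, \sum_i lmatrix L g j i * lmatrix L g^-1%g i l = (j == l)%:R.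
Proof.
move=> Gg j l; set z := lbasis L.
have lactB h : h \in G -> zmod_morphism (lact L ^~ h).
  move=> Gh x y; have lact0 : lact L 0 h = 0.
    by apply: (addrI (lact L 0 h)); rewrite -lactD // !addr0.
  by rewrite lactD //; congr (_ + _); apply/eqP;
    rewrite -addr_eq0 -lactD // addNr lact0.
pose f h (Gh : h \in G) : {additive L -> L} := HB.pack (lact L ^~ h)
  (GRing.isZmodMorphism.Build _ _ _ (lactB h Gh)).
have Gg' : g^-1%g \in G by rewrite groupV.
have zE i : lact L (z i) g^-1%g = zcomb z [ffun l => lmatrix L g^-1%g i l].
  by rewrite -[LHS]lcoordK; apply: eq_bigr => k _; rewrite ffunE.
have e1 : zcomb z [ffun l => \sum_i lmatrix L g j i * lmatrix L g^-1%g i l] = z j.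
  have <- : lact L (lact L (z j) g) g^-1%g = z j.
    have [inj hM] : is_action G (lact L) by case: (lact L).
    rewrite -hM // mulgV; apply: (inj 1%g); by rewrite -hM ?group1 // mulg1.
  rewrite -[lact L (z j) g]lcoordK -[lact L _ _]/(f _ Gg' _) raddf_sum /=.
  rewrite /zcomb; transitivity
    (\sum_l \sum_i z l *~ (lmatrix L g j i * lmatrix L g^-1%g i l)).
    by apply: eq_bigr => i _; rewrite ffunE mulrz_sumr.
  rewrite exchange_big /=; apply: eq_bigr => i _.
  rewrite -[lact L _ _]/(f _ Gg' _) raddfMz /= zE /zcomb mulrz_suml; apply: eq_bigr => k _.
  by rewrite ffunE mulrC mulrzA.
have e2 : zcomb z [ffun l => (j == l)%:R] = z j.
  rewrite /zcomb (bigD1 j) //= ffunE eqxx mulr1z big1 ?addr0 // => i.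
  by rewrite ffunE eq_sym => /negbTE->; rewrite mulr0z.
have /ffunP/(_ l) := bij_inj (lbasisP L) (etrans e1 (esym e2)).
by rewrite !ffunE.
Qed.

Definition direct_sum (M M1 M2 : glattice G) : Prop :=
  exists f : {additive M1 * M2 -> M}, bijective f /\
    {in G, forall g x, f (lact M1 x.1 g, lact M2 x.2 g) = lact M (f x) g}.
End Lattice.

Arguments lmatrix {gT G} L g j i.

Section FixedField.
Variables (k : fieldType) (K : splittingFieldType k).
Variables (gT : finGroupType) (G : {group gT}).
Variables (gal : {morphism G >-> gal_of {:K}}) (L : glattice G).

Local Notation ratfun := {fraction {mpoly K[rank L]}}.

(* The action of G on K(L) = ratfun; see ratfun_actC and ratfun_actX for its
   values on K and on the z_j = 'X_j. *)
Definition ratfun_act (g : gT) : ratfun -> ratfun :=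
  fraclift (monomial_map (gal_repr (gal g)) (lmatrix L g)).

Lemma galK g : g \in G -> cancel (gal g) (gal g^-1%g).
Proof.
by move=> Gg c; rewrite -galM ?memvf // -morphM ?groupV // mulgV morph1 gal_id.
Qed.

Lemma ratfun_map_inj g : g \in G ->
  injective (monomial_map (gal_repr (gal g)) (lmatrix L g)).
Proof. by move=> Gg; exact: monomial_map_inj (galK Gg) (lmatrixK Gg). Qed.

Lemma ratfun_actE g p q : g \in G -> q != 0 ->
  let phi := monomial_map (gal_repr (gal g)) (lmatrix L g) in
  ratfun_act g (tofrac p / tofrac q) = phi p / phi q.
Proof. by move=> Gg q0; exact: fraclift_frac (ratfun_map_inj Gg) _ _ q0. Qed.

Lemma ratfun_act_zmod g : g \in G -> zmod_morphism (ratfun_act g).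
Proof. by move=> Gg; exact: fraclift_is_zmod_morphism (ratfun_map_inj Gg). Qed.

Lemma ratfun_act_monoid g : g \in G -> monoid_morphism (ratfun_act g).
Proof. by move=> Gg; exact: fraclift_is_monoid_morphism (ratfun_map_inj Gg). Qed.

Lemma ratfun_actC g c : g \in G -> ratfun_act g (fracC _ c) = fracC _ (gal g c).
Proof.
by move=> Gg; rewrite [LHS](fraclift_tofrac (ratfun_map_inj Gg)) /= monomial_mapC.
Qed.

Lemma ratfun_actX g j : g \in G ->
  ratfun_act g (tofrac 'X_j) =
  \prod_i (tofrac ('X_i : {mpoly K[rank L]})) ^ lmatrix L g j i.
Proof.
by move=> Gg; rewrite [LHS](fraclift_tofrac (ratfun_map_inj Gg)) /= monomial_mapX.
Qed.

Definition fixed : {pred ratfun} :=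
  fun x => [forall (g | g \in G), ratfun_act g x == x].

Lemma fixedP x : reflect {in G, forall g, ratfun_act g x = x} (x \in fixed).
Proof. by apply: (iffP forall_inP) => h g Gg; apply/eqP/h. Qed.

Lemma fixed_divring_closed : divring_closed fixed.
Proof.
split=> [|x y /fixedP xf /fixedP yf|x y /fixedP xf /fixedP yf].
- by apply/fixedP => g Gg; have [] := ratfun_act_monoid Gg.
- by apply/fixedP => g Gg; rewrite ratfun_act_zmod // xf // yf.
apply/fixedP => g Gg.
pose f : {rmorphism ratfun -> ratfun} := HB.pack (ratfun_act g)
  (GRing.isZmodMorphism.Build _ _ _ (ratfun_act_zmod Gg))
  (GRing.isMonoidMorphism.Build _ _ _ (ratfun_act_monoid Gg)).
by rewrite -[ratfun_act g]/(f : _ -> _) fmorph_div /= xf // yf.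
Qed.
HB.instance Definition _ :=
  GRing.isDivringClosed.Build ratfun fixed fixed_divring_closed.

Definition fixfield : fieldType := subfield_of fixed.

Lemma fixed_base c : fracC (rank L) (c%:A : K) \in fixed.
Proof.
by apply/fixedP => g Gg; rewrite ratfun_actC // linearZ /= rmorph1.
Qed.

Definition base (c : k) : fixfield :=
  in_subfield (fixed_base c : _ \in (fixed : divringClosed _)).

Lemma base_zmod : zmod_morphism base.
Proof. by move=> c d; apply: val_inj; rewrite /= -rmorphB -scalerBl. Qed.

Lemma base_monoid : monoid_morphism base.
Proof.
split=> [|c d]; apply: val_inj; rewrite /= ?scale1r ?rmorph1 //.
by rewrite -rmorphM -scalerAl mul1r scalerA.
Qed.
HB.instance Definition _ := GRing.isZmodMorphism.Build k fixfield base base_zmod.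
HB.instance Definition _ :=
  GRing.isMonoidMorphism.Build k fixfield base base_monoid.

End FixedField.

Arguments ratfun_act {k K gT G} gal L g x.
Arguments fixed {k K gT G} gal L.
Arguments fixfield {k K gT G} gal L.
Arguments base {k K gT G} gal L c.

Section Localization.
Variables (R : idomainType) (f : R).

(* R[1/f] inside the fraction field of R, when f != 0 (otherwise this is the
   whole fraction field): x = p / f ^ e is written without division. *)
Definition away : {pred {fraction R}} :=
  fun x => `[< exists e p, x * tofrac f ^+ e = tofrac p >].

Lemma awayP x :
  reflect (exists e p, x * tofrac f ^+ e = tofrac p) (x \in away).
Proof. exact: asboolP. Qed.

Lemma away_subring_closed : subring_closed away.
Proof.
split=> [|x y /awayP[e [p xp]] /awayP[d [q yq]]
         |x y /awayP[e [p xp]] /awayP[d [q yq]]]; apply/awayP.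
- by exists 0, 1; rewrite mulr1 rmorph1.
- exists (e + d)%N, (p * f ^+ d - q * f ^+ e).
  rewrite rmorphB !rmorphM !rmorphXn /= -xp -yq mulrBl exprD !mulrA.
  by congr (_ - _); rewrite mulrAC.
- by exists (e + d)%N, (p * q); rewrite exprD rmorphM /= -xp -yq mulrACA.
Qed.
HB.instance Definition _ :=
  GRing.isSubringClosed.Build {fraction R} away away_subring_closed.

End Localization.

Section Rationality.
Variables (k F : fieldType) (iota : {rmorphism k -> F}).

(* F, an extension of k through iota, is k(t_1, ..., t_n) with the t_i
   algebraically independent over k *)
Definition rational : Prop :=
  exists n (t : 'I_n -> F),
    (forall p : {mpoly k[n]}, mmap iota t p = 0 -> p = 0) /\
    (forall x : F, exists p q : {mpoly k[n]},
       mmap iota t q != 0 /\ x = mmap iota t p / mmap iota t q).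

(* A is a subring of F containing k with fraction field F.  As k is embedded in
   F and in k[X][1/f] rather than in the subrings, k-linearity of phi and psi is
   stated on the elements of these subrings coming from k. *)
Definition retract_rational : Prop :=
  exists A : subringClosed F,
    [/\ forall c, iota c \in A,
        forall x : F, exists a b, [/\ a \in A, b \in A, b != 0 & x = a / b] &
        exists m (f : {mpoly k[m]}), f != 0 /\
        exists (phi : {rmorphism subring_of A -> subring_of (away f)})
               (psi : {rmorphism subring_of (away f) -> subring_of A}),
        [/\ forall (c : k) (a : subring_of A),
              val a = iota c -> val (phi a) = fracC m c,
            forall (c : k) (b : subring_of (away f)),
              val b = fracC m c -> val (psi b) = iota c &
            cancel phi psi]].
End Rationality.

Definition infinite_field (k : fieldType) := forall s : seq k, exists x, x \notin s.

(* Main.v *)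
(* A rational quotient K(M)^G = k(t) has a factorial model K[t] with units K^*, and
   the Laurent polynomials K[M] are another model.  Comparing their divisors turns
   an equivariant system of functionals on a summand of M (its embedding into a
   permutation lattice) into elements of K(M), and so into a congruence, which
   fails for a few groups acting by signed permutations on the face-centred and
   body-centred cubic lattices.  Conversely a torus is rational when G permutes up
   to sign a basis, the vertices of a simplex or of a hexagon, or such a basis
   together with a vector fixed modulo it.  In rank at most 3 one of the two
   happens: Selling reduction gives an obtuse superbase for an invariant form, G
   permutes the coordinate differences along the edges of its graph, and the six
   possible graphs are examined one by one; this proves (3).  For (2), generators
   of K(M1)^G and K(M2)^G generate K(M)^G by Galois descent.

   For (1), K(L)^G is retract rational if and only if there are y_1, ..., y_m in
   K(L)^G and an equivariant homomorphism w from L to the units of the local ring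
   of K[X_1, ..., X_m] at y whose value at y is the character of each element of L.
   Such homomorphisms multiply over direct sums.  They restrict to a summand M1
   after y is specialised along chi (m1 + m2) |-> chi m1 * u m2 for a generic
   equivariant u : M2 -> K^*; as K is infinite, such u separate the elements of M2,
   so that by Dedekind no nonzero polynomial vanishes on all of them. *)

Require Import Defs.
From HB Require Import structures.
From mathcomp Require Import all_boot all_order all_algebra all_fingroup all_field.
From mathcomp Require Import zify ring mpoly boolp.

Set Implicit Arguments.
Unset Strict Implicit.
Unset Printing Implicit Defensive.

Import GRing.Theory.
Local Open Scope ring_scope.

(** * Transcendence degree *)

(** Statements about K(M)^G are proved inside K(M) with its semilinear action of G. By descent
    K(M)^G is rational exactly when K(M) is generated over K by at most rank M fixed elements: the
    bound on their number stands in for independence, so a construction only has to exhibit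
    generators. The coordinates used for this are chosen so that G acts on them affinely over K, in
    every characteristic.

    In (3) M itself may have rank 6, and its group is not classified. Hence the dichotomy in rank at
    most 3 is not between rational and not rational: [bad_lattice] says that the lattice obstructs
    the rationality of every lattice of which it is a summand. The obstruction is built for this.
    Let N be the quotient of the permutation lattice Z^B by the embedded summand. Rationality makes
    the identity of N factor through a permutation module, so the pairing of an invariant of N with
    an invariant form on N is a sum over orbits. The length of an orbit, played against the parities
    of the cubic lattices, makes each orbit sum divisible by 4, whereas the pairing itself is 2. *)

Section Transcendence.
Variables (K F : fieldType) (io : {rmorphism K -> F}).

Definition algindep n (t : 'I_n -> F) :=
  forall p : {mpoly K[n]}, mmap io t p = 0 -> p = 0.

Definition genfield n (t : 'I_n -> F) (x : F) :=
  exists p q : {mpoly K[n]}, mmap io t q != 0 /\ x = mmap io t p / mmap io t q.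

Section Gen.
Variables (n : nat) (t : 'I_n -> F).

Lemma genfield_mmap p : genfield t (mmap io t p).
Proof. by exists p, 1; rewrite rmorph1 divr1 oner_neq0. Qed.

Lemma genfieldC c : genfield t (io c).
Proof. by rewrite -(mmapC t io); apply: genfield_mmap. Qed.

Lemma genfield_var i : genfield t (t i).
Proof. by have := genfield_mmap 'X_i; rewrite mmapX mmap1U. Qed.

Lemma genfieldD x y : genfield t x -> genfield t y -> genfield t (x + y).
Proof.
move=> [p [q [q0 ->]]] [p' [q' [q0' ->]]].
by exists (p * q' + p' * q), (q * q'); rewrite addf_div // !(rmorphM, rmorphD) mulf_neq0.
Qed.

Lemma genfieldM x y : genfield t x -> genfield t y -> genfield t (x * y).
Proof.
move=> [p [q [q0 ->]]] [p' [q' [q0' ->]]].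
by exists (p * p'), (q * q'); rewrite mulf_div !rmorphM mulf_neq0.
Qed.

Lemma genfieldN x : genfield t x -> genfield t (- x).
Proof. by move=> xt; rewrite -mulN1r -(rmorph1 io) -rmorphN; apply/genfieldM/xt/genfieldC. Qed.

Lemma genfieldV x : genfield t x -> genfield t x^-1.
Proof.
move=> [p [q [q0 ->]]]; have [p0|p0] := eqVneq (mmap io t p) 0.
  by rewrite p0 mul0r invr0 -(rmorph0 io); apply: genfieldC.
by exists q, p; rewrite invf_div.
Qed.

Lemma genfield_sum (I : Type) (r : seq I) (P : pred I) (f : I -> F) :
  (forall i, P i -> genfield t (f i)) -> genfield t (\sum_(i <- r | P i) f i).
Proof.
move=> h; elim/big_ind: _ => //; last exact: genfieldD.
by rewrite -(rmorph0 io); apply: genfieldC.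
Qed.

Lemma genfield_prod (I : Type) (r : seq I) (P : pred I) (f : I -> F) :
  (forall i, P i -> genfield t (f i)) -> genfield t (\prod_(i <- r | P i) f i).
Proof.
move=> h; elim/big_ind: _ => //; last exact: genfieldM.
by rewrite -(rmorph1 io); apply: genfieldC.
Qed.

Lemma genfieldX x k : genfield t x -> genfield t (x ^+ k).
Proof.
move=> h; elim: k => [|k IH]; first by rewrite expr0 -(rmorph1 io); apply: genfieldC.
by rewrite exprS; apply: genfieldM.
Qed.

Lemma genfieldXz x (k : int) : genfield t x -> genfield t (x ^ k).
Proof. by case: k => k h; rewrite ?NegzE -?exprnN; [|apply: genfieldV]; apply: genfieldX. Qed.

End Gen.

Lemma genfield_trans m n (t : 'I_m -> F) (u : 'I_n -> F) x :
  (forall j, genfield t (u j)) -> genfield u x -> genfield t x.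
Proof.
move=> tu [p [q [q0 ->]]].
have h r : genfield t (mmap io u r).
  rewrite /mmap; apply: genfield_sum => i _; apply: genfieldM; first exact: genfieldC.
  by rewrite /mmap1; apply: genfield_prod => j _; apply: genfieldX.
by apply: genfieldM; [|apply: genfieldV].
Qed.

End Transcendence.

Lemma lin_dep (K : fieldType) (A T : finType) (M : A -> T -> K) :
  (#|T| < #|A|)%N ->
  exists v : A -> K, (exists a, v a != 0) /\ forall t, \sum_a v a * M a t = 0.
Proof.
move=> ltTA; pose N : 'M[K]_(#|A|, #|T|) := \matrix_(i, j) M (enum_val i) (enum_val j).
have : kermx N != 0.
  rewrite -mxrank_eq0 mxrank_ker subn_eq0 -ltnNge.
  exact: leq_ltn_trans (rank_leq_col _) ltTA.
case/rowV0Pn => w /sub_kermxP wN w0.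
exists (fun a => w 0 (enum_rank a)); split.
  have /rV0Pn[i wi] := w0; exists (enum_val i); by rewrite enum_valK.
move=> t; have /matrixP/(_ 0 (enum_rank t)) := wN; rewrite !mxE => e.
rewrite -[RHS]e (reindex (@enum_val A (mem A))) /=.
  by apply: eq_bigr => i _; rewrite !mxE !enum_rankK enum_valK.
by exists enum_rank => a _; rewrite ?enum_valK ?enum_rankK.
Qed.

(** A mean value estimate for the m-th power. *)
Lemma expnD_le x d m : ((x + d) ^ m <= x ^ m + m * d * (x + d) ^ m.-1)%N.
Proof.
elim: m => [|m IH]; first by rewrite !expn0.
have h : (m * (x + d) ^ m.-1 * x <= m * (x + d) ^ m)%N.
  case: m {IH} => [|m] //=; rewrite -mulnA leq_mul2l expnS mulnC leq_mul2r.
  by rewrite leq_addr !orbT.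
rewrite /= !expnS.
apply: (@leq_trans (x * (x ^ m + m * d * (x + d) ^ m.-1) + d * (x + d) ^ m)%N).
  by rewrite mulnDl leq_add2r leq_mul2l IH orbT.
rewrite mulnDr -addnA leq_add2l; nia.
Qed.

(** The difference of the two m-th powers is at most m d (cN + d + 1)^(m-1), of degree m - 1 in N,
    and is overtaken by (N + 1)^n. For positive m the chosen N makes this bound at most N (N +
    1)^(m-1). *)
Lemma box_count c d m n : (m <= n)%N ->
  exists N, ((c * N + d).+1 ^ m < N.+1 ^ n + (c * N).+1 ^ m)%N.
Proof.
move=> mn; pose N := (m * d * (c + d).+1 ^ m.-1)%N; exists N.
apply: (@leq_ltn_trans (m * d * (c * N + d).+1 ^ m.-1 + (c * N).+1 ^ m)%N).
  by rewrite -addSn [leqRHS]addnC; apply: expnD_le.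
rewrite ltn_add2r; apply: (@leq_trans (N.+1 ^ m)%N); last by rewrite leq_pexp2l.
case: m @N {mn} => [|m] N; first by rewrite mul0n.
apply: (@leq_ltn_trans (N * N.+1 ^ m)%N); last by rewrite expnS ltn_pmul2r ?expn_gt0.
have NE : N = (m.+1 * d * (c + d).+1 ^ m)%N by [].
rewrite [X in (_ <= X * _)%N]NE -[leqRHS]mulnA leq_mul2l -expnMn; apply/orP; right.
case: m N NE => [|m] N _; first by rewrite !expn0.
by rewrite leq_exp2r //; nia.
Qed.

Section Box.
Variables (K : fieldType).

Definition box n (N : nat) (p : {mpoly K[n]}) :=
  forall m, m \in msupp p -> forall i, (m i <= N)%N.

Lemma box_le n N N' (p : {mpoly K[n]}) : (N <= N')%N -> box N p -> box N' p.
Proof. by move=> le h m mp i; apply: leq_trans (h m mp i) le. Qed.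

Lemma box_ex n (p : {mpoly K[n]}) : exists N, box N p.
Proof.
exists (\max_(m <- msupp p) \max_i m i) => m mp i.
apply: (@leq_trans (\max_i m i)); first exact: leq_bigmax.
exact: (@leq_bigmax_seq _ _ _ (fun m : 'X_{1..n} => \max_i m i)).
Qed.

Lemma box0 n N : box N (0 : {mpoly K[n]}).
Proof. by move=> m; rewrite msupp0. Qed.

Lemma boxD n N (p q : {mpoly K[n]}) : box N p -> box N q -> box N (p + q).
Proof. by move=> hp hq m /msuppD_le; rewrite mem_cat => /orP[/hp|/hq]. Qed.

Lemma boxZ n N c (p : {mpoly K[n]}) : box N p -> box N (c *: p).
Proof. by move=> hp m /msuppZ_le /hp. Qed.

Lemma box_sum n N (I : Type) (r : seq I) (f : I -> {mpoly K[n]}) :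
  (forall i, box N (f i)) -> box N (\sum_(i <- r) f i).
Proof. by move=> h; elim/big_ind: _ => //; [apply: box0|apply: boxD]. Qed.

Lemma boxM n N N' (p q : {mpoly K[n]}) : box N p -> box N' q -> box (N + N') (p * q).
Proof.
move=> hp hq m /msuppM_le /allpairsP[[m1 m2] /= [h1 h2 ->]] i.
by rewrite mnmDE leq_add ?hp ?hq.
Qed.

Lemma box1 n : box 0 (1 : {mpoly K[n]}).
Proof. by move=> m; rewrite msupp1 inE => /eqP -> i; rewrite mnm0E. Qed.

Lemma boxXn n N k (p : {mpoly K[n]}) : box N p -> box (k * N) (p ^+ k).
Proof.
move=> h; elim: k => [|k IH]; first by rewrite expr0; apply: box1.
by rewrite exprS mulSn; apply: boxM.
Qed.

Lemma box_prod n N m (e : 'I_m -> nat) (f : 'I_m -> {mpoly K[n]}) :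
  (forall i, box N (f i)) -> box ((\sum_i e i) * N) (\prod_i f i ^+ e i).
Proof.
move=> h; elim/big_rec2: _ => [|i x y _ IH]; first exact: box1.
by rewrite mulnDl; apply: boxM => //; apply: boxXn.
Qed.

Lemma boxX n N (e : {ffun 'I_n -> 'I_N.+1}) :
  box N ('X_[[multinom (e i : nat) | i < n]] : {mpoly K[n]}).
Proof. by move=> m; rewrite msuppX inE => /eqP-> i; rewrite mnmE -ltnS. Qed.

Lemma box_eq0 n N (p : {mpoly K[n]}) : box N p ->
  (forall e : {ffun 'I_n -> 'I_N.+1}, p@_[multinom (e i : nat) | i < n] = 0) -> p = 0.
Proof.
move=> hp h; apply/mpolyP => m; rewrite mcoeff0.
have [mp|] := boolP (m \in msupp p); last by move/memN_msupp_eq0.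
rewrite -[RHS](h [ffun i => inord (m i)]); congr _@__.
by apply/mnmP => i; rewrite mnmE ffunE inordK // ltnS; apply: hp.
Qed.

End Box.

Section TranscendenceDegree.
Variables (K F : fieldType) (io : {rmorphism K -> F}).

Lemma common_denom m n (u : 'I_m -> F) (w : 'I_n -> F) :
  (forall j, genfield io u (w j)) ->
  exists (q : {mpoly K[m]}) (p : 'I_n -> {mpoly K[m]}), mmap io u q != 0 /\
    forall j, w j = mmap io u (p j) / mmap io u q.
Proof.
move=> h.
have [pq pqP] := choice (fun j => let: ex_intro p (ex_intro q e) := h j in
  ex_intro (fun z : _ * _ => mmap io u z.2 != 0 /\ w j = mmap io u z.1 / mmap io u z.2) (p, q) e).
exists (\prod_j (pq j).2), (fun j => (pq j).1 * \prod_(i | i != j) (pq i).2).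
have p0 (P : pred 'I_n) : mmap io u (\prod_(i | P i) (pq i).2) != 0.
  by rewrite rmorph_prod; apply/prodf_neq0 => i _; have [] := pqP i.
split=> // j; have [q0 ->] := pqP j.
by rewrite [X in _ = _ / mmap io u X](bigD1 j) //= !rmorphM /= -mulf_div divff ?mulr1.
Qed.

(* Transcendence degree without bases: the monomials in [w] with exponents at most N
   become, over a common denominator, polynomials in [u] of degree O(N); modulo a
   relation between the [u] these span a space of dimension O(N^(m-1)). *)
Theorem algindep_gen m n (u : 'I_m -> F) (w : 'I_n -> F) : (m <= n)%N ->
  (forall j, genfield io u (w j)) -> algindep io w -> algindep io u.
Proof.
move=> mn uw wi P Pu; apply/eqP/negP => /negP P0.
have [q [p [q0 wE]]] := common_denom uw.
have [c1 hc1] := box_ex q; have [d Pd] := box_ex P.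
have [c2 hc2] : exists c2, forall j, box c2 (p j).
  have [g gP] := choice (fun j => box_ex (p j)); exists (\max_j g j) => j.
  by apply: box_le (gP j); apply: leq_bigmax.
pose c := (maxn c1 c2 * n)%N.
have bq : box (maxn c1 c2) q by apply: box_le hc1; rewrite leq_maxl.
have bp j : box (maxn c1 c2) (p j) by apply: box_le (hc2 j); rewrite leq_maxr.
have [N ltN] := box_count c d mn.
pose A := ({ffun 'I_n -> 'I_N.+1} + {ffun 'I_m -> 'I_(c * N).+1})%type.
pose T := {ffun 'I_m -> 'I_(c * N + d).+1}.
pose S (b : {ffun 'I_n -> 'I_N.+1}) := (\sum_i b i)%N.
have SN b : (S b <= n * N)%N.
  rewrite -[n in leqRHS]card_ord -sum_nat_const; apply: leq_sum => i _.
  by rewrite -ltnS.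
(* Over the denominator [q ^+ (n * N)] the monomials in [w] become polynomials in [u]. Together with
   monomial multiples of [P] they outnumber, by [box_count], the monomials of the box that contains
   them, so they are dependent. *)
pose Q (a : A) : {mpoly K[m]} := match a with
  | inl b => (\prod_i p i ^+ b i) * q ^+ (n * N - S b)
  | inr e => P * 'X_[[multinom (e i : nat) | i < m]] end.
have Qbox a : box (c * N + d) (Q a).
  case: a => [b|e] /=.
    apply: (@box_le _ _ (S b * maxn c1 c2 + (n * N - S b) * maxn c1 c2)).
      by rewrite -mulnDl subnKC // mulnC mulnA; apply: leq_addr.
    by apply: boxM; [apply: box_prod|apply: boxXn].
  by rewrite addnC; apply: boxM => //; apply: boxX.
have [v [[a0 va0] vP]] := @lin_dep K A T
  (fun a (e : T) => (Q a)@_[multinom (e i : nat) | i < m])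
  ltac:(by rewrite card_sum !card_ffun !card_ord).
have sum0 : \sum_a v a *: Q a = 0.
  apply: (@box_eq0 _ _ (c * N + d)).
    by apply: box_sum => a; apply: boxZ.
  move=> e; rewrite raddf_sum /= -[RHS](vP e); apply: eq_bigr => a _.
  by rewrite mcoeffZ.
rewrite big_sumType /= in sum0.
(* If only multiples of [P] occur, cancelling [P] leaves a relation between distinct monomials.
   Otherwise evaluation at [u] kills these multiples and leaves a relation between the [w]. *)
have [/existsP[b vb]|] := boolP [exists b, v (inl b) != 0]; last first.
  rewrite negb_exists => /forallP vl.
  have vl0 b : v (inl b) = 0 by apply/eqP; rewrite -[_ == _]negbK.
  move: sum0; rewrite big1 ?add0r => [|b _]; last by rewrite vl0 scale0r.
  under eq_bigr do rewrite scalerAr.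
  rewrite -mulr_sumr => /eqP; rewrite mulf_eq0 (negbTE P0) /= => /eqP s0.
  case: a0 va0 => [b|e]; first by rewrite vl0 eqxx.
  move/eqP; apply.
  have := congr1 (fun r => r@_[multinom (e i : nat) | i < m]) s0.
  rewrite raddf_sum /= mcoeff0 (bigD1 e) //= mcoeffZ mcoeffX eqxx mulr1.
  rewrite big1 ?addr0 // => e' e'e; rewrite mcoeffZ mcoeffX.
  case: eqP => [/mnmP E|]; rewrite ?mulr0 //; case/eqP: e'e.
  by apply/ffunP => i; apply: val_inj; have := E i; rewrite !mnmE.
have := congr1 (mmap io u) sum0; rewrite rmorphD rmorph0 !raddf_sum /=.
rewrite [X in _ + X]big1 ?addr0; last first.
  by move=> e _; rewrite -mul_mpolyC !rmorphM /= Pu mul0r mulr0.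
pose R : {mpoly K[n]} := \sum_b v (inl b) *: 'X_[[multinom (b i : nat) | i < n]].
have RE : mmap io u (\sum_b v (inl b) *: Q (inl b)) = mmap io w R * mmap io u q ^+ (n * N).
  rewrite !raddf_sum /= mulr_suml; apply: eq_bigr => e _.
  rewrite -!mul_mpolyC !rmorphM /= !mmapC -mulrA; congr (_ * _).
  rewrite mmapX /mmap1 rmorph_prod rmorphXn /=.
  rewrite -[in RHS](subnKC (SN e)) exprD mulrA; congr (_ * _).
  rewrite /S -prodrXr -big_split /=; apply: eq_bigr => i _.
  by rewrite mnmE wE rmorphXn expr_div_n mulfVK ?expf_neq0.
move: RE; rewrite raddf_sum /= => -> /eqP; rewrite mulf_eq0 expf_eq0 (negbTE q0) andbF orbF.
move=> /eqP /wi /(congr1 (fun r => r@_[multinom (b i : nat) | i < n])).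
rewrite raddf_sum /= mcoeff0 (bigD1 b) //= mcoeffZ mcoeffX eqxx mulr1.
rewrite big1 ?addr0; first by move/eqP; rewrite (negbTE vb).
move=> e' e'e; rewrite mcoeffZ mcoeffX.
case: eqP => [/mnmP E|]; rewrite ?mulr0 //; case/eqP: e'e.
by apply/ffunP => i; apply: val_inj; have := E i; rewrite !mnmE.
Qed.

(** If m < n, padding [u] with zeros to n elements keeps [w] in the generated field, so
    [algindep_gen] would make the padded family independent, although its last member is 0. *)
Theorem algindep_card m n (u : 'I_m -> F) (w : 'I_n -> F) :
  (forall j, genfield io u (w j)) -> algindep io w -> (n <= m)%N.
Proof.
move=> uw wi; rewrite leqNgt; apply/negP => ltmn.
pose u' (i : 'I_n) : F := if insub (val i) is Some j then u j else 0.
have u'E i : u' (widen_ord (ltnW ltmn) i) = u i.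
  rewrite /u'; case: insubP => [j _ /val_inj -> //|]; by rewrite /= ltn_ord.
have ui j : genfield io u' (w j).
  apply: genfield_trans (uw j) => i; rewrite -u'E; exact: genfield_var.
have [n' n'E] : exists n', n = n'.+1 by exists n.-1; rewrite prednK // (leq_trans _ ltmn).
subst n; have := algindep_gen (leqnn _) ui wi (p := 'X_ord_max).
rewrite mmapX mmap1U /u' insubN -?leqNgt // => /(_ erefl)/(congr1 (mcoeff U_(ord_max))).
by rewrite mcoeffX eqxx mcoeff0 => /eqP; rewrite oner_eq0.
Qed.

End TranscendenceDegree.

(** * Galois descent *)

Section Descent.
Variables (k : fieldType) (K : splittingFieldType k).
Variables (gT : finGroupType) (G : {group gT}).
Variables (gal : {morphism G >-> gal_of {:K}}).
Hypothesis gal_inj : {in G &, injective gal}.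

Lemma gal_separates g : g \in G -> g != 1%g -> exists z : K, gal g z != z.
Proof.
move=> Gg g1; apply: contrapT => h; case/eqP: g1; apply: gal_inj => //.
rewrite morph1; apply/eqP/gal_eqP => z _; rewrite gal_id; apply/eqP/negPn/negP => hz.
by apply: h; exists z.
Qed.

(* The element of [K ⊗ K] that is the product over g != 1 of
   (1 ⊗ z_g - g(z_g) ⊗ 1) / (z_g - g(z_g)). *)
Lemma galois_idempotent : exists s : seq (K * K),
  {in G, forall g, \sum_(cy <- s) cy.1 * gal g cy.2 = (g == 1%g)%:R}.
Proof.
suff h (r : seq gT) : {subset r <= G} -> 1%g \notin r ->
    exists s : seq (K * K), \sum_(cy <- s) cy.1 * cy.2 = 1 /\
      {in r, forall g, \sum_(cy <- s) cy.1 * gal g cy.2 = 0}.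
  have [||s [s1 s0]] := h [seq g <- enum G | g != 1%g].
  - by move=> g; rewrite mem_filter mem_enum => /andP[].
  - by rewrite mem_filter eqxx.
  exists s => g Gg; have [->|g1] := eqVneq g 1%g.
    by rewrite -[RHS]s1 morph1; apply: eq_bigr => cy _; rewrite gal_id.
  by rewrite s0 // mem_filter g1 mem_enum.
elim: r => [|g r IH] rG r1.
  by exists [:: (1, 1)]; rewrite big_seq1 mulr1; split.
have Gg : g \in G by apply: rG; rewrite mem_head.
move: r1; rewrite inE negb_or eq_sym => /andP[g1 r1].
have [s [s1 s0]] := IH (fun h (rh : h \in r) => rG h (@mem_behead _ (g :: r) h rh)) r1.
have [z zg] := gal_separates Gg g1.
have d0 : z - gal g z != 0 by rewrite subr_eq0 eq_sym.
(* Multiplication by the factor that belongs to g: at h it takes the value (h z - g z) / (z - g z),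
   which is 1 for h = 1 and 0 for h = g. *)
exists ([seq (cy.1 / (z - gal g z), cy.2 * z) | cy <- s] ++
        [seq (- cy.1 * gal g z / (z - gal g z), cy.2) | cy <- s]).
have E h : \sum_(cy <- [seq (cy.1 / (z - gal g z), cy.2 * z) | cy <- s] ++
        [seq (- cy.1 * gal g z / (z - gal g z), cy.2) | cy <- s]) cy.1 * (gal h) cy.2 =
    (\sum_(cy <- s) cy.1 * gal h cy.2) * ((gal h z - gal g z) / (z - gal g z)).
  rewrite big_cat !big_map /= -big_split /= mulr_suml; apply: eq_bigr => cy _.
  by rewrite rmorphM; field.
have s1' := E 1%g; rewrite morph1 in s1'.
split.
  move: s1'; rewrite gal_id divff // mulr1.
  under eq_bigr do rewrite gal_id; under [in RHS]eq_bigr do rewrite gal_id.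
  by rewrite s1.
move=> h; rewrite inE => /predU1P[->|hr]; rewrite E; first by rewrite subrr mul0r mulr0.
by rewrite s0 // mul0r.
Qed.

(* Galois descent: [v] is a combination of traces, for any semilinear action. *)
Lemma trace_decomposition : exists s : seq (K * K),
  forall (V : zmodType) (sc : K -> V -> V) (sg : gT -> V -> V),
    (forall v, {morph sc^~ v : a b / a + b}) ->
    (forall a, {morph sc a : v w / v + w}) ->
    (forall a b v, sc a (sc b v) = sc (a * b) v) -> (forall v, sc 1 v = v) ->
    {in G, forall g a v, sg g (sc a v) = sc (gal g a) (sg g v)} ->
    (forall v, sg 1%g v = v) ->
  forall v, v = \sum_(cy <- s) sc cy.1 (\sum_(g in G) sg g (sc cy.2 v)).
Proof.
have [s sP] := galois_idempotent; exists s => V sc sg scDl scDr scA sc1 sgZ sg1 v.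
have sc0l w : sc 0 w = 0 by apply: (addrI (sc 0 w)); rewrite -scDl !addr0.
have sc0r a : sc a 0 = 0 by apply: (addrI (sc a 0)); rewrite -scDr !addr0.
transitivity (\sum_(g in G) sc (\sum_(cy <- s) cy.1 * gal g cy.2) (sg g v)).
  rewrite (bigD1 1%g) //= sP // eqxx sc1 sg1 big1 ?addr0 // => g /andP[Gg g1].
  by rewrite sP // (negbTE g1) sc0l.
transitivity (\sum_(g in G) \sum_(cy <- s) sc (cy.1 * gal g cy.2) (sg g v)).
  by apply: eq_bigr => g _; apply: (big_morph _ (scDl _) (sc0l _)).
rewrite exchange_big /=; apply: eq_bigr => cy _.
rewrite (big_morph _ (scDr _) (sc0r _)); apply: eq_bigr => g Gg.
by rewrite sgZ // scA.
Qed.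

End Descent.

Lemma rmorph_frac_ext (R : idomainType) (F : fieldType) (f f' : {rmorphism {fraction R} -> F}) :
  (forall r, f (tofrac r) = f' (tofrac r)) -> f =1 f'.
Proof. by move=> h x; have [n [d [d0 ->]]] := fracP x; rewrite !fmorph_div !h. Qed.

Lemma rmorph_ratfun_ext (K F : fieldType) n (f f' : {rmorphism {fraction {mpoly K[n]}} -> F}) :
  (forall c, f (fracC n c) = f' (fracC n c)) ->
  (forall j, f (tofrac 'X_j) = f' (tofrac 'X_j)) -> f =1 f'.
Proof.
move=> hC hX; apply: rmorph_frac_ext => p.
rewrite [p]mpolyE !raddf_sum; apply: eq_bigr => m _.
rewrite /= -mul_mpolyC !rmorphM /=; congr (_ * _); first exact: hC.
by rewrite mpolyXE_id !rmorph_prod; apply: eq_bigr => i _; rewrite /= !rmorphXn /= hX.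
Qed.

Lemma rmorph_prodXz (R R' : fieldType) (f : {rmorphism R -> R'}) n (x : 'I_n -> R) (m : 'I_n -> int) :
  f (\prod_i x i ^ m i) = \prod_i f (x i) ^ m i.
Proof. by rewrite rmorph_prod; apply: eq_bigr => i _; rewrite fmorphXz. Qed.

Section LatticeBasics.
Variables (gT : finGroupType) (G : {group gT}) (L : glattice G).

Lemma lcoord_uniq (x : L) c : zcomb (lbasis L) c = x -> lcoord x = c.
Proof. by move=> h; apply: (bij_inj (lbasisP L)); rewrite lcoordK h. Qed.

Lemma lcoordD (x y : L) : lcoord (x + y) = [ffun i => lcoord x i + lcoord y i].
Proof.
apply: lcoord_uniq; rewrite -{2}(lcoordK x) -{2}(lcoordK y) /zcomb -big_split /=.
by apply: eq_bigr => i _; rewrite ffunE mulrzDr.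
Qed.

Lemma lcoord_basis i : lcoord (lbasis L i) = [ffun j => (j == i)%:R].
Proof.
apply: lcoord_uniq; rewrite /zcomb (bigD1 i) //= ffunE eqxx mulr1z big1 ?addr0 // => j.
by rewrite ffunE => /negbTE->; rewrite mulr0z.
Qed.

Lemma lact1 (x : L) : lact L x 1%g = x.
Proof.
have [inj hM] : is_action G (lact L) by case: (lact L).
by apply: (inj 1%g); rewrite -hM ?group1 // mulg1.
Qed.

Lemma lactM (x : L) : {in G &, forall g h, lact L x (g * h)%g = lact L (lact L x g) h}.
Proof. by move=> g h Gg Gh; have [_ ->] : is_action G (lact L) by case: (lact L). Qed.

Lemma lactB g : g \in G -> zmod_morphism (lact L ^~ g).
Proof.
move=> Gg x y; have lact0 : lact L 0 g = 0.
  by apply: (addrI (lact L 0 g)); rewrite -lactD // !addr0.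
by rewrite lactD //; congr (_ + _); apply/eqP; rewrite -addr_eq0 -lactD // addNr lact0.
Qed.

Definition lact_add g (Gg : g \in G) : {additive L -> L} :=
  HB.pack (lact L ^~ g) (GRing.isZmodMorphism.Build _ _ _ (lactB Gg)).

Lemma zcomb_lact n (b : 'I_n -> L) c g : g \in G ->
  lact L (zcomb b c) g = zcomb (fun i => lact L (b i) g) c.
Proof.
move=> Gg; rewrite -[LHS]/(lact_add Gg _) raddf_sum; apply: eq_bigr => i _.
by rewrite raddfMz.
Qed.

End LatticeBasics.

(** * Characters and traces in K(L) *)

Section TorusField.
Variables (k : fieldType) (K : splittingFieldType k).
Variables (gT : finGroupType) (G : {group gT}).
Variables (gal : {morphism G >-> gal_of {:K}}) (L : glattice G).

Local Notation F := {fraction {mpoly K[rank L]}}.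
Local Notation io := (fracC (rank L) : K -> F).
Local Notation act := (ratfun_act gal L).

Definition chi (x : L) : F := laurent K (lcoord x).

Lemma chi_neq0 x : chi x != 0. Proof. exact: laurent_neq0. Qed.

Lemma chiD x y : chi (x + y) = chi x * chi y.
Proof.
rewrite /chi /laurent -big_split; apply: eq_bigr => i _.
by rewrite lcoordD ffunE expfzDr // X_neq0.
Qed.

Lemma chi0 : chi 0 = 1.
Proof. by apply: (mulfI (chi_neq0 0)); rewrite -chiD addr0 mulr1. Qed.

Lemma chiN x : chi (- x) = (chi x)^-1.
Proof. by apply: (mulfI (chi_neq0 x)); rewrite -chiD subrr chi0 divff // chi_neq0. Qed.

Lemma chi_sum (I : Type) (r : seq I) (P : pred I) (f : I -> L) :
  chi (\sum_(i <- r | P i) f i) = \prod_(i <- r | P i) chi (f i).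
Proof. exact: (big_morph _ chiD chi0). Qed.

Lemma chiMn x m : chi (x *+ m) = chi x ^+ m.
Proof. by elim: m => [|m IH]; rewrite ?mulr0n ?chi0 // mulrS chiD IH exprS. Qed.

Lemma chiMz x (m : int) : chi (x *~ m) = chi x ^ m.
Proof. by case: m => m; rewrite ?NegzE ?mulrNz -?exprnN ?chiN -pmulrn chiMn. Qed.

Lemma chi_zcomb n (b : 'I_n -> L) c : chi (zcomb b c) = \prod_i chi (b i) ^ c i.
Proof. by rewrite chi_sum; apply: eq_bigr => i _; rewrite chiMz. Qed.

Lemma chi_basis i : chi (lbasis L i) = tofrac 'X_i.
Proof.
rewrite /chi /laurent lcoord_basis (bigD1 i) //= ffunE eqxx big1 ?mulr1 // => j.
by rewrite ffunE => /negbTE->.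
Qed.

Definition ratfun_mor g (Gg : g \in G) : {rmorphism F -> F} :=
  HB.pack (act g) (GRing.isZmodMorphism.Build _ _ _ (@ratfun_act_zmod _ _ _ _ gal L g Gg))
    (GRing.isMonoidMorphism.Build _ _ _ (@ratfun_act_monoid _ _ _ _ gal L g Gg)).

Lemma ract_chi g x : g \in G -> act g (chi x) = chi (lact L x g).
Proof.
move=> Gg; rewrite -{2}[x]lcoordK (zcomb_lact _ _ Gg) chi_zcomb.
apply: etrans (rmorph_prodXz (ratfun_mor Gg) _ _) _; apply: eq_bigr => i _.
by congr (_ ^ _); exact: ratfun_actX.
Qed.

Lemma ract_comp : {in G &, forall g h x, act (g * h)%g x = act h (act g x)}.
Proof.
move=> g h Gg Gh x; have Ggh := groupM Gg Gh.
apply: (@rmorph_ratfun_ext _ _ _ (ratfun_mor Ggh) (ratfun_mor Gh \o ratfun_mor Gg)) => [c|j] /=.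
  by rewrite !ratfun_actC // morphM // galM ?memvf.
by rewrite -chi_basis !ract_chi // lactM.
Qed.

Lemma ract_id x : act 1%g x = x.
Proof.
apply: (@rmorph_ratfun_ext _ _ _ (ratfun_mor (group1 G)) idfun) => [c|j] /=.
  by rewrite ratfun_actC // morph1 gal_id.
by rewrite -chi_basis ract_chi // lact1.
Qed.

Lemma ract_io : {in G, forall g c, act g (io c) = io (gal g c)}.
Proof. by move=> g Gg c; apply: ratfun_actC. Qed.
Lemma ract_add g : g \in G -> {morph act g : x y / x + y}.
Proof. by move=> Gg; apply: (raddfD (ratfun_mor Gg)). Qed.
Lemma ract_mul g : g \in G -> {morph act g : x y / x * y}.
Proof. by move=> Gg; apply: (rmorphM (ratfun_mor Gg)). Qed.
Lemma ract_sum g (I : Type) (r : seq I) (P : pred I) (f : I -> F) : g \in G ->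
  act g (\sum_(i <- r | P i) f i) = \sum_(i <- r | P i) act g (f i).
Proof. by move=> Gg; rewrite -[act g]/(ratfun_mor Gg : _ -> _) rmorph_sum. Qed.
Lemma ract_prod g (I : Type) (r : seq I) (P : pred I) (f : I -> F) : g \in G ->
  act g (\prod_(i <- r | P i) f i) = \prod_(i <- r | P i) act g (f i).
Proof. by move=> Gg; rewrite -[act g]/(ratfun_mor Gg : _ -> _) rmorph_prod. Qed.
Lemma ract_eq0 g x : g \in G -> (act g x == 0) = (x == 0).
Proof. by move=> Gg; rewrite -[act g]/(ratfun_mor Gg : _ -> _) fmorph_eq0. Qed.

Lemma ract_mmap g n (t : 'I_n -> F) p : g \in G ->
  act g (mmap io t p) = mmap io (act g \o t) (map_mpoly (gal g) p).
Proof.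
move=> Gg; rewrite {1}[p]mpolyE raddf_sum ract_sum // /map_mpoly {2}/mmap raddf_sum.
apply: eq_bigr => m _ /=; rewrite -mul_mpolyC !rmorphM /= ract_mul //.
rewrite !mmapC /= ratfun_actC // mmap1_id; congr (_ * _).
rewrite !mmapX /mmap1 ract_prod //; apply: eq_bigr => i _.
by rewrite -[act g]/(ratfun_mor Gg : _ -> _) rmorphXn.
Qed.

Definition trace (x : F) : F := \sum_(g in G) act g x.

Lemma trace_fixed x : trace x \in fixed gal L.
Proof.
apply/fixedP => h Gh; rewrite /trace (ract_sum _ _ _ Gh) [RHS](reindex_inj (mulIg h)) /=.
by apply: eq_big => [g|g Gg]; [rewrite groupMr | rewrite (ract_comp Gg Gh)].
Qed.

Hypothesis gal_inj : {in G &, injective gal}.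

Lemma trace_span : exists s : seq (K * K),
  forall x, x = \sum_(cy <- s) io cy.1 * trace (io cy.2 * x).
Proof.
have [s sP] := trace_decomposition gal_inj; exists s => x.
apply: (sP F (fun c x => io c * x) act).
- by move=> v a b; rewrite rmorphD mulrDl.
- by move=> a v w; rewrite mulrDr.
- by move=> a b v; rewrite rmorphM mulrA.
- by move=> v; rewrite rmorph1 mul1r.
- by move=> g Gg a v; rewrite ract_mul // ratfun_actC.
- exact: ract_id.
Qed.

Definition ptrace n (p : {mpoly K[n]}) : {mpoly K[n]} := \sum_(g in G) map_mpoly (gal g) p.

Lemma ptrace_span : exists s : seq (K * K),
  forall n (p : {mpoly K[n]}), p = \sum_(cy <- s) cy.1 *: ptrace (cy.2 *: p).
Proof.
have [s sP] := trace_decomposition gal_inj; exists s => n p.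
apply: (sP {mpoly K[n]} (fun c x => c *: x) (fun g => map_mpoly (gal g))).
- by move=> v a b; rewrite scalerDl.
- by move=> a v w; rewrite scalerDr.
- by move=> a b v; rewrite scalerA.
- by move=> v; rewrite scale1r.
- by move=> g Gg a v; rewrite -!mul_mpolyC rmorphM /= map_mpolyC.
- by move=> v; rewrite morph1; apply/mpolyP => m; rewrite mcoeff_map_mpoly; apply: gal_id.
Qed.

End TorusField.

Section SemilinearField.
Variables (k : fieldType) (K : splittingFieldType k).
Variables (gT : finGroupType) (G : {group gT}).
Variables (gal : {morphism G >-> gal_of {:K}}).
Hypotheses (galoisK : galois 1 {:K}) (isoG : isom G 'Gal({:K} / 1) gal).

Lemma isom_gal_inj : {in G &, injective gal}.
Proof. by have /isomP[/injmP] := isoG. Qed.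

Lemma gal_fixed_const c : {in G, forall g, gal g c = c} -> exists a : k, c = a%:A.
Proof.
move=> h; have /isomP[_ im] := isoG.
have /galois_fixedField fx := galoisK.
suff : c \in (1%VS : {vspace K}) by case/vlineP => a ->; exists a.
rewrite -fx; apply/fixedFieldP; first exact: memvf.
by move=> x; rewrite -im => /morphimP[g Gg _ ->]; apply: h.
Qed.

Lemma mpoly_descent n (p : {mpoly K[n]}) :
  {in G, forall g, map_mpoly (gal g) p = p} ->
  exists p0 : {mpoly k[n]}, map_mpoly (in_alg K) p0 = p.
Proof.
move=> h.
have /choice[a aP] (m : 'X_{1..n}) : exists a : k, a%:A = p@_m.
  have [|a ->] := @gal_fixed_const p@_m; last by exists a.
  by move=> g Gg; rewrite -[in RHS](h g Gg) mcoeff_map_mpoly.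
exists (\sum_(m <- msupp p) a m *: 'X_[m]).
rewrite raddf_sum [RHS]mpolyE; apply: eq_bigr => m _.
by rewrite /= map_mpolyZ map_mpolyX /= aP.
Qed.

Lemma ptrace_fixed n (p : {mpoly K[n]}) :
  {in G, forall g, map_mpoly (gal g) (ptrace gal p) = ptrace gal p}.
Proof.
move=> h Gh; rewrite /ptrace raddf_sum [RHS](reindex_inj (mulIg h)) /=.
apply: eq_big => [g|g Gg]; first by rewrite groupMr.
apply/mpolyP => m; rewrite !mcoeff_map_mpoly /= morphM //.
by rewrite galM ?memvf.
Qed.

Variables (F : fieldType) (io : {rmorphism K -> F}) (act : gT -> F -> F).
Hypothesis actD : {in G, forall g, {morph act g : x y / x + y}}.
Hypothesis actM : {in G, forall g, {morph act g : x y / x * y}}.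
Hypothesis act_io : {in G, forall g c, act g (io c) = io (gal g c)}.
Hypothesis act_comp : {in G &, forall g h x, act (g * h)%g x = act h (act g x)}.
Hypothesis act_id : forall x, act 1%g x = x.

Let actB g : g \in G -> zmod_morphism (act g).
Proof.
move=> Gg x y; have a0 : act g 0 = 0.
  by apply: (addrI (act g 0)); rewrite -actD // !addr0.
rewrite actD //; congr (_ + _); apply/eqP.
by rewrite -addr_eq0 -actD // addNr a0.
Qed.

Let actMM g : g \in G -> monoid_morphism (act g).
Proof.
move=> Gg; split; last by move=> x y; apply: actM.
by rewrite -(rmorph1 io) act_io // !rmorph1.
Qed.

Definition sact_mor g (Gg : g \in G) : {rmorphism F -> F} :=
  HB.pack (act g) (GRing.isZmodMorphism.Build _ _ _ (actB Gg))
    (GRing.isMonoidMorphism.Build _ _ _ (actMM Gg)).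

Definition sfixed x := {in G, forall g, act g x = x}.
Definition strace x := \sum_(g in G) act g x.

Lemma sact_sum g (I : Type) (r : seq I) (P : pred I) (f : I -> F) : g \in G ->
  act g (\sum_(i <- r | P i) f i) = \sum_(i <- r | P i) act g (f i).
Proof. by move=> Gg; rewrite -[act g]/(sact_mor Gg : _ -> _) rmorph_sum. Qed.

Lemma sact_prod g (I : Type) (r : seq I) (P : pred I) (f : I -> F) : g \in G ->
  act g (\prod_(i <- r | P i) f i) = \prod_(i <- r | P i) act g (f i).
Proof. by move=> Gg; rewrite -[act g]/(sact_mor Gg : _ -> _) rmorph_prod. Qed.

Lemma sact_mmap g n (t : 'I_n -> F) p : g \in G ->
  act g (mmap io t p) = mmap io (act g \o t) (map_mpoly (gal g) p).
Proof.
move=> Gg; rewrite {1}[p]mpolyE raddf_sum sact_sum // /map_mpoly {2}/mmap raddf_sum.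
apply: eq_bigr => m _ /=; rewrite -mul_mpolyC !rmorphM /= actM //.
rewrite !mmapC /= act_io // mmap1_id; congr (_ * _).
rewrite !mmapX /mmap1 sact_prod //; apply: eq_bigr => i _.
by rewrite -[act g]/(sact_mor Gg : _ -> _) rmorphXn.
Qed.

Lemma strace_fixed x : sfixed (strace x).
Proof.
move=> h Gh; rewrite /strace sact_sum // [RHS](reindex_inj (mulIg h)) /=.
by apply: eq_big => [g|g Gg]; rewrite ?groupMr // act_comp.
Qed.

Lemma strace_span : exists s : seq (K * K),
  forall x, x = \sum_(cy <- s) io cy.1 * strace (io cy.2 * x).
Proof.
have [s sP] := trace_decomposition isom_gal_inj; exists s => x.
apply: (sP F (fun c x => io c * x) act) => //.
- by move=> v a b; rewrite rmorphD mulrDl.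
- by move=> a v w; rewrite mulrDr.
- by move=> a b v; rewrite rmorphM mulrA.
- by move=> v; rewrite rmorph1 mul1r.
- by move=> g Gg a v; rewrite actM // act_io.
Qed.

Lemma mmap_in_alg n (t : 'I_n -> F) p :
  mmap io t (map_mpoly (in_alg K) p) = mmap (io \o in_alg K) t p.
Proof.
rewrite /map_mpoly {2}/mmap raddf_sum; apply: eq_bigr => m _ /=.
by rewrite rmorphM /= mmapC mmap1_id mmapX.
Qed.

(** In x = P / Q the coefficients are still in K. As Q(t) is a combination of traces, some multiple
    yQ has nonzero trace at t, and x Tr(yQ) = Tr(yP) because x is fixed. The traces have
    coefficients in k. *)
Lemma fixed_gen n (t : 'I_n -> F) x : (forall i, sfixed (t i)) ->
  sfixed x -> genfield io t x -> genfield (io \o in_alg K) t x.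
Proof.
move=> tf xf [P [Q [Q0 xE]]].
have [s sP] := strace_span.
have xQ : x * mmap io t Q = mmap io t P by rewrite xE mulfVK.
have E (R : {mpoly K[n]}) y : strace (io y * mmap io t R) = mmap io t (ptrace gal (y *: R)).
  rewrite /strace /ptrace raddf_sum; apply: eq_bigr => g Gg /=.
  rewrite -mul_mpolyC rmorphM /= map_mpolyC rmorphM /= mmapC actM // act_io //.
  rewrite sact_mmap //; congr (_ * _); rewrite /mmap; apply: eq_bigr => m _.
  by congr (_ * _); rewrite /mmap1; apply: eq_bigr => i _; rewrite /= tf.
have [cy cys cy0] : exists2 cy, cy \in s & strace (io cy.2 * mmap io t Q) != 0.
  apply: contrapT => h; move: Q0; rewrite [mmap io t Q]sP big_seq big1 ?eqxx // => cy cys.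
  apply/eqP; rewrite mulf_eq0; apply/orP; right; apply/negPn/negP => n0.
  by apply: h; exists cy.
have [p0 p0E] := mpoly_descent (ptrace_fixed (cy.2 *: P)).
have [q0 q0E] := mpoly_descent (ptrace_fixed (cy.2 *: Q)).
exists p0, q0; rewrite -!mmap_in_alg p0E q0E -!E; split=> //.
apply: (canRL (mulfK cy0)); rewrite -xQ /strace mulr_sumr; apply: eq_bigr => g Gg.
by rewrite !actM // xf // mulrCA.
Qed.

(** A relation over K is a combination of the traces of its multiples; each of these is again a
    relation, because the [t] are fixed, and has coefficients in k. *)
Lemma fixed_algindep n (t : 'I_n -> F) : (forall i, sfixed (t i)) ->
  algindep (io \o in_alg K) t -> algindep io t.
Proof.
move=> tf ti p pt0; have [s sP] := ptrace_span isom_gal_inj.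
rewrite [p]sP big1_seq // => cy _.
have [p0 p0E] := mpoly_descent (ptrace_fixed (cy.2 *: p)).
suff p00 : p0 = 0 by rewrite -p0E p00 raddf0 scaler0.
apply: ti; rewrite -mmap_in_alg p0E /ptrace raddf_sum big1 // => g Gg /=.
rewrite -mul_mpolyC rmorphM /= map_mpolyC rmorphM /=.
suff -> : mmap io t (map_mpoly (gal g) p) = act g (mmap io t p).
  by rewrite pt0 -[act g]/(sact_mor Gg : _ -> _) rmorph0 mulr0.
rewrite sact_mmap // /mmap; apply: eq_bigr => m _.
by congr (_ * _); rewrite /mmap1; apply: eq_bigr => i _; rewrite /= tf.
Qed.

Lemma algindep_in_alg n (t : 'I_n -> F) : algindep io t -> algindep (io \o in_alg K) t.
Proof.
move=> ti p; rewrite -mmap_in_alg => /ti /mpolyP h; apply/mpolyP => m.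
have := h m; rewrite mcoeff_map_mpoly !mcoeff0 /= => /eqP.
by rewrite scaler_eq0 oner_eq0 orbF => /eqP.
Qed.

(* Galois descent turns an affine semilinear action into a trivial one. *)
Lemma linearize n (f : 'I_n -> F) :
  (forall x, genfield io f x) ->
  (forall g, g \in G -> forall i, exists (a : 'I_n -> K) b,
     act g (f i) = \sum_j io (a j) * f j + io b) ->
  exists r (t : 'I_r -> F), [/\ (r <= n)%N, forall i, sfixed (t i)
    & forall x, genfield io t x].
Proof.
move=> fgen faff; have [s sP] := strace_span.
pose I := ('I_(size s) * 'I_n)%type.
pose T (x : I) := strace (io (tnth (in_tuple s) x.1).2 * f x.2).
have /choice[m mP] (x : I) : exists m : ('I_n -> K) * K,
    T x = \sum_j io (m.1 j) * f j + io m.2.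
  case: x => l i.
  rewrite /T /strace /=; set y := (tnth _ _).2.
  have /choice[a aP] (g : gT) : exists m : ('I_n -> K) * K,
      g \in G -> act g (f i) = \sum_j io (m.1 j) * f j + io m.2.
    have [Gg|_] := boolP (g \in G); last by exists (fun=> 0, 0).
    by have [a [b e]] := faff g Gg i; exists (a, b).
  exists (fun j => \sum_(g in G) gal g y * (a g).1 j, \sum_(g in G) gal g y * (a g).2) => /=.
  under [X in _ = X + _]eq_bigr do rewrite rmorph_sum mulr_suml.
  rewrite exchange_big rmorph_sum -big_split; apply: eq_bigr => g Gg /=.
  rewrite actM // act_io // aP // mulrDr mulr_sumr rmorphM; congr (_ + _).
  by apply: eq_bigr => j _; rewrite rmorphM mulrA.
(* The traces [T x] are affine in [f]. It is enough to keep those whose linear parts form a basis of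
   the row space, hence at most n: every other one differs from a combination of these by a
   constant. *)
pose A : 'M[K]_(#|{: I}|, n) := \matrix_(x, j) (m (enum_val x)).1 j.
exists (\rank A), (fun i => T (enum_val (maxrankfun A i))); split.
- exact: rank_leq_col.
- by move=> i; apply: strace_fixed.
move=> x; apply: genfield_trans (fgen x) => j; rewrite [f j]sP.
rewrite (big_nth (0, 0)) big_mkord; apply: genfield_sum => l _.
apply: genfieldM; first exact: genfieldC.
have -> : strace (io (nth (0, 0) s l).2 * f j) = T (l, j) by rewrite /T (tnth_nth (0, 0)).
have : (row (enum_rank (l, j)) A <= rowsub (maxrankfun A) A)%MS.
  by rewrite (eq_maxrowsub A) row_sub.
case/submxP => D DE.
have -> : T (l, j) = \sum_i io (D 0 i) * T (enum_val (maxrankfun A i)) +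
    io ((m (l, j)).2 - \sum_i D 0 i * (m (enum_val (maxrankfun A i))).2).
  rewrite mP; under [in RHS]eq_bigr do rewrite mP mulrDr mulr_sumr.
  rewrite big_split /= exchange_big /= rmorphB rmorph_sum /= -addrA; congr (_ + _).
    apply: eq_bigr => h _; have /rowP/(_ h) := DE; rewrite !mxE enum_rankK => ->.
    rewrite rmorph_sum mulr_suml; apply: eq_bigr => i _.
    by rewrite !mxE rmorphM mulrA.
  rewrite addrCA; under [in X in _ + (_ - X)]eq_bigr do rewrite rmorphM.
  by rewrite subrr addr0.
apply: genfieldD; last exact: genfieldC.
apply: genfield_sum => i _; apply: genfieldM; first exact: genfieldC.
exact: genfield_var.
Qed.

End SemilinearField.

(** * Rationality of K(L)^G *)

Lemma mmap_fracX (K : fieldType) n (p : {mpoly K[n]}) :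
  mmap (fracC n) (fun i => tofrac ('X_i : {mpoly K[n]})) p = tofrac p.
Proof.
rewrite {2}[p]mpolyE rmorph_sum /mmap; apply: eq_bigr => m _ /=.
rewrite -mul_mpolyC rmorphM /=; congr (_ * _).
by rewrite /mmap1 mpolyXE_id rmorph_prod; apply: eq_bigr => i _; rewrite rmorphXn.
Qed.

Lemma ratfun_algindep (K : fieldType) n :
  algindep (fracC n) (fun i => tofrac ('X_i : {mpoly K[n]})).
Proof. by move=> p /eqP; rewrite mmap_fracX tofrac_eq0 => /eqP. Qed.

Lemma ratfun_gen (K : fieldType) n x :
  genfield (fracC n) (fun i => tofrac ('X_i : {mpoly K[n]})) x.
Proof.
by have [p [q [q0 ->]]] := fracP x; exists p, q; rewrite !mmap_fracX tofrac_eq0.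
Qed.

Lemma algindep_reindex (K F : fieldType) (io : {rmorphism K -> F}) m n (u : 'I_n -> 'I_m) (t : 'I_m -> F) : injective u ->
  algindep io t -> algindep io (t \o u).
Proof.
move=> ui ti p p0.
pose q : {mpoly K[m]} := mmap (@mpolyC m K) (fun i => 'X_(u i)) p.
have q0 : q = 0.
  apply: ti; rewrite -[RHS]p0 /q {2}/mmap raddf_sum [RHS]/mmap; apply: eq_bigr => h _ /=.
  rewrite rmorphM /= mmapC /mmap1 rmorph_prod; congr (_ * _); apply: eq_bigr => i _.
  by rewrite rmorphXn /= mmapX mmap1U.
pose r : 'I_m -> {mpoly K[n]} := fun j => if [pick i | u i == j] is Some i then 'X_i else 0.
have rE i : r (u i) = 'X_i.
  by rewrite /r; case: pickP => [i' /eqP/ui->|/(_ i)]; rewrite ?eqxx.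
have : mmap (@mpolyC n K) r q = p.
  rewrite [RHS]mpolyE /q {2}/mmap raddf_sum; apply: eq_bigr => h _.
  rewrite /= rmorphM /= mmapC -mul_mpolyC /mmap1 rmorph_prod; congr (_ * _).
  by rewrite mpolyXE_id; apply: eq_bigr => i _; rewrite rmorphXn /= mmapX mmap1U rE.
by rewrite q0 rmorph0.
Qed.

Section SubfieldVal.
Variables (E : fieldType) (A : divringClosed E).
Implicit Types x y : subfield_of A.
Lemma subfield_valD x y : val (x + y) = val x + val y. Proof. exact: raddfD. Qed.
Lemma subfield_valM x y : val (x * y) = val x * val y. Proof. exact: rmorphM. Qed.
Lemma subfield_valV x : val x^-1 = (val x)^-1. Proof. exact: fmorphV. Qed.
Lemma subfield_val0 : val (0 : subfield_of A) = 0. Proof. exact: raddf0. Qed.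
Lemma subfield_val1 : val (1 : subfield_of A) = 1. Proof. exact: rmorph1. Qed.
End SubfieldVal.

Section Criterion.
Variables (k : fieldType) (K : splittingFieldType k).
Variables (gT : finGroupType) (G : {group gT}).
Variables (gal : {morphism G >-> gal_of {:K}}) (L : glattice G).
Hypotheses (galoisK : galois 1 {:K}) (isoG : isom G 'Gal({:K} / 1) gal).

Local Notation F := {fraction {mpoly K[rank L]}}.
Local Notation io := (fracC (rank L) : K -> F).
Local Notation act := (ratfun_act gal L).

Lemma val_mmap_base n (t : 'I_n -> fixfield gal L) p :
  val (mmap (base gal L) t p) = mmap (fracC (rank L) \o in_alg K) (fun i => val (t i)) p.
Proof.
rewrite /mmap (big_morph _ (@subfield_valD _ _) (@subfield_val0 _ _)); apply: eq_bigr => m _; rewrite subfield_valM; congr (_ * _).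
rewrite /mmap1 (big_morph _ (@subfield_valM _ _) (@subfield_val1 _ _)); apply: eq_bigr => i _.
by elim: (m i) => [|j IH]; rewrite ?expr0 // !exprS subfield_valM IH.
Qed.

Lemma rational_algindep n (t : 'I_n -> F) :
  (forall i, t i \in fixed gal L) -> algindep (fracC _) t ->
  (forall x, genfield (fracC _) t x) -> rational (base gal L).
Proof.
move=> tf ti tg; pose t' i : fixfield gal L := in_subfield (tf i : _ \in (fixed gal L : divringClosed _)).
have tf' i : sfixed G act (t i) by apply/fixedP.
exists n, t'; split.
  move=> p /(congr1 val); rewrite val_mmap_base; apply: (algindep_in_alg ti).
move=> x; have [|p [q [q0 xE]]] := fixed_gen galoisK isoG (@ract_add _ _ _ _ gal L) (@ract_mul _ _ _ _ gal L)
  (@ract_io _ _ _ _ gal L) (@ract_id _ _ _ _ gal L) tf' _ (tg (val x)).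
  by move=> g Gg; have /fixedP -> := valP x.
exists p, q; split.
  apply: contraNneq q0 => /(congr1 val); rewrite val_mmap_base subfield_val0 => e.
  by apply/eqP; exact: e.
apply: val_inj; rewrite subfield_valM subfield_valV !val_mmap_base.
exact: xE.
Qed.

(** Generators of K(L) in number at most [rank L] are independent, by comparison with the [rank L]
    independent variables. *)
Lemma rational_gen n (t : 'I_n -> F) : (n <= rank L)%N ->
  (forall i, t i \in fixed gal L) ->
  (forall x, genfield (fracC _) t x) -> rational (base gal L).
Proof.
move=> nL tf tg; apply: (rational_algindep tf) => //.
apply: (algindep_gen nL (w := fun i => tofrac 'X_i)) => //.
exact: ratfun_algindep.
Qed.

Lemma base_genfield n (t : 'I_n -> fixfield gal L) (x : fixfield gal L) :
  genfield (base gal L) t x -> genfield (fracC (rank L)) (fun i => val (t i)) (val x).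
Proof.
have E r : mmap (fracC (rank L)) (fun i => val (t i)) (map_mpoly (in_alg K) r) =
    val (mmap (base gal L) t r) by rewrite val_mmap_base; exact: mmap_in_alg.
move=> [p [q [q0 ->]]]; exists (map_mpoly (in_alg K) p), (map_mpoly (in_alg K) q).
rewrite (E p) (E q) subfield_valM subfield_valV; split; last reflexivity.
by apply: contraNneq q0 => e; apply/eqP/val_inj; rewrite subfield_val0; exact: e.
Qed.

(** Fixed elements generating K(L)^G over k also generate K(L) over K, since every element is a
    K-combination of traces; they stay independent over K by [fixed_algindep], which bounds their
    number by [rank L]. *)
Lemma rational_exists : rational (base gal L) ->
  exists n (t : 'I_n -> F), [/\ (n <= rank L)%N, forall i, t i \in fixed gal L,
    algindep (fracC (rank L)) t & forall x, genfield (fracC (rank L)) t x].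
Proof.
move=> [n [t [ti tg]]]; exists n, (fun i => val (t i)).
have tf i : val (t i) \in fixed gal L by exact: valP.
have tiK : algindep (fracC (rank L)) (fun i => val (t i)).
  apply: (fixed_algindep galoisK isoG (@ract_add _ _ _ _ gal L)
    (@ract_mul _ _ _ _ gal L) (@ract_io _ _ _ _ gal L)).
    by move=> i; apply/fixedP.
  move=> p p0; apply: ti; apply: val_inj; rewrite val_mmap_base subfield_val0; exact: p0.
split=> //; first by apply: algindep_card tiK => j; apply: ratfun_gen.
have [s sP] := trace_span L (isom_gal_inj isoG).
move=> x; rewrite [x]sP; apply: genfield_sum => i _; apply: genfieldM.
  exact: genfieldC.
have fx := trace_fixed gal (fracC (rank L) i.2 * x).
exact: (base_genfield (tg (in_subfield (fx : _ \in (fixed gal L : divringClosed _))))).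
Qed.

End Criterion.

Section LatticeBases.
Variables (gT : finGroupType) (G : {group gT}) (L : glattice G).

Definition spans n (w : 'I_n -> L) := forall x, exists c, zcomb w c = x.

Lemma zcomb_sum n (w : 'I_n -> L) m (d : 'I_m -> int) (c : 'I_m -> {ffun 'I_n -> int}) :
  \sum_i zcomb w (c i) *~ d i = zcomb w [ffun l => \sum_i d i * c i l].
Proof.
rewrite /zcomb; under eq_bigr do rewrite mulrz_suml.
rewrite exchange_big; apply: eq_bigr => l _ /=.
by rewrite ffunE mulrz_sumr; apply: eq_bigr => i _; rewrite -mulrzA mulrC.
Qed.

(** With coordinates taken both ways, the rational matrices satisfy B A = 1, so the size n of this
    identity is at most the number of columns of B. *)
Lemma zbasis_rank_le n (w : 'I_n -> L) : injective (zcomb w) -> spans w -> (n <= rank L)%N.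
Proof.
move=> wi ws; have [c cP] := choice (fun i => ws (lbasis L i)).
pose A : 'M[rat]_(rank L, n) := \matrix_(i, l) (c i l)%:~R.
pose B : 'M[rat]_(n, rank L) := \matrix_(j, i) (lcoord (w j) i)%:~R.
suff BA : B *m A = 1%:M.
  rewrite -[n in (n <= _)%N](@mxrank1 rat n) -BA.
  exact: leq_trans (mxrankM_maxl _ _) (rank_leq_col _).
apply/matrixP => j l; rewrite !mxE.
have e : zcomb w [ffun l => \sum_i lcoord (w j) i * c i l] = zcomb w [ffun l => (j == l)%:R].
  rewrite -zcomb_sum; under eq_bigr do rewrite cP.
  rewrite -[LHS]/(zcomb (lbasis L) (lcoord (w j))) lcoordK.
  rewrite /zcomb (bigD1 j) //= ffunE eqxx mulr1z big1 ?addr0 // => i.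
  by rewrite ffunE eq_sym => /negbTE->; rewrite mulr0z.
have /ffunP/(_ l) := wi _ _ e; rewrite !ffunE => /(congr1 (fun z : int => z%:~R : rat)).
rewrite rmorph_sum /= natz -pmulrn => <-; apply: eq_bigr => i _.
by rewrite !mxE rmorphM.
Qed.

End LatticeBases.

Section ChiGen.
Variables (k : fieldType) (K : splittingFieldType k).
Variables (gT : finGroupType) (G : {group gT}) (L : glattice G).
Local Notation io := (fracC (rank L) : K -> {fraction {mpoly K[rank L]}}).

Lemma chi_gen m n (u : 'I_m -> {fraction {mpoly K[rank L]}}) (w : 'I_n -> L) :
  spans w -> (forall i, genfield io u (chi K (w i))) -> forall x, genfield io u x.
Proof.
move=> ws uw x; apply: genfield_trans (ratfun_gen x) => j.
rewrite -chi_basis; have [c <-] := ws (lbasis L j).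
by rewrite chi_zcomb; apply: genfield_prod => i _; apply: genfieldXz.
Qed.

Lemma chi_algindep n (w : 'I_n -> L) : spans w -> (n <= rank L)%N ->
  algindep io (fun i => chi K (w i)).
Proof.
move=> ws nL; apply: (algindep_gen nL (w := fun i => tofrac 'X_i)); last exact: ratfun_algindep.
by move=> j; apply: (chi_gen ws) => i; apply: genfield_var.
Qed.

End ChiGen.

(** * Direct sums *)

Section Embedding.
Variables (k : fieldType) (K : splittingFieldType k).
Variables (gT : finGroupType) (G : {group gT}).
Variables (gal : {morphism G >-> gal_of {:K}}) (L' L : glattice G).
Variable j : {additive L' -> L}.
Hypothesis j_act : {in G, forall g x, j (lact L' x g) = lact L (j x) g}.

Local Notation F' := {fraction {mpoly K[rank L']}}.
Local Notation F := {fraction {mpoly K[rank L]}}.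

Hypothesis j_indep : algindep (fracC (rank L) : K -> F) (fun i => chi K (j (lbasis L' i))).

Definition emb_poly : {mpoly K[rank L']} -> F :=
  mmap (fracC (rank L)) (fun i => chi K (j (lbasis L' i))).
HB.instance Definition _ := GRing.RMorphism.on emb_poly.

Lemma emb_poly_inj : injective emb_poly.
Proof. by apply: raddf_inj; apply: j_indep. Qed.

Definition emb_fun : F' -> F := fraclift emb_poly.

Definition emb : {rmorphism F' -> F} := HB.pack emb_fun
  (GRing.isZmodMorphism.Build _ _ _ (fraclift_is_zmod_morphism emb_poly_inj))
  (GRing.isMonoidMorphism.Build _ _ _ (fraclift_is_monoid_morphism emb_poly_inj)).

Lemma emb_tofrac p : emb (tofrac p) = emb_poly p.
Proof. exact: (fraclift_tofrac emb_poly_inj). Qed.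

Lemma emb_io c : emb (fracC _ c) = fracC _ c.
Proof. by rewrite [LHS]emb_tofrac /emb_poly mmapC. Qed.

Lemma emb_X i : emb (tofrac 'X_i) = chi K (j (lbasis L' i)).
Proof. by rewrite emb_tofrac /emb_poly mmapX mmap1U. Qed.

Lemma emb_chi x : emb (chi K x) = chi K (j x).
Proof.
rewrite -[in RHS](lcoordK x) /zcomb raddf_sum chi_sum.
apply: etrans (rmorph_prodXz emb _ _) _; apply: eq_bigr => i _.
by rewrite raddfMz chiMz -emb_X.
Qed.

Lemma emb_act : {in G, forall g x, emb (ratfun_act gal L' g x) = ratfun_act gal L g (emb x)}.
Proof.
move=> g Gg; apply: (@rmorph_ratfun_ext _ _ _ (emb \o ratfun_mor gal L' Gg)
  (ratfun_mor gal L Gg \o emb)) => [c|i] /=.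
  rewrite ratfun_actC //; apply: etrans (emb_io _) _; apply: esym.
  by apply: etrans (congr1 (ratfun_act gal L g) (emb_io c)) _; apply: ratfun_actC.
rewrite -chi_basis ract_chi //; apply: etrans (emb_chi _) _; apply: esym.
by apply: etrans (congr1 (ratfun_act gal L g) (emb_chi _)) _; rewrite ract_chi // j_act.
Qed.

Lemma emb_fixed x : x \in fixed gal L' -> emb x \in fixed gal L.
Proof. by move=> /fixedP h; apply/fixedP => g Gg; rewrite -emb_act // h. Qed.

Lemma emb_mmap n (t : 'I_n -> F') p :
  emb (mmap (fracC _) t p) = mmap (fracC _) (emb \o t) p.
Proof.
rewrite /mmap [LHS]rmorph_sum; apply: eq_bigr => m _.
rewrite rmorphM; congr (_ * _); first exact: emb_io.
by rewrite /mmap1 [LHS]rmorph_prod; apply: eq_bigr => i _; rewrite rmorphXn.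
Qed.

Lemma emb_genfield n (t : 'I_n -> F') x :
  genfield (fracC _) t x -> genfield (fracC _) (emb \o t) (emb x).
Proof.
move=> [p [q [q0 ->]]]; exists p, q; rewrite -!emb_mmap fmorph_div; split; last by [].
by rewrite fmorph_eq0.
Qed.

End Embedding.

Section DirectSum.
Variables (gT : finGroupType) (G : {group gT}) (M M1 M2 : glattice G).
Variable f : {additive M1 * M2 -> M}.
Hypothesis f_bij : bijective f.
Hypothesis f_act : {in G, forall g x, f (lact M1 x.1 g, lact M2 x.2 g) = lact M (f x) g}.

Definition dinl (x : M1) : M := f (x, 0).
Definition dinr (x : M2) : M := f (0, x).

Lemma dinl_zmod : zmod_morphism dinl.
Proof. by move=> x y; rewrite /dinl -raddfB; congr (f _); rewrite /= -[LHS]/(x - y, 0) -[RHS]/(x - y, 0 - 0) subr0. Qed.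
Lemma dinr_zmod : zmod_morphism dinr.
Proof. by move=> x y; rewrite /dinr -raddfB; congr (f _); rewrite -[RHS]/(0 - 0, x - y) subr0. Qed.
HB.instance Definition _ := GRing.isZmodMorphism.Build _ _ dinl dinl_zmod.
HB.instance Definition _ := GRing.isZmodMorphism.Build _ _ dinr dinr_zmod.

Lemma lact0 (L : glattice G) g : g \in G -> lact L 0 g = 0.
Proof. by move=> Gg; apply: (raddf0 (lact_add L Gg)). Qed.

Lemma dinl_act : {in G, forall g x, dinl (lact M1 x g) = lact M (dinl x) g}.
Proof. by move=> g Gg x; rewrite /dinl -f_act // lact0. Qed.
Lemma dinr_act : {in G, forall g x, dinr (lact M2 x g) = lact M (dinr x) g}.
Proof. by move=> g Gg x; rewrite /dinr -f_act // lact0. Qed.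

Lemma dsumE x : f x = dinl x.1 + dinr x.2.
Proof.
rewrite /dinl /dinr -raddfD; congr (f _).
by rewrite -[RHS]/(x.1 + 0, 0 + x.2) addr0 add0r -surjective_pairing.
Qed.

Definition dbasis (i : 'I_(rank M1 + rank M2)) : M :=
  match split i with inl a => dinl (lbasis M1 a) | inr b => dinr (lbasis M2 b) end.

Lemma dbasis_zcomb c : zcomb dbasis c =
  f (zcomb (lbasis M1) [ffun i => c (lshift _ i)], zcomb (lbasis M2) [ffun i => c (rshift _ i)]).
Proof.
rewrite dsumE /zcomb big_split_ord /= !raddf_sum; congr (_ + _); apply: eq_bigr => i _.
  by rewrite raddfMz ffunE /dbasis -/(unsplit (inl _)) unsplitK.
by rewrite raddfMz ffunE /dbasis -/(unsplit (inr _)) unsplitK.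
Qed.

Lemma dbasis_inj : injective (zcomb dbasis).
Proof.
move=> c d; rewrite !dbasis_zcomb => /(bij_inj f_bij) [/(bij_inj (lbasisP M1)) /ffunP e1
  /(bij_inj (lbasisP M2)) /ffunP e2]; apply/ffunP => i.
by case: (split_ordP i) => a ->; [have := e1 a|have := e2 a]; rewrite !ffunE.
Qed.

Lemma dbasis_spans : spans dbasis.
Proof.
move=> x; have [h _ hK] := f_bij.
exists [ffun i => match split i with inl a => lcoord (h x).1 a | inr b => lcoord (h x).2 b end].
rewrite dbasis_zcomb -[RHS]hK [h x in RHS]surjective_pairing; congr (f (_, _)).
  rewrite -[RHS]lcoordK; congr zcomb; apply/ffunP => i.
  by rewrite !ffunE -/(unsplit (inl _)) unsplitK.
rewrite -[RHS]lcoordK; congr zcomb; apply/ffunP => i.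
by rewrite !ffunE -/(unsplit (inr _)) unsplitK.
Qed.

Lemma dsum_rank_le : (rank M1 + rank M2 <= rank M)%N.
Proof. exact: zbasis_rank_le dbasis_inj dbasis_spans. Qed.

Variables (k : fieldType) (K : splittingFieldType k).
Variables (gal : {morphism G >-> gal_of {:K}}).
Hypotheses (galoisK : galois 1 {:K}) (isoG : isom G 'Gal({:K} / 1) gal).
Local Notation F := {fraction {mpoly K[rank M]}}.
Local Notation io := (fracC (rank M) : K -> F).

Lemma dbasis_algindep : algindep io (fun i => chi K (dbasis i)).
Proof. exact: chi_algindep dbasis_spans dsum_rank_le. Qed.

Lemma dinl_algindep : algindep io (fun i => chi K (dinl (lbasis M1 i))).
Proof.
have := algindep_reindex (@lshift_inj (rank M1) (rank M2)) dbasis_algindep.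
by congr (algindep io _); apply/funext => i; rewrite /= /dbasis -/(unsplit (inl _)) unsplitK.
Qed.

Lemma dinr_algindep : algindep io (fun i => chi K (dinr (lbasis M2 i))).
Proof.
have := algindep_reindex (@rshift_inj (rank M1) (rank M2)) dbasis_algindep.
by congr (algindep io _); apply/funext => i; rewrite /= /dbasis -/(unsplit (inr _)) unsplitK.
Qed.

Lemma rational_direct_sum :
  rational (base gal M1) -> rational (base gal M2) -> rational (base gal M).
Proof.
move=> /(rational_exists galoisK isoG)[a [t [ta tf _ tg]]].
move=> /(rational_exists galoisK isoG)[b [s [sb sf _ sg]]].
pose e1 := emb dinl_algindep; pose e2 := emb dinr_algindep.
pose T (i : 'I_(a + b)) : F := match split i with inl i => e1 (t i) | inr i => e2 (s i) end.
apply: (rational_gen galoisK isoG (t := T)).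
- exact: leq_trans (leq_add ta sb) dsum_rank_le.
- move=> i; rewrite /T; case: (split i) => j; first exact: (emb_fixed dinl_act).
  exact: (emb_fixed dinr_act).
apply: (chi_gen dbasis_spans) => i; rewrite /dbasis; case: (split i) => j.
  have <- := emb_X dinl_algindep j.
  apply: genfield_trans (emb_genfield dinl_algindep (tg _)) => l.
  have -> : (emb dinl_algindep \o t) l = T (lshift b l).
    by rewrite /T -/(unsplit (inl _)) unsplitK.
  exact: genfield_var.
have <- := emb_X dinr_algindep j.
apply: genfield_trans (emb_genfield dinr_algindep (sg _)) => l.
have -> : (emb dinr_algindep \o s) l = T (rshift a l).
  by rewrite /T -/(unsplit (inr _)) unsplitK.
exact: genfield_var.
Qed.

End DirectSum.

(** * Rational tori *)

(* K(L) with its action and its characters, presented abstractly. *)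
Record torus_field (k : fieldType) (K : splittingFieldType k) (gT : finGroupType)
    (G : {group gT}) (gal : {morphism G >-> gal_of {:K}}) (L : glattice G) := TorusField {
  tf_sort :> fieldType;
  tio : {rmorphism K -> tf_sort};
  tact : gT -> tf_sort -> tf_sort;
  tchi : L -> tf_sort;
  tactD : {in G, forall g, {morph tact g : x y / x + y}};
  tactM : {in G, forall g, {morph tact g : x y / x * y}};
  tact_io : {in G, forall g c, tact g (tio c) = tio (gal g c)};
  tact_comp : {in G &, forall g h x, tact (g * h)%g x = tact h (tact g x)};
  tact_id : forall x, tact 1%g x = x;
  tchi_neq0 : forall x, tchi x != 0;
  tchiD : {morph tchi : x y / x + y >-> x * y};
  tact_chi : {in G, forall g x, tact g (tchi x) = tchi (lact L x g)};
  tgen : forall x, genfield tio (fun i => tchi (lbasis L i)) x;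
  tindep : algindep tio (fun i => tchi (lbasis L i))
}.

Section TorusTheory.
Variables (k : fieldType) (K : splittingFieldType k).
Variables (gT : finGroupType) (G : {group gT}).
Variables (gal : {morphism G >-> gal_of {:K}}) (L : glattice G).
Variable T : torus_field gal L.
Local Notation io := (tio T).
Local Notation act := (@tact _ _ _ _ _ _ T).
Local Notation chi := (@tchi _ _ _ _ _ _ T).

Definition tmor g (Gg : g \in G) : {rmorphism T -> T} :=
  sact_mor (@tactD _ _ _ _ _ _ T) (@tactM _ _ _ _ _ _ T) (@tact_io _ _ _ _ _ _ T) Gg.

Lemma tactB g : g \in G -> {morph act g : x y / x - y}.
Proof. by move=> Gg x y; rewrite -[act g]/(tmor Gg : _ -> _) rmorphB. Qed.
Lemma tactV g x : g \in G -> act g x^-1 = (act g x)^-1.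
Proof. by move=> Gg; rewrite -[act g]/(tmor Gg : _ -> _) fmorphV. Qed.
Lemma tact1 g : g \in G -> act g 1 = 1.
Proof. by move=> Gg; rewrite -[act g]/(tmor Gg : _ -> _) rmorph1. Qed.
Lemma tact0 g : g \in G -> act g 0 = 0.
Proof. by move=> Gg; rewrite -[act g]/(tmor Gg : _ -> _) rmorph0. Qed.
Lemma tact_eq0 g x : g \in G -> (act g x == 0) = (x == 0).
Proof. by move=> Gg; rewrite -[act g]/(tmor Gg : _ -> _) fmorph_eq0. Qed.
Lemma tactXz g (n : int) x : g \in G -> act g (x ^ n) = act g x ^ n.
Proof. by move=> Gg; rewrite -[act g]/(tmor Gg : _ -> _) fmorphXz. Qed.
Lemma tact_sum g (I : Type) (r : seq I) (P : pred I) (f : I -> T) : g \in G ->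
  act g (\sum_(i <- r | P i) f i) = \sum_(i <- r | P i) act g (f i).
Proof. by move=> Gg; rewrite -[act g]/(tmor Gg : _ -> _) rmorph_sum. Qed.
Lemma tact_prod g (I : Type) (r : seq I) (P : pred I) (f : I -> T) : g \in G ->
  act g (\prod_(i <- r | P i) f i) = \prod_(i <- r | P i) act g (f i).
Proof. by move=> Gg; rewrite -[act g]/(tmor Gg : _ -> _) rmorph_prod. Qed.

Lemma tchi0 : chi 0 = 1.
Proof. by apply: (mulfI (tchi_neq0 T 0)); rewrite -tchiD addr0 mulr1. Qed.
Lemma tchiN x : chi (- x) = (chi x)^-1.
Proof. by apply: (mulfI (tchi_neq0 T x)); rewrite -tchiD subrr tchi0 divff // tchi_neq0. Qed.
Lemma tchi_sum (I : Type) (r : seq I) (P : pred I) (f : I -> L) :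
  chi (\sum_(i <- r | P i) f i) = \prod_(i <- r | P i) chi (f i).
Proof. exact: (big_morph _ (@tchiD _ _ _ _ _ _ T) tchi0). Qed.
Lemma tchiMn x m : chi (x *+ m) = chi x ^+ m.
Proof. by elim: m => [|m IH]; rewrite ?mulr0n ?tchi0 // mulrS tchiD IH exprS. Qed.
Lemma tchiMz x (m : int) : chi (x *~ m) = chi x ^ m.
Proof. by case: m => m; rewrite ?NegzE ?mulrNz -?exprnN ?tchiN -pmulrn tchiMn. Qed.
Lemma tchi_zcomb n (b : 'I_n -> L) c : chi (zcomb b c) = \prod_i chi (b i) ^ c i.
Proof. by rewrite tchi_sum; apply: eq_bigr => i _; rewrite tchiMz. Qed.

Lemma tchi_gen m n (u : 'I_m -> T) (w : 'I_n -> L) :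
  spans w -> (forall i, genfield io u (chi (w i))) -> forall x, genfield io u x.
Proof.
move=> ws uw x; apply: genfield_trans (tgen x) => j.
have [c <-] := ws (lbasis L j).
by rewrite tchi_zcomb; apply: genfield_prod => i _; apply: genfieldXz.
Qed.

Lemma tchi_algindep n (w : 'I_n -> L) : spans w -> (n <= rank L)%N ->
  algindep io (fun i => chi (w i)).
Proof.
move=> ws nL; apply: (algindep_gen nL (w := fun i => chi (lbasis L i))); last exact: tindep.
by move=> j; apply: (tchi_gen ws) => i; apply: genfield_var.
Qed.

(** Independence of [t] over K is encoded in the bound n <= [rank L], from which it follows once [t]
    generates. *)
Definition torus_rational := exists n (t : 'I_n -> T),
  [/\ (n <= rank L)%N, forall i, sfixed G act (t i) & forall x, genfield io t x].

Hypothesis isoG : isom G 'Gal({:K} / 1) gal.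

Lemma torus_linearize n (f : 'I_n -> T) : (n <= rank L)%N ->
  (forall x, genfield io f x) ->
  (forall g, g \in G -> forall i, exists (a : 'I_n -> K) b,
     act g (f i) = \sum_j io (a j) * f j + io b) -> torus_rational.
Proof.
move=> nL fg fa; have [r [t [rn tf tg]]] := linearize isoG (@tactD _ _ _ _ _ _ T)
  (@tactM _ _ _ _ _ _ T) (@tact_io _ _ _ _ _ _ T) (@tact_comp _ _ _ _ _ _ T) (@tact_id _ _ _ _ _ _ T) fg fa.
by exists r, t; split=> //; apply: leq_trans nL.
Qed.

End TorusTheory.

Section RatfunTorus.
Variables (k : fieldType) (K : splittingFieldType k).
Variables (gT : finGroupType) (G : {group gT}).
Variables (gal : {morphism G >-> gal_of {:K}}) (L : glattice G).

Lemma ratfun_chi_gen x : genfield (fracC (rank L) : K -> _) (fun i => chi K (lbasis L i)) x.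
Proof.
rewrite (_ : (fun i => _) = fun i => tofrac 'X_i); last by apply/funext => i; apply: chi_basis.
exact: ratfun_gen.
Qed.

Lemma ratfun_chi_algindep : algindep (fracC (rank L) : K -> _) (fun i => chi K (lbasis L i)).
Proof.
rewrite (_ : (fun i => _) = fun i => tofrac 'X_i); last by apply/funext => i; apply: chi_basis.
exact: ratfun_algindep.
Qed.

Definition ratfun_torus : torus_field gal L :=
  @TorusField _ _ _ _ gal L {fraction {mpoly K[rank L]}} (fracC (rank L)) (ratfun_act gal L)
    (@chi _ K _ _ L) (@ract_add _ _ _ _ gal L) (@ract_mul _ _ _ _ gal L)
    (@ract_io _ _ _ _ gal L) (@ract_comp _ _ _ _ gal L) (@ract_id _ _ _ _ gal L)
    (@chi_neq0 _ K _ _ L) (@chiD _ K _ _ L) (fun g Gg x => @ract_chi _ _ _ _ gal L g x Gg)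
    ratfun_chi_gen ratfun_chi_algindep.

Hypotheses (galoisK : galois 1 {:K}) (isoG : isom G 'Gal({:K} / 1) gal).

Lemma torus_rationalP : rational (base gal L) <-> torus_rational ratfun_torus.
Proof.
split=> [/(rational_exists galoisK isoG)[n [t [nL tf _ tg]]]|[n [t [nL tf tg]]]].
  by exists n, t; split=> // i; apply/fixedP.
apply: (@rational_gen _ _ _ _ gal L galoisK isoG n t nL) => [i|]; last exact: tg.
by apply/fixedP; apply: tf.
Qed.

End RatfunTorus.

(** * Rational coordinates from invariant affine spaces *)

Section Constructions.
Variables (k : fieldType) (K : splittingFieldType k).
Variables (gT : finGroupType) (G : {group gT}).
Variables (gal : {morphism G >-> gal_of {:K}}) (L : glattice G).
Variable T : torus_field gal L.
Hypothesis isoG : isom G 'Gal({:K} / 1) gal.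
Local Notation F := (tf_sort T).
Local Notation io := (tio T).
Local Notation act := (@tact _ _ _ _ _ _ T).
Local Notation chi := (@tchi _ _ _ _ _ _ T).

Definition affine_in n (f : 'I_n -> F) (x : F) :=
  exists (a : 'I_n -> K) b, x = \sum_j io (a j) * f j + io b.

Lemma affine_var n (f : 'I_n -> F) i : affine_in f (f i).
Proof.
exists (fun j => (j == i)%:R), 0; rewrite rmorph0 addr0 (bigD1 i) //= eqxx rmorph1 mul1r.
by rewrite big1 ?addr0 // => j /negbTE->; rewrite rmorph0 mul0r.
Qed.

Lemma affine_const n (f : 'I_n -> F) b : affine_in f (io b).
Proof. by exists (fun=> 0), b; rewrite big1 ?add0r // => j _; rewrite rmorph0 mul0r. Qed.

Lemma affineD n (f : 'I_n -> F) x y : affine_in f x -> affine_in f y -> affine_in f (x + y).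
Proof.
move=> [a [b ->]] [a' [b' ->]]; exists (fun j => a j + a' j), (b + b').
rewrite rmorphD addrACA; congr (_ + _); rewrite -big_split; apply: eq_bigr => j _.
by rewrite rmorphD mulrDl.
Qed.

Lemma affineN n (f : 'I_n -> F) x : affine_in f x -> affine_in f (- x).
Proof.
move=> [a [b ->]]; exists (fun j => - a j), (- b).
by rewrite rmorphN opprD -sumrN; congr (_ + _); apply: eq_bigr => j _; rewrite rmorphN mulNr.
Qed.

Lemma affine_sum n (f : 'I_n -> F) (I : Type) (r : seq I) (P : pred I) (g : I -> F) :
  (forall i, P i -> affine_in f (g i)) -> affine_in f (\sum_(i <- r | P i) g i).
Proof.
move=> h; elim/big_ind: _ => //; last exact: affineD.
by rewrite -(rmorph0 (tio T)); apply: affine_const.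
Qed.

Section Cayley.
Variable e : L.
Hypothesis e1 : chi e != 1.

(* The coordinate on P^1 that moves the fixed point 1 of inversion to infinity. *)
Definition cayley : F := (chi e - 1)^-1.

Lemma cayley_chi : chi e = 1 + cayley^-1.
Proof. by rewrite /cayley invrK addrC subrK. Qed.

End Cayley.

(** Inversion of a character becomes the affine map z |-> -1 - z. The usual (1 + x) / (1 - x) would
    be constant in characteristic 2; this coordinate is not. *)
Lemma cayleyN e : chi e != 1 -> cayley (- e) = -1 - cayley e.
Proof.
move=> e1; have x0 := tchi_neq0 T e; rewrite /cayley tchiN.
have x1 : chi e - 1 != 0 by rewrite subr_eq0.
have x2 : 1 - chi e != 0 by rewrite -opprB oppr_eq0.
have -> : (chi e)^-1 - 1 = (1 - chi e) / chi e by rewrite mulrBl divff // mul1r.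
rewrite invf_div -[1 - chi e]opprB invrN mulrN.
apply: (mulIf x1); rewrite mulNr divfK // mulrBl mulVf //; ring.
Qed.

Lemma act_cayley g e : g \in G -> act g (cayley e) = cayley (lact L e g).
Proof.
move=> Gg; rewrite /cayley tactV // -tact_chi //.
by rewrite tactB // tact1.
Qed.

Definition signed n (e : 'I_n -> L) := forall g, g \in G -> forall i,
  exists j, lact L (e i) g = e j \/ lact L (e i) g = - e j.

Lemma chi_neq1 n (e : 'I_n -> L) i : algindep io (fun i => chi (e i)) -> chi (e i) != 1.
Proof.
move=> ei; apply/eqP => e1; have := ei ('X_i - 1).
rewrite rmorphB rmorph1 /= mmapX mmap1U e1 subrr => /(_ erefl) /(congr1 (mcoeff U_(i))).
rewrite mcoeffB mcoeffX eqxx mcoeff1 mnm1_eq0 subr0 mcoeff0 => /eqP.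
by rewrite oner_eq0.
Qed.

Lemma signed_cayley n (e : 'I_n -> L) : algindep io (fun i => chi (e i)) -> signed e ->
  forall g, g \in G -> forall i, exists j, act g (cayley (e i)) = cayley (e j) \/
    act g (cayley (e i)) = -1 - cayley (e j).
Proof.
move=> ei es g Gg i; have [j [h|h]] := es g Gg i; exists j; rewrite act_cayley // h.
  by left.
by right; apply: cayleyN; apply: (chi_neq1 (e := e)).
Qed.

Lemma gen_cayley n (f : 'I_n -> F) e : genfield io f (cayley e) -> genfield io f (chi e).
Proof.
move=> h; rewrite cayley_chi; apply: genfieldD; last exact: genfieldV.
by rewrite -(rmorph1 (tio T)); apply: genfieldC.
Qed.

Lemma affine_signed n m (f : 'I_n -> F) (e : 'I_m -> L) x :
  (forall j, affine_in f (cayley (e j))) ->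
  (exists j, x = cayley (e j) \/ x = -1 - cayley (e j)) -> affine_in f x.
Proof.
move=> fe [j [->|->]] //; apply: affineD; last exact/affineN.
by rewrite -(rmorph1 (tio T)) -rmorphN; apply: affine_const.
Qed.

(** In the Cayley coordinates a signed permutation of the basis acts by permutations and z |-> -1 -
    z, so their affine span over K is G-stable and [linearize] applies. *)
Theorem rational_signed n (e : 'I_n -> L) :
  (n <= rank L)%N -> spans e -> signed e -> torus_rational T.
Proof.
move=> nL es eG; have ei := tchi_algindep (T := T) es nL.
apply: (torus_linearize isoG (f := fun i => cayley (e i)) nL).
  by apply: (tchi_gen es) => i; apply/gen_cayley/genfield_var.
move=> g Gg i; apply: affine_signed (signed_cayley ei eG Gg i) => j.
exact: (affine_var (fun i => cayley (e i))).
Qed.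

(* e_0, ..., e_{n-1} span an invariant sublattice and G fixes e modulo it: Hilbert 90
   provides a multiple of chi e that is fixed by G. *)
Theorem rational_signed_fixed n (e : 'I_n -> L) (e' : L) (w : 'I_n.+1 -> L) :
  (n.+1 <= rank L)%N -> spans w -> (forall i, w (lift ord_max i) = e i) -> w ord_max = e' ->
  signed e -> (forall g, g \in G -> exists c, lact L e' g = e' + zcomb e c) ->
  torus_rational T.
Proof.
move=> nL ws we we' eG e'G; have wi := tchi_algindep (T := T) ws nL.
have ei : algindep io (fun i => chi (e i)).
  suff -> : (fun i => chi (e i)) = (fun i => chi (w i)) \o lift ord_max.
    exact: algindep_reindex lift_inj wi.
  by apply/funext => i /=; rewrite we.
pose m g := lact L e' g - e'.
have mM : {in G &, forall g h, m (g * h)%g = m h + lact L (m g) h}.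
  move=> g h Gg Gh; rewrite /m lactM // -[lact L (_ - _) h]/(lact_add L Gh _) raddfB /=.
  by rewrite [RHS]addrC addrA subrK.
have [s sP] := trace_decomposition (isom_gal_inj isoG).
(* The semilinear action twisted by the cocycle [chi (m g)]. By the trace decomposition 1 is a
   combination of the twisted traces [c y] of constants, so one of them is nonzero; it satisfies act
   h (c y) = chi (m h) c y. *)
pose sg g (x : F) := act g x / chi (m g).
pose c (y : K) := \sum_(g in G) sg g (io y).
have [y cy0] : exists y, c y != 0.
  apply: contrapT => h; have := oner_neq0 F.
  rewrite [1](sP F (fun c x => io c * x) sg).
  - rewrite big1 ?eqxx // => cy _.
    rewrite (_ : \sum_(g in G) _ = c cy.2); last by apply: eq_bigr => g _; rewrite mulr1.
    have [->|c0] := eqVneq (c cy.2) 0; first by rewrite mulr0.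
    by case: h; exists cy.2.
  - by move=> v a b; rewrite rmorphD mulrDl.
  - by move=> a v v'; rewrite mulrDr.
  - by move=> a b v; rewrite rmorphM mulrA.
  - by move=> v; rewrite rmorph1 mul1r.
  - by move=> g Gg a v; rewrite /sg tactM // tact_io // mulrA.
  - by move=> v; rewrite /sg tact_id /m lact1 subrr tchi0 divr1.
have actc h : h \in G -> act h (c y) = chi (m h) * c y.
  move=> Gh; rewrite /c tact_sum // mulr_sumr [RHS](reindex_inj (mulIg h)) /=.
  apply: eq_big => [g|g Gg]; first by rewrite groupMr.
  rewrite /sg tactM // tactV // tact_chi // mM // tchiD -tact_comp //.
  by rewrite invfM [RHS]mulrCA mulVKf ?tchi_neq0.
have mZ g : g \in G -> exists b, m g = zcomb e b.
  by move=> Gg; have [b e'E] := e'G g Gg; exists b; rewrite /m e'E addrC addKr.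
pose f (i : 'I_n.+1) := if unlift ord_max i is Some i then cayley (e i) else chi e' / c y.
have fl i : f (lift ord_max i) = cayley (e i) by rewrite /f liftK.
have fm : f ord_max = chi e' / c y by rewrite /f unlift_none.
have fe i : genfield io f (chi (e i)).
  by apply/gen_cayley; rewrite -fl; apply: genfield_var.
(* [c y] involves only constants and characters of the sublattice spanned by [e], which the Cayley
   coordinates already generate. *)
have fc : genfield io f (c y).
  apply: genfield_sum => g Gg; apply: genfieldM; first by rewrite tact_io //; apply: genfieldC.
  have [b ->] := mZ g Gg; apply: genfieldV; rewrite tchi_zcomb.
  by apply: genfield_prod => i _; apply: genfieldXz.
apply: (torus_linearize isoG (f := f) nL).
  apply: (tchi_gen ws) => i; case: (unliftP ord_max i) => [i' ->|->].
    by rewrite we.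
  rewrite we' -[chi e'](divfK cy0) -fm; apply: genfieldM => //; exact: genfield_var.
move=> g Gg i; case: (unliftP ord_max i) => [i' ->|->]; rewrite -/(affine_in f _).
  rewrite fl; apply: affine_signed (signed_cayley ei eG Gg i') => j.
  by rewrite -fl; apply: affine_var.
rewrite fm tactM // tact_chi // tactV // actc //.
have -> : lact L e' g = e' + m g by rewrite /m addrC subrK.
rewrite tchiD [chi e' * _]mulrC -mulf_div divff ?tchi_neq0 // mul1r -fm.
exact: affine_var.
Qed.

(* The lattice A_n with its permutations: x_i / (x_0 + ... + x_n) are permuted. *)
Theorem rational_simplex n (D : 'I_n.+1 -> L) :
  (n <= rank L)%N -> D ord0 = 0 -> spans (fun i : 'I_n => D (lift ord0 i)) ->
  (forall g, g \in G -> exists s : {perm 'I_n.+1},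
     forall i, lact L (D i) g = D (s i) - D (s ord0)) ->
  torus_rational T.
Proof.
move=> nL D0 Ds DG; have Di := tchi_algindep (T := T) Ds nL.
pose S := \sum_i chi (D i).
have S0 : S != 0.
  rewrite /S big_ord_recl D0 tchi0; apply/eqP => S0.
  have := Di (1 + \sum_i 'X_i).
  rewrite rmorphD rmorph1 rmorph_sum /=.
  under eq_bigr do rewrite mmapX mmap1U.
  move=> /(_ S0) /(congr1 (mcoeff 0%MM)).
  rewrite mcoeffD mcoeff1 eqxx mcoeff0 raddf_sum big1 ?addr0.
    by move/eqP; rewrite oner_eq0.
  by move=> i _; rewrite /= mcoeffX mnm1_eq0.
pose h i := chi (D i) / S.
pose f (i : 'I_n) := h (lift ord0 i).
have h0 : h ord0 = 1 - \sum_i f i.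
  apply/eqP; rewrite eq_sym subr_eq; apply/eqP; rewrite -(divff S0) {1}/S mulr_suml big_ord_recl.
  by congr (_ + _).
have hf i : affine_in f (h i).
  case: (unliftP ord0 i) => [j ->|->]; first exact: (affine_var f).
  rewrite h0; apply: affineD; last by apply/affineN/affine_sum => j _; apply: affine_var.
  by rewrite -(rmorph1 (tio T)); apply: affine_const.
have aff_gen x : affine_in f x -> genfield io f x.
  move=> [a [b ->]]; apply: genfieldD; last exact: genfieldC.
  by apply: genfield_sum => j _; apply: genfieldM; [apply: genfieldC|apply: genfield_var].
apply: (torus_linearize isoG (f := f) nL).
  apply: (tchi_gen Ds) => i.
  have -> : chi (D (lift ord0 i)) = h (lift ord0 i) / h ord0.
    by rewrite /h D0 tchi0 mul1r invrK divfK.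
  by apply: genfieldM; [|apply: genfieldV]; apply: aff_gen.
move=> g Gg i; rewrite -/(affine_in f _); have [s sP] := DG g Gg.
have Sg : act g S = S / chi (D (s ord0)).
  rewrite /S tact_sum // mulr_suml [in RHS](reindex_inj (@perm_inj _ s)) /=.
  by apply: eq_bigr => j _; rewrite tact_chi // sP tchiD tchiN.
rewrite /f /h tactM // tactV // Sg tact_chi // sP tchiD tchiN invf_div.
rewrite mulrA divfK ?tchi_neq0 //; exact: hf.
Qed.

(* Invariant rows span, so a semilinear action on row vectors has an invariant basis. *)
Lemma semilinear_basis n (sg : gT -> 'rV[K]_n -> 'rV[K]_n) :
  {in G, forall g, {morph sg g : u v / u + v}} ->
  {in G, forall g a v, sg g (a *: v) = gal g a *: sg g v} ->
  {in G &, forall g h v, sg (g * h)%g v = sg h (sg g v)} -> (forall v, sg 1%g v = v) ->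
  exists B : 'M[K]_n, B \in unitmx /\ {in G, forall g i, sg g (row i B) = row i B}.
Proof.
move=> sgD sgZ sgM sg1; have [s sP] := trace_decomposition (isom_gal_inj isoG).
pose Tr v := \sum_(g in G) sg g v.
have sg0 g : g \in G -> sg g 0 = 0.
  by move=> Gg; apply: (addrI (sg g 0)); rewrite -sgD // !addr0.
have TrG v g : g \in G -> sg g (Tr v) = Tr v.
  move=> Gg; rewrite /Tr (big_morph _ (sgD g Gg) (sg0 g Gg)) [RHS](reindex_inj (mulIg g)) /=.
  by apply: eq_big => [h|h Gh]; rewrite ?groupMr // sgM.
pose I := ('I_(size s) * 'I_n)%type.
pose t (x : I) := Tr ((tnth (in_tuple s) x.1).2 *: delta_mx 0 x.2).
pose A : 'M[K]_(#|{: I}|, n) := \matrix_x t (enum_val x).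
have Af : row_full A.
  apply/row_fullP; rewrite -/(exists B, _); apply/row_fullP; rewrite -sub1mx; apply/row_subP => i.
  rewrite row1 (sP 'rV[K]_n (fun c x => c *: x) sg _ _ _ _ _ _ (delta_mx 0 i)) //.
  - rewrite (big_nth (0, 0)) big_mkord; apply: summx_sub => l _; apply: scalemx_sub.
    have -> : \sum_(g in G) sg g ((nth (0, 0) s l).2 *: delta_mx 0 i) = row (enum_rank ((l, i) : I)) A.
      by rewrite rowK enum_rankK /t /Tr (tnth_nth (0, 0)).
    exact: row_sub.
  - by move=> v a b; rewrite scalerDl.
  - by move=> a u v; rewrite scalerDr.
  - by move=> a b v; rewrite scalerA.
  - by move=> v; rewrite scale1r.
exists (rowsub (fullrankfun Af) A); split; first exact: fullrowsub_unit.
by move=> g Gg i; rewrite row_rowsub rowK TrG.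
Qed.

(** Every permutation of Z/3 is affine: i |-> i + b or i |-> -i + b. *)
Lemma perm3_cases (s : {perm 'I_3}) :
  (forall i, s (i + 1) = s i + 1 /\ s (i + 2) = s i + 2) \/
  (forall i, s (i + 1) = s i + 2 /\ s (i + 2) = s i + 1).
Proof.
have ex i : [\/ i = 0, i = 1 | i = 2 :> 'I_3].
  by case: i => [[|[|[|//]]] h]; [constructor 1|constructor 2|constructor 3]; apply: val_inj.
have n01 : s 0 != s 1 by rewrite (inj_eq perm_inj).
have n02 : s 0 != s 2 by rewrite (inj_eq perm_inj).
have n12 : s 1 != s 2 by rewrite (inj_eq perm_inj).
have e11 : 1 + 1 = 2 :> 'I_3 by apply: val_inj.
have e12 : 1 + 2 = 0 :> 'I_3 by apply: val_inj.
have e21 : 2 + 1 = 0 :> 'I_3 by apply: val_inj.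
have e22 : 2 + 2 = 1 :> 'I_3 by apply: val_inj.
move: n01 n02 n12; case: (ex (s 0)) => h0; case: (ex (s 1)) => h1; case: (ex (s 2)) => h2;
  rewrite h0 h1 h2 // => _ _ _;
  solve [left => i; case: (ex i) => ->; rewrite ?add0r ?e11 ?e12 ?e21 ?e22 ?h0 ?h1 ?h2 ?add0r ?e11 ?e12 ?e21 ?e22 //
   | right => i; case: (ex i) => ->; rewrite ?add0r ?e11 ?e12 ?e21 ?e22 ?h0 ?h1 ?h2 ?add0r ?e11 ?e12 ?e21 ?e22 //].
Qed.

Section Hexagon.
Variables (D : 'I_3 -> L) (s : gT -> {perm 'I_3}) (sw : gT -> bool).
Hypothesis D0 : D 0 = 0.
Hypothesis sM : {in G &, {morph s : g h / (g * h)%g}}.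
Hypothesis s1 : s 1%g = 1%g.
Hypothesis DG : {in G, forall g i j, lact L (D i - D j) g =
  if sw g then D (s g j) - D (s g i) else D (s g i) - D (s g j)}.
Hypothesis Di : forall p : {mpoly K[2]},
  mmap io (fun i : 'I_2 => chi (D (lift 0 i))) p = 0 -> p = 0.

Let x i := chi (D i).
Let c' (i : 'I_3) : F := x (i + 1) - x (i + 2).
Let c (i : 'I_3) : F := - x i * c' i.

Let sum3 (V : zmodType) (f : 'I_3 -> V) : \sum_i f i = f 0 + f 1 + f 2.
Proof.
rewrite !big_ord_recl big_ord0 addr0 addrA.
by congr (f _ + f _ + f _); apply: val_inj.
Qed.

Let x0 : x 0 = 1. Proof. by rewrite /x D0 tchi0. Qed.

Let xE : (x 1 = chi (D (lift 0 0)) /\ x 2 = chi (D (lift 0 1))).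
Proof. by split; congr (chi (D _)); apply: val_inj. Qed.

Let e01 : 0 + 1 = 1 :> 'I_3. Proof. exact: val_inj. Qed.
Let e02 : 0 + 2 = 2 :> 'I_3. Proof. exact: val_inj. Qed.
Let e11 : 1 + 1 = 2 :> 'I_3. Proof. exact: val_inj. Qed.
Let e12 : 1 + 2 = 0 :> 'I_3. Proof. exact: val_inj. Qed.
Let e21 : 2 + 1 = 0 :> 'I_3. Proof. exact: val_inj. Qed.
Let e22 : 2 + 2 = 1 :> 'I_3. Proof. exact: val_inj. Qed.

Let sum_c' : \sum_i c' i = 0.
Proof. rewrite sum3 /c' e01 e02 e11 e12 e21 e22; ring. Qed.
Let sum_c : \sum_i c i = 0.
Proof. rewrite sum3 /c /c' e01 e02 e11 e12 e21 e22; ring. Qed.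

(* Partial fractions: the three numbers (x_{i+1} - x_{i+2}) (y - x_i) have sum zero and
   determine y; c and c' are their values at y = 0 and y = oo, which G permutes. *)
Let act_c g : g \in G -> exists l l' : F, [/\ l != 0, l' != 0 &
  (forall i, act g (c i) = l * c (s g i) /\ act g (c' i) = l' * c' (s g i)) \/
  (forall i, act g (c i) = l * c' (s g i) /\ act g (c' i) = l' * c (s g i))].
Proof.
move=> Gg; have xn0 i : x i != 0 by apply: tchi_neq0.
have [m [m0 actx]] : exists m, m != 0 /\
    forall i, act g (x i) = m * (if sw g then (x (s g i))^-1 else x (s g i)).
  exists (act g (x 0) / (if sw g then (x (s g 0))^-1 else x (s g 0))); split.
    by rewrite mulf_neq0 ?invr_eq0 ?tact_eq0 //; case: ifP; rewrite ?invr_eq0.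
  move=> i; have -> : x i = chi (D i - D 0) * x 0 by rewrite -tchiD subrK.
  rewrite tactM // tact_chi // DG //.
  by case: (sw g); rewrite tchiD tchiN -!/(x _) ?invrK; ring.
have [e [e0 eP]] : exists e : F, e != 0 /\ forall i,
    x (s g (i + 1)) - x (s g (i + 2)) = e * (x (s g i + 1) - x (s g i + 2)).
  have [h|h] := perm3_cases (s g); [exists 1|exists (-1)]; split; rewrite ?oppr_eq0 ?oner_neq0 // => i.
    by have [-> ->] := h i; rewrite mul1r.
  by have [-> ->] := h i; rewrite mulN1r opprB.
have prodE i : x (s g 0) * x (s g 1) * x (s g 2) =
    x (s g i) * (x (s g (i + 1)) * x (s g (i + 2))).
  have : [\/ i = 0, i = 1 | i = 2 :> 'I_3].
    by case: i => [[|[|[|//]]] h]; [constructor 1|constructor 2|constructor 3]; apply: val_inj.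
  by case=> ->; rewrite ?e01 ?e02 ?e11 ?e12 ?e21 ?e22; ring.
have actc' i : act g (c' i) = if sw g then m * e / (x (s g 0) * x (s g 1) * x (s g 2)) * c (s g i)
    else m * e * c' (s g i).
  rewrite /c' tactB // !actx -mulrBr; case: (sw g); last by rewrite eP mulrA.
  rewrite (prodE i) /c /c'.
  have -> : (x (s g (i + 1)))^-1 - (x (s g (i + 2)))^-1 =
      - (x (s g (i + 1)) - x (s g (i + 2))) / (x (s g (i + 1)) * x (s g (i + 2))).
    by field; rewrite !xn0.
  by rewrite eP; field; rewrite !xn0.
have actc i : act g (c i) = if sw g then m * m * e / (x (s g 0) * x (s g 1) * x (s g 2)) * c' (s g i)
    else m * m * e * c (s g i).
  rewrite {1}/c tactM // -[- x i]sub0r tactB // tact0 // sub0r actx actc'.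
  by case: (sw g); rewrite /c; [field; rewrite ?xn0|ring].
exists (if sw g then m * m * e / (x (s g 0) * x (s g 1) * x (s g 2)) else m * m * e),
  (if sw g then m * e / (x (s g 0) * x (s g 1) * x (s g 2)) else m * e).
split.
- by case: (sw g); rewrite !(mulf_eq0, invr_eq0) !negb_or m0 e0 ?xn0.
- by case: (sw g); rewrite !(mulf_eq0, invr_eq0) !negb_or m0 e0 ?xn0.
by case: (sw g) actc actc' => actc actc'; [right|left] => i; rewrite actc actc'.
Qed.

(** A linear form on the plane of triples with sum 0 is a triple modulo constants. [ext] normalises
    it by the value 0 at the last index, whence the subtraction in [sg], the action of G on such
    forms. *)
Let ext (v : 'rV[K]_2) (i : 'I_3) : K := if unlift ord_max i is Some j then v 0 j else 0.
Let sg g (v : 'rV[K]_2) : 'rV[K]_2 := \row_j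
  (gal g (ext v ((s g)^-1%g (lift ord_max j))) - gal g (ext v ((s g)^-1%g ord_max))).

Let ext_sg g v i : ext (sg g v) i =
  gal g (ext v ((s g)^-1%g i)) - gal g (ext v ((s g)^-1%g ord_max)).
Proof.
rewrite {1}/ext; case: (unliftP ord_max i) => [j ->|->]; first by rewrite mxE.
by rewrite subrr.
Qed.

Let ext_inj u v : ext u =1 ext v -> u = v.
Proof. by move=> h; apply/rowP => j; have := h (lift ord_max j); rewrite /ext liftK. Qed.

Let extD u v i : ext (u + v) i = ext u i + ext v i.
Proof. by rewrite /ext; case: unliftP => [j _|_]; rewrite ?mxE ?addr0. Qed.

Let extZ a v i : ext (a *: v) i = a * ext v i.
Proof. by rewrite /ext; case: unliftP => [j _|_]; rewrite ?mxE ?mulr0. Qed.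

Let pair (v : 'rV[K]_2) (d : 'I_3 -> F) := \sum_i io (ext v i) * d i.

Let pair_sg g v (d : 'I_3 -> F) : \sum_i d i = 0 ->
  \sum_i io (gal g (ext v i)) * d (s g i) = pair (sg g v) d.
Proof.
move=> d0; rewrite /pair [RHS](reindex_inj (@perm_inj _ (s g))).
under [in RHS]eq_bigr do rewrite ext_sg permK rmorphB mulrBl.
rewrite sumrB -mulr_sumr.
have -> : \sum_i d (s g i) = \sum_i d i by rewrite [RHS](reindex_inj (@perm_inj _ (s g))).
by rewrite d0 mulr0 subr0.
Qed.

(** Up to scalars [c] and [c'] are two points of the projective line of triples with sum 0, and G
    permutes these two points while permuting the indices. In a G-invariant basis of linear forms,
    provided by descent, their affine coordinates are [q] and [q']. *)
Lemma hexagon_coordinates : exists q q' : F,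
  [/\ forall g, g \in G -> (act g q = q /\ act g q' = q') \/ (act g q = q' /\ act g q' = q) &
   forall n (f : 'I_n -> F), genfield io f q -> genfield io f q' ->
     forall i, genfield io f (chi (D i))].
Proof.
have [B [Bu BG]] : exists B : 'M[K]_2, B \in unitmx /\ {in G, forall g i, sg g (row i B) = row i B}.
  apply: semilinear_basis.
  - move=> g Gg u v; apply: ext_inj => i; rewrite extD !ext_sg !extD !rmorphD; ring.
  - move=> g Gg a v; apply: ext_inj => i; rewrite extZ !ext_sg !extZ !rmorphM; ring.
  - move=> g h Gg Gh v; apply: ext_inj => i; rewrite !ext_sg sM // morphM // invMg !permM.
    by rewrite !galM ?memvf // !rmorphB; ring.
  - move=> v; apply: ext_inj => i; rewrite ext_sg morph1 !gal_id s1 invg1 !perm1.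
    by rewrite [X in _ - X]/ext unlift_none subr0.
pose q d := pair (row 0 B) d / pair (row 1 B) d.
have qact g l (d d' : 'I_3 -> F) : g \in G -> l != 0 -> \sum_i d' i = 0 ->
    (forall i, act g (d i) = l * d' (s g i)) -> act g (q d) = q d'.
  move=> Gg l0 d0 h; have E j : act g (pair (row j B) d) = l * pair (row j B) d'.
    rewrite -[row j B in RHS](BG g Gg) -pair_sg // mulr_sumr /pair tact_sum //.
    by apply: eq_bigr => i _; rewrite tactM // tact_io // h mulrCA.
  by rewrite /q tactM // tactV // !E invfM mulrACA divff ?mul1r.
exists (q c), (q c'); split.
  move=> g Gg; have [l [l' [l0 l0' [h|h]]]] := act_c Gg; [left|right]; split.
  - by apply: (qact _ l) => // i; have [] := h i.
  - by apply: (qact _ l') => // i; have [] := h i.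
  - by apply: (qact _ l) => // i; have [] := h i.
  - by apply: (qact _ l') => // i; have [] := h i.
have [x1E x2E] := xE.
pose X1 : {mpoly K[2]} := 'X_0; pose X2 : {mpoly K[2]} := 'X_1.
have ev1 : mmap io (fun i : 'I_2 => chi (D (lift 0 i))) X1 = x 1.
  by rewrite mmapX mmap1U -x1E.
have ev2 : mmap io (fun i : 'I_2 => chi (D (lift 0 i))) X2 = x 2.
  by rewrite mmapX mmap1U -x2E.
have pair2 j d : pair (row j B) d = \sum_(i < 2) io (B j i) * d (lift ord_max i).
  rewrite /pair (bigD1 ord_max) //= {1}/ext unlift_none rmorph0 mul0r add0r.
  rewrite (reindex_onto (lift ord_max) (fun i => odflt 0 (unlift ord_max i))) /=.
    apply: eq_big => [i|i _]; first by rewrite eq_sym neq_lift liftK eqxx.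
    by rewrite /ext liftK mxE.
  by move=> i; case: unliftP => [i' -> //|->]; rewrite eqxx.
have l0 : lift ord_max (0 : 'I_2) = 0 :> 'I_3 by apply: val_inj.
have l1 : lift ord_max (1 : 'I_2) = 1 :> 'I_3 by apply: val_inj.
have pairE j d : pair (row j B) d = io (B j 0) * d 0 + io (B j 1) * d 1.
  rewrite pair2 !big_ord_recl big_ord0 addr0; congr (io (B j _) * d _ + io (B j _) * d _);
  exact: val_inj.
have Brow j : B j 0 = 0 -> B j 1 = 0 -> False.
  move=> b0 b1; have r0 : row j B = 0.
    apply/rowP => i; rewrite !mxE; case: i => [[|[|//]] h].
      by rewrite -[RHS]b0; congr (B j _); apply: val_inj.
    by rewrite -[RHS]b1; congr (B j _); apply: val_inj.
  have := congr1 (row j) (mulmxV Bu); rewrite row_mul r0 mul0mx => /rowP/(_ j).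
  by rewrite !mxE eqxx => /esym/eqP; rewrite oner_eq0.
pose pt (a b : K) (i : 'I_2) := if i == 0 then a else b.
have pt0 a b : (X1.@[pt a b] = a) /\ (X2.@[pt a b] = b) by rewrite !mevalXU /pt.
have zz p a b : p = 0 :> {mpoly K[2]} -> p.@[pt a b] = 0 by move=> ->; rewrite meval0.
have pc0 : pair (row 1 B) c != 0.
  rewrite pairE //; apply/eqP => e.
  have /Di h : mmap io (fun i : 'I_2 => chi (D (lift 0 i)))
      ((B 1 0)%:MP * (X2 - X1) + (B 1 1)%:MP * (X1 * (1 - X2))) = 0.
    rewrite rmorphD !rmorphM !rmorphB rmorph1 /= !mmapC ev1 ev2 -[RHS]e /c /c'.
    rewrite e01 e02 e11 e12 x0; ring.
  have [] := (zz _ 0 1 h, zz _ 1 0 h); rewrite !(mevalD, mevalM, mevalN, mevalC, meval1).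
  have [-> ->] := pt0 0 1; have [-> ->] := pt0 1 0.
  rewrite !(subr0, sub0r, subrr, mulr0, mul0r, mulr1, addr0) => b0; rewrite b0 mul0r add0r.
  exact: Brow.
have pc0' : pair (row 1 B) c' != 0.
  rewrite pairE //; apply/eqP => e.
  have /Di h : mmap io (fun i : 'I_2 => chi (D (lift 0 i)))
      ((B 1 0)%:MP * (X1 - X2) + (B 1 1)%:MP * (X2 - 1)) = 0.
    rewrite rmorphD !rmorphM !rmorphB rmorph1 /= !mmapC ev1 ev2 -[RHS]e /c'.
    rewrite e01 e02 e11 e12 x0; ring.
  have [] := (zz _ 0 1 h, zz _ 1 1 h); rewrite !(mevalD, mevalM, mevalN, mevalC, meval1).
  have [-> ->] := pt0 0 1; have [-> ->] := pt0 1 1.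
  rewrite !(subr0, sub0r, subrr, mulr0, mul0r, mulr1, addr0) => b0 _.
  have {}b0 : B 1 0 = 0 by apply/eqP; rewrite -oppr_eq0 -mulrN1 b0.
  have := zz _ 0 0 h; rewrite !(mevalD, mevalM, mevalN, mevalC, meval1).
  have [-> ->] := pt0 0 0; rewrite b0 mul0r add0r sub0r mulrN1 => /eqP; rewrite oppr_eq0 => /eqP.
  exact: Brow.
have xneq : [/\ x 1 != x 0, x 2 != x 0 & x 1 != x 2].
  have nz (p : {mpoly K[2]}) a b : p.@[pt a b] != 0 -> mmap io (fun i : 'I_2 => chi (D (lift 0 i))) p != 0.
    by apply: contraNneq => /Di h; apply/eqP; apply: zz.
  have := (nz (X1 - 1) 0 0, nz (X2 - 1) 0 0, nz (X1 - X2) 1 0).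
  rewrite !(mevalD, mevalN, meval1); have [-> ->] := pt0 0 0; have [-> ->] := pt0 1 0.
  rewrite !rmorphB rmorph1 /= ev1 ev2 x0 sub0r subr0 oppr_eq0 oner_eq0 !subr_eq0.
  by case=> -[-> // -> // -> //].
have c'0 i : c' i != 0.
  rewrite /c' subr_eq0; have [h1 h2 h3] := xneq.
  have : [\/ i = 0, i = 1 | i = 2 :> 'I_3].
    by case: i => [[|[|[|//]]] h]; [constructor 1|constructor 2|constructor 3]; apply: val_inj.
  by case=> ->; rewrite ?e01 ?e02 ?e11 ?e12 ?e21 ?e22 // eq_sym.
move=> n f fq fq'.
have gen d : \sum_i d i = 0 -> pair (row 1 B) d != 0 -> genfield io f (q d) ->
    forall i, genfield io f (d i / pair (row 1 B) d).
  move=> d0 p0 fd.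
  have h j : genfield io f (d (lift ord_max j) / pair (row 1 B) d).
    have -> : d (lift ord_max j) / pair (row 1 B) d = io (invmx B j 0) * q d + io (invmx B j 1).
      apply: (mulIf p0); rewrite divfK // mulrDl -mulrA divfK //.
      transitivity (\sum_l io (invmx B j l) * pair (row l B) d).
        under eq_bigr do rewrite pair2 mulr_sumr.
        rewrite exchange_big /=.
        transitivity (\sum_(i < 2) io ((invmx B *m B) j i) * d (lift ord_max i)).
          rewrite mulVmx // (bigD1 j) //= mxE eqxx rmorph1 mul1r big1 ?addr0 // => i ij.
          by rewrite mxE eq_sym (negbTE ij) rmorph0 mul0r.
        apply: eq_bigr => i _; rewrite mxE rmorph_sum mulr_suml; apply: eq_bigr => l _.
        by rewrite rmorphM mulrA.
      rewrite !big_ord_recl big_ord0 addr0.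
      by congr (io (invmx B j _) * pair (row _ B) d + io (invmx B j _) * pair (row _ B) d); apply: val_inj.
    by apply: genfieldD; [apply: genfieldM => //|]; apply: genfieldC.
  move=> i; case: (unliftP ord_max i) => [j ->|->]; first exact: h.
  have -> : d ord_max = - \sum_j d (lift ord_max j).
    apply/eqP; rewrite -addr_eq0 -[X in _ == X]d0 (bigD1 (ord_max : 'I_3)) //=; apply/eqP; congr (_ + _).
    rewrite [RHS](reindex_onto (lift ord_max) (fun i => odflt 0 (unlift ord_max i))) /=.
      by apply: eq_bigl => l; rewrite eq_sym neq_lift liftK eqxx.
    by move=> l; case: unliftP => [l' -> //|->]; rewrite eqxx.
  rewrite mulNr mulr_suml; apply/genfieldN/genfield_sum => j _; exact: h.
have gc := gen c sum_c pc0 fq; have gc' := gen c' sum_c' pc0' fq'.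
have c0 i : c i != 0 by rewrite mulf_neq0 // oppr_eq0 tchi_neq0.
move=> i; rewrite -/(x i).
(* Since c i = - x i * c' i and x 0 = 1, the unknown scalars that normalise [c] and [c'] cancel in
   this double ratio. *)
have -> : x i = c i / pair (row 1 B) c * (c' 0 / pair (row 1 B) c') /
    (c 0 / pair (row 1 B) c * (c' i / pair (row 1 B) c')).
  rewrite {1}/c {2}/c x0; field; rewrite ?pc0 ?pc0' ?c'0 ?oppr_eq0 ?oner_eq0 //.
by apply: genfieldM; [|apply: genfieldV]; apply: genfieldM.
Qed.

End Hexagon.

(** The coordinates [q] and [q'], which G fixes or exchanges, and the Cayley coordinates of the
    signed part [e] together span a G-stable affine space. *)
Theorem rational_hexagon n (D : 'I_3 -> L) (s : gT -> {perm 'I_3}) (sw : gT -> bool)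
    (e : 'I_n -> L) (w : 'I_(2 + n) -> L) :
  (2 + n <= rank L)%N -> spans w -> (forall i, w (lshift n i) = D (lift 0 i)) ->
  (forall i, w (rshift 2 i) = e i) -> D 0 = 0 ->
  {in G &, {morph s : g h / (g * h)%g}} ->
  {in G, forall g i j, lact L (D i - D j) g =
    if sw g then D (s g j) - D (s g i) else D (s g i) - D (s g j)} ->
  signed e -> torus_rational T.
Proof.
move=> nL ws wD we D0 sM DG eG; have wi := tchi_algindep (T := T) ws nL.
have s1 : s 1%g = 1%g.
  by apply: (mulgI (s 1%g)); rewrite mulg1 -sM ?group1 // mulg1.
have Di : algindep io (fun i : 'I_2 => chi (D (lift 0 i))).
  suff -> : (fun i : 'I_2 => chi (D (lift 0 i))) = (fun i => chi (w i)) \o lshift n.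
    exact: algindep_reindex (@lshift_inj 2 n) wi.
  by apply/funext => i /=; rewrite wD.
have ei : algindep io (fun i => chi (e i)).
  suff -> : (fun i => chi (e i)) = (fun i => chi (w i)) \o @rshift 2 n.
    exact: algindep_reindex (@rshift_inj 2 n) wi.
  by apply/funext => i /=; rewrite we.
have [q [q' [qG qgen]]] := hexagon_coordinates D0 sM s1 DG Di.
pose f (i : 'I_(2 + n)) := match split i with
  | inl i => if i == 0 then q else q' | inr i => cayley (e i) end.
have fq : f (lshift n 0) = q by rewrite /f -/(unsplit (inl _)) unsplitK.
have fq' : f (lshift n 1) = q' by rewrite /f -/(unsplit (inl _)) unsplitK.
have fe i : f (rshift 2 i) = cayley (e i) by rewrite /f -/(unsplit (inr _)) unsplitK.
have gq : genfield io f q by rewrite -fq; apply: genfield_var.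
have gq' : genfield io f q' by rewrite -fq'; apply: genfield_var.
have aq : affine_in f q by rewrite -fq; apply: affine_var.
have aq' : affine_in f q' by rewrite -fq'; apply: affine_var.
apply: (torus_linearize isoG (f := f) nL).
  apply: (tchi_gen ws) => i; case: (split_ordP i) => j ->; first by rewrite wD; apply: qgen.
  by rewrite we; apply: gen_cayley; rewrite -fe; apply: genfield_var.
move=> g Gg i; rewrite -/(affine_in f _); case: (split_ordP i) => j ->; last first.
  rewrite fe; apply: affine_signed (signed_cayley ei eG Gg j) => l.
  by rewrite -fe; apply: affine_var.
have -> : f (lshift n j) = if j == 0 then q else q'.
  by rewrite /f -/(unsplit (inl _)) unsplitK.
by have [[h h']|[h h']] := qG g Gg; case: (j == 0); rewrite ?h ?h'.
Qed.

End Constructions.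

(** * Factorial polynomial rings *)

Section Factorial.
Variable R : idomainType.
Implicit Types a b c p q x : R.

Definition divides p a := exists c, a = c * p.
Definition prime_elt p :=
  [/\ p != 0, p \isn't a GRing.unit & forall a b, divides p (a * b) -> divides p a \/ divides p b].
Definition prime_product x u (s : seq R) :=
  [/\ u \is a GRing.unit, forall p, p \in s -> prime_elt p & x = u * \prod_(p <- s) p].
Definition factorial_dom := forall x, x != 0 -> exists u s, prime_product x u s.

Lemma dividesMl p a b : divides p a -> divides p (b * a).
Proof. by move=> [c ->]; exists (b * c); rewrite mulrA. Qed.
Lemma dividesMr p a b : divides p a -> divides p (a * b).
Proof. by rewrite mulrC; apply: dividesMl. Qed.
Lemma divides_refl p : divides p p. Proof. by exists 1; rewrite mul1r. Qed.
Lemma divides0 p : divides p 0. Proof. by exists 0; rewrite mul0r. Qed.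
Lemma dividesD p a b : divides p a -> divides p b -> divides p (a + b).
Proof. by move=> [c ->] [d ->]; exists (c + d); rewrite mulrDl. Qed.
Lemma dividesB p a b : divides p a -> divides p b -> divides p (a - b).
Proof. by move=> [c ->] [d ->]; exists (c - d); rewrite mulrBl. Qed.
Lemma divides_sum p (I : Type) (r : seq I) (P : pred I) (f : I -> R) :
  (forall i, P i -> divides p (f i)) -> divides p (\sum_(i <- r | P i) f i).
Proof. by move=> h; elim/big_ind: _ => //; [apply: divides0|apply: dividesD]. Qed.

Lemma prime_divides_unit p u : prime_elt p -> u \is a GRing.unit -> ~ divides p u.
Proof. by move=> [_ /negP pu _] uu [c e]; apply: pu; move: uu; rewrite e unitrM => /andP[]. Qed.

Lemma prime_divides_prod p (s : seq R) : prime_elt p ->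
  divides p (\prod_(q <- s) q) -> exists2 q, q \in s & divides p q.
Proof.
move=> pp; elim: s => [|q s IH]; first by rewrite big_nil => /(prime_divides_unit pp (unitr1 R)).
rewrite big_cons; have [_ _ h] := pp; case/h => [|/IH[r rs pr]]; first by exists q; rewrite ?mem_head.
by exists r; rewrite // inE rs orbT.
Qed.

Lemma prime_divides_prime p q : prime_elt p -> prime_elt q -> divides p q ->
  exists2 u, u \is a GRing.unit & q = u * p.
Proof.
move=> pp [q0 _ qp] [c qE]; have [|[d cE]|[d pE]] := qp c p; first by exists 1; rewrite mul1r.
- have : d * p = 1.
    by apply: (mulIf q0); rewrite mul1r mulrAC -cE -qE.
  have [p0 pu _] := pp; move=> /(congr1 (fun z => z \is a GRing.unit)).
  by rewrite unitr1 unitrM (negbTE pu) andbF.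
exists c => //; have cd : c * d = 1.
  by apply: (mulIf q0); rewrite mul1r -mulrA -pE.
by apply/unitrP; exists d; rewrite mulrC.
Qed.

End Factorial.

Section FactorialPoly.
Variable R : idomainType.
Hypothesis Rf : factorial_dom R.
Implicit Types (f g h : {poly R}).

Lemma divides_polyC (p : R) f : divides p%:P f <-> forall i, divides p f`_i.
Proof.
split=> [[g ->] i|h]; first by exists g`_i; rewrite coefMC.
have [c cP] := choice h; exists (\poly_(i < size f) c i).
apply/polyP => i; rewrite coefMC coef_poly; case: ltnP => [_|/leq_sizeP/(_ i (leqnn _))->] //.
by rewrite mul0r.
Qed.

(** Gauss: if p divides neither f nor g, take in each the first coefficient that p does not divide,
    at indices i and j. All other products in the coefficient of f g at i + j are divisible by p. *)
Lemma prime_polyC (p : R) : prime_elt p -> prime_elt p%:P.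
Proof.
move=> [p0 pu pp]; split; first by rewrite polyC_eq0.
  apply: contra pu; rewrite poly_unitE coefC eqxx => /andP[] //.
move=> f g /divides_polyC h; apply: contrapT => /not_orP[nf ng].
have ex f' : ~ divides p%:P f' -> exists i, ~ divides p f'`_i /\ forall j, (j < i)%N -> divides p f'`_j.
  move=> /divides_polyC /existsNP[i ni]; elim/ltn_ind: i ni => i IH ni.
  have [[j [ji nj]]|na] := pselect (exists j, (j < i)%N /\ ~ divides p f'`_j); first exact: IH nj.
  by exists i; split=> // j ji; apply: contrapT => nj; apply: na; exists j.
have [i [fi fl]] := ex f nf; have [j [gj gl]] := ex g ng.
suff : divides p (f`_i * g`_j) by case/pp.
have := h (i + j)%N; rewrite coefM (bigD1 (Ordinal (leq_addr j i : i < (i + j).+1)%N)) //= addKn.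
set S := \sum_(_ | _) _; move=> hS; rewrite -[_ * _](addrK S); apply: dividesB => //.
apply: divides_sum => l li; have [lt|ge] := ltnP l i; first by apply/dividesMr/fl.
apply/dividesMl/gl; have : (l : nat) != i by apply: contra li => /eqP e; apply/eqP/val_inj.
have := ltn_ord l; lia.
Qed.

Definition primitive h := forall p : R, prime_elt p -> ~ divides p%:P h.

(** The prime factors of c are cancelled one at a time: each divides b h, hence b, because h is
    primitive. *)
Lemma primitive_cancel h a b (c : R) : primitive h -> c != 0 -> c *: a = b * h -> divides h a.
Proof.
move=> hp c0; have [u [s [uu sp cE]]] := Rf c0; rewrite {}cE {c c0}.
elim: s sp b => [|p s IH] sp b; rewrite ?big_nil ?big_cons => e.
  exists (u^-1 *: b); rewrite -scalerAl -e mulr1 scalerA mulVr ?scale1r //.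
have pp : prime_elt p by apply: sp; rewrite mem_head.
have : divides p%:P (b * h).
  by rewrite -e -mul_polyC mulrCA rmorphM /= -mulrA; apply: dividesMr; apply: divides_refl.
have [_ _ /[apply]] := prime_polyC pp; case=> [[b' bE]|/(hp p pp)//].
apply: (IH _ b') => [q qs|]; first by apply: sp; rewrite inE qs orbT.
have p0 : p%:P != 0 by rewrite polyC_eq0; have [] := pp.
apply: (mulfI p0); rewrite mulrA [p%:P * b']mulrC -bE -e mul_polyC scalerA.
by congr (_ *: _); rewrite mulrCA.
Qed.

(* Over the field of fractions an irreducible polynomial is prime; primitivity brings the
   quotient back to R. *)
Lemma primitive_irreducible_prime h : primitive h -> irreducible_poly h -> prime_elt h.
Proof.
move=> hp [hs hi]; have h0 : h != 0 by rewrite -size_poly_gt0 ltnW.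
split=> // [|a b [c abE]].
  by rewrite poly_unitE; move: hs; case: eqP => // ->.
have hd : (h %| a * b)%R by rewrite abE dvdp_mull.
have back f : (h %| f)%R -> divides h f.
  move=> /Pdiv.Idomain.dvdpP[[d q] /= d0 e]; exact: (primitive_cancel hp d0 e).
have [cop|ncop] := boolP (coprimep h a).
  by right; apply: back; rewrite -(Gauss_dvdpr _ cop).
left; apply: back; have := hi (gcdp h a) ncop (dvdp_gcdl _ _).
by rewrite /eqp => /andP[_ h1]; apply: dvdp_trans h1 (dvdp_gcdr _ _).
Qed.

(** Extracting common prime factors ends, because each of them uses up one prime factor of the
    leading coefficient. *)
Lemma primitive_part f : f != 0 -> exists (c : R) h, [/\ c != 0, f = c *: h & primitive h].
Proof.
move=> f0; have l0 : lead_coef f != 0 by rewrite lead_coef_eq0.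
have [u [s [uu sp lE]]] := Rf l0.
have [k ks] := ubnP (size s); elim: k f f0 u s uu sp lE ks {l0} => // k IH f f0 u s uu sp lE ks.
have [[p [pp [g fE]]]|np] := pselect (exists p, prime_elt p /\ divides p%:P f); last first.
  by exists 1, f; rewrite oner_neq0 scale1r; split=> // p pp pf; apply: np; exists p.
have p0 : p != 0 by have [] := pp.
have g0 : g != 0 by apply: contraNneq f0 => g0; rewrite fE g0 mul0r.
have lf : lead_coef f = lead_coef g * p by rewrite fE lead_coefM lead_coefC.
have [q qs pq] : exists2 q, q \in s & divides p q.
  apply: prime_divides_prod => //; have : divides p (u * \prod_(q <- s) q).
    by rewrite -lE lf; exists (lead_coef g).
  by have [_ _ /[apply]] := pp; case=> // /(prime_divides_unit pp uu).
have [v vu qE] := prime_divides_prime pp (sp q qs) pq.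
have lg : lead_coef g = (u * v) * \prod_(r <- rem q s) r.
  apply: (mulIf p0); rewrite -lf lE (perm_big _ (perm_to_rem qs)) big_cons /= qE; ring.
have [|||c [h [c0 gE hp]]] := IH g g0 (u * v) (rem q s) _ _ lg.
- by rewrite unitrM uu.
- by move=> r /mem_rem; apply: sp.
- have s0 : (0 < size s)%N by case: (s) qs.
  by rewrite size_rem //; case: (size s) ks s0.
exists (p * c), h; split=> //; first by rewrite mulf_neq0.
by rewrite fE gE mulrC mul_polyC scalerA.
Qed.

(** A non-constant divisor of f of least degree, up to scalars, is irreducible; its primitive part
    is prime and divides f with a quotient of smaller degree. *)
Theorem factorial_poly : factorial_dom {poly R}.
Proof.
move=> f; have [n] := ubnP (size f); elim: n f => // n IH f fn f0.
have [sf|sf] := leqP (size f) 1.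
  have [c fE] : exists c, f = c%:P by exists f`_0; apply: size1_polyC.
  have c0 : c != 0 by rewrite -polyC_eq0 -fE.
  have [u [s [uu sp cE]]] := Rf c0; exists u%:P, (map polyC s); split.
  - rewrite poly_unitE coefC eqxx size_polyC uu andbT.
    by have -> : u != 0 by apply: contraTneq uu => ->; rewrite unitr0.
  - by move=> p /mapP[q qs ->]; apply/prime_polyC/sp.
  - by rewrite fE cE rmorphM rmorph_prod big_map.
have [h [hs hf hm]] : exists h, [/\ (1 < size h)%N, (h %| f)%R &
    forall g, (1 < size g)%N -> (g %| h)%R -> (size h <= size g)%N].
  have : exists h, (1 < size h)%N /\ (h %| f)%R by exists f; rewrite dvdpp.
  case=> h; have [m] := ubnP (size h); elim: m h => // m IHm h hm [hs hf].
  have [[g [gs gh gl]]|ng] := pselect (exists g, [/\ (1 < size g)%N, (g %| h)%R & (size g < size h)%N]).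
    apply: (IHm g); last by split=> //; apply: dvdp_trans gh hf.
    by rewrite -ltnS (leq_trans _ hm).
  exists h; split=> // g gs gh; rewrite leqNgt; apply/negP => gl.
  by apply: ng; exists g.
have h0 : h != 0 by rewrite -size_poly_gt0 ltnW.
have [c [h' [c0 hE hp]]] := primitive_part h0.
have hh' : (h' %= h)%R by rewrite hE eqp_sym eqp_scale.
have h'0 : h' != 0 by rewrite -size_poly_gt0 (eqp_size hh') ltnW.
have hi : irreducible_poly h'.
  split; first by rewrite (eqp_size hh').
  move=> q q1 qh; have q0 : q != 0.
    by apply: contraTneq qh => ->; rewrite dvd0p -size_poly_gt0 (eqp_size hh') ltnW.
  have qs : (1 < size q)%N by rewrite ltn_neqAle eq_sym q1 size_poly_gt0.
  have qh' : (q %| h)%R by rewrite -(eqp_dvdr _ hh').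
  by rewrite -dvdp_size_eqp // eqn_leq (dvdp_leq h'0 qh) (eqp_size hh') hm.
have h'p := primitive_irreducible_prime hp hi.
have /Pdiv.Idomain.dvdpP[[d q] /= d0 e] : (h' %| f)%R by rewrite (eqp_dvdl _ hh').
have [g fE] := primitive_cancel hp d0 e.
have g0 : g != 0 by apply: contraNneq f0 => g0; rewrite fE g0 mul0r.
have [|u [s [uu sp gE]]] := IH g _ g0.
  have : (size f <= n)%N by [].
  rewrite fE size_mul // (eqp_size hh'); move: hs; lia.
exists u, (h' :: s); split=> //; last by rewrite big_cons fE gE mulrAC mulrA.
by move=> p; rewrite inE => /predU1P[->|/sp].
Qed.

End FactorialPoly.

Lemma factorial_iso (R S : idomainType) (t : {rmorphism R -> S}) :
  injective t -> (forall y, exists x, t x = y) -> factorial_dom R -> factorial_dom S.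
Proof.
move=> ti ts Rf y; have [x <-] := ts y; rewrite -(rmorph0 t) (inj_eq ti) => x0.
have [u [s [uu sp ->]]] := Rf x x0; exists (t u), (map t s); split.
- exact: rmorph_unit.
- move=> p /mapP[q /sp[q0 qu qp] ->]; split; first by rewrite -(rmorph0 t) (inj_eq ti).
    apply: contra qu => /unitrP[z [e _]]; have [w wE] := ts z.
    by apply/unitrP; exists w; split; apply: ti; rewrite rmorphM wE rmorph1 // mulrC.
  move=> a b; have [a' <-] := ts a; have [b' <-] := ts b; rewrite -rmorphM => -[c].
  have [c' <-] := ts c; rewrite -rmorphM => /ti e.
  by case: (qp a' b') => [|[d ->]|[d ->]]; [exists c' | left | right] => //; exists (t d); rewrite rmorphM.
by rewrite rmorphM rmorph_prod big_map.
Qed.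

Section PolyMpoly.
Variables (K : fieldType) (n : nat).

Definition poly_mpoly : {poly {mpoly K[n]}} -> {mpoly K[n.+1]} :=
  horner_eval ('X_ord_max) \o map_poly (@mwiden n K).
HB.instance Definition _ := GRing.RMorphism.on poly_mpoly.

Definition mpoly_poly : {mpoly K[n.+1]} -> {poly {mpoly K[n]}} :=
  mmap (polyC \o @mpolyC n K) (fun i => if unlift ord_max i is Some j then ('X_j)%:P else 'X).
HB.instance Definition _ := GRing.RMorphism.on mpoly_poly.

Lemma poly_mpolyC p : poly_mpoly p%:P = mwiden p.
Proof. by rewrite /poly_mpoly /= map_polyC /horner_eval hornerC. Qed.

Lemma poly_mpolyX : poly_mpoly 'X = 'X_ord_max.
Proof. by rewrite /poly_mpoly /= map_polyX /horner_eval hornerX. Qed.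

Lemma widen_lift (i : 'I_n) : widen_ord (leqnSn n) i = lift ord_max i.
Proof. by apply: val_inj; rewrite /= /bump leqNgt ltn_ord. Qed.

Lemma mpoly_poly_widen p : mpoly_poly (mwiden p) = p%:P.
Proof.
rewrite /mwiden {1}/mmap raddf_sum [in RHS](mpolyE p) raddf_sum; apply: eq_bigr => m _ /=.
rewrite rmorphM -mul_mpolyC [in RHS]rmorphM /= /mpoly_poly mmapC; congr (_ * _).
rewrite /mmap1 rmorph_prod mpolyXE_id rmorph_prod; apply: eq_bigr => i _.
by rewrite !rmorphXn /= mmapX mmap1U widen_lift liftK.
Qed.

Lemma poly_mpolyK : cancel poly_mpoly mpoly_poly.
Proof.
move=> p; rewrite -{1}[p]coefK poly_def raddf_sum raddf_sum /=.
rewrite -[RHS]coefK poly_def; apply: eq_bigr => i _.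
by rewrite -mul_polyC !rmorphM /= poly_mpolyC mpoly_poly_widen !rmorphXn /= poly_mpolyX
  /mpoly_poly mmapX mmap1U unlift_none.
Qed.

Lemma mpoly_polyK : cancel mpoly_poly poly_mpoly.
Proof.
move=> p; rewrite {1}/mpoly_poly /mmap raddf_sum [RHS]mpolyE; apply: eq_bigr => m _ /=.
rewrite rmorphM /= poly_mpolyC mwidenC -mul_mpolyC; congr (_ * _).
rewrite /mmap1 rmorph_prod mpolyXE_id; apply: eq_bigr => i _.
rewrite rmorphXn /=; congr (_ ^+ _); case: unliftP => [j ->|->]; last exact: poly_mpolyX.
by rewrite poly_mpolyC mwidenX mnmwiden1 widen_lift.
Qed.

End PolyMpoly.

Lemma mpoly0_factorial (K : fieldType) : factorial_dom {mpoly K[0]}.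
Proof.
move=> p p0; exists p, [::]; split; rewrite ?big_nil ?mulr1 //.
have pE : p = (p@_0%MM)%:MP.
  apply/mpolyP => m; rewrite mcoeffC; have -> : m = 0%MM by apply/mnmP => -[].
  by rewrite eqxx mulr1.
have c0 : p@_0%MM != 0 by apply: contraNneq p0 => c0; rewrite pE c0 mpolyC0.
rewrite pE; apply: (rmorph_unit (@mpolyC 0 K)).
by rewrite unitfE.
Qed.

Lemma mpolyS_factorial (K : fieldType) n :
  factorial_dom {poly {mpoly K[n]}} -> factorial_dom {mpoly K[n.+1]}.
Proof.
have ti : injective (@poly_mpoly K n) := can_inj (@poly_mpolyK K n).
have ts y : exists x, @poly_mpoly K n x = y.
  by exists (mpoly_poly y); apply: mpoly_polyK.
pose t : {rmorphism {poly {mpoly K[n]}} -> {mpoly K[n.+1]}} := @poly_mpoly K n.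
have h := @factorial_iso {poly {mpoly K[n]}} {mpoly K[n.+1]} t.
have h2 := h ti ts.
exact: h2.
Qed.

Lemma mpoly_factorial (K : fieldType) n : factorial_dom {mpoly K[n]}.
Proof.
elim: n => [|n IH]; first exact: mpoly0_factorial.
exact/mpolyS_factorial/factorial_poly.
Qed.

(** * Valuations and divisors *)

Section FieldDivisors.
Variables (F : fieldType) (A : F -> Prop).
Hypothesis A1 : A 1.
Hypothesis AB : forall x y, A x -> A y -> A (x - y).
Hypothesis AM : forall x y, A x -> A y -> A (x * y).
Hypothesis Afrac : forall f, exists a b, [/\ A a, A b, b != 0 & f = a / b].

(** Divisibility, units and primes are taken relative to a predicate [A] on the field F, because two
    different subrings of the same field will be compared. *)
Definition fdivides p x := exists2 c, A c & x = c * p.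
Definition funit u := [/\ u != 0, A u & A u^-1].
Definition fprime p := [/\ A p, p != 0, ~ A p^-1 &
  forall a b, A a -> A b -> fdivides p (a * b) -> fdivides p a \/ fdivides p b].

Hypothesis Afact : forall x, A x -> x != 0 ->
  exists u s, [/\ funit u, forall p, p \in s -> fprime p & x = u * \prod_(p <- s) p].

Let A_0 : A 0. Proof. by rewrite -(subrr 1); apply: AB. Qed.
Let AN x : A x -> A (- x). Proof. by rewrite -sub0r; apply: AB. Qed.
Let AD x y : A x -> A y -> A (x + y).
Proof. by move=> ax ay; rewrite -[y]opprK; apply/AB/AN. Qed.

Lemma funit1 : funit 1. Proof. by split; rewrite ?oner_neq0 ?invr1. Qed.
Lemma funitM u v : funit u -> funit v -> funit (u * v).
Proof. by move=> [u0 au au'] [v0 av av']; split; rewrite ?mulf_neq0 ?invfM; try apply: AM. Qed.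
Lemma funitV u : funit u -> funit u^-1.
Proof. by move=> [u0 au au']; split; rewrite ?invr_eq0 ?invrK. Qed.

Definition has_valuation p f (n : int) :=
  exists a b, [/\ A a, A b, ~ fdivides p a, ~ fdivides p b & f = p ^ n * (a / b)].

Lemma fdivides0 p : fdivides p 0. Proof. by exists 0; rewrite ?mul0r. Qed.
Lemma nfdivides0 p a : ~ fdivides p a -> a != 0.
Proof. by move=> h; apply/eqP => a0; apply: h; rewrite a0; apply: fdivides0. Qed.

Lemma has_valuation_uniq p f n m : fprime p ->
  has_valuation p f n -> has_valuation p f m -> n = m.
Proof.
wlog: n m / n <= m => [h pp fn fm|].
  have [le|le] : n <= m \/ m <= n by lia.
    exact: h le pp fn fm.
  exact/esym/(h _ _ le).
move=> nm [ap p0 np pp] [a [b [aa ab na nb fE]]] [a' [b' [aa' ab' na' nb' fE']]].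
have [k mE] : exists k : nat, m = n + k%:Z by exists (absz (m - n)); lia.
case: k mE => [|k] mE; first by rewrite mE addr0.
have b0 := nfdivides0 nb; have b0' := nfdivides0 nb'.
have e : a * b' = p ^+ k * (a' * b) * p.
  have : a / b = p ^+ k.+1 * (a' / b').
    by apply: (mulfI (expfz_neq0 n p0)); rewrite -fE fE' mE expfzDr // -mulrA.
  move/(congr1 (fun z => z * (b * b'))); move=> e.
  transitivity (a / b * (b * b')); first by field.
  by rewrite e exprS; field.
case: (pp a b' aa ab') => //; exists (p ^+ k * (a' * b)) => //.
apply: AM; last exact: AM.
by elim: (k) => [|l IH]; rewrite ?expr0 // exprS; apply: AM.
Qed.

Lemma nfdividesM p a b : fprime p -> A a -> A b ->
  ~ fdivides p a -> ~ fdivides p b -> ~ fdivides p (a * b).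
Proof. by move=> [_ _ _ pp] aa ab na nb /(pp a b aa ab)[]. Qed.

Lemma has_valuationM p f h n m : fprime p ->
  has_valuation p f n -> has_valuation p h m -> has_valuation p (f * h) (n + m).
Proof.
move=> pp [a [b [aa ab na nb ->]]] [a' [b' [aa' ab' na' nb' ->]]].
exists (a * a'), (b * b'); split; try exact: AM; try exact: nfdividesM.
have [_ p0 _ _] := pp; rewrite expfzDr // -mulf_div; ring.
Qed.

Lemma has_valuationV p f n : fprime p -> has_valuation p f n -> has_valuation p f^-1 (- n).
Proof.
move=> pp [a [b [aa ab na nb ->]]]; exists b, a; split=> //.
by rewrite invfM invf_div invr_expz.
Qed.

Lemma has_valuation_unit p u : fprime p -> funit u -> has_valuation p u 0.
Proof.
move=> [ap p0 np pp] [u0 au au']; exists u, 1.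
have n1 : ~ fdivides p 1.
  by move=> [c ac e]; apply: np; rewrite -[p^-1]mul1r e mulfK.
split=> //; last by rewrite expr0z mul1r divr1.
by move=> [c ac e]; apply: n1; exists (u^-1 * c); [apply: AM|rewrite -mulrA -e mulVf].
Qed.

Lemma fprime_assoc p q : fprime p -> fprime q -> fdivides p q -> exists2 u, funit u & q = u * p.
Proof.
move=> [ap p0 np pp] [aq q0 nq qp] [c ac qE].
have c0 : c != 0 by apply: contraNneq q0 => c0; rewrite qE c0 mul0r.
exists c => //; split=> //; case: (qp c p) => //; first by exists 1; rewrite ?mul1r.
- move=> [d ad cE]; case: np; have -> : p^-1 = d; last exact: ad.
  by apply: (mulIf p0); rewrite mulVf //; apply: (mulIf c0); rewrite mul1r {1}cE qE; ring.
move=> [d ad pE]; have -> : c^-1 = d; last exact: ad.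
by apply: (mulIf c0); rewrite mulVf //; apply: (mulIf p0); rewrite mul1r {1}pE qE; ring.
Qed.

Lemma has_valuation_prime p q : fprime p -> fprime q ->
  has_valuation p q (if `[< fdivides p q >] then 1 else 0).
Proof.
move=> pp pq; have [ap p0 np _] := pp; have [aq q0 _ _] := pq.
case: asboolP => [/(fprime_assoc pp pq)[u uu ->]|h].
  apply: (has_valuationM (n := 0) (m := 1)) => //; first exact: has_valuation_unit.
  have [a [b [aa ab na nb e]]] := has_valuation_unit pp funit1.
  by exists a, b; split=> //; rewrite expr1z -[a / b]mul1r -(expr0z p) -e mulr1.
exists q, 1; split=> //; last by rewrite expr0z mul1r divr1.
by have [a [b [_ _ _ _]]] := has_valuation_unit pp funit1; move=> _ [c ac e];
  apply: np; rewrite -[p^-1]mul1r e mulfK.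
Qed.

Lemma has_valuation_prod p (s : seq F) : fprime p -> (forall q, q \in s -> fprime q) ->
  has_valuation p (\prod_(q <- s) q) (count (fun q => `[< fdivides p q >]) s)%:Z.
Proof.
move=> pp; elim: s => [|q s IH] sp.
  by rewrite big_nil /=; apply: has_valuation_unit => //; apply: funit1.
rewrite big_cons /= PoszD; apply: has_valuationM => //; last first.
  by apply: IH => r rs; apply: sp; rewrite inE rs orbT.
have := has_valuation_prime pp (sp q (mem_head _ _)).
by case: asbool.
Qed.

Lemma factored_fraction f : f != 0 -> exists u s s', [/\ funit u, forall p, p \in s -> fprime p,
  forall p, p \in s' -> fprime p & f = u * (\prod_(p <- s) p) / (\prod_(p <- s') p)].
Proof.
move=> f0; have [a [b [aa ab b0 fE]]] := Afrac f.
have a0 : a != 0 by apply: contraNneq f0 => a0; rewrite fE a0 mul0r.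
have [u [s [uu sp aE]]] := Afact aa a0; have [u' [s' [uu' sp' bE]]] := Afact ab b0.
exists (u / u'), s, s'; split=> //; first exact/funitM/funitV.
by rewrite fE aE bE -mulf_div mulrA.
Qed.

Lemma has_valuation_fraction p u s s' : fprime p -> funit u -> (forall p, p \in s -> fprime p) ->
  (forall p, p \in s' -> fprime p) ->
  has_valuation p (u * (\prod_(p <- s) p) / (\prod_(p <- s') p))
   ((count (fun q => `[< fdivides p q >]) s)%:Z - (count (fun q => `[< fdivides p q >]) s')%:Z).
Proof.
move=> pp uu sp sp'; apply: has_valuationM => //.
  rewrite -[Posz _]add0r; apply: has_valuationM => //; first exact: has_valuation_unit.
  exact: has_valuation_prod.
by apply: has_valuationV => //; apply: has_valuation_prod.
Qed.

(** The value at f = 0 is fixed to 0 so that associate primes define equal functions on the whole of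
    F. *)
Lemma has_valuation_ex p f : exists n : int,
  (f = 0 -> n = 0) /\ (fprime p -> f != 0 -> has_valuation p f n).
Proof.
have [->|f0] := eqVneq f 0; first by exists 0; split=> // _; rewrite eqxx.
have fn0 : f = 0 -> False by move/eqP; rewrite (negbTE f0).
have [pp|np] := pselect (fprime p); last by exists 0.
have [u [s [s' [uu sp sp' fE]]]] := factored_fraction f0.
by have := has_valuation_fraction pp uu sp sp'; rewrite -fE => h; refine (ex_intro _ _ (conj _ (fun _ _ => h))) => /fn0.
Qed.

Definition valuation p f : int := projT1 (cid (has_valuation_ex p f)).

Lemma valuation0 p : valuation p 0 = 0.
Proof. by rewrite /valuation; case: (cid _) => n /= [n0 _]; apply: n0. Qed.

Lemma valuationP p f : fprime p -> f != 0 -> has_valuation p f (valuation p f).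
Proof. by rewrite /valuation; case: cid => n []. Qed.

Lemma valuationE p f n : fprime p -> f != 0 -> has_valuation p f n -> valuation p f = n.
Proof. by move=> pp f0 h; apply: has_valuation_uniq (valuationP pp f0) h. Qed.

(** In a factored fraction every prime of the numerator has, by the count of valuations, an
    associate in the denominator, and the two are cancelled against a unit. *)
Lemma funit_valuation f : f != 0 -> (forall p, fprime p -> valuation p f = 0) -> funit f.
Proof.
move=> f0; have [u [s [s' [uu sp sp' fE]]]] := factored_fraction f0.
have [n] := ubnP (size s); elim: n s s' u f f0 uu sp sp' fE => // n IH s s' u f f0 uu sp sp' fE sn fv.
have cnt p : fprime p ->
    count (fun q => `[< fdivides p q >]) s = count (fun q => `[< fdivides p q >]) s'.
  move=> pp; have := fv p pp.
  have := has_valuation_fraction pp uu sp sp'; rewrite -fE => /(valuationE pp f0) ->.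
  by move/eqP; rewrite subr_eq0 => /eqP[].
have self p : fdivides p p by exists 1; rewrite ?mul1r.
case: s => [|p s] in sp fE sn cnt *.
  case: s' => [|q s'] in sp' fE cnt *.
    by rewrite fE !big_nil mulr1 divr1.
  have := cnt q (sp' q (mem_head _ _)); rewrite /=.
  by case: asboolP => // /(_ (self q)).
have pp := sp p (mem_head _ _).
have : has (fun q => `[< fdivides p q >]) s'.
  by rewrite has_count -cnt //=; case: asboolP => // /(_ (self p)).
case/hasP => q qs' /asboolP pq.
have [v vu qE] := fprime_assoc pp (sp' q qs') pq.
have [_ p0 _ _] := pp; have [v0 _ _] := vu.
have s'0 : \prod_(r <- rem q s') r != 0.
  by rewrite prodf_seq_neq0; apply/allP => r /mem_rem/sp'[].
apply: (IH s (rem q s') (u / v) f f0).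
- exact/funitM/funitV.
- by move=> r rs; apply: sp; rewrite inE rs orbT.
- by move=> r /mem_rem; apply: sp'.
- have gen X Y : Y != 0 -> u * (p * X) / (q * Y) = u / v * X / Y.
    by move=> Y0; rewrite qE; field; rewrite Y0 v0 p0.
  by rewrite fE (perm_big _ (perm_to_rem qs')) !big_cons /= gen.
- by [].
- exact: fv.
Qed.

Lemma valuation_assoc p q f : fprime p -> fprime q -> fdivides p q -> valuation p f = valuation q f.
Proof.
move=> pp pq pq'; have [u uu qE] := fprime_assoc pp pq pq'.
have [f0|f0] := eqVneq f 0; first by rewrite f0 !valuation0.
have [_ p0 _ _] := pp; have [_ q0 _ _] := pq; have [u0 au au'] := uu.
apply: valuationE => //; have [a [b [aa ab na nb]]] := valuationP pq f0.
move: (valuation q f) => m e; have upow (n : int) : A (u ^ n).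
  by case: n => n; rewrite ?NegzE -?exprnP -?exprnN -?exprVn; elim: n => [|n IH];
    rewrite ?expr0 // exprS; apply: AM => //; rewrite exprS; apply: AM.
exists (u ^ m * a), b; split=> //; last by rewrite {1}e qE expfzMl; ring.
- exact: AM.
- move=> [c ac h]; apply: na; exists (u ^ (- m - 1) * c); first exact: AM.
  rewrite qE (_ : _ * _ * (u * p) = u ^ (- m - 1) * u * (c * p)); last by ring.
  rewrite -h mulrA -{2}[u]expr1z -!expfzDr //.
  by rewrite (_ : _ - 1 + 1 + _ = 0) ?expr0z ?mul1r //; lia.
move=> [c ac h]; apply: nb; exists (u ^ (-1) * c); first exact: AM.
by rewrite qE mulrACA -{2}[u]expr1z -!expfzDr // addNr expr0z mul1r.
Qed.

(** A divisor is the valuation function itself rather than a prime: associate primes are then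
    identified, and G acts by composition. *)
Definition divisor (v : F -> int) := exists2 p, fprime p & v = valuation p.

Lemma divisor_mul v f h : divisor v -> f != 0 -> h != 0 -> v (f * h) = v f + v h.
Proof.
move=> [p pp ->] f0 h0; apply: valuationE; rewrite ?mulf_neq0 //.
by apply: has_valuationM => //; apply: valuationP.
Qed.

Lemma divisor_unit v u : divisor v -> funit u -> v u = 0.
Proof. by move=> [p pp ->] uu; apply: valuationE => //; [case: uu|apply: has_valuation_unit]. Qed.

Lemma divisor_ker f : f != 0 -> (forall v, divisor v -> v f = 0) -> funit f.
Proof. by move=> f0 h; apply: funit_valuation => // p pp; apply: h; exists p. Qed.

Lemma valuation_prime p q : fprime p -> fprime q -> valuation p q != 0 -> valuation p = valuation q.
Proof.
move=> pp pq; have [_ q0 _ _] := pq; rewrite (valuationE pp q0 (has_valuation_prime pp pq)).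
by case: asboolP => // d _; apply/funext => f; apply: valuation_assoc.
Qed.

Lemma divisor_uniformizer v : divisor v ->
  exists pi, pi != 0 /\ forall w, divisor w -> w pi = (w == v)%:R.
Proof.
move=> [p pp ->]; have [_ p0 _ _] := pp; exists p; split=> // w [q pq ->].
have [e|ne] := eqVneq (valuation q) (valuation p).
  rewrite e (valuationE pp p0 (has_valuation_prime pp pp)).
  by case: asboolP => // -[]; exists 1; rewrite ?mul1r.
by apply/eqP; apply: contraNT ne => /(valuation_prime pq pp)->.
Qed.

Lemma divisor_support f : f != 0 -> exists s : seq (F -> int), forall v, divisor v -> v f != 0 -> v \in s.
Proof.
move=> f0; have [u [s [s' [uu sp sp' fE]]]] := factored_fraction f0.
exists (map valuation (s ++ s')) => _ [p pp ->].
rewrite fE (valuationE pp _ (has_valuation_fraction pp uu sp sp')) -?fE // => c0.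
have : has (fun q => `[< fdivides p q >]) (s ++ s').
  by rewrite has_count count_cat; lia.
case/hasP => q; rewrite mem_cat => qs /asboolP d; apply/mapP; exists q; first by rewrite mem_cat.
have pq : fprime q by case/orP: qs => [/sp|/sp'].
by apply/funext => h; apply: valuation_assoc.
Qed.

Section Transport.
Variables s t : {rmorphism F -> F}.
Hypotheses (sK : cancel s t) (tK : cancel t s).
Hypotheses (sA : forall x, A x -> A (s x)) (tA : forall x, A x -> A (t x)).

Let fdivides_s p x : fdivides (s p) (s x) -> fdivides p x.
Proof. by move=> [c ac e]; exists (t c); [apply: tA|apply: (can_inj sK); rewrite rmorphM tK]. Qed.

Let fprime_s p : fprime p -> fprime (s p).
Proof.
move=> [ap p0 np pp]; split; [exact: sA|by rewrite fmorph_eq0|..].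
  by rewrite -fmorphV => /tA; rewrite sK.
move=> a b aa ab; rewrite -[a]tK -[b]tK -rmorphM => /fdivides_s/(pp _ _ (tA aa) (tA ab)).
by case=> -[c ac ->]; [left|right]; exists (s c); rewrite ?rmorphM //; apply: sA.
Qed.

Lemma divisor_transport v : divisor v -> divisor (v \o t).
Proof.
move=> [p pp ->]; exists (s p); first exact: fprime_s.
apply/funext => f /=; have [->|f0] := eqVneq f 0; first by rewrite rmorph0 !valuation0.
apply/esym/valuationE => //; first exact: fprime_s.
have tf0 : t f != 0 by rewrite fmorph_eq0.
have [a [b [aa ab na nb e]]] := valuationP pp tf0.
exists (s a), (s b); split; try exact: sA.
- by move/fdivides_s.
- by move/fdivides_s.
by rewrite -fmorph_div -fmorphXz -rmorphM -e tK.
Qed.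

End Transport.

End FieldDivisors.

(** The exact sequence from U through the multiplicative group of F onto the free group on D: finite
    support gives the map, [div_ker] its kernel, and uniformizers its surjectivity. *)
Record divisor_theory (F : fieldType) (U : F -> Prop) (D : (F -> int) -> Prop) : Prop := {
  divM : forall v f h, D v -> f != 0 -> h != 0 -> v (f * h) = v f + v h;
  div_unit : forall v u, D v -> U u -> v u = 0;
  div_ker : forall f, f != 0 -> (forall v, D v -> v f = 0) -> U f;
  div_uniformizer : forall v, D v -> exists pi, pi != 0 /\ forall w, D w -> w pi = (w == v)%:R;
  div_support : forall f, f != 0 ->
    exists s : seq (F -> int), forall v, D v -> v f != 0 -> v \in s
}.

Section Localization.
Variables (F : fieldType) (A S : F -> Prop).
Hypothesis A1 : A 1.
Hypothesis AB : forall x y, A x -> A y -> A (x - y).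
Hypothesis AM : forall x y, A x -> A y -> A (x * y).
Hypothesis S1 : S 1.
Hypothesis SM : forall x y, S x -> S y -> S (x * y).
Hypothesis SA : forall x, S x -> A x /\ x != 0.

Definition localized x := exists2 s, S s & A (x * s).

Lemma localized_sub x : A x -> localized x.
Proof. by exists 1; rewrite ?mulr1. Qed.

Lemma localizedB x y : localized x -> localized y -> localized (x - y).
Proof.
move=> [s ss ax] [s' ss' ay]; exists (s * s'); first exact: SM.
rewrite mulrBl mulrA [s * s']mulrC mulrA; apply: AB; apply: AM => //; by case: (SA ss); case: (SA ss').
Qed.

Lemma localizedM x y : localized x -> localized y -> localized (x * y).
Proof.
move=> [s ss ax] [s' ss' ay]; exists (s * s'); first exact: SM.
by rewrite mulrACA; apply: AM.
Qed.

Lemma localizedV s : S s -> localized s^-1.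
Proof. by move=> ss; have [_ s0] := SA ss; exists s => //; rewrite mulVf. Qed.

(** A prime dividing some element of S becomes a unit. One dividing none stays prime, because
    denominators from S can be cleared from a divisibility by q. *)
Lemma localized_prime q : fprime A q -> fprime localized q \/ funit localized q.
Proof.
move=> [aq q0 nq qp]; have [[s [ss [c ac sE]]]|ns] := pselect (exists s, S s /\ fdivides A q s).
  have [_ s0] := SA ss; right; split=> //; first exact: localized_sub.
  by exists s => //; rewrite sE mulrC mulfK.
left; split=> //; first exact: localized_sub.
  move=> [s ss aqs]; apply: ns; exists s; split=> //.
  by exists (q^-1 * s) => //; rewrite mulrC mulVKf.
have lift a s : S s -> fdivides A q (a * s) -> fdivides localized q a.
  move=> ss [d ad e]; have [_ s0] := SA ss; exists (d / s).
    by apply: localizedM (localized_sub ad) (localizedV ss).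
  by rewrite mulrAC -e mulfK.
move=> a b [s ss as_] [s' ss' bs'] [c [r rr cr] e].
have [ar r0] := SA rr.
have : fdivides A q ((a * s) * (b * s') * r).
  exists (c * r * (s * s')); first by apply: AM => //; apply: AM; [case: (SA ss)|case: (SA ss')].
  by rewrite mulrACA e; ring.
move/(qp _ _ (AM as_ bs') ar) => [/(qp _ _ as_ bs')[]|h]; last by case: ns; exists r.
  by move/(lift _ _ ss); left.
by move/(lift _ _ ss'); right.
Qed.

End Localization.

Lemma factorial_divisor_theory (F : fieldType) (A : F -> Prop) :
  A 1 -> (forall x y, A x -> A y -> A (x - y)) -> (forall x y, A x -> A y -> A (x * y)) ->
  (forall f, exists a b, [/\ A a, A b, b != 0 & f = a / b]) ->
  (forall x, A x -> x != 0 -> exists u s,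
    [/\ funit A u, forall p, p \in s -> fprime A p & x = u * \prod_(p <- s) p]) ->
  exists D, divisor_theory (funit A) D /\
    forall s t : {rmorphism F -> F}, cancel s t -> cancel t s ->
      (forall x, A x -> A (s x)) -> (forall x, A x -> A (t x)) -> forall v, D v -> D (v \o t).
Proof.
move=> A1 AB AM Afrac Afact; exists (divisor A1 AM Afrac Afact); split; last first.
  by move=> s t sK tK sA tA v; apply: (divisor_transport AB sK tK sA tA).
split.
- exact: divisor_mul.
- exact: divisor_unit.
- exact: divisor_ker.
- exact: divisor_uniformizer.
- exact: divisor_support.
Qed.

Section MonomialDivisors.
Variables (K : fieldType) (n : nat).

Let kill (i : 'I_n) : {rmorphism {mpoly K[n]} -> {mpoly K[n]}} :=
  mmap (@mpolyC n K) (fun j => if j == i then 0 else 'X_j).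

(** ['X_i] generates the kernel of the substitution of 0 for it, whose target is a domain. *)
Lemma prime_mpolyX (i : 'I_n) : prime_elt ('X_i : {mpoly K[n]}).
Proof.
have killX j : kill i 'X_j = if j == i then 0 else 'X_j by rewrite /kill /= mmapX mmap1U.
have killC c : kill i c%:MP = c%:MP by rewrite /kill /= mmapC.
have div p : divides ('X_i) (p - kill i p).
  elim/mpolyind: p => [|c m p _ _ IH]; first by rewrite rmorph0 subrr; apply: divides0.
  rewrite rmorphD opprD addrACA; apply: dividesD; last exact: IH.
  rewrite -mul_mpolyC rmorphM killC -mulrBr; apply: dividesMl.
  rewrite [('X_[m])]mpolyXE_id; elim/big_ind: _ => [|x y dx dy|j _].
  - by rewrite rmorph1 subrr; apply: divides0.
  - rewrite rmorphM (_ : _ - _ = (x - kill i x) * y + kill i x * (y - kill i y)).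
      by apply: dividesD; [apply: dividesMr; exact: dx|apply: dividesMl; exact: dy].
    by ring.
  rewrite rmorphXn; elim: (m j) => [|l IHl]; first by rewrite !expr0 subrr; apply: divides0.
  rewrite !exprS (_ : _ - _ = ('X_j - kill i 'X_j) * 'X_j ^+ l
    + kill i 'X_j * ('X_j ^+ l - kill i 'X_j ^+ l)); last by ring.
  apply: dividesD; [apply: dividesMr|exact: dividesMl].
  rewrite killX; case: eqP => [->|_]; first by rewrite subr0; apply: divides_refl.
  by rewrite subrr; apply: divides0.
have killP p : kill i p = 0 <-> divides ('X_i) p.
  split=> [p0|[c ->]]; first by have := div p; rewrite p0 subr0.
  by rewrite rmorphM killX eqxx mulr0.
split.
- by apply/eqP => /(congr1 (mcoeff U_(i))); rewrite mcoeffX eqxx mcoeff0; apply/eqP/oner_neq0.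
- apply/negP => /unitrP[y [/(congr1 (kill i)) + _]].
  by rewrite rmorphM rmorph1 killX eqxx mulr0 => /eqP; rewrite eq_sym oner_eq0.
move=> a b /killP; rewrite rmorphM => /eqP; rewrite mulf_eq0.
by case/orP => /eqP/killP; [left|right].
Qed.

Lemma monomial_neq0 (m : 'X_{1..n}) : 'X_[m] != 0 :> {mpoly K[n]}.
Proof. by apply/eqP => /(congr1 (mcoeff m)); rewrite mcoeffX eqxx mcoeff0; apply/eqP/oner_neq0. Qed.

Lemma divides_monomial (m : 'X_{1..n}) (p q : {mpoly K[n]}) :
  p * q = 'X_[m] -> exists c m', p = c *: 'X_[m'].
Proof.
have [d] := ubnP (mdeg m); elim: d m p q => // d IH m p q dm e.
have [m0|] := eqVneq m 0%MM.
  have : p \is a GRing.unit by apply/unitrP; exists q; rewrite mulrC e m0 mpolyX0.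
  case/andP => /eqP -> _; exists (p@_0%MM), 0%MM.
  by rewrite mpolyX0 -mul_mpolyC mulr1.
move=> mn0; have /existsP[i mi] : [exists i, m i != 0%N].
  apply: contraNT mn0; rewrite negb_exists => /forallP h; apply/eqP/mnmP => i.
  by rewrite mnm0E; apply/eqP; rewrite -[_ == _]negbK; apply: h.
have mE : m = ((m - U_(i)) + U_(i))%MM by rewrite submK // lep1mP.
have dm' : (mdeg (m - U_(i))%MM < d)%N.
  by move: dm; rewrite {1}mE mdegD mdeg1 addn1.
have Xi0 : ('X_i : {mpoly K[n]}) != 0 by case: (prime_mpolyX i).
have [_ _ /(_ p q)[]] := prime_mpolyX i.
- by exists 'X_[m - U_(i)]; rewrite e {1}mE mpolyXD.
- move=> [r pE]; have [|c [m' rE]] := IH (m - U_(i))%MM r q dm'.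
    by apply: (mulIf Xi0); rewrite -mpolyXD -mE -e pE mulrAC.
  by exists c, (m' + U_(i))%MM; rewrite pE rE mpolyXD scalerAl.
move=> [r qE]; apply: (IH (m - U_(i))%MM p r dm').
by apply: (mulIf Xi0); rewrite -mpolyXD -mE -e qE mulrA.
Qed.

End MonomialDivisors.

Section PolynomialSubring.
Variables (K F : fieldType) (io : {rmorphism K -> F}) (n : nat) (t : 'I_n -> F).
Hypotheses (ti : algindep io t) (tg : forall x, genfield io t x).

Definition polyring x := exists p, x = mmap io t p.

Lemma polyring1 : polyring 1. Proof. by exists 1; rewrite rmorph1. Qed.
Lemma polyringB x y : polyring x -> polyring y -> polyring (x - y).
Proof. by move=> [p ->] [q ->]; exists (p - q); rewrite rmorphB. Qed.
Lemma polyringM x y : polyring x -> polyring y -> polyring (x * y).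
Proof. by move=> [p ->] [q ->]; exists (p * q); rewrite rmorphM. Qed.

Lemma polyring_frac f : exists a b, [/\ polyring a, polyring b, b != 0 & f = a / b].
Proof.
by have [p [q [q0 ->]]] := tg f; exists (mmap io t p), (mmap io t q); split=> //; eexists.
Qed.

Let mmap_inj : injective (mmap io t).
Proof. by move=> p q e; apply/eqP; rewrite -subr_eq0; apply/eqP/ti; rewrite rmorphB /= e subrr. Qed.

Let mmap_eq0 p : (mmap io t p == 0) = (p == 0).
Proof. by rewrite -[X in _ == X](rmorph0 (mmap io t)) (inj_eq mmap_inj). Qed.

Lemma polyring_unit p : funit polyring (mmap io t p) -> p \is a GRing.unit.
Proof.
move=> [p0 _ [q e]]; apply/unitrP; exists q; rewrite mulrC; split; apply: mmap_inj;
  by rewrite rmorphM /= -e rmorph1 divff.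
Qed.

Lemma polyring_funit u : funit polyring u -> exists2 c, c != 0 & u = io c.
Proof.
move=> h; have [_ [p pE] _] := h; move: h; rewrite pE => /polyring_unit /andP[/eqP pC pu].
by exists (p@_0%MM); rewrite -?unitfE // {1}pC mmapC.
Qed.

Lemma polyring_prime p : prime_elt p -> fprime polyring (mmap io t p).
Proof.
move=> [p0 np pp]; split; first by eexists.
- by rewrite mmap_eq0.
- by move=> h; move/negP: np; apply; apply: polyring_unit; split=> //; [rewrite mmap_eq0|eexists].
move=> _ _ [a ->] [b ->] [_ [c ->]]; rewrite -!rmorphM => /mmap_inj e.
have [|[d ->]|[d ->]] := pp a b; first by exists c.
  by left; exists (mmap io t d); rewrite ?rmorphM //; eexists.
by right; exists (mmap io t d); rewrite ?rmorphM //; eexists.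
Qed.

Lemma polyring_factorial x : polyring x -> x != 0 -> exists u s,
  [/\ funit polyring u, forall p, p \in s -> fprime polyring p & x = u * \prod_(p <- s) p].
Proof.
move=> [p ->]; rewrite mmap_eq0 => p0; have [u [s [uu sp ->]]] := mpoly_factorial p0.
exists (mmap io t u), (map (mmap io t) s); split.
- have := uu; case/unitrP => v [e _]; split; first by rewrite mmap_eq0; apply: contraTneq uu => ->; rewrite unitr0.
    by eexists.
  exists v; apply: (mulIf (x := mmap io t u)).
    by rewrite mmap_eq0; apply: contraTneq uu => ->; rewrite unitr0.
  rewrite -rmorphM e rmorph1 mulVf // mmap_eq0; apply: contraTneq uu => ->; rewrite unitr0 //.
- by move=> _ /mapP[q /sp qp ->]; apply: polyring_prime.
by rewrite rmorphM rmorph_prod big_map.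
Qed.

Let mono x := exists m, x = mmap io t 'X_[m].
Definition laurent_ring := localized polyring mono.

Let mono1 : mono 1. Proof. by exists 0%MM; rewrite mpolyX0 rmorph1. Qed.
Let monoM x y : mono x -> mono y -> mono (x * y).
Proof. by move=> [m ->] [m' ->]; exists (m + m')%MM; rewrite mpolyXD rmorphM. Qed.
Let mono_sub x : mono x -> polyring x /\ x != 0.
Proof. by move=> [m ->]; split; [eexists|rewrite mmap_eq0 monomial_neq0]. Qed.

Lemma laurent_ring_sub x : polyring x -> laurent_ring x.
Proof. exact: localized_sub. Qed.
Lemma laurent_ringB x y : laurent_ring x -> laurent_ring y -> laurent_ring (x - y).
Proof. exact: (localizedB polyringB polyringM monoM mono_sub). Qed.
Lemma laurent_ringM x y : laurent_ring x -> laurent_ring y -> laurent_ring (x * y).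
Proof. exact: (localizedM polyringM monoM). Qed.
Lemma laurent_ring1 : laurent_ring 1. Proof. exact/laurent_ring_sub/polyring1. Qed.
Lemma laurent_ring_monoV m : laurent_ring (mmap io t 'X_[m])^-1.
Proof. by apply: (localizedV polyring1 mono_sub); exists m. Qed.

Lemma laurent_ring_frac f : exists a b, [/\ laurent_ring a, laurent_ring b, b != 0 & f = a / b].
Proof.
by have [a [b [aa ab b0 fE]]] := polyring_frac f; exists a, b; split=> //; apply: laurent_ring_sub.
Qed.

(** If u and its inverse become polynomials p and q after multiplication by monomials, then p q is a
    monomial, and its divisors are monomials up to constants. *)
Lemma laurent_ring_funit u : funit laurent_ring u ->
  exists c m m', c != 0 /\ u = io c * mmap io t 'X_[m] / mmap io t 'X_[m'].
Proof.
move=> [u0 [_ [m ->] [p pE]] [_ [m' ->] [q qE]]].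
have [m0 m0'] : mmap io t 'X_[m] != 0 /\ mmap io t 'X_[m'] != 0.
  by rewrite !mmap_eq0 !monomial_neq0.
have /divides_monomial[c [m'' e]] : p * q = 'X_[m + m'].
  by apply: mmap_inj; rewrite mpolyXD !rmorphM /= -pE -qE; field; rewrite u0.
have uE : u = io c * mmap io t 'X_[m''] / mmap io t 'X_[m].
  by rewrite -(mulfK m0 u) pE e -mul_mpolyC rmorphM /= mmapC.
exists c, m'', m; split=> //; apply: contraNneq u0 => c0.
by rewrite uE c0 rmorph0 !mul0r.
Qed.

Lemma laurent_ring_factorial x : laurent_ring x -> x != 0 -> exists u s,
  [/\ funit laurent_ring u, forall p, p \in s -> fprime laurent_ring p & x = u * \prod_(p <- s) p].
Proof.
move=> [_ [m ->] ax] x0; have m0 : mmap io t 'X_[m] != 0 by rewrite mmap_eq0 monomial_neq0.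
have [u [s [[u0 au au'] sp e]]] := polyring_factorial ax (mulf_neq0 x0 m0).
have uu : funit laurent_ring (u / mmap io t 'X_[m]).
  apply: (funitM laurent_ringM); first by split=> //; apply: laurent_ring_sub.
  split; rewrite ?invr_eq0 ?invrK //; first exact: laurent_ring_monoV.
  by apply: laurent_ring_sub; eexists.
have {e} xE : x = u / mmap io t 'X_[m] * \prod_(p <- s) p by rewrite mulrAC -e mulfK.
move: x x0 {ax} (u / _) uu xE; elim: s sp => [|p s IH] sp x x0 v vu xE; first by exists v, [::].
have [//|//|w [s' [wu sp' xE']]] := IH _ (v * \prod_(q <- s) q) _ v vu erefl.
- by move=> q qs; apply: sp; rewrite inE qs orbT.
- by apply: contraNneq x0 => e; rewrite xE big_cons mulrCA e mulr0.
have := localized_prime polyring1 polyringM mono1 monoM mono_sub (sp p (mem_head _ _)).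
case=> pp.
  exists w, (p :: s'); split=> //; first by move=> q; rewrite inE => /predU1P[->|/sp'].
  by rewrite xE !big_cons mulrCA xE' mulrCA.
exists (p * w), s'; split=> //; first exact: (funitM laurent_ringM).
by rewrite xE big_cons mulrCA xE' mulrA.
Qed.

End PolynomialSubring.

(** * The two factorial models of K(L) and their divisors *)

Section TorusDivisors.
Variables (k : fieldType) (K : splittingFieldType k).
Variables (gT : finGroupType) (G : {group gT}).
Variables (gal : {morphism G >-> gal_of {:K}}) (L : glattice G).
Variable T : torus_field gal L.
Local Notation F := (tf_sort T).
Local Notation io := (tio T).
Local Notation act := (@tact _ _ _ _ _ _ T).
Local Notation chi := (@tchi _ _ _ _ _ _ T).

Lemma tact_mmap g n (t : 'I_n -> F) p : g \in G ->
  act g (mmap io t p) = mmap io (act g \o t) (map_mpoly (gal g) p).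
Proof. exact: (sact_mmap (@tactD _ _ _ _ _ _ T) (@tactM _ _ _ _ _ _ T) (@tact_io _ _ _ _ _ _ T)). Qed.

Lemma tactK g : g \in G -> cancel (act g) (act g^-1%g).
Proof. by move=> Gg x; rewrite -tact_comp ?groupV // mulgV tact_id. Qed.
Lemma tactKV g : g \in G -> cancel (act g^-1%g) (act g).
Proof. by move=> Gg x; rewrite -tact_comp ?groupV // mulVg tact_id. Qed.

Lemma stable_divisors (A : F -> Prop) (D : (F -> int) -> Prop) :
  {in G, forall g x, A x -> A (act g x)} ->
  (forall s t : {rmorphism F -> F}, cancel s t -> cancel t s ->
     (forall x, A x -> A (s x)) -> (forall x, A x -> A (t x)) -> forall v, D v -> D (v \o t)) ->
  {in G, forall g v, D v -> D (v \o act g)}.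
Proof.
move=> AG h g Gg; have Gg' : g^-1%g \in G by rewrite groupV.
by apply: (h (tmor T Gg') (tmor T Gg)); [exact: tactKV|exact: tactK|exact: AG|exact: AG].
Qed.

Lemma fixed_divisor_theory n (t : 'I_n -> F) :
  (forall i, {in G, forall g, act g (t i) = t i}) -> algindep io t ->
  (forall x, genfield io t x) ->
  exists D, divisor_theory (fun u => exists2 c, c != 0 & u = io c) D /\
    {in G, forall g v, D v -> D (v \o act g)}.
Proof.
move=> tf ti tg; have [D [DU Dt]] := factorial_divisor_theory (polyring1 io t)
  (@polyringB _ _ io _ t) (@polyringM _ _ io _ t) (polyring_frac tg) (polyring_factorial ti (t := t)).
exists D; split; last first.
  apply: stable_divisors Dt => g Gg _ [p ->]; rewrite tact_mmap //.
  by exists (map_mpoly (gal g) p); congr (mmap io _ _); apply/funext => i; apply: tf.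
split; [exact: divM DU| |by move=> f f0 /(div_ker DU f0)/(polyring_funit ti)
  |exact: div_uniformizer DU|exact: div_support DU].
move=> v _ Dv [c c0 ->]; apply: (div_unit DU Dv); split; first by rewrite fmorph_eq0.
  by exists c%:MP; rewrite mmapC.
by rewrite -fmorphV; exists (c^-1)%:MP; rewrite mmapC.
Qed.

(** The Laurent ring in the basis characters is the group ring K[L]: it contains every character, so
    it is G-stable, and its units are the constants times characters. *)
Lemma chi_divisor_theory :
  exists D, divisor_theory (fun u => exists c m, c != 0 /\ u = io c * chi m) D /\
    {in G, forall g v, D v -> D (v \o act g)}.
Proof.
pose t i := chi (lbasis L i); pose B := laurent_ring io t.
have ti : algindep io t := @tindep _ _ _ _ _ _ T.
have tg : forall x, genfield io t x := @tgen _ _ _ _ _ _ T.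
have BM : forall x y, B x -> B y -> B (x * y) := @laurent_ringM _ _ io _ t.
have BB : forall x y, B x -> B y -> B (x - y) := laurent_ringB ti.
have B1 : B 1 := laurent_ring1 io t.
have B0 : B 0 by rewrite -(subrr 1); apply: BB.
have BD x y : B x -> B y -> B (x + y).
  by move=> bx Hy; rewrite -[y]opprK; apply: (BB) => //; rewrite -sub0r; apply: (BB).
have [D [DU Dt]] := factorial_divisor_theory B1 BB BM (laurent_ring_frac tg)
  (laurent_ring_factorial ti).
have chiX m : mmap io t 'X_[m] = chi (\sum_i lbasis L i *+ m i).
  by rewrite mmapX tchi_sum; apply: eq_bigr => i _; rewrite tchiMn.
have Bio c : B (io c) by apply: laurent_ring_sub; exists c%:MP; rewrite mmapC.
have Bprod (I : finType) (f : I -> F) : (forall i, B (f i)) -> B (\prod_i f i).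
  by move=> h; elim/big_ind: _ => // x y; apply: BM.
have Bt i : B (t i) by apply: laurent_ring_sub; exists 'X_i; rewrite mmapX mmap1U.
have BtV i : B (t i)^-1 by have := laurent_ring_monoV ti U_(i)%MM; rewrite mmapX mmap1U.
have BX x l : B x -> B (x ^+ l).
  by move=> bx; elim: l => [|l IH]; rewrite ?expr0 // exprS; apply: BM.
have Bchi m : B (chi m).
  rewrite -[m]lcoordK tchi_zcomb; apply: Bprod => i.
  by case: (lcoord m i) => l; rewrite ?NegzE -?exprnN -?exprVn; apply: BX; [apply: Bt|apply: BtV].
have BG : {in G, forall g x, B x -> B (act g x)}.
  move=> g Gg x [_ [m ->] [p xE]]; have m0 : mmap io t 'X_[m] != 0 by rewrite chiX tchi_neq0.
  rewrite -(mulfK m0 x) tactM // tactV // xE chiX tact_chi // -tchiN; apply: (BM) => //.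
  rewrite tact_mmap //; elim/mpolyind: (map_mpoly (gal g) p) => [|c l q _ _ IH].
    by rewrite rmorph0.
  rewrite rmorphD -mul_mpolyC rmorphM /= mmapC mmapX; apply: BD => //; apply: (BM) => //.
    exact: Bio.
  by rewrite /mmap1; apply: (Bprod) => i; apply: (BX); rewrite /= tact_chi.
exists D; split; last exact: stable_divisors BG Dt.
split; [exact: divM DU| |move=> f f0 /(div_ker DU f0)/(laurent_ring_funit ti)
  |exact: div_uniformizer DU|exact: div_support DU].
  move=> v _ Dv [c [m [c0 ->]]]; apply: (div_unit DU Dv).
  split; rewrite ?mulf_neq0 ?fmorph_eq0 ?tchi_neq0 //; first exact: BM.
  by rewrite invfM -fmorphV -tchiN; apply: BM.
move=> [c [m [m' [c0 ->]]]]; exists c, (\sum_i lbasis L i *+ m i - \sum_i lbasis L i *+ m' i).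
by split=> //; rewrite !chiX tchiD tchiN mulrA.
Qed.

End TorusDivisors.

(** * The obstruction to rationality *)

Lemma choice_on (X Y : Type) (y0 : Y) (P : X -> Prop) (Q : X -> Y -> Prop) :
  (forall x, P x -> exists y, Q x y) -> exists f, forall x, P x -> Q x (f x).
Proof.
move=> h; have h' x : exists y, P x -> Q x y.
  have [px|np] := pselect (P x); last by exists y0.
  by have [y qy] := h x px; exists y.
by have [f fP] := choice h'; exists f.
Qed.

Section OrbitSum.
Variables (gT : finGroupType) (H : {group gT}) (X : eqType) (tau : gT -> X -> X).
Hypothesis tau1 : forall x, tau 1%g x = x.
Hypothesis tauM : {in H &, forall g h x, tau (g * h)%g x = tau h (tau g x)}.

(** The terms of one orbit are all equal, and there are |H : S| of them, where S is the stabiliser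
    of a point. The orbits are removed one by one. *)
Lemma orbit_sum_dvd (d : int) (s : seq X) (w : X -> int) : uniq s ->
  (forall x, x \in s -> {in H, forall g, tau g x \in s /\ w (tau g x) = w x}) ->
  (forall x, x \in s -> forall S : {group gT}, S \subset H ->
     {in S, forall g, tau g x = x} -> (d %| #|H : S|%g%:Z * w x)%Z) ->
  (d %| \sum_(x <- s) w x)%Z.
Proof.
have [n] := ubnP (size s); elim: n s => // n IH [|x s'] sn us st cd; first by rewrite big_nil dvdz0.
set s := x :: s' in sn us st cd *.
have tauK g y : g \in H -> tau g^-1%g (tau g y) = y.
  by move=> Hg; rewrite -tauM ?groupV // mulgV tau1.
have tauKV g y : g \in H -> tau g (tau g^-1%g y) = y.
  by move=> Hg; rewrite -tauM ?groupV // mulVg tau1.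
have S_group : group_set [set g in H | tau g x == x].
  apply/group_setP; split=> [|g h]; first by rewrite inE group1 tau1 eqxx.
  rewrite !inE => /andP[Hg /eqP gx] /andP[Hh /eqP hx].
  by rewrite groupM // tauM // gx hx eqxx.
pose S := group S_group.
have sSH : S \subset H by apply/subsetP => g; rewrite inE => /andP[].
pose o := undup [seq tau g x | g <- enum H].
have oP y : reflect (exists2 g, g \in H & y = tau g x) (y \in o).
  rewrite mem_undup; apply: (iffP mapP) => -[g]; rewrite ?mem_enum => Hg ->; exists g => //.
  by rewrite mem_enum.
have xs : x \in s by rewrite mem_head.
have os : {subset o <= s} by move=> y /oP[g Hg ->]; case: (st x xs g Hg).
have card_o : (size o * #|S| = #|H|)%N.
  have <- : (\sum_(g in H) \sum_(y <- o) (tau g x == y) = #|H|)%N.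
    rewrite -sum1_card; apply: eq_bigr => g Hg.
    rewrite (bigD1_seq (tau g x)) ?undup_uniq //=; last by apply/oP; exists g.
    by rewrite eqxx big1 // => y /negbTE; rewrite eq_sym => ->.
  rewrite exchange_big /= -sum1_size big_distrl /= big_seq [RHS]big_seq.
  apply: eq_bigr => y /oP[h Hh ->]; rewrite mul1n -big_mkcondr /= sum1_card.
  rewrite -(card_rcoset S h); apply: eq_card => g; rewrite mem_rcoset inE [RHS]unfold_in.
  have [Hg|ng] := boolP (g \in H); last first.
    by rewrite groupMr ?groupV // (negbTE ng).
  rewrite groupM ?groupV //= tauM ?groupV //.
  by apply/eqP/eqP => [{2}<-|->]; rewrite ?tauKV ?tauK.
have idx : size o = #|H : S|%g.
  by apply/eqP; rewrite -(eqn_pmul2r (cardG_gt0 S)) card_o mulnC Lagrange.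
rewrite (bigID [pred y | y \in o]) /=; apply: rpredD.
  rewrite -big_filter.
  have -> : \sum_(y <- [seq y <- s | y \in o]) w y = \sum_(y <- o) w x.
    rewrite (perm_big o); last first.
      apply: uniq_perm; rewrite ?filter_uniq ?undup_uniq // => y.
      by rewrite mem_filter; have [/os|] := boolP (y \in o).
    by rewrite big_seq [RHS]big_seq; apply: eq_bigr => y /oP[g Hg ->]; case: (st x xs g Hg).
  rewrite big_const_seq count_predT iter_addr_0 -mulr_natl idx natz.
  by apply: (cd x xs S sSH) => g; rewrite inE => /andP[_ /eqP].
rewrite -big_filter; apply: IH.
- rewrite size_filter -ltnS; apply: leq_trans sn; rewrite ltnS.
  rewrite -(count_predC [pred y | y \in o] s) -[X in (X < _)%N]add0n ltn_add2r -has_count.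
  by apply/hasP; exists x => //; apply/oP; exists 1%g; rewrite ?group1 ?tau1.
- exact: filter_uniq.
- move=> y; rewrite mem_filter => /andP[no ys] g Hg; have [gs ->] := st y ys g Hg.
  split=> //; rewrite mem_filter gs andbT; apply: contra no => /oP[h Hh e].
  by apply/oP; exists (h * g^-1)%g; rewrite ?groupM ?groupV // tauM ?groupV // -e tauK.
by move=> y; rewrite mem_filter => /andP[_ ys]; apply: cd.
Qed.

End OrbitSum.

Section DivisorTheory.
Variables (F : fieldType) (U : F -> Prop) (D : (F -> int) -> Prop).
Hypothesis dt : divisor_theory U D.

Lemma div1 v : D v -> v 1 = 0.
Proof.
move=> Dv; have := divM dt Dv (oner_neq0 F) (oner_neq0 F); rewrite mulr1 => e.
by apply: (addrI (v 1)); rewrite addr0.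
Qed.

Lemma divV v f : D v -> f != 0 -> v f^-1 = - v f.
Proof.
move=> Dv f0; apply/eqP; rewrite -addr_eq0 -(divM dt) ?invr_eq0 //.
by rewrite mulVf // div1.
Qed.

Lemma divXz v f (n : int) : D v -> f != 0 -> v (f ^ n) = n * v f.
Proof.
move=> Dv f0.
have h (m : nat) : v (f ^+ m) = m%:Z * v f.
  elim: m => [|m IH]; first by rewrite expr0 div1 // mul0r.
  by rewrite exprS (divM dt) ?expf_neq0 // IH -add1n PoszD mulrDl mul1r.
by case: n => m; rewrite ?NegzE -?exprnN ?divV ?expf_neq0 // h // mulNr.
Qed.

Lemma div_prod v (I : Type) (r : seq I) (P : pred I) (f : I -> F) : D v ->
  (forall i, P i -> f i != 0) -> v (\prod_(i <- r | P i) f i) = \sum_(i <- r | P i) v (f i).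
Proof.
move=> Dv f0; suff [] : \prod_(i <- r | P i) f i != 0 /\
  v (\prod_(i <- r | P i) f i) = \sum_(i <- r | P i) v (f i) by [].
elim/big_rec2: _ => [|i y x Pi [x0 <-]]; first by rewrite oner_neq0 div1.
by rewrite mulf_neq0 ?f0 // (divM dt) ?f0.
Qed.

Lemma div_ker2 f h : f != 0 -> h != 0 -> (forall v, D v -> v f = v h) -> U (f / h).
Proof.
move=> f0 h0 e; apply: (div_ker dt); first by rewrite mulf_neq0 ?invr_eq0.
by move=> v Dv; rewrite (divM dt) ?invr_eq0 // divV // e // subrr.
Qed.

End DivisorTheory.

Lemma sum_int_additive (L : zmodType) (l : L -> int) : {morph l : x y / x + y} ->
  [/\ l 0 = 0, forall x (n : int), l (x *~ n) = l x * n &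
   forall (I : Type) (r : seq I) (P : pred I) (f : I -> L),
     l (\sum_(i <- r | P i) f i) = \sum_(i <- r | P i) l (f i)].
Proof.
move=> lD; have l0 : l 0 = 0 by apply: (addrI (l 0)); rewrite -lD !addr0.
have lN x : l (- x) = - l x by apply/eqP; rewrite -addr_eq0 -lD addNr l0.
split=> // [x n|I r P f]; last exact: (big_morph l lD l0).
have h (m : nat) : l (x *+ m) = l x * m%:Z.
  elim: m => [|m IH]; first by rewrite mulr0n mulr0.
  by rewrite mulrS lD IH -add1n PoszD mulrDr mulr1.
by case: n => m; rewrite ?NegzE ?mulrNz ?lN -pmulrn h // mulrN.
Qed.

Section Obstruction.
Variables (k : fieldType) (K : splittingFieldType k).
Variables (gT : finGroupType) (G : {group gT}).
Variables (gal : {morphism G >-> gal_of {:K}}) (L : glattice G).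
Variable T : torus_field gal L.
Local Notation F := (tf_sort T).
Local Notation io := (tio T).
Local Notation act := (@tact _ _ _ _ _ _ T).
Local Notation chi := (@tchi _ _ _ _ _ _ T).

Lemma tchi_const m c : chi m = io c -> m = 0.
Proof.
move=> e; pose z := lcoord m.
pose p : 'X_{1..rank L} := [multinom absz (Num.max (z i) 0) | i < rank L].
pose q : 'X_{1..rank L} := [multinom absz (Num.max (- z i) 0) | i < rank L].
have zE i : z i = (p i)%:Z - (q i)%:Z by rewrite !mnmE; lia.
have h : mmap io (fun i => chi (lbasis L i)) ('X_[p] - c *: 'X_[q]) = 0.
  rewrite rmorphB /= -mul_mpolyC rmorphM /= mmapC.
  rewrite -[X in _ - X * _]e.
  rewrite !mmapX -[m]lcoordK tchi_zcomb -/z.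
  apply/eqP; rewrite subr_eq0 -big_split /=; apply/eqP; apply: eq_bigr => i _.
  by rewrite !exprnP zE -expfzDr ?tchi_neq0 // subrK.
have /mpolyP/(_ p) := tindep h; rewrite mcoeffB mcoeffZ !mcoeffX eqxx mcoeff0.
have [pq _|] := eqVneq q p; last by rewrite mulr0 subr0 => _ /eqP; rewrite oner_eq0.
rewrite -[m]lcoordK; apply: big1 => i _; rewrite -/z zE pq subrr mulr0z //.
Qed.

Lemma tchi_inj m m' c c' : c' != 0 -> io c * chi m = io c' * chi m' -> m = m'.
Proof.
move=> c0 e; have c0'0 : io c' != 0 by rewrite fmorph_eq0.
have c0'' : io c != 0.
  apply/eqP => c0'; move: e; rewrite c0' mul0r => /esym/eqP.
  by rewrite mulf_eq0 (negbTE (tchi_neq0 T m')) (negbTE c0'0).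
apply/eqP; rewrite -subr_eq0; apply/eqP/(tchi_const (c := c' / c)).
rewrite tchiD tchiN fmorph_div; apply: (mulIf (tchi_neq0 T m')); rewrite mulfVK ?tchi_neq0 //.
by apply: (mulfI c0''); rewrite e mulrA mulrCA divff // mulr1.
Qed.

Variables (H : {group gT}) (L1 : glattice G) (j : {additive L1 -> L}) (pr : {additive L -> L1}).
Hypothesis sHG : H \subset G.
Hypothesis prj : cancel j pr.
Hypothesis j_act : {in H, forall g m, j (lact L1 m g) = lact L (j m) g}.
Hypothesis pr_act : {in H, forall g m, pr (lact L m g) = lact L1 (pr m) g}.

Variables (B : finType) (bact : gT -> B -> B) (nu : B -> L1 -> int).
Hypothesis bact1 : forall b, bact 1%g b = b.
Hypothesis bactM : {in H &, forall g h b, bact (g * h)%g b = bact h (bact g b)}.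
Hypothesis nuD : forall b, {morph nu b : x y / x + y}.
Hypothesis nu_act : {in H, forall g b m, nu (bact g b) (lact L1 m g) = nu b m}.

(** The map m |-> (nu b m)_b embeds L1 in Z^B. [psi] is an equivariant section, as a map of sets, of
    the dual map from Z^B to Hom(L1, Z): a functional fixed by S lifts to an S-invariant vector.
    Thus Z^B begins a flasque resolution of L1, with quotient N = Z^B / L1. *)
Variable psi : (L1 -> int) -> B -> int.
Hypothesis psiP : forall l, {morph l : x y / x + y} -> forall m, l m = \sum_b psi l b * nu b m.
Hypothesis psi_act : {in H, forall g l, {morph l : x y / x + y} -> forall b,
  psi (fun m => l (lact L1 m g)) b = psi l (bact g b)}.
Hypothesis psi0 : forall l, (forall m, l m = 0) -> forall b, psi l b = 0.

(** [a] is an H-invariant class in N, [beta] an H-invariant form on N. If the identity of N factors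
    through a permutation module, beta(a) is the sum over its basis of products f(a) beta(c), where
    f is a form on N and c a class in N, both invariant under the stabiliser S of the basis element.
    [local_dvd] makes each orbit sum divisible by d. *)
Variables (d : int) (a beta : B -> int).
Hypothesis a_inv : {in H, forall g, exists m, forall b, a (bact g b) = a b + nu b m}.
Hypothesis beta_inv : {in H, forall g b, beta (bact g b) = beta b}.
Hypothesis beta_nu : forall m, \sum_b beta b * nu b m = 0.
Hypothesis local_dvd : forall (S : {group gT}) (f c : B -> int), S \subset H ->
  {in S, forall g b, f (bact g b) = f b} -> (forall m, \sum_b f b * nu b m = 0) ->
  {in S, forall g, exists m, forall b, c (bact g b) = c b + nu b m} ->
  (d %| #|H : S|%g%:Z * ((\sum_b f b * a b) * \sum_b beta b * c b))%Z.

Let HG g : g \in H -> g \in G. Proof. exact: (subsetP sHG). Qed.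

Let bactK g b : g \in H -> bact g^-1%g (bact g b) = b.
Proof. by move=> Hg; rewrite -bactM ?groupV // mulgV bact1. Qed.
Let bactKV g b : g \in H -> bact g (bact g^-1%g b) = b.
Proof. by move=> Hg; rewrite -bactM ?groupV // mulVg bact1. Qed.
Let reindex_bact g (f : B -> int) : g \in H -> \sum_b f b = \sum_b f (bact g b).
Proof.
move=> Hg; apply: reindex; exists (bact g^-1%g) => b _; [exact: bactK|exact: bactKV].
Qed.

Let dot (f h : B -> int) := \sum_b f b * h b.

Let dot_a f g : g \in H -> (forall m, dot f (nu^~ m) = 0) ->
  dot (fun b => f (bact g b)) a = dot f a.
Proof.
move=> Hg fk; have [m mP] := a_inv Hg; apply/eqP; rewrite eq_sym -subr_eq0.
rewrite /dot (reindex_bact _ Hg) -sumrB.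
under eq_bigr => b _ do rewrite mP -mulrBr [_ + _ - _]addrAC subrr add0r -(nu_act Hg).
by rewrite -(reindex_bact (fun b => f b * nu b (lact L1 m g))) // -/(dot f _) fk.
Qed.

(* The elements [e b] lift the functionals [nu b] to F^*, using a factorial subring with units
   K^* on which the unit part of the action is trivial. *)
Lemma functional_elements n (t : 'I_n -> F) :
  (forall i, {in G, forall g, act g (t i) = t i}) -> algindep io t ->
  (forall x, genfield io t x) ->
  exists e : B -> F, [/\ forall b, e b != 0,
    {in H, forall g b, exists2 c, c != 0 & act g (e b) = io c * e (bact g b)} &
    forall m, exists2 c, c != 0 & \prod_b e b ^ nu b m = io c * chi (j m)].
Proof.
move=> tf ti tg; have [D [dt Dact]] := fixed_divisor_theory tf ti tg.
pose lam (v : F -> int) m := v (chi (j m)).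
have lamD v : D v -> {morph lam v : x y / x + y}.
  by move=> Dv x y; rewrite /lam raddfD tchiD (divM dt) ?tchi_neq0.
have /choice[sup supP] := fun i => div_support dt (tchi_neq0 T (j (lbasis L1 i))).
pose s := undup (flatten [seq sup i | i <- enum 'I_(rank L1)]).
have sP v : D v -> v \notin s -> forall m, lam v m = 0.
  move=> Dv vs m; have [l0 lz lsum] := sum_int_additive (lamD v Dv).
  rewrite -[m]lcoordK lsum big1 // => i _; rewrite lz.
  have [->|nz] := eqVneq (lam v (lbasis L1 i)) 0; first by rewrite mul0r.
  case/negP: vs; rewrite mem_undup; apply/flattenP; exists (sup i); last exact: supP.
  by apply/mapP; exists i; rewrite ?mem_enum.
have [pi piP] := choice_on (0 : F) (div_uniformizer dt).
pose s' := [seq v <- s | `[< D v >]].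
(* Each divisor v gives the functional [lam v] on L1, and [e b] is the element with v (e b) = psi
   (lam v) b. Equivariance of [psi] makes [e] equivariant up to units, which are constants here. *)
pose e b := \prod_(v <- s') pi v ^ psi (lam v) b.
have Ds v : v \in s' -> D v by rewrite mem_filter => /andP[/asboolP].
have e0 b : e b != 0.
  rewrite /e prodf_seq_neq0; apply/allP => v vs /=.
  by apply: expfz_neq0; case: (piP v (Ds v vs)).
have ve w b : D w -> w (e b) = psi (lam w) b.
  move=> Dw; rewrite /e big_seq (div_prod dt) => [|//|v /Ds Dv]; last first.
    by apply: expfz_neq0; case: (piP v Dv).
  transitivity (\sum_(v <- s') psi (lam v) b * (w == v)%:R).
    rewrite [RHS]big_seq; apply: eq_bigr => v /Ds Dv; have [p0 pP] := piP v Dv.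
    by rewrite (divXz dt) // pP.
  have [ws|nws] := boolP (w \in s').
    rewrite (bigD1_seq w) ?filter_uniq ?undup_uniq //= eqxx mulr1 big1 ?addr0 // => v.
    by rewrite eq_sym => /negbTE->; rewrite mulr0.
  rewrite big_seq big1 => [|v vs]; last first.
    by case: eqP nws => [->|_]; rewrite ?vs // mulr0.
  rewrite psi0 // => m; apply: sP => //; apply: contra nws.
  by rewrite mem_filter => ->; rewrite andbT; apply/asboolP.
exists e; split=> // [g Hg b|m].
  have [] : exists2 c, c != 0 & act g (e b) / e (bact g b) = io c; last first.
    by move=> c c0 h; exists c; rewrite // -h mulfVK.
  apply: (div_ker2 dt) => //; first by rewrite tact_eq0 ?HG.
  move=> v Dv; rewrite ve // -psi_act //; last exact: lamD.
  have := ve _ b (Dact g (HG Hg) v Dv); rewrite /= => ->.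
  congr psi; apply/funext => m; rewrite /lam /= tact_chi ?HG // j_act //.
have [] : exists2 c, c != 0 & (\prod_b e b ^ nu b m) / chi (j m) = io c; last first.
  by move=> c c0 h; exists c; rewrite // -h mulfVK // tchi_neq0.
apply: (div_ker2 dt); rewrite ?tchi_neq0 //.
  by apply/prodf_neq0 => b _; apply: expfz_neq0.
move=> v Dv; rewrite (div_prod dt) // => [|b _]; last exact: expfz_neq0.
rewrite -/(lam v m) (psiP (lamD v Dv)); apply: eq_bigr => b _.
by rewrite (divXz dt) // ve // mulrC.
Qed.

(** The elements [e b], obtained from the model K[t], are decomposed along the divisors of the group
    ring K[L]. This makes the identity of N factor through the sum of Z^B and Z^s, with s the
    divisors on which some [e b] is not trivial. *)
Theorem obstruction : torus_rational T -> (d %| \sum_b beta b * a b)%Z.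
Proof.
move=> [n [t [nL tf tg]]].
have ti : algindep io t.
  by apply: (algindep_gen nL (w := fun i => chi (lbasis L i))) => [i|]; [apply: tg|apply: tindep].
have [e [e0 eact eprod]] := functional_elements tf ti tg.
have [D [dt Dact]] := chi_divisor_theory T.
have DactH g y : g \in H -> D y -> D (y \o act g) by move=> /HG Gg; exact: Dact.
have Uy y c m : D y -> c != 0 -> y (io c * chi m) = 0.
  by move=> Dy c0; apply: (div_unit dt Dy); exists c, m.
have Uy' y c : D y -> c != 0 -> y (io c) = 0.
  by move=> Dy c0; rewrite -[io c]mulr1 -(tchi0 T); apply: Uy.
have actc y g b : D y -> g \in H -> y (act g (e b)) = y (e (bact g b)).
  move=> Dy Hg; have [c c0 ->] := eact g Hg b.
  by rewrite (divM dt) ?fmorph_eq0 // Uy' // add0r.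
have yk y m : D y -> \sum_b y (e b) * nu b m = 0.
  move=> Dy; have [c c0 h] := eprod m; transitivity (y (io c * chi (j m))); last exact: Uy.
  rewrite -h (div_prod dt) //.
    by apply: eq_bigr => b _; rewrite (divXz dt) // mulrC.
  by move=> b _; apply: expfz_neq0.
have /choice[sup supP] := fun b => div_support dt (e0 b).
pose s := [seq y <- undup (flatten [seq sup b | b <- enum B]) |
  `[< D y >] && [exists b, y (e b) != 0]].
have sE y : y \in s <-> D y /\ exists b, y (e b) != 0.
  rewrite mem_filter; split=> [/andP[/andP[/asboolP Dy /existsP h] _] //|[Dy [b yb]]].
  apply/andP; split; first by apply/andP; split; [apply/asboolP|apply/existsP; exists b].
  rewrite mem_undup; apply/flattenP; exists (sup b); last exact: supP.
  by apply/mapP; exists b; rewrite ?mem_enum.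
have sD y : y \in s -> D y by case/sE.
have s_uniq : uniq s by rewrite filter_uniq // undup_uniq.
have sact g y : g \in H -> y \in s -> y \o act g \in s.
  move=> Hg /sE[Dy [b yb]]; apply/sE; split; first exact: DactH.
  by exists (bact g^-1%g b); rewrite /= actc // bactKV.
have compK g (y : F -> int) : g \in H -> (y \o act g^-1%g) \o act g = y.
  by move=> /HG Gg; apply/funext => x /=; rewrite tactK.
have compKV g (y : F -> int) : g \in H -> (y \o act g) \o act g^-1%g = y.
  by move=> /HG Gg; apply/funext => x /=; rewrite tactKV.
have [pi piP] := choice_on (0 : F) (div_uniformizer dt).
have pi0 y : D y -> pi y != 0 by move=> /piP[].
have piE y w : D y -> D w -> w (pi y) = (w == y)%:R by move=> /piP[_ h] /h.
(* The chosen uniformizers are permuted by H only up to units of the group ring, hence up to a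
   constant and a character; these characters form a cocycle, by [mmM]. *)
have [m0 m0P] : exists m0 : gT * (F -> int) -> L, forall gy, gy.1 \in H /\ D gy.2 ->
    exists2 c, c != 0 & act gy.1 (pi (gy.2 \o act gy.1)) = io c * chi (m0 gy) * pi gy.2.
  apply: (@choice_on _ _ (0 : L) (fun gy : gT * (F -> int) => gy.1 \in H /\ D gy.2)
    (fun gy m => exists2 c, c != 0 &
      act gy.1 (pi (gy.2 \o act gy.1)) = io c * chi m * pi gy.2)) => -[g y] /= [Hg Dy].
  have Dyg := DactH g y Hg Dy.
  have [c [m [c0 h]]] : exists c m, c != 0 /\
      act g (pi (y \o act g)) / pi y = io c * chi m.
    apply: (div_ker2 dt); [by rewrite tact_eq0 ?HG // pi0|exact: pi0|].
    move=> w Dw; have := piE _ _ Dyg (DactH g w Hg Dw); rewrite /= => ->.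
    rewrite piE //; congr (nat_of_bool _)%:R; apply/eqP/eqP => [|-> //] e1.
    by rewrite -(compKV g w Hg) e1 compKV.
  by exists m, c; rewrite // -h mulfVK // pi0.
pose mm g y := m0 (g, y).
have mmP g y : g \in H -> D y ->
    exists2 c, c != 0 & act g (pi (y \o act g)) = io c * chi (mm g y) * pi y.
  by move=> Hg Dy; apply: (m0P (g, y)).
have mmM h g y : h \in H -> g \in H -> D y ->
    mm (h * g)%g y = lact L (mm h (y \o act g)) g + mm g y.
  move=> Hh Hg Dy; have Dyg := DactH g y Hg Dy.
  have [c c0 e1] := mmP _ _ (groupM Hh Hg) Dy.
  have [c1 c10 e2] := mmP _ _ Hh Dyg; have [c2 c20 e3] := mmP _ _ Hg Dy.
  have yE : y \o act (h * g)%g = (y \o act g) \o act h.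
    by apply/funext => x /=; rewrite tact_comp ?HG.
  move: e1; rewrite yE tact_comp ?HG // e2 !tactM ?HG // tact_io ?HG // tact_chi ?HG // e3.
  move=> e1; apply/esym; apply: (tchi_inj (c := gal g c1 * c2) c0); rewrite tchiD rmorphM.
  by apply: (mulIf (pi0 y Dy)); rewrite -e1; ring.
pose S y b := \sum_(h in H) nu b (pr (mm h y)).
(* In Z^B the cocycle is a coboundary. Averaging over H shows it over the rationals; rounding down
   keeps it integral and exact, because the averages to be compared differ by integers. *)
pose c y b := (- S y b %/ #|H|%:Z)%Z.
have cP g y b : g \in H -> D y ->
    c (y \o act g) b = c y (bact g b) + nu (bact g b) (pr (mm g y)).
  move=> Hg Dy; have SE : S y (bact g b) =
      S (y \o act g) b + #|H|%:Z * nu (bact g b) (pr (mm g y)).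
    rewrite /S (reindex_inj (mulIg g)) /=; under eq_bigl do rewrite groupMr //.
    rewrite -[X in X * nu _ _]natz mulr_natl -sumr_const -big_split /=; apply: eq_bigr => h Hh.
    by rewrite mmM // raddfD nuD pr_act // nu_act.
  have H0 : #|H|%:Z != 0 by have := cardG_gt0 H; lia.
  rewrite /c SE (_ : - (_ + _ * ?[z]) = - ?z * #|H|%:Z + - S (y \o act g) b); last by ring.
  by rewrite divzMDl // addrAC addNr add0r.
have prodact g b : g \in H -> \prod_(y <- s) act g (pi y) ^ y (e b) =
    \prod_(y <- s) act g (pi (y \o act g)) ^ y (e (bact g b)).
  move=> Hg; rewrite (perm_big (map (fun y => y \o act g) s)).
    rewrite big_map big_seq [RHS]big_seq; apply: eq_bigr => y /sD Dy.
    by rewrite /= actc.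
  apply: uniq_perm => //.
    by rewrite map_inj_uniq // => y w h; rewrite -(compKV g y Hg) h compKV.
  move=> y; apply/idP/mapP => [ys|[w ws ->]]; last exact: sact.
  exists (y \o act g^-1%g); last by rewrite compK.
  by apply: sact; rewrite ?groupV.
(* Divisor factorisation of [e b] in the group ring: a constant, a character and powers of the
   chosen uniformizers. *)
have mb_ex b : exists mb, exists2 c, c != 0 &
    e b = io c * chi mb * \prod_(y <- s) pi y ^ y (e b).
  pose P := \prod_(y <- s) pi y ^ y (e b).
  have P0 : P != 0.
    rewrite /P prodf_seq_neq0; apply/allP => y /sD Dy /=.
    exact/expfz_neq0/pi0.
  have [c1 [m [c0 h]]] : exists c m, c != 0 /\ e b / P = io c * chi m.
    apply: (div_ker2 dt) => // w Dw; rewrite /P big_seq (div_prod dt) // => [|y /sD Dy]; last first.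
      exact/expfz_neq0/pi0.
    rewrite -big_seq; have [ws|nws] := boolP (w \in s).
      rewrite (bigD1_seq w) //= (divXz dt) ?pi0 // piE // eqxx mulr1 big_seq_cond big1 ?addr0 //.
      by move=> y /andP[/sD Dy]; rewrite eq_sym (divXz dt) ?pi0 // piE // => /negbTE->; rewrite mulr0.
    rewrite big_seq big1 => [|y ys]; last first.
      have Dy := sD y ys; rewrite (divXz dt) ?pi0 // piE //.
      have [e1|_] := eqVneq w y; last by rewrite mulr0.
      by rewrite e1 ys in nws.
    have [//|nz] := eqVneq (w (e b)) 0.
    by case/negP: nws; apply/sE; split=> //; exists b.
  by exists m, c1; rewrite // -h mulfVK.
have [mb mbP] := choice mb_ex.
(* The first term lies in the image of L1, so modulo L1 the matrix [A] factors through Z^s. It is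
   H-equivariant by [Aact] and the identity on L1 by [Anu]. Hence the identity of N is (1 - A) + A,
   with 1 - A defined on N with values in Z^B. *)
pose A b b' := nu b' (pr (mb b)) + \sum_(y <- s) y (e b) * c y b'.
have nu0 b : nu b 0 = 0 by have [] := sum_int_additive (nuD b).
have nuz b x (m : int) : nu b (x *~ m) = nu b x * m by have [] := sum_int_additive (nuD b).
have nusum b (I : Type) (r : seq I) (f : I -> L1) :
    nu b (\sum_(i <- r) f i) = \sum_(i <- r) nu b (f i).
  by have [_ _] := sum_int_additive (nuD b).
have Aact g b b' : g \in H -> A (bact g b) (bact g b') = A b b'.
  move=> Hg; have mbE : mb (bact g b) =
      lact L (mb b) g + \sum_(y <- s) mm g y *~ y (e (bact g b)).
    have [c1 c10 e1] := mbP b; have [c2 c20 e2] := mbP (bact g b).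
    have [c3 c30 e3] := eact g Hg b.
    have [C C0 CE] : exists2 C, C != 0 &
        \prod_(y <- s) act g (pi (y \o act g)) ^ y (e (bact g b)) =
        io C * chi (\sum_(y <- s) mm g y *~ y (e (bact g b))) *
        \prod_(y <- s) pi y ^ y (e (bact g b)).
      elim: (s) sD => [|y r IH] rD.
        by exists 1; rewrite ?oner_neq0 // !big_nil rmorph1 tchi0 !mulr1.
      have [|C C0 CE] := IH; first by move=> w wr; apply: rD; rewrite inE wr orbT.
      have Dy : D y by apply: rD; rewrite mem_head.
      have [c4 c40 e4] := mmP g y Hg Dy; exists (c4 ^ y (e (bact g b)) * C).
        by rewrite mulf_neq0 // expfz_neq0.
      rewrite !big_cons CE e4 !expfzMl -tchiMz tchiD rmorphM fmorphXz; ring.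
    move: e3; rewrite {1}e1 !tactM ?HG // tact_io ?HG // tact_chi ?HG // tact_prod ?HG //.
    under eq_bigr => y _ do rewrite tactXz ?HG //.
    rewrite prodact // CE [X in _ = _ * X]e2 => e3.
    apply/esym; apply: (tchi_inj (c := gal g c1 * C) (mulf_neq0 c30 c20)).
    have P0 : \prod_(y <- s) pi y ^ y (e (bact g b)) != 0.
      rewrite prodf_seq_neq0; apply/allP => y /sD Dy /=.
    exact/expfz_neq0/pi0.
    apply: (mulIf P0); rewrite tchiD !rmorphM.
    by move: e3; rewrite !mulrA => <-; congr (_ * _ * _); rewrite mulrAC.
  rewrite /A mbE raddfD nuD pr_act // nu_act // -addrA; congr (_ + _).
  rewrite raddf_sum nusum -big_split /=.
  transitivity (\sum_(y <- s) (y \o act g) (e b) * c (y \o act g) b').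
    rewrite big_seq [RHS]big_seq; apply: eq_bigr => y /sD Dy.
    by rewrite raddfMz nuz cP //= actc // mulrDr addrC [_ * y _]mulrC.
  rewrite -(big_map (fun y => y \o act g) xpredT (fun y => y (e b) * c y b')).
  apply: perm_big; apply: uniq_perm => //.
    by rewrite map_inj_uniq // => y w h; rewrite -(compKV g y Hg) h compKV.
  move=> y; apply/mapP/idP => [[w ws ->]|ys]; first exact: sact.
  exists (y \o act g^-1%g); last by rewrite compK.
  by apply: sact; rewrite ?groupV.
(* The product of the e b ^ nu b m is [chi (j m)] up to a constant. Its divisor is trivial, so the
   uniformizers cancel and the characters must agree. *)
have Anu m b' : \sum_b nu b m * A b b' = nu b' m.
  have mE : \sum_b mb b *~ nu b m = j m.
    have [C C0] := eprod m.
    have [C' C0' ->] : exists2 C, C != 0 & \prod_b e b ^ nu b m =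
        io C * chi (\sum_b mb b *~ nu b m) * \prod_(y <- s) pi y ^ (\sum_b y (e b) * nu b m).
      have [cb cbP] := choice (fun b => let: ex_intro2 x p q := mbP b in
        ex_intro (fun x => x != 0 /\ e b = io x * chi (mb b) * \prod_(y <- s) pi y ^ y (e b))
          x (conj p q)).
      exists (\prod_b cb b ^ nu b m).
        by apply/prodf_neq0 => b _; apply: expfz_neq0; case: (cbP b).
      have -> : \prod_(y <- s) pi y ^ (\sum_b y (e b) * nu b m) =
          \prod_b (\prod_(y <- s) pi y ^ y (e b)) ^ nu b m.
        have pz (r : seq (F -> int)) (h : (F -> int) -> F) (z : int) :
            (\prod_(y <- r) h y) ^ z = \prod_(y <- r) h y ^ z.
          by elim: r => [|y r IH]; rewrite ?big_nil ?exp1rz // !big_cons expfzMl IH.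
        under [RHS]eq_bigr => b _ do rewrite pz.
        rewrite exchange_big /= big_seq [RHS]big_seq; apply: eq_bigr => y /sD Dy.
        rewrite (big_morph _ (fun z w => expfzDr z w (pi0 y Dy)) (expr0z (pi y))).
        by apply: eq_bigr => b _; rewrite exprz_exp.
      rewrite rmorph_prod tchi_sum -!big_split /=; apply: eq_bigr => b _.
      by have [_ {1}->] := cbP b; rewrite !expfzMl tchiMz fmorphXz.
    have -> : \prod_(y <- s) pi y ^ (\sum_b y (e b) * nu b m) = 1.
      by rewrite big_seq big1 // => y /sD Dy; rewrite yk // expr0z.
    by rewrite mulr1; apply: tchi_inj.
  rewrite -[in RHS](prj m) -mE raddf_sum nusum /A.
  under eq_bigr => b _ do rewrite mulrDr.
  rewrite big_split /= [X in _ + X](_ : _ = 0) ?addr0.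
    by apply: eq_bigr => b _; rewrite raddfMz nuz mulrC.
  under eq_bigr => b _ do rewrite mulr_sumr.
  rewrite exchange_big /= big_seq big1 // => y /sD Dy.
  transitivity ((\sum_b y (e b) * nu b m) * c y b'); last by rewrite yk // mul0r.
  by rewrite mulr_suml; apply: eq_bigr => b _; ring.
pose f b' b := (b == b')%:R - A b b'.
have fk b' m : \sum_b f b' b * nu b m = 0.
  rewrite /f; under eq_bigr => b _ do rewrite mulrBl.
  rewrite sumrB (bigD1 b') //= eqxx mul1r big1 ?addr0 => [|b /negbTE->]; last by rewrite mul0r.
  apply/eqP; rewrite subr_eq0; apply/eqP; rewrite -{1}(Anu m b').
  by apply: eq_bigr => b _; rewrite mulrC.
have -> : \sum_b beta b * a b = \sum_(b' <- enum B) dot (f b') a * beta b' +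
    \sum_(y <- s) dot (fun b => y (e b)) a * dot beta (c y).
  rewrite big_enum /=.
  have e1 : \sum_b' beta b' * (\sum_b a b * A b b') =
      \sum_(y <- s) dot (fun b => y (e b)) a * dot beta (c y).
    transitivity (\sum_b a b * \sum_(y <- s) y (e b) * dot beta (c y)).
      under eq_bigr => b' _ do rewrite mulr_sumr.
      rewrite exchange_big /=; apply: eq_bigr => b _.
      under eq_bigr => b' _ do rewrite mulrCA mulrDr.
      rewrite -mulr_sumr big_split /= beta_nu add0r; congr (_ * _).
      under eq_bigr => b' _ do rewrite mulr_sumr.
      rewrite exchange_big /=; apply: eq_bigr => y _; rewrite mulr_sumr.
      by apply: eq_bigr => b' _; ring.
    under eq_bigr => b _ do rewrite mulr_sumr.
    rewrite exchange_big /=; apply: eq_bigr => y _; rewrite mulr_suml.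
    by apply: eq_bigr => b _; ring.
  rewrite -e1 -big_split /=; apply: eq_bigr => b' _.
  rewrite /dot /f; under [X in _ = X * _ + _]eq_bigr => b _ do rewrite mulrBl.
  rewrite sumrB [X in (X - _) * _](bigD1 b') //= eqxx mul1r.
  rewrite [X in (_ + X - _) * _]big1 ?addr0 => [|b /negbTE->]; last by rewrite mul0r.
  under [X in (_ - X) * _]eq_bigr => b _ do rewrite mulrC.
  ring.
apply: rpredD.
  apply: (orbit_sum_dvd bact1 bactM (enum_uniq B)).
    move=> b' _ g Hg; rewrite mem_enum; split=> //; rewrite beta_inv //.
    rewrite -(dot_a Hg (fk (bact g b'))); congr (_ * _); apply: eq_bigr => b _.
    by rewrite /f Aact // (can_eq (fun z => bactK z Hg)).
  move=> b' _ S' sSH st; have := local_dvd (f := f b') (c := fun b => (b == b')%:R) sSH.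
  have bb : \sum_b beta b * (b == b')%:R = beta b'.
    rewrite (bigD1 b') //= eqxx mulr1 big1 ?addr0 // => b /negbTE->; exact: mulr0.
  rewrite bb; apply.
  - move=> g Sg b; have Hg := subsetP sSH g Sg; rewrite /f -{1 2}(st g Sg) Aact //.
    by rewrite (can_eq (fun z => bactK z Hg)).
  - exact: fk.
  move=> g Sg; exists 0 => b; have Hg := subsetP sSH g Sg.
  by rewrite nu0 addr0 -{1}(st g Sg) (can_eq (fun z => bactK z Hg)).
have tauM : {in H &, forall g h (y : F -> int),
    y \o act (g * h)%g^-1%g = (y \o act g^-1%g) \o act h^-1%g}.
  move=> g h Hg Hh y; apply/funext => x /=.
  by rewrite invMg tact_comp ?groupV ?HG.
have tau1 (y : F -> int) : y \o act 1%g^-1%g = y.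
  by apply/funext => x /=; rewrite invg1 tact_id.
apply: (@orbit_sum_dvd gT H _ (fun g (y : F -> int) => y \o act g^-1%g) tau1 tauM) => //.
- move=> y ys g Hg; have Hg' : g^-1%g \in H by rewrite groupV.
  have Dy := sD y ys; split; first exact: sact.
  congr (_ * _).
    rewrite -(dot_a Hg' (f := fun b => y (e b))) //; last by move=> m; apply: yk.
    by apply: eq_bigr => b _; rewrite /= actc.
  rewrite /dot (reindex_bact _ Hg') [RHS](reindex_bact _ Hg').
  rewrite -(reindex_bact (fun b => beta b * c (y \o act g^-1%g) b)) //.
  under eq_bigr => b _ do rewrite cP // mulrDr.
  rewrite big_split /= [X in _ + X](_ : _ = 0) ?addr0.
    by apply: eq_bigr => b _; rewrite beta_inv.
  rewrite -[RHS](beta_nu (pr (mm g^-1%g y))) [RHS](reindex_bact _ Hg').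
  by apply: eq_bigr => b _; rewrite beta_inv.
move=> y ys S' sSH st; have Dy := sD y ys; apply: local_dvd => //.
- move=> g Sg b; have Hg := subsetP sSH g Sg; rewrite -actc //.
  by have := congr1 (fun z => z (act g (e b))) (st g Sg); rewrite /= tactK ?HG.
- by move=> m; apply: yk.
move=> g Sg; have Hg := subsetP sSH g Sg; exists (lact L1 (pr (mm g y)) g^-1%g *~ -1) => b.
have yg : y \o act g = y by rewrite -{1}(st g Sg) compK.
have -> : nu b (lact L1 (pr (mm g y)) g^-1%g *~ -1) = - nu (bact g b) (pr (mm g y)).
  by rewrite nuz mulrN1 -(nu_act Hg b) -lactM ?groupV ?HG // mulVg lact1.
by have := cP g y b Hg Dy; rewrite yg => ->; rewrite addrK.
Qed.

End Obstruction.

(** * Cubic lattices *)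

Section SignCharacters.
Variables (gT : finGroupType) (H : {group gT}).

Definition sign_character (ch : gT -> bool) := {in H &, forall g h, ch (g * h)%g = ch g (+) ch h}.

Lemma sign_characterD ch ch' : sign_character ch -> sign_character ch' ->
  sign_character (fun g => ch g (+) ch' g).
Proof. by move=> h h' g g' Hg Hg'; rewrite h // h' // !addbA; congr (_ (+) _); rewrite -!addbA; congr (_ (+) _); rewrite addbC. Qed.

Lemma sign_character1 ch : sign_character ch -> ch 1%g = false.
Proof. by move=> h; have := h 1%g 1%g (group1 H) (group1 H); rewrite mulg1 addbb. Qed.

Lemma sign_kernel_group ch : sign_character ch -> group_set [set g in H | ~~ ch g].
Proof.
move=> h; apply/group_setP; split=> [|g g']; first by rewrite inE group1 sign_character1.
rewrite !inE => /andP[Hg ng] /andP[Hg' ng'].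
by rewrite groupM // h // (negbTE ng) (negbTE ng').
Qed.

Lemma sign_kernel_index ch : sign_character ch -> (exists2 g, g \in H & ch g) ->
  exists N : {group gT}, [/\ N \subset H, #|H : N|%g = 2 & forall g, (g \in N) = (g \in H) && ~~ ch g].
Proof.
move=> h [g0 Hg0 cg0]; exists (group (sign_kernel_group h)); split=> [||g].
- by apply/subsetP => g; rewrite inE => /andP[].
- have sNH : group (sign_kernel_group h) \subset H by apply/subsetP => g; rewrite inE => /andP[].
  apply/eqP; rewrite -(eqn_pmul2l (cardG_gt0 (group (sign_kernel_group h)))) Lagrange //.
  rewrite muln2 -addnn; apply/eqP.
  rewrite -(cardsID [set g in H | ~~ ch g] H); congr (_ + _)%N.
    by apply: eq_card => g; rewrite !inE; case: (g \in H).
  rewrite -[RHS](card_rcoset _ g0); apply: eq_card => g; rewrite mem_rcoset !inE.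
  have [Hg|ng] := boolP (g \in H); last by rewrite groupMr ?groupV // (negbTE ng) andbF.
  have chV : ch g0^-1%g = ch g0.
    have := h g0 g0^-1%g Hg0; rewrite groupV mulgV sign_character1 // => /(_ Hg0).
    by case: (ch g0); case: (ch _).
  by rewrite groupM ?groupV //= h ?groupV // chV cg0 addbT negbK andbT.
by rewrite inE.
Qed.

Lemma sign_index2 ch (S : {group gT}) : S \subset H -> sign_character ch ->
  (exists2 g, g \in H & ch g) -> {in S, forall g, ~~ ch g} -> (2 %| #|H : S|%g)%N.
Proof.
move=> sSH h ex hS; have [N [sNH i2 Nin]] := sign_kernel_index h ex.
have sSN : S \subset N by apply/subsetP => g Sg; rewrite Nin (subsetP sSH) ?hS.
by rewrite -(Lagrange_index sNH sSN) i2 dvdn_mulr.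
Qed.

End SignCharacters.

Lemma sign_index4 (gT : finGroupType) (H S : {group gT}) ch ch' : S \subset H ->
  sign_character H ch -> sign_character H ch' ->
  (exists2 g, g \in H & ch g) -> (exists2 g, g \in H & ~~ ch g && ch' g) ->
  {in S, forall g, ~~ ch g} -> {in S, forall g, ~~ ch' g} -> (4 %| #|H : S|%g)%N.
Proof.
move=> sSH h h' ex [g0 Hg0 /andP[ng0 cg0]] hS hS'; have [N [sNH i2 Nin]] := sign_kernel_index h ex.
have sSN : S \subset N by apply/subsetP => g Sg; rewrite Nin (subsetP sSH) ?hS.
rewrite -(Lagrange_index sNH sSN) i2 (_ : 4 = 2 * 2)%N // dvdn_pmul2l //.
apply: (sign_index2 (ch := ch') sSN) => //.
  by move=> g g' Ng Ng'; apply: h'; apply: (subsetP sNH).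
by exists g0; rewrite // Nin Hg0.
Qed.

Section SignSpan.
Variables (gT : finGroupType) (H S : {group gT}) (p q r : gT -> bool).
Hypothesis sSH : S \subset H.
Hypotheses (ph : sign_character H p) (qh : sign_character H q) (rh : sign_character H r).

Let sM g h : g \in S -> h \in S ->
  [/\ (g * h)%g \in S, p (g * h)%g = p g (+) p h, q (g * h)%g = q g (+) q h &
      r (g * h)%g = r g (+) r h].
Proof. by move=> Sg Sh; rewrite groupM ?ph ?qh ?rh ?(subsetP sSH). Qed.

(** The image of S under (p, q) in the plane over F_2 lies in no line, so it is the whole plane. *)
Lemma sign_span2 : (exists2 g, g \in S & p g) -> (exists2 g, g \in S & q g) ->
  (exists2 g, g \in S & p g (+) q g) -> exists2 g, g \in S & p g && ~~ q g.
Proof.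
move=> [g1 S1 p1] [g2 S2 q2] [g3 S3 h3].
have [S12 p12 q12 _] := sM S1 S2; have [S13 p13 q13 _] := sM S1 S3.
have [S23 p23 q23 _] := sM S2 S3.
move: p1 q2 h3 p12 q12 p13 q13 p23 q23.
case e1: (q g1); last by move=> p1 *; exists g1; rewrite ?p1 ?e1.
case e2: (p g2); last first.
  by move=> p1 q2 _ p12 q12 *; exists (g1 * g2)%g; rewrite // p12 q12 p1 q2.
case e3: (p g3); case e4: (q g3) => //= p1 q2 _ p12 q12 p13 q13 p23 q23.
  by exists g3; rewrite ?e3 ?e4.
by exists (g1 * g3)%g; rewrite // p13 q13 p1.
Qed.

(** No nonzero linear form vanishes on the image of S in the 3-space over F_2, so the image is
    everything. The elements g1, g2, g3 are found by elimination. *)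
Lemma sign_span3 :
  (forall a b c, [|| a, b | c] -> exists2 g, g \in S & (a && p g) (+) (b && q g) (+) (c && r g)) ->
  exists2 g, g \in S & [&& p g, ~~ q g & ~~ r g].
Proof.
move=> h; have [g1 S1 h1] := h true false false isT.
have p1 : p g1 by move: h1; rewrite /= !addbF.
have [|g2 S2 h2] := h (q g1) true false; first by rewrite orbT.
set e := (r g1 && p g2) (+) r g2.
have [|g3 S3 h3] := h (r g1 (+) (e && q g1)) e true; first by rewrite !orbT.
have gen a b c : exists2 g, g \in S & [/\ p g = (a && p g1) (+) (b && p g2) (+) (c && p g3),
    q g = (a && q g1) (+) (b && q g2) (+) (c && q g3) &
    r g = (a && r g1) (+) (b && r g2) (+) (c && r g3)].
  pose f (a' : bool) (g : gT) := if a' then g else 1%g.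
  have fP (a' : bool) g : g \in S -> [/\ f a' g \in S, p (f a' g) = a' && p g, q (f a' g) = a' && q g &
      r (f a' g) = a' && r g].
    by case: a' => Sg; rewrite /f ?Sg ?group1 ?(sign_character1 ph) ?(sign_character1 qh) ?(sign_character1 rh).
  have [A1 A2 A3 A4] := fP a g1 S1; have [B1 B2 B3 B4] := fP b g2 S2.
  have [C1 C2 C3 C4] := fP c g3 S3; have [D1 D2 D3 D4] := sM A1 B1.
  have [E1 E2 E3 E4] := sM D1 C1.
  by exists (f a g1 * f b g2 * f c g3)%g; rewrite // E2 E3 E4 D2 D3 D4 A2 A3 A4 B2 B3 B4 C2 C3 C4.
have sol : exists a b c, [/\ true = (a && p g1) (+) (b && p g2) (+) (c && p g3),
    false = (a && q g1) (+) (b && q g2) (+) (c && q g3) &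
    false = (a && r g1) (+) (b && r g2) (+) (c && r g3)].
  move: h2 h3; rewrite {}/e p1 {gen h h1}; clear.
  case: (q g1); case: (r g1); case: (p g2); case: (q g2); case: (r g2) => //=;
    case: (p g3); case: (q g3); case: (r g3) => //= _ _;
    solve [ by exists true, true, true | by exists true, true, false | by exists true, false, true
          | by exists true, false, false | by exists false, true, true | by exists false, true, false
          | by exists false, false, true ].
have [a [b [c [ea eb ec]]]] := sol; have [g Sg [pg qg rg]] := gen a b c.
by exists g; rewrite // pg qg rg -ea -eb -ec.
Qed.

End SignSpan.

Lemma even_dvd4 (n : nat) (a b : int) :
  [\/ (4 %| n)%N, (2 %| n)%N /\ ((exists k, a = k * 2) \/ (exists k, b = k * 2)) |
      (exists k, a = k * 2) /\ (exists k, b = k * 2)] -> (4 %| n%:Z * (a * b))%Z.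
Proof.
case=> [/dvdnP[m ->]|[/dvdnP[m ->] [[k ->]|[k ->]]]|[[k ->] [l ->]]]; apply/dvdzP.
- by exists (m%:Z * (a * b)); rewrite PoszM; ring.
- by exists (m%:Z * (k * b)); rewrite PoszM; ring.
- by exists (m%:Z * (a * k)); rewrite PoszM; ring.
by exists (n%:Z * (k * l)); ring.
Qed.

Definition sg (s : bool) (n : int) : int := if s then - n else n.

(* The fourteen functionals of a frame: eight (or four, twice) half-sums of signed coordinates,
   and the six signed coordinates. *)
Definition frame_index : finType := ((bool * bool * bool) + (bool + bool + bool))%type.
Notation Half a b c := (inl (a, b, c)).
Notation Cx s := (inr (inl (inl s))).
Notation Cy s := (inr (inl (inr s))).
Notation Cz s := (inr (inr s)).

Lemma sum_frame_index (f : frame_index -> int) : \sum_b f b =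
  f (Half false false false) + f (Half false false true) + f (Half false true false) +
  f (Half false true true) + f (Half true false false) + f (Half true false true) +
  f (Half true true false) + f (Half true true true) +
  (f (Cx false) + f (Cx true) + f (Cy false) + f (Cy true) + f (Cz false) + f (Cz true)).
Proof.
have pairE (I J : finType) (h : I * J -> int) : \sum_p h p = \sum_i \sum_j h (i, j).
  by rewrite pair_bigA; apply: eq_bigr => -[].
rewrite !big_sumType !big_bool !pairE !big_bool /=.
by ring.
Qed.

Definition frame_form (u v s : int) (b : frame_index) : int :=
  match b with
  | Half a b c => ((sg a u + sg b v + sg c s) %/ 2)%Z
  | Cx e => sg e u | Cy e => sg e v | Cz e => sg e s
  end.

(* For p = q = r mod 2, coefficients of (p u + q v + r s) / 2, compatible with signed permutations. *)
Definition frame_coef (p q r : int) (b : frame_index) : int :=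
  match b with
  | Half a b c => (odd (absz p) && ((p < 0) == a) && ((q < 0) == b) && ((r < 0) == c))%:R
  | Cx e => if (p < 0) == e then (absz p)./2%:Z else 0
  | Cy e => if (q < 0) == e then (absz q)./2%:Z else 0
  | Cz e => if (r < 0) == e then (absz r)./2%:Z else 0
  end.

Lemma halves (e : int) : exists k, (absz e)./2%:Z = k /\
  e = if e < 0 then - (k * 2 + (odd (absz e))%:R) else k * 2 + (odd (absz e))%:R.
Proof. by exists (absz e)./2; split=> //; case: ifP; lia. Qed.

Lemma frame_coefP (p q r n u v s c c' d : int) :
  p + q = c * 2 -> q + r = c' * 2 -> u + v + s = d * 2 -> n * 2 = p * u + q * v + r * s ->
  n = \sum_b frame_coef p q r b * frame_form u v s b.
Proof.
move=> e1 e2 e3 e4; rewrite sum_frame_index /frame_coef /frame_form /sg.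
have [kp [-> pE]] := halves p; have [kq [-> qE]] := halves q; have [kr [-> rE]] := halves r.
have [oq or] : odd (absz q) = odd (absz p) /\ odd (absz r) = odd (absz p) by split; lia.
rewrite oq or in qE rE; move: pE qE rE.
case: (p < 0); case: (q < 0); case: (r < 0); case: (odd (absz p)) => /= pE qE rE;
  rewrite ?mul0r ?mul1r ?addr0 ?add0r; rewrite pE qE rE in e4; clear pE qE rE e1 e2; lia.
Qed.

Definition frame_act (w s1 s2 t : bool) (b : frame_index) : frame_index :=
  match b with
  | Half a b c => Half (s1 (+) (if w then b else a)) (s2 (+) (if w then a else b)) (t (+) c)
  | Cx e => if w then Cy (s2 (+) e) else Cx (s1 (+) e)
  | Cy e => if w then Cx (s1 (+) e) else Cy (s2 (+) e)
  | Cz e => Cz (t (+) e)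
  end.

Lemma frame_act_form w s1 s2 t u v s b :
  frame_form (sg s1 (if w then v else u)) (sg s2 (if w then u else v)) (sg t s)
    (frame_act w s1 s2 t b) = frame_form u v s b.
Proof.
case: b => [[[a b] c]|[[e|e]|e]]; rewrite /frame_form /frame_act /sg; last 3 first.
- by case: w; case: s1; case: s2; case: e => /=; rewrite ?opprK.
- by case: w; case: s1; case: s2; case: e => /=; rewrite ?opprK.
- by case: t; case: e => /=; rewrite ?opprK.
by congr (_ %/ _)%Z; case: w; case: s1; case: s2; case: t; case: a; case: b; case: c => /=;
  rewrite ?opprK // [in RHS]addrC -?addrA //; ring.
Qed.

Lemma frame_act_coef w s1 s2 t p q r c c' b : p + q = c * 2 -> q + r = c' * 2 ->
  frame_coef (if w then sg s2 q else sg s1 p) (if w then sg s1 p else sg s2 q) (sg t r) b =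
  frame_coef p q r (frame_act w s1 s2 t b).
Proof.
move=> e1 e2; rewrite /frame_coef /frame_act /sg.
have [oq or] : odd (absz q) = odd (absz p) /\ odd (absz r) = odd (absz p) by split; lia.
have oN (e : int) : odd (absz (- e)) = odd (absz e) by rewrite abszN.
have lN (e : int) : odd (absz e) -> (- e < 0) = ~~ (e < 0) by lia.
have lN' (e : int) (f : bool) : (if (- e < 0) == f then (absz (- e))./2%:Z else 0) =
    if (e < 0) == ~~ f then (absz e)./2%:Z else 0.
  by rewrite abszN; have [->|e0] := eqVneq e 0; rewrite ?if_same //; case: f; do 2 case: ifP; lia.
case: b => [[[a b] d]|[[e|e]|e]]; last 3 first.
- by case: w; [case: s2|case: s1]; rewrite ?lN'.
- by case: w; [case: s1|case: s2]; rewrite ?lN'.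
- by case: t; rewrite ?lN'.
congr (nat_of_bool _)%:R; have [op|np] := boolP (odd (absz p)); last first.
  by case: w; case: s1; case: s2; rewrite /= ?oN ?oq (negbTE np).
by case: w; case: s1; case: s2; case: t; rewrite /= ?oN ?oq op /= ?lN ?oq ?or //;
  case: a; case: b; case: d; case: (p < 0); case: (q < 0); case: (r < 0).
Qed.

(* For the other frame the half-sums are (u, v)/2, indexed by Half false, and (v, s)/2,
   indexed by Half true. *)
Definition bframe_form (u v s : int) (b : frame_index) : int :=
  match b with
  | Half k a c => if k then ((sg a v + sg c s) %/ 2)%Z else ((sg a u + sg c v) %/ 2)%Z
  | Cx e => sg e u | Cy e => sg e v | Cz e => sg e s
  end.

(** No half-sum of u and s is available. For q even and p, r odd, a half-sum of u, v and one of v, s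
    are used with opposite signs of v. The sign [(p < 0) (+) (r < 0)] is equivariant because the
    third sign character is the product of the other two. *)
Definition bframe_coef (p q r : int) (b : frame_index) : int :=
  let u := (p < 0) (+) (r < 0) in
  match b with
  | Half false a c => [&& odd (absz p), (p < 0) == a & (if odd (absz q) then q < 0 else u) == c]%:R
  | Half true a c => [&& odd (absz r), (if odd (absz q) then q < 0 else ~~ u) == a & (r < 0) == c]%:R
  | Cx e => if (p < 0) == e then (absz p)./2%:Z else 0
  | Cy e => if (q < 0) == e then (absz q)./2%:Z else 0
  | Cz e => if (r < 0) == e then (absz r)./2%:Z else 0
  end.

Lemma bframe_coefP (p q r n u v s c d d' : int) :
  p + q + r = c * 2 -> u + v = d * 2 -> v + s = d' * 2 -> n * 2 = p * u + q * v + r * s ->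
  n = \sum_b bframe_coef p q r b * bframe_form u v s b.
Proof.
move=> e1 e2 e3 e4; rewrite sum_frame_index /bframe_coef /bframe_form /sg.
have [kp [-> pE]] := halves p; have [kq [-> qE]] := halves q; have [kr [-> rE]] := halves r.
have or : odd (absz r) = odd (absz p) (+) odd (absz q).
  by case E1: (odd (absz p)); case E2: (odd (absz q)); case E3: (odd (absz r)) => //=; lia.
rewrite or in rE *; move: pE qE rE.
case: (p < 0); case: (q < 0); case: (r < 0); case: (odd (absz p)); case: (odd (absz q));
  move=> /= pE qE rE;
  rewrite ?mul0r ?mul1r ?addr0 ?add0r; rewrite pE qE rE in e4; clear pE qE rE or e1; lia.
Qed.

Definition bframe_act (s1 s2 : bool) (b : frame_index) : frame_index :=
  match b with
  | Half k a c => if k then Half true (s2 (+) a) (s1 (+) s2 (+) c)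
                  else Half false (s1 (+) a) (s2 (+) c)
  | Cx e => Cx (s1 (+) e) | Cy e => Cy (s2 (+) e) | Cz e => Cz (s1 (+) s2 (+) e)
  end.

Lemma bframe_act_form s1 s2 u v s b :
  bframe_form (sg s1 u) (sg s2 v) (sg (s1 (+) s2) s) (bframe_act s1 s2 b) = bframe_form u v s b.
Proof.
case: b => [[[k a] c]|[[e|e]|e]]; rewrite /bframe_form /bframe_act /sg; last 3 first.
- by case: s1; case: e => /=; rewrite ?opprK.
- by case: s2; case: e => /=; rewrite ?opprK.
- by case: s1; case: s2; case: e => /=; rewrite ?opprK.
by case: k; congr (_ %/ _)%Z; case: s1; case: s2; case: a; case: c => /=; rewrite ?opprK.
Qed.

Lemma bframe_act_coef s1 s2 p q r c b : p + q + r = c * 2 ->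
  bframe_coef (sg s1 p) (sg s2 q) (sg (s1 (+) s2) r) b = bframe_coef p q r (bframe_act s1 s2 b).
Proof.
move=> e1; rewrite /bframe_coef /bframe_act.
have oN e (n : int) : odd (absz (sg e n)) = odd (absz n) by case: e => //=; rewrite abszN.
have lN e (n : int) : odd (absz n) -> (sg e n < 0) = e (+) (n < 0) by case: e => /=; lia.
have lN' e (n : int) (f : bool) : (if (sg e n < 0) == f then (absz (sg e n))./2%:Z else 0) =
    if (n < 0) == e (+) f then (absz n)./2%:Z else 0.
  case: e => //=; rewrite abszN; have [->|e0] := eqVneq n 0; first by rewrite ?if_same.
  by case: f; do 2 case: ifP; lia.
have or : odd (absz r) = odd (absz p) (+) odd (absz q).
  by case E1: (odd (absz p)); case E2: (odd (absz q)); case E3: (odd (absz r)) => //=; lia.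
case: b => [[[k a] f]|[[e|e]|e]]; rewrite ?lN' ?addbA // !oN.
case op: (odd (absz p)) or; case oq: (odd (absz q)) => /= or; rewrite ?or ?andbF //=;
  rewrite ?lN ?or ?op ?oq //; case: k => //=; rewrite ?lN ?or ?op ?oq //=; congr (nat_of_bool _)%:R;
  by case: s1; case: s2; case: a; case: f; case: (p < 0); case: (q < 0); case: (r < 0).
Qed.

(** The a's are the coordinates of the lattice vector by which [c] changes under an element that
    negates z and keeps the x- and y-axes, negating both if e. [b1] is the x-coordinate for an
    element that exchanges these two axes. *)
Lemma fourfold_parity (e sr : bool) (c : frame_index -> int) (a1 a2 a3 b1 d : int) :
  a1 + a2 + a3 = d * 2 -> c (Cz true) = c (Cz false) + a3 ->
  c (Cx e) = c (Cx false) + a1 -> c (Cy e) = c (Cy false) + a2 ->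
  c (Cy sr) = c (Cx false) + b1 -> c (Cy (~~ sr)) = c (Cx true) - b1 ->
  exists k, c (Cz false) + c (Cz true) = k * 2.
Proof.
move: (c (Cz true)) (c (Cz false)) => Z' Z dP zE; rewrite {}zE.
have {dP} -> : a3 = d * 2 - a1 - a2 by rewrite -dP; ring.
case: e => [xE yE|/eqP xE /eqP yE _ _]; last first.
  have -> : a1 = 0 by lia.
  have -> : a2 = 0 by lia.
  by exists (Z + d); ring.
rewrite {}xE; case: sr; move: yE; move: (c _) (c _) (c _) => Y' Y X yE /= y1 y2.
  by exists (Z + d - b1); lia.
by exists (Z + d - a2 - b1); lia.
Qed.

Section Frame.
Variables (k : fieldType) (K : splittingFieldType k).
Variables (gT : finGroupType) (G : {group gT}).
Variables (gal : {morphism G >-> gal_of {:K}}) (L : glattice G).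
Variable T : torus_field gal L.
Variables (H : {group gT}) (L1 : glattice G) (j : {additive L1 -> L}) (pr : {additive L -> L1}).
Hypothesis sHG : H \subset G.
Hypothesis prj : cancel j pr.
Hypothesis j_act : {in H, forall g m, j (lact L1 m g) = lact L (j m) g}.
Hypothesis pr_act : {in H, forall g m, pr (lact L m g) = lact L1 (pr m) g}.

Variables x y z : L1 -> int.
Hypotheses (xD : {morph x : m n / m + n}) (yD : {morph y : m n / m + n}).
Hypothesis (zD : {morph z : m n / m + n}).
Hypothesis xyz_inj : forall m n, x m = x n -> y m = y n -> z m = z n -> m = n.

Section FaceCentred.
Hypothesis par : forall m, exists c, x m + y m + z m = c * 2.
Hypothesis surj : forall p q r, (exists c, p + q + r = c * 2) ->
  exists m, [/\ x m = p, y m = q & z m = r].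
Variables w s1 s2 t : gT -> bool.
Hypothesis xa : {in H, forall g m, x (lact L1 m g) = sg (s1 g) (if w g then y m else x m)}.
Hypothesis ya : {in H, forall g m, y (lact L1 m g) = sg (s2 g) (if w g then x m else y m)}.
Hypothesis za : {in H, forall g m, z (lact L1 m g) = sg (t g) (z m)}.

Let nu (b : frame_index) (m : L1) : int := frame_form (x m) (y m) (z m) b.
Let bact (g : gT) := frame_act (w g) (s1 g) (s2 g) (t g).

Let nuD b : {morph nu b : m n / m + n}.
Proof.
move=> m n; rewrite /nu xD yD zD; have [c1 h1] := par m; have [c2 h2] := par n.
move: (x m) (y m) (z m) (x n) (y n) (z n) h1 h2 => x1 y1 z1 x2 y2 z2.
case: b => [[[a b] c]|[[s|s]|s]]; rewrite /frame_form /sg; try by case: s => _ _; ring.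
by clear; case: a; case: b; case: c; lia.
Qed.

Let nu_act : {in H, forall g b m, nu (bact g b) (lact L1 m g) = nu b m}.
Proof. by move=> g Hg b m; rewrite /nu xa // ya // za //; apply: frame_act_form. Qed.

Let ux_ex : exists m, [/\ x m = 2, y m = 0 & z m = 0]. Proof. by apply: surj; exists 1. Qed.
Let uy_ex : exists m, [/\ x m = 0, y m = 2 & z m = 0]. Proof. by apply: surj; exists 1. Qed.
Let uz_ex : exists m, [/\ x m = 0, y m = 0 & z m = 2]. Proof. by apply: surj; exists 1. Qed.
Let ux := projT1 (cid ux_ex).
Let uy := projT1 (cid uy_ex).
Let uz := projT1 (cid uz_ex).
Let uxP : [/\ x ux = 2, y ux = 0 & z ux = 0]. Proof. exact: projT2 (cid ux_ex). Qed.
Let uyP : [/\ x uy = 0, y uy = 2 & z uy = 0]. Proof. exact: projT2 (cid uy_ex). Qed.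
Let uzP : [/\ x uz = 0, y uz = 0 & z uz = 2]. Proof. exact: projT2 (cid uz_ex). Qed.

Let nu_inj b b' : (forall m, nu b m = nu b' m) -> b = b'.
Proof.
have [x1 x2 x3] := uxP; have [y1 y2 y3] := uyP; have [z1 z2 z3] := uzP.
move=> h; have := h ux; have := h uy; have := h uz; rewrite /nu /frame_form ?x1 ?x2 ?x3 ?y1 ?y2 ?y3 ?z1 ?z2 ?z3.
by case: b b' {h} => [[[[] []] []]|[[[]|[]]|[]]] [[[[] []] []]|[[[]|[]]|[]]].
Qed.

Let bact1 b : bact 1%g b = b.
Proof. by apply: nu_inj => m; have := nu_act (group1 H) b m; rewrite lact1. Qed.

Let lact_surj g m : g \in H -> lact L1 (lact L1 m g^-1%g) g = m.
Proof.
move=> Hg; have Gg := subsetP sHG g Hg.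
by rewrite -lactM ?groupV // mulVg lact1.
Qed.

Let bactM : {in H &, forall g h b, bact (g * h)%g b = bact h (bact g b)}.
Proof.
move=> g h Hg Hh b; apply: nu_inj => m; rewrite -(lact_surj m Hh) -(lact_surj (lact L1 m h^-1%g) Hg).
by rewrite -{1}lactM ?(subsetP sHG) // !nu_act // groupM.
Qed.

(** The vectors of coordinates 2 on the axes lie in the lattice, so l is (p x + q y + r z) / 2 with
    p, q, r its values on them. These have equal parity: the dual of the face-centred lattice is
    body-centred. *)
Let psi (l : L1 -> int) := frame_coef (l ux) (l uy) (l uz).

Let psi0 (l : L1 -> int) : (forall m, l m = 0) -> forall b, psi l b = 0.
Proof. by move=> h [[[a b] c]|[[s|s]|s]]; rewrite /psi !h //=; case: ifP. Qed.

Let double_frame m : m *+ 2 = ux *~ x m + uy *~ y m + uz *~ z m.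
Proof.
have [x1 x2 x3] := uxP; have [y1 y2 y3] := uyP; have [z1 z2 z3] := uzP.
have [_ xz _] := sum_int_additive xD; have [_ yz _] := sum_int_additive yD.
have [_ zz _] := sum_int_additive zD.
by apply: xyz_inj; rewrite mulr2n ?xD ?yD ?zD ?xz ?yz ?zz ?x1 ?x2 ?x3 ?y1 ?y2 ?y3 ?z1 ?z2 ?z3; ring.
Qed.

Let psi_parity (l : L1 -> int) : {morph l : m n / m + n} ->
  exists c c', l ux + l uy = c * 2 /\ l uy + l uz = c' * 2.
Proof.
move=> lD; have [l0 lz _] := sum_int_additive lD.
have [a [a1 a2 a3]] : exists m, [/\ x m = 1, y m = 1 & z m = 0] by apply: surj; exists 1.
have [b [b1 b2 b3]] : exists m, [/\ x m = 0, y m = 1 & z m = 1] by apply: surj; exists 1.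
exists (l a), (l b); split.
  have := congr1 l (double_frame a); rewrite mulr2n a1 a2 a3 !lD !lz; lia.
have := congr1 l (double_frame b); rewrite mulr2n b1 b2 b3 !lD !lz; lia.
Qed.

Let psiP (l : L1 -> int) : {morph l : m n / m + n} -> forall m, l m = \sum_b psi l b * nu b m.
Proof.
move=> lD m; have [c [c' [e1 e2]]] := psi_parity lD; have [d e3] := par m.
have [l0 lz _] := sum_int_additive lD.
apply: (frame_coefP e1 e2 e3).
by have := congr1 l (double_frame m); rewrite mulr2n !lD !lz => h; rewrite -h; ring.
Qed.

Let psi_act : {in H, forall g (l : L1 -> int), {morph l : m n / m + n} -> forall b,
  psi (fun m => l (lact L1 m g)) b = psi l (bact g b)}.
Proof.
move=> g Hg l lD b; have [c [c' [e1 e2]]] := psi_parity lD.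
have [x1 x2 x3] := uxP; have [y1 y2 y3] := uyP; have [z1 z2 z3] := uzP.
have [_ xz _] := sum_int_additive xD; have [_ yz _] := sum_int_additive yD.
have [_ zz _] := sum_int_additive zD; have [_ lz _] := sum_int_additive lD.
have ex : lact L1 ux g = if w g then uy *~ sg (s2 g) 1 else ux *~ sg (s1 g) 1.
  apply: xyz_inj; rewrite ?xa ?ya ?za // ?x1 ?x2 ?x3; case: (w g);
  by rewrite ?xz ?yz ?zz ?x1 ?x2 ?x3 ?y1 ?y2 ?y3 /sg; do ?case: ifP.
have ey : lact L1 uy g = if w g then ux *~ sg (s1 g) 1 else uy *~ sg (s2 g) 1.
  apply: xyz_inj; rewrite ?xa ?ya ?za // ?y1 ?y2 ?y3; case: (w g);
  by rewrite ?xz ?yz ?zz ?x1 ?x2 ?x3 ?y1 ?y2 ?y3 /sg; do ?case: ifP.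
have ez : lact L1 uz g = uz *~ sg (t g) 1.
  apply: xyz_inj; rewrite ?xa ?ya ?za // ?z1 ?z2 ?z3; case: (w g);
  by rewrite ?xz ?yz ?zz ?z1 ?z2 ?z3 /sg; do ?case: ifP.
have {}ex : l (lact L1 ux g) = if w g then sg (s2 g) (l uy) else sg (s1 g) (l ux).
  by rewrite ex /sg; case: (w g); rewrite lz; case: ifP => _; ring.
have {}ey : l (lact L1 uy g) = if w g then sg (s1 g) (l ux) else sg (s2 g) (l uy).
  by rewrite ey /sg; case: (w g); rewrite lz; case: ifP => _; ring.
have {}ez : l (lact L1 uz g) = sg (t g) (l uz) by rewrite ez /sg lz; case: ifP => _; ring.
by rewrite /psi /= ex ey ez; apply: frame_act_coef e1 e2.
Qed.

Let t_char : sign_character H t.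
Proof.
move=> g h Hg Hh; have [z1 z2 z3] := uzP.
have := za (groupM Hg Hh) uz; rewrite lactM ?(subsetP sHG) // !za // z3 /sg.
by case: (t g); case: (t h); case: (t _).
Qed.

Let w_char : sign_character H w.
Proof.
move=> g h Hg Hh; have [x1 x2 x3] := uxP.
have := xa (groupM Hg Hh) ux; rewrite lactM ?(subsetP sHG) // !(xa, ya) // x1 x2 /sg.
by case: (w g); case: (w h); case: (w _); case: (s1 g); case: (s1 h); case: (s2 g); case: (s1 _).
Qed.

Section Signs.
Hypothesis w0 : {in H, forall g, w g = false}.
Hypothesis all_signs : forall a b c, exists2 g, g \in H & [/\ s1 g = a, s2 g = b & t g = c].

Let s1_char : sign_character H s1.
Proof.
move=> g h Hg Hh; have [x1 x2 x3] := uxP.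
have := xa (groupM Hg Hh) ux; rewrite lactM ?(subsetP sHG) // !xa // !w0 ?groupM // x1 /sg.
by case: (s1 g); case: (s1 h); case: (s1 _).
Qed.

Let s2_char : sign_character H s2.
Proof.
move=> g h Hg Hh; have [y1 y2 y3] := uyP.
have := ya (groupM Hg Hh) uy; rewrite lactM ?(subsetP sHG) // !ya // !w0 ?groupM // y2 /sg.
by case: (s2 g); case: (s2 h); case: (s2 _).
Qed.

(** Here [a] and [beta] are the sum of the two functionals x and -x. If S negates x, then f(a) is
    even; either some sign character is trivial on S and the index is even, or S has an element
    negating x alone, and the parity of the lattice makes beta(c) even. If [s1] is trivial on S, the
    index is even. A further trivial character of y and z brings it to 4; otherwise f, invariant
    under the signs of y and z, vanishes at [ux] only if f(a) is even. *)
Theorem fcc_signs_nonrational : ~ torus_rational T.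
Proof.
pose a (b : frame_index) : int := if b is Cx _ then 1 else 0.
have aE (f : frame_index -> int) : \sum_b f b * a b = f (Cx false) + f (Cx true).
  by rewrite sum_frame_index /a; ring.
have aE' (f : frame_index -> int) : \sum_b a b * f b = f (Cx false) + f (Cx true).
  by rewrite -aE; apply: eq_bigr => b _; rewrite mulrC.
have nu0 b : nu b 0 = 0 by have [] := sum_int_additive (nuD b).
have a_inv : {in H, forall g b, a (bact g b) = a b}.
  by move=> g Hg [[[? ?] ?]|[[?|?]|?]]; rewrite /bact /= ?w0.
move=> rat; have : (4 %| \sum_b a b * a b)%Z; last by rewrite aE.
apply: (obstruction sHG prj j_act pr_act bact1 bactM nuD nu_act psiP psi_act psi0
  (d := 4) (a := a) (beta := a)) rat => //.
- by move=> g Hg; exists 0 => b; rewrite nu0 addr0 a_inv.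
- by move=> m; rewrite aE' /nu /= addrN.
move=> S f c sSH fS fk cS; rewrite aE aE'; apply: even_dvd4.
pose ch e1 e2 e3 g := (e1 && s1 g) (+) (e2 && s2 g) (+) (e3 && t g).
have chP e1 e2 e3 : sign_character H (ch e1 e2 e3).
  by apply: sign_characterD; [apply: sign_characterD|]; [case: e1|case: e2|case: e3].
have ch_ex e1 e2 e3 : [|| e1, e2 | e3] -> exists2 g, g \in H & ch e1 e2 e3 g.
  move=> e; have [g Hg [g1 g2 g3]] := all_signs e1 (~~ e1 && e2) [&& ~~ e1, ~~ e2 & e3].
  by exists g; rewrite // /ch g1 g2 g3; case: e1 e2 e3 e {g1 g2 g3} => [] [] [].
have triv (e : gT -> bool) : (exists2 g, g \in S & e g) \/ {in S, forall g, ~~ e g}.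
  have [|h] := pselect (exists2 g, g \in S & e g); [by left|right=> g Sg].
  by apply/negP => eg; apply: h; exists g.
have HS g : g \in S -> g \in H by apply: (subsetP sSH).
have [[g Sg g1]|n1] := triv s1.
  have fx : f (Cx false) = f (Cx true).
    by rewrite -(fS g Sg) /bact /= (w0 (HS g Sg)) g1.
  have ev : exists k, f (Cx false) + f (Cx true) = k * 2 by exists (f (Cx true)); rewrite fx; ring.
  have [[e [en eS]]|all3] := pselect (exists e : bool * bool * bool,
      [|| e.1.1, e.1.2 | e.2] /\ {in S, forall g, ~~ ch e.1.1 e.1.2 e.2 g}).
    by constructor 2; split; [apply: sign_index2 eS => //; apply: ch_ex|left].
  have [|h Sh /and3P[h1 h2 h3]] := sign_span3 sSH s1_char s2_char t_char.
    move=> e1 e2 e3 e; have [//|eS] := triv (ch e1 e2 e3).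
    by case: all3; exists (e1, e2, e3).
  constructor 3; split=> //; have [m mP] := cS h Sh.
  have := mP (Cx false); have := mP (Cy false); have := mP (Cz false).
  rewrite /bact /nu /= (w0 (HS h Sh)) h1 (negbTE h2) (negbTE h3) /sg /= => z0 y0 x0.
  have zm : z m = 0 by apply: (addrI (c (Cz false))); rewrite -z0 addr0.
  have ym : y m = 0 by apply: (addrI (c (Cy false))); rewrite -y0 addr0.
  have [d dP] := par m; rewrite ym zm !addr0 in dP.
  by exists (c (Cx false) + d); rewrite x0 dP; ring.
have i2 : (2 %| #|H : S|%g)%N.
  apply: (sign_index2 sSH s1_char) n1.
  by have [g Hg [g1 _ _]] := all_signs true false false; exists g; rewrite ?g1.
have idx4 e2 e3 : e2 || e3 -> {in S, forall g, ~~ ch false e2 e3 g} -> (4 %| #|H : S|%g)%N.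
  move=> e eS; apply: (sign_index4 sSH s1_char (chP false e2 e3)) n1 eS.
    by have [g Hg [g1 _ _]] := all_signs true false false; exists g; rewrite ?g1.
  have [g Hg [g1 g2 g3]] := all_signs false e2 (~~ e2 && e3).
  by exists g; rewrite // /ch g1 g2 g3; case: e2 e3 e {g1 g2 g3} => [] [].
have [[g2 S2 h2]|n2] := triv (ch false true false); last by constructor 1; apply: idx4 n2.
have [[g3 S3 h3]|n3] := triv (ch false false true); last by constructor 1; apply: idx4 n3.
have [[g4 S4 h4]|n4] := triv (ch false true true); last by constructor 1; apply: idx4 n4.
have ex2 : exists2 g, g \in S & s2 g && ~~ t g.
  by apply: (sign_span2 sSH s2_char t_char t_char); [exists g2|exists g3|exists g4];
    move: h2 h3 h4; rewrite // /ch /= ?addbF.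
have ex3 : exists2 g, g \in S & t g && ~~ s2 g.
  by apply: (sign_span2 sSH t_char s2_char t_char); [exists g3|exists g2|exists g4];
    move: h2 h3 h4; rewrite // /ch /= ?addbF // addbC.
constructor 2; split=> //; left.
have [g Sg /andP[gy /negbTE gz]] := ex2; have [h Sh /andP[hz /negbTE hy]] := ex3.
have := fk ux; rewrite sum_frame_index /nu /frame_form; have [-> -> ->] := uxP.
have fg b e d : f (Half b (~~ e) d) = f (Half b e d).
  by rewrite -(fS g Sg (Half b e d)) /bact /= (w0 (HS g Sg)) gy gz (negbTE (n1 g Sg)).
have fh b e d : f (Half b e (~~ d)) = f (Half b e d).
  by rewrite -(fS h Sh (Half b e d)) /bact /= (w0 (HS h Sh)) hy hz (negbTE (n1 h Sh)).
rewrite (fg false false) (fg true false) (fh false false false) (fh true false false).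
have := fg false false true; have := fg true false true; rewrite /= => -> ->.
rewrite (fh false false false) (fh true false false) /sg /=.
rewrite (_ : (_ %/ 2)%Z = 1) // (_ : (_ %/ 2)%Z = -1) // => e.
exists (f (Cx true) + f (Half true false false) - f (Half false false false)).
move: (f (Cx false)) (f (Cx true)) (f (Cy false)) (f (Cy true)) (f (Cz false)) (f (Cz true)) e.
move: (f (Half true false false)) (f (Half false false false)); clear.
by move=> *; lia.
Qed.

End Signs.

Section FourFold.
Hypothesis w_signs : {in H, forall g, s1 g = s2 g (+) w g}.
Hypothesis four_ex : exists2 g, g \in H & w g && ~~ t g.
Hypothesis flip_ex : exists2 g, g \in H & t g && ~~ w g.

(** The same dichotomy with the pair z, -z. If S negates z, then f(a) is even, and either the index
    is even or S contains both a quarter turn type element fixing z and one negating z without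
    exchanging axes, to which [fourfold_parity] applies. Otherwise the index is even, and either
    divisible by 4 or vanishing of f at [uz] makes f(a) even. *)
Theorem fcc_fourfold_nonrational : ~ torus_rational T.
Proof.
pose a (b : frame_index) : int := if b is Cz _ then 1 else 0.
have aE (f : frame_index -> int) : \sum_b f b * a b = f (Cz false) + f (Cz true).
  by rewrite sum_frame_index /a; ring.
have aE' (f : frame_index -> int) : \sum_b a b * f b = f (Cz false) + f (Cz true).
  by rewrite -aE; apply: eq_bigr => b _; rewrite mulrC.
have nu0 b : nu b 0 = 0 by have [] := sum_int_additive (nuD b).
have a_inv : {in H, forall g b, a (bact g b) = a b}.
  by move=> g Hg [[[? ?] ?]|[[?|?]|?]]; rewrite /bact /=; case: (w g).
move=> rat; have : (4 %| \sum_b a b * a b)%Z; last by rewrite aE.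
apply: (obstruction sHG prj j_act pr_act bact1 bactM nuD nu_act psiP psi_act psi0
  (d := 4) (a := a) (beta := a)) rat => //.
- by move=> g Hg; exists 0 => b; rewrite nu0 addr0 a_inv.
- by move=> m; rewrite aE' /nu /= addrN.
move=> S f c sSH fS fk cS; rewrite aE aE'; apply: even_dvd4.
have triv (e : gT -> bool) : (exists2 g, g \in S & e g) \/ {in S, forall g, ~~ e g}.
  have [|h] := pselect (exists2 g, g \in S & e g); [by left|right=> g Sg].
  by apply/negP => eg; apply: h; exists g.
have HS g : g \in S -> g \in H by apply: (subsetP sSH).
have w_ex : exists2 g, g \in H & w g by have [g Hg /andP[wg _]] := four_ex; exists g.
have t_ex : exists2 g, g \in H & t g by have [g Hg /andP[tg _]] := flip_ex; exists g.
have wt_ex : exists2 g, g \in H & w g (+) t g.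
  by have [g Hg /andP[tg /negbTE wg]] := flip_ex; exists g; rewrite // wg tg.
have wt_char : sign_character H (fun g => w g (+) t g) by apply: sign_characterD.
have [[g3 S3 h3]|n3] := triv t.
  have fz : f (Cz false) = f (Cz true) by rewrite -(fS g3 S3) /bact /= h3.
  have ev : exists k, f (Cz false) + f (Cz true) = k * 2 by exists (f (Cz true)); rewrite fz; ring.
  have [[g1 S1 h1]|n1] := triv w; last first.
    by constructor 2; split; [apply: sign_index2 n1|left].
  have [[g2 S2 h2]|n2] := triv (fun g => w g (+) t g); last first.
    by constructor 2; split; [apply: sign_index2 n2|left].
  have [r Sr /andP[wr /negbTE tr]] : exists2 g, g \in S & w g && ~~ t g.
    by apply: (sign_span2 sSH w_char t_char t_char); [exists g1|exists g3|exists g2].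
  have [n Sn /andP[tn /negbTE wn]] : exists2 g, g \in S & t g && ~~ w g.
    by apply: (sign_span2 sSH t_char w_char t_char); [exists g3|exists g1|exists g2; rewrite // addbC].
  constructor 3; split=> //; have [m mP] := cS n Sn; have [m' mP'] := cS r Sr.
  have z0 := mP (Cz false); have x0 := mP (Cx false); have y0 := mP (Cy false).
  have x1 := mP' (Cx false); have x2 := mP' (Cx true); have [d dP] := par m.
  have w1 := w_signs (HS r Sr); have w2 := w_signs (HS n Sn).
  rewrite wr in w1; rewrite wn addbF in w2.
  move: z0 x0 y0 x1 x2; rewrite /bact /nu /= wr tn wn w2 /sg /= !addbT addbF.
  by rewrite !addbF => h1' h2' h3' h4' h5'; apply: (fourfold_parity dP h1' h2' h3' h4' h5').
have i2 : (2 %| #|H : S|%g)%N by apply: (sign_index2 sSH t_char) n3.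
have [[r Sr wr]|n1] := triv w; last first.
  constructor 1; apply: (sign_index4 sSH t_char w_char) n3 n1 => //.
  by have [g Hg /andP[wg tg]] := four_ex; exists g; rewrite // tg wg.
constructor 2; split=> //; left.
have := fk uz; rewrite sum_frame_index /nu /frame_form; have [-> -> ->] := uzP.
have fr a' b' c' : f (Half (~~ s2 r (+) b') (s2 r (+) a') c') = f (Half a' b' c').
  have w1 := w_signs (HS r Sr); rewrite wr addbT in w1.
  by rewrite -(fS r Sr (Half a' b' c')) /bact /= wr w1 (negbTE (n3 r Sr)).
have fr' c' : f (Half false true c') = f (Half false false c') /\
    f (Half true false c') = f (Half false false c') /\
    f (Half true true c') = f (Half false false c').
  have := fr false false c'; have := fr true false c'; have := fr true true c'.
  by have := fr false true c'; case: (s2 r) => /= E1 E2 E3 E4; do ?apply: conj; congruence.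
have [-> [-> ->]] := fr' false; have [-> [-> ->]] := fr' true; rewrite /sg /=.
rewrite (_ : (_ %/ 2)%Z = 1) // (_ : (_ %/ 2)%Z = -1) // => e.
exists (f (Cz true) + (f (Half false false true) - f (Half false false false))).
move: (f (Cx false)) (f (Cx true)) (f (Cy false)) (f (Cy true)) (f (Cz false)) (f (Cz true)) e.
move: (f (Half false false true)) (f (Half false false false)); clear.
by move=> *; lia.
Qed.

End FourFold.

End FaceCentred.

Section BodyCentred.
Hypothesis par : forall m, exists c d, x m + y m = c * 2 /\ y m + z m = d * 2.
Hypothesis surj : forall p q r, (exists c d, p + q = c * 2 /\ q + r = d * 2) ->
  exists m, [/\ x m = p, y m = q & z m = r].
Variables s1 s2 : gT -> bool.
Hypothesis xa : {in H, forall g m, x (lact L1 m g) = sg (s1 g) (x m)}.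
Hypothesis ya : {in H, forall g m, y (lact L1 m g) = sg (s2 g) (y m)}.
Hypothesis za : {in H, forall g m, z (lact L1 m g) = sg (s1 g (+) s2 g) (z m)}.
Hypothesis all_signs : forall a b, exists2 g, g \in H & s1 g = a /\ s2 g = b.

Let nu (b : frame_index) (m : L1) : int := bframe_form (x m) (y m) (z m) b.
Let bact (g : gT) := bframe_act (s1 g) (s2 g).

Let nuD b : {morph nu b : m n / m + n}.
Proof.
move=> m n; rewrite /nu xD yD zD; have [c1 [d1 [h1 h1']]] := par m.
have [c2 [d2 [h2 h2']]] := par n.
move: (x m) (y m) (z m) (x n) (y n) (z n) h1 h2 h1' h2' => x1 y1 z1 x2 y2 z2.
case: b => [[[a b] c]|[[s|s]|s]]; rewrite /bframe_form /sg; try by case: s => _ _ _ _; ring.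
by clear; case: a; case: b; case: c; lia.
Qed.

Let nu_act : {in H, forall g b m, nu (bact g b) (lact L1 m g) = nu b m}.
Proof. by move=> g Hg b m; rewrite /nu xa // ya // za //; apply: bframe_act_form. Qed.

Let ux_ex : exists m, [/\ x m = 2, y m = 0 & z m = 0].
Proof. by apply: surj; exists 1, 0. Qed.
Let uy_ex : exists m, [/\ x m = 0, y m = 2 & z m = 0].
Proof. by apply: surj; exists 1, 1. Qed.
Let uz_ex : exists m, [/\ x m = 0, y m = 0 & z m = 2].
Proof. by apply: surj; exists 0, 1. Qed.
Let ux := projT1 (cid ux_ex).
Let uy := projT1 (cid uy_ex).
Let uz := projT1 (cid uz_ex).
Let uxP : [/\ x ux = 2, y ux = 0 & z ux = 0]. Proof. exact: projT2 (cid ux_ex). Qed.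
Let uyP : [/\ x uy = 0, y uy = 2 & z uy = 0]. Proof. exact: projT2 (cid uy_ex). Qed.
Let uzP : [/\ x uz = 0, y uz = 0 & z uz = 2]. Proof. exact: projT2 (cid uz_ex). Qed.

Let nu_inj b b' : (forall m, nu b m = nu b' m) -> b = b'.
Proof.
have [x1 x2 x3] := uxP; have [y1 y2 y3] := uyP; have [z1 z2 z3] := uzP.
move=> h; have := h ux; have := h uy; have := h uz.
rewrite /nu /bframe_form ?x1 ?x2 ?x3 ?y1 ?y2 ?y3 ?z1 ?z2 ?z3.
by case: b b' {h} => [[[[] []] []]|[[[]|[]]|[]]] [[[[] []] []]|[[[]|[]]|[]]].
Qed.

Let bact1 b : bact 1%g b = b.
Proof. by apply: nu_inj => m; have := nu_act (group1 H) b m; rewrite lact1. Qed.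

Let lact_surj g m : g \in H -> lact L1 (lact L1 m g^-1%g) g = m.
Proof.
move=> Hg; have Gg := subsetP sHG g Hg.
by rewrite -lactM ?groupV // mulVg lact1.
Qed.

Let bactM : {in H &, forall g h b, bact (g * h)%g b = bact h (bact g b)}.
Proof.
move=> g h Hg Hh b; apply: nu_inj => m; rewrite -(lact_surj m Hh) -(lact_surj (lact L1 m h^-1%g) Hg).
by rewrite -{1}lactM ?(subsetP sHG) // !nu_act // groupM.
Qed.

Let psi (l : L1 -> int) := bframe_coef (l ux) (l uy) (l uz).

Let psi0 (l : L1 -> int) : (forall m, l m = 0) -> forall b, psi l b = 0.
Proof. by move=> h [[[[] b] c]|[[s|s]|s]]; rewrite /psi !h //=; case: ifP. Qed.

Let double_frame m : m *+ 2 = ux *~ x m + uy *~ y m + uz *~ z m.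
Proof.
have [x1 x2 x3] := uxP; have [y1 y2 y3] := uyP; have [z1 z2 z3] := uzP.
have [_ xz _] := sum_int_additive xD; have [_ yz _] := sum_int_additive yD.
have [_ zz _] := sum_int_additive zD.
by apply: xyz_inj; rewrite mulr2n ?xD ?yD ?zD ?xz ?yz ?zz ?x1 ?x2 ?x3 ?y1 ?y2 ?y3 ?z1 ?z2 ?z3; ring.
Qed.

Let psi_parity (l : L1 -> int) : {morph l : m n / m + n} ->
  exists c, l ux + l uy + l uz = c * 2.
Proof.
move=> lD; have [l0 lz _] := sum_int_additive lD.
have [a [a1 a2 a3]] : exists m, [/\ x m = 1, y m = 1 & z m = 1] by apply: surj; exists 1, 1.
by exists (l a); have := congr1 l (double_frame a); rewrite mulr2n a1 a2 a3 !lD !lz; lia.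
Qed.

Let psiP (l : L1 -> int) : {morph l : m n / m + n} -> forall m, l m = \sum_b psi l b * nu b m.
Proof.
move=> lD m; have [c e1] := psi_parity lD; have [d [d' [e2 e3]]] := par m.
have [l0 lz _] := sum_int_additive lD.
apply: (bframe_coefP e1 e2 e3).
by have := congr1 l (double_frame m); rewrite mulr2n !lD !lz => h; rewrite -h; ring.
Qed.

Let psi_act : {in H, forall g (l : L1 -> int), {morph l : m n / m + n} -> forall b,
  psi (fun m => l (lact L1 m g)) b = psi l (bact g b)}.
Proof.
move=> g Hg l lD b; have [c e1] := psi_parity lD.
have [x1 x2 x3] := uxP; have [y1 y2 y3] := uyP; have [z1 z2 z3] := uzP.
have [_ xz _] := sum_int_additive xD; have [_ yz _] := sum_int_additive yD.
have [_ zz _] := sum_int_additive zD; have [_ lz _] := sum_int_additive lD.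
have ex : lact L1 ux g = ux *~ sg (s1 g) 1.
  by apply: xyz_inj; rewrite ?xa ?ya ?za // ?xz ?yz ?zz ?x1 ?x2 ?x3 /sg; do ?case: ifP.
have ey : lact L1 uy g = uy *~ sg (s2 g) 1.
  by apply: xyz_inj; rewrite ?xa ?ya ?za // ?xz ?yz ?zz ?y1 ?y2 ?y3 /sg; do ?case: ifP.
have ez : lact L1 uz g = uz *~ sg (s1 g (+) s2 g) 1.
  by apply: xyz_inj; rewrite ?xa ?ya ?za // ?xz ?yz ?zz ?z1 ?z2 ?z3 /sg; do ?case: ifP.
have {}ex : l (lact L1 ux g) = sg (s1 g) (l ux) by rewrite ex /sg lz; case: ifP => _; ring.
have {}ey : l (lact L1 uy g) = sg (s2 g) (l uy) by rewrite ey /sg lz; case: ifP => _; ring.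
have {}ez : l (lact L1 uz g) = sg (s1 g (+) s2 g) (l uz) by rewrite ez /sg lz; case: ifP => _; ring.
by rewrite /psi /= ex ey ez; apply: bframe_act_coef e1.
Qed.

Let s1_char : sign_character H s1.
Proof.
move=> g h Hg Hh; have [x1 x2 x3] := uxP.
have := xa (groupM Hg Hh) ux; rewrite lactM ?(subsetP sHG) // !xa // x1 /sg.
by case: (s1 g); case: (s1 h); case: (s1 _).
Qed.

Let s2_char : sign_character H s2.
Proof.
move=> g h Hg Hh; have [y1 y2 y3] := uyP.
have := ya (groupM Hg Hh) uy; rewrite lactM ?(subsetP sHG) // !ya // y2 /sg.
by case: (s2 g); case: (s2 h); case: (s2 _).
Qed.

(** Unlike [beta], the vector [a] is invariant only modulo L1: an element negating x changes it by
    the image of [ux]. An element of S that negates y but not x makes f(a) even, one that negates x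
    makes beta(c) even by the parity of the lattice, and each missing sign character makes the index
    even. *)
Theorem bcc_rotations_nonrational : ~ torus_rational T.
Proof.
pose a (b : frame_index) : int :=
  match b with Half false false _ => -1 | Cx true => 2 | _ => 0 end.
pose be (b : frame_index) : int := if b is Cx _ then 1 else 0.
have aE (f : frame_index -> int) : \sum_b f b * a b =
    f (Cx true) * 2 - f (Half false false false) - f (Half false false true).
  by rewrite sum_frame_index /a; ring.
have bE (f : frame_index -> int) : \sum_b be b * f b = f (Cx false) + f (Cx true).
  by rewrite sum_frame_index /be; ring.
have nu0 b : nu b 0 = 0 by have [] := sum_int_additive (nuD b).
have nuz b m (e : int) : nu b (m *~ e) = nu b m * e by have [] := sum_int_additive (nuD b).
move=> rat; have : (4 %| \sum_b be b * a b)%Z; last by rewrite aE.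
apply: (obstruction sHG prj j_act pr_act bact1 bactM nuD nu_act psiP psi_act psi0
  (d := 4) (a := a) (beta := be)) rat => //.
- move=> g Hg; exists (ux *~ (s1 g)%:R) => b; rewrite nuz /nu /bact; have [-> -> ->] := uxP.
  by case: b => [[[[] []] []]|[[[]|[]]|[]]]; case: (s1 g); case: (s2 g).
- by move=> g Hg [[[[] []] []]|[[[]|[]]|[]]].
- by move=> m; rewrite bE /nu /= addrN.
move=> S f c sSH fS fk cS; rewrite aE bE; apply: even_dvd4.
have triv (e : gT -> bool) : (exists2 g, g \in S & e g) \/ {in S, forall g, ~~ e g}.
  have [|h] := pselect (exists2 g, g \in S & e g); [by left|right=> g Sg].
  by apply/negP => eg; apply: h; exists g.
have s12_char : sign_character H (fun g => s1 g (+) s2 g) by apply: sign_characterD.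
have s1_ex : exists2 g, g \in H & s1 g.
  by have [g Hg [h _]] := all_signs true false; exists g; rewrite ?h.
have s2_ex : exists2 g, g \in H & s2 g.
  by have [g Hg [_ h]] := all_signs false true; exists g; rewrite ?h.
have s12_ex : exists2 g, g \in H & s1 g (+) s2 g.
  by have [g Hg [h h']] := all_signs true false; exists g; rewrite ?h ?h'.
have ev_f g : g \in S -> ~~ s1 g && s2 g ->
    exists k, f (Cx true) * 2 - f (Half false false false) - f (Half false false true) = k * 2.
  move=> Sg /andP[/negbTE h1 h2]; exists (f (Cx true) - f (Half false false false)).
  by have := fS g Sg (Half false false false); rewrite /bact /= h1 h2 /= => ->; ring.
have ev_c g : g \in S -> s1 g -> exists k, c (Cx false) + c (Cx true) = k * 2.
  move=> Sg h1; have [m mP] := cS g Sg; have [d [d' [e e']]] := par m.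
  have := mP (Cx false); rewrite /bact /nu /= h1 /= => ->.
  have [q ->] : exists q, x m = q * 2.
    case h2: (s2 g).
      have := mP (Cz false); rewrite /bact /nu /= h1 h2 /= => /eqP.
      rewrite eq_sym -subr_eq0 addrC addKr => /eqP zm; rewrite zm addr0 in e'.
      by exists (d - d'); rewrite mulrBl -e -e' addrK.
    have := mP (Cy false); rewrite /bact /nu /= h2 /= => /eqP.
    rewrite eq_sym -subr_eq0 addrC addKr => /eqP ym; rewrite ym addr0 in e.
    by exists d.
  by exists (c (Cx false) + q); ring.
have [[g1 S1 h1]|n1] := triv s1; last first.
  have i2 : (2 %| #|H : S|%g)%N by apply: (sign_index2 sSH s1_char) n1.
  have [[g2 S2 h2]|n2] := triv s2; last first.
    constructor 1; apply: (sign_index4 sSH s1_char s2_char) n1 n2 => //.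
    by have [g Hg [h h']] := all_signs false true; exists g; rewrite ?h ?h'.
  by constructor 2; split=> //; left; apply: (ev_f g2) => //; rewrite n1.
have ec := ev_c g1 S1 h1.
have [[g2 S2 h2]|n2] := triv s2; last first.
  by constructor 2; split; [apply: (sign_index2 sSH s2_char) n2|right].
have [[g3 S3 h3]|n3] := triv (fun g => s1 g (+) s2 g); last first.
  by constructor 2; split; [apply: (sign_index2 sSH s12_char) n3|right].
have [g Sg] : exists2 g, g \in S & s2 g && ~~ s1 g.
  by apply: (sign_span2 sSH s2_char s1_char s1_char); [exists g2|exists g1|exists g3; rewrite // addbC].
by rewrite andbC => h; constructor 3; split=> //; apply: (ev_f g).
Qed.

End BodyCentred.
End Frame.

(** * Signed permutations *)

Notation vec3 := (int * int * int)%type.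

(* A signed permutation: the permutation is numbered 0..5 and applied first. *)
Notation sperm := (nat * (bool * bool * bool))%type.

Definition permute3 (A : Type) (p : nat) (v : A * A * A) : A * A * A :=
  let: (x, y, z) := v in
  match p with
  | 0 => (x, y, z) | 1 => (y, x, z) | 2 => (x, z, y) | 3 => (z, y, x) | 4 => (y, z, x)
  | _ => (z, x, y)
  end.

Definition perm3_comp (p q : nat) : nat :=
  match permute3 q (permute3 p (0, 1, 2))%N with
  | (0, 1, _) => 0 | (1, 0, _) => 1 | (0, _, _) => 2 | (2, 1, _) => 3 | (1, _, _) => 4
  | _ => 5
  end%N.

Definition sperm_act (c : sperm) (v : vec3) : vec3 :=
  let: (a, b, d) := c.2 in let: (x, y, z) := permute3 c.1 v in (sg a x, sg b y, sg d z).

Definition sperm_mul (c e : sperm) : sperm :=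
  let: (a, b, d) := permute3 e.1 c.2 in let: (a', b', d') := e.2 in
  (perm3_comp c.1 e.1, (a (+) a', b (+) b', d (+) d')).

Lemma sgM a b n : sg b (sg a n) = sg (a (+) b) n.
Proof. by case: a; case: b; rewrite //= opprK. Qed.

Lemma sperm_actM c e v : (c.1 < 6)%N -> (e.1 < 6)%N ->
  sperm_act (sperm_mul c e) v = sperm_act e (sperm_act c v).
Proof.
case: c => p [[a b] d]; case: e => q [[a' b'] d']; case: v => [[x y] z] /=.
by case: p => [|[|[|[|[|[|//]]]]]] _; case: q => [|[|[|[|[|[|//]]]]]] _;
  rewrite /sperm_act /= !sgM.
Qed.

(** These tests and those below are written with [if], so that evaluation by value stops at the
    first failure; they run inside exhaustive searches. *)
Definition beqb (a b : bool) := if a then b else ~~ b.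
Definition sperm_eq (c e : sperm) : bool :=
  let: (p, (a, b, d)) := c in let: (q, (a', b', d')) := e in
  if Nat.eqb p q then if beqb a a' then if beqb b b' then beqb d d' else false else false else false.

Lemma sperm_eqP c e : reflect (c = e) (sperm_eq c e).
Proof.
have h : sperm_eq c e = (c == e).
  case: c => p [[a b] d]; case: e => q [[a' b'] d']; rewrite /sperm_eq !xpair_eqE.
  have -> : Nat.eqb p q = (p == q) by elim: p q => [|p IH] [|q] //=; rewrite IH eqSS.
  by case: (p == q) => //; case: a; case: a'; case: b; case: b'; case: d; case: d'.
by rewrite h; apply: eqP.
Qed.

Fixpoint sperm_mem (c : sperm) (s : seq sperm) : bool :=
  if s is e :: s' then (if sperm_eq c e then true else sperm_mem c s') else false.

Lemma sperm_memE c s : sperm_mem c s = (c \in s).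
Proof.
elim: s => //= e s IH; rewrite inE -IH.
by case: sperm_eqP => [->|/eqP/negbTE->] //; rewrite eqxx.
Qed.

Definition sperm_add (s l : seq sperm) : seq sperm :=
  foldr (fun c s' => if sperm_mem c s' then s' else c :: s') s l.

Lemma mem_sperm_add s l c : (c \in sperm_add s l) = (c \in s) || (c \in l).
Proof.
elim: l => [|e l IH] /=; first by rewrite orbF.
rewrite sperm_memE; case: ifP => h; rewrite ?inE IH; last by rewrite orbCA.
by have [ce|//] := eqVneq c e; rewrite /= orbT -IH ce h.
Qed.

Fixpoint sperm_closure (n : nat) (gens s : seq sperm) : seq sperm :=
  if n is n'.+1 then
    let s' := sperm_add s [seq sperm_mul c e | c <- s, e <- gens] in
    if Nat.eqb (size s') (size s) then s else sperm_closure n' gens s'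
  else s.

Arguments sperm_closure : simpl never.

Section SubgroupSearch.
Variables bad good : seq (seq sperm).

(* Branches on the membership of each element; [inn] is generated by [gens]. *)
Fixpoint subgroup_search (und gens inn out : seq sperm) : bool :=
  if has (fun b => all (sperm_mem^~ inn) b) bad then true else
  if und is c :: und' then
    if sperm_mem c inn then subgroup_search und' gens inn out else
    let inn' := sperm_closure 8 (c :: gens) (sperm_add inn [:: c]) in
    (if has (sperm_mem^~ out) inn' then true else subgroup_search und' (c :: gens) inn' out)
    && subgroup_search und' gens inn (c :: out)
  else has (fun e => all (sperm_mem^~ e) inn) good.

Variable Q : sperm -> Prop.
Hypothesis QM : forall c e, Q c -> Q e -> Q (sperm_mul c e).

Let closure_sub n gens s : (forall c, c \in gens -> Q c) -> (forall c, c \in s -> Q c) ->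
  (forall c, c \in sperm_closure n gens s -> Q c) /\ {subset s <= sperm_closure n gens s}.
Proof.
move=> gQ; elim: n s => [|n IH] s sQ; rewrite /sperm_closure -/sperm_closure; first by split.
case: (Nat.eqb _ _); first by split.
have [|h h'] := IH (sperm_add s [seq sperm_mul c e | c <- s, e <- gens]).
  move=> c; rewrite mem_sperm_add => /orP[/sQ //|/allpairsP[[a b] /= [/sQ qa /gQ qb ->]]].
  exact: QM.
by split=> // c cs; apply: h'; rewrite mem_sperm_add cs.
Qed.

(** The invariant is that Q contains [inn], avoids [out], and lies in the union of [inn] and [und].
    When [und] is empty Q is contained in [inn]. Soundness rests only on the closure staying inside
    Q, whatever its number of rounds. *)
Lemma subgroup_searchP und gens inn out : subgroup_search und gens inn out ->
  (forall c, c \in gens -> Q c) -> (forall c, c \in inn -> Q c) ->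
  (forall c, c \in out -> ~ Q c) -> (forall c, Q c -> c \in inn \/ c \in und) ->
  (exists2 b, b \in bad & forall c, c \in b -> Q c) \/
  (exists2 e, e \in good & forall c, Q c -> c \in e).
Proof.
elim: und gens inn out => [|c und IH] gens inn out /=; case: ifP => [/hasP[b bb /allP h] _ gQ iQ _ _|_].
- by left; exists b => // c /h; rewrite sperm_memE => /iQ.
- move=> /hasP[e eg /allP h] _ iQ _ uQ; right; exists e => // c /uQ[/h|//].
  by rewrite sperm_memE.
- by left; exists b => // e /h; rewrite sperm_memE => /iQ.
case: ifP => [|_]; first rewrite sperm_memE => ci /IH h gQ iQ oQ uQ; last first.
  move=> /andP[h1 h2] gQ iQ oQ uQ; have [qc|nq] := pselect (Q c); last first.
    apply: IH h2 gQ iQ _ _ => e; first by rewrite inE => /predU1P[->|/oQ].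
    move=> qe; case: (uQ e qe) => [|]; first by left.
    by rewrite inE => /predU1P[ec|]; [rewrite ec in qe|right].
  have gQ' e : e \in c :: gens -> Q e by rewrite inE => /predU1P[->|/gQ].
  have [|cQ cs] := closure_sub 8 gQ' (s := sperm_add inn [:: c]).
    by move=> e; rewrite mem_sperm_add inE => /orP[/iQ|/eqP->].
  move: h1; case: ifP => [/hasP[e /cQ qe]|_ h1]; first by rewrite sperm_memE => /oQ.
  apply: IH h1 gQ' cQ oQ _ => e /uQ[ei|].
    by left; apply: cs; rewrite mem_sperm_add ei.
  rewrite inE => /predU1P[->|]; last by right.
  by left; apply: cs; rewrite mem_sperm_add mem_seq1 eqxx orbT.
by apply: h => // e /uQ[|]; [left|rewrite inE => /predU1P[->|]; [left|right]].
Qed.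

End SubgroupSearch.

Definition bools : seq (bool * bool * bool) :=
  [seq (ab, c) | ab <- [seq (a, b) | a <- [:: false; true], b <- [:: false; true]], c <- [:: false; true]].

Definition sperms (l : seq nat) : seq sperm := [seq (p, s) | p <- l, s <- bools].
Definition all_sperms := sperms (iota 0 6).

Lemma mem_bools s : s \in bools. Proof. by case: s => [[[] []] []]. Qed.
Lemma mem_sperms l c : (c \in sperms l) = (c.1 \in l).
Proof.
case: c => p s; apply/allpairsP/idP => [[[q s'] /= [ql _ [-> _]]] //|pl].
by exists (p, s); rewrite mem_bools.
Qed.

(* The stabilizer of (2, 4, 6) among signed permutations is trivial. *)
Definition sperm_decode (v : vec3) : sperm :=
  let: (x, y, z) := v in
  (match absz x, absz y with 2, 4 => 0 | 4, 2 => 1 | 2, _ => 2 | 6, 4 => 3 | 4, _ => 4 | _, _ => 5 end%N,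
   (x < 0, y < 0, z < 0)).

Lemma sperm_decodeK c : (c.1 < 6)%N -> sperm_decode (sperm_act c (2, 4, 6)) = c.
Proof.
by case: c => p [[a b] d] /=; case: p => [|[|[|[|[|[|//]]]]]] _; case: a; case: b; case: d.
Qed.

Lemma sperm_mul_lt6 c e : (c.1 < 6)%N -> (e.1 < 6)%N -> ((sperm_mul c e).1 < 6)%N.
Proof.
case: c => p [[a b] d]; case: e => q [[a' b'] d'] /=.
by case: p => [|[|[|[|[|[|//]]]]]] _; case: q => [|[|[|[|[|[|//]]]]]] _.
Qed.

Section TetragonalGroups.
Definition fourfold_list : seq sperm := [seq c <- sperms [:: 0; 1]%N |
  let: (p, (a, b, _)) := c in beqb a (b (+) Nat.eqb p 1)].
Definition signs_list : seq sperm := sperms [:: 0%N].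
(* Half-turns about z and x + y, x - y. *)
Definition rotations_list : seq sperm :=
  [:: (0%N, (false, false, false)); (0%N, (true, true, false)); (1%N, (false, false, true));
      (1%N, (true, true, true))].
(** By [tetragonal_search] these eleven groups are enough to cover the subgroups of the tetragonal
    group of order 16 that contain none of the three bad ones; the bits are the exchange of x and y
    and the three signs. *)
Definition tetragonal_good : seq (seq sperm) := map (map (fun c : bool * bool * bool * bool =>
    let: (w, a, b, d) := c in (nat_of_bool w, (a, b, d))))
  (let o := false in let i := true in
  [:: [:: (o,o,o,o); (o,o,i,i); (o,i,o,o); (o,i,i,i)];
      [:: (o,o,o,o); (o,o,i,o); (o,i,o,i); (o,i,i,i)];
      [:: (o,o,o,o); (o,i,i,i); (i,o,o,i); (i,i,i,o)];
      [:: (o,o,o,o); (o,o,o,i); (o,i,i,o); (o,i,i,i)];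
      [:: (o,o,o,o); (o,i,i,i); (i,o,o,o); (i,i,i,i)];
      [:: (o,o,o,o); (o,o,o,i); (i,o,o,o); (i,o,o,i)];
      [:: (o,o,o,o); (o,o,o,i); (o,o,i,o); (o,o,i,i)];
      [:: (o,o,o,o); (o,o,o,i); (o,i,o,o); (o,i,o,i)];
      [:: (o,o,o,o); (o,o,o,i); (i,i,i,o); (i,i,i,i)];
      [:: (o,o,o,o); (o,o,i,o); (o,i,o,o); (o,i,i,o); (i,o,o,o); (i,o,i,o); (i,i,o,o); (i,i,i,o)];
      [:: (o,o,o,o); (o,o,i,i); (o,i,o,i); (o,i,i,o); (i,o,o,o); (i,o,i,i); (i,i,o,i); (i,i,i,o)]]).

Lemma tetragonal_search : subgroup_search [:: signs_list; fourfold_list; rotations_list]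
  tetragonal_good (sperms [:: 0; 1]%N) [::] [:: (0%N, (false, false, false))] [::].
Proof. by vm_compute. Qed.

Definition cyc : sperm := (4%N, (false, false, false)).
(** In crystallographic notation: D3d is the stabiliser of the line through (1, 1, 1), Td the
    symmetry group of a regular tetrahedron inscribed in the cube, and D2 the half-turns about the
    coordinate axes. *)
Definition D3d_list : seq sperm := [seq c <- all_sperms | let: (_, (a, b, d)) := c in beqb a b && beqb b d].
Definition Td_list : seq sperm := [seq c <- all_sperms | let: (_, (a, b, d)) := c in ~~ (a (+) b (+) d)].
Definition D2_list : seq sperm := [seq c <- sperms [:: 0%N] | let: (_, (a, b, d)) := c in ~~ (a (+) b (+) d)].

Lemma trigonal_fcc_search : subgroup_search [:: signs_list; rotations_list] [:: Td_list; D3d_list]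
  all_sperms [:: cyc] [:: (0%N, (false, false, false)); cyc; sperm_mul cyc cyc] [::].
Proof. by vm_compute. Qed.

Lemma trigonal_bcc_search : subgroup_search [:: D2_list] [:: D3d_list]
  all_sperms [:: cyc] [:: (0%N, (false, false, false)); cyc; sperm_mul cyc cyc] [::].
Proof. by vm_compute. Qed.

End TetragonalGroups.

Definition fcc (v : vec3) := exists c, v.1.1 + v.1.2 + v.2 = c * 2.
Definition bcc (v : vec3) := exists c d, v.1.1 + v.1.2 = c * 2 /\ v.1.2 + v.2 = d * 2.

Definition det3 (u v w : vec3) : int :=
  u.1.1 * (v.1.2 * w.2 - v.2 * w.1.2) - u.1.2 * (v.1.1 * w.2 - v.2 * w.1.1)
  + u.2 * (v.1.1 * w.1.2 - v.1.2 * w.1.1).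

Lemma vec3_eq (u v : vec3) : u.1.1 = v.1.1 -> u.1.2 = v.1.2 -> u.2 = v.2 -> u = v.
Proof. by case: u => [[a b] c]; case: v => [[a' b'] c'] /= -> -> ->. Qed.

Lemma vec3Mz (u : vec3) (n : int) : u *~ n = (u.1.1 * n, u.1.2 * n, u.2 * n).
Proof.
have h (m : nat) : u *+ m = (u.1.1 * m%:Z, u.1.2 * m%:Z, u.2 * m%:Z).
  elim: m => [|m IH]; first by rewrite mulr0n !mulr0.
  by rewrite mulrS IH -add1n PoszD; apply: vec3_eq => /=; ring.
case: n => m; first exact: h.
by rewrite NegzE mulrNz -pmulrn h; apply: vec3_eq => /=; ring.
Qed.

Lemma det3_even u v w : fcc u -> fcc v -> fcc w -> exists c, det3 u v w = c * 2.
Proof.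
case: u => [[a b] c]; case: v => [[a' b'] c']; case: w => [[a'' b''] c''].
move=> [p /= e] [q /= e'] [r /= e''].
exists (p * (a' * b'' - b' * a'') - q * (a * b'' - b * a'') + r * (a * b' - b * a')).
have -> : c = p * 2 - a - b by rewrite -e; ring.
have -> : c' = q * 2 - a' - b' by rewrite -e'; ring.
have -> : c'' = r * 2 - a'' - b'' by rewrite -e''; ring.
rewrite /det3 /=; ring.
Qed.

(** Cramer: determinants of vectors of the face-centred lattice are even, so a determinant 2 or -2
    already makes all quotients integral. *)
Lemma fcc_span (u1 u2 u3 v : vec3) (e : bool) : fcc u1 -> fcc u2 -> fcc u3 ->
  det3 u1 u2 u3 = sg e 2 -> fcc v ->
  exists c1 c2 c3 : int, v = u1 *~ c1 + u2 *~ c2 + u3 *~ c3.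
Proof.
move=> f1 f2 f3 d fv.
have [c1 e1] := det3_even fv f2 f3; have [c2 e2] := det3_even f1 fv f3.
have [c3 e3] := det3_even f1 f2 fv.
exists (sg e c1), (sg e c2), (sg e c3); rewrite !vec3Mz.
have cr (x : vec3 -> int) : x u1 * det3 v u2 u3 + x u2 * det3 u1 v u3 + x u3 * det3 u1 u2 v =
    x v * det3 u1 u2 u3 -> x v = x u1 * sg e c1 + x u2 * sg e c2 + x u3 * sg e c3.
  by rewrite e1 e2 e3 d /sg; move: (x v) (x u1) (x u2) (x u3); case: e {d} => *; lia.
by apply: vec3_eq => /=; [apply: (cr (fun v => v.1.1))|apply: (cr (fun v => v.1.2))|apply: (cr snd)];
  rewrite /det3; ring.
Qed.

Lemma sperm_actD c (u v : vec3) : sperm_act c (u + v) = sperm_act c u + sperm_act c v.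
Proof.
case: c => p [[a b] d]; case: u => [[x y] z]; case: v => [[x' y'] z'].
by case: p => [|[|[|[|[|p]]]]]; apply: vec3_eq; rewrite /= /sg; case: ifP => _; rewrite ?opprD.
Qed.

Definition sperm1 : sperm := (0%N, (false, false, false)).
Definition sperm_inv (c : sperm) : sperm :=
  let q := (match c.1 with 4 => 5 | 5 => 4 | p => p end)%N in (q, permute3 q c.2).

Lemma sperm_invK c : (c.1 < 6)%N -> sperm_mul c (sperm_inv c) = sperm1.
Proof.
by case: c => p [[a b] d] /=; case: p => [|[|[|[|[|[|//]]]]]] _; rewrite /sperm_mul /= !addbb.
Qed.
Lemma sperm_invKl c : (c.1 < 6)%N -> sperm_mul (sperm_inv c) c = sperm1.
Proof.
by case: c => p [[a b] d] /=; case: p => [|[|[|[|[|[|//]]]]]] _; rewrite /sperm_mul /= !addbb.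
Qed.
Lemma sperm_inv_lt6 c : (c.1 < 6)%N -> ((sperm_inv c).1 < 6)%N.
Proof. by case: c => p s; case: p => [|[|[|[|[|[|//]]]]]]. Qed.
Lemma sperm_act1 v : sperm_act sperm1 v = v. Proof. by case: v => [[x y] z]. Qed.

(** * Lattices on which G acts by signed permutations of a frame *)

Section Frames.
Variables (k : fieldType) (K : splittingFieldType k).
Variables (gT : finGroupType) (G : {group gT}).
Variables (gal : {morphism G >-> gal_of {:K}}).
Hypothesis isoG : isom G 'Gal({:K} / 1) gal.

(* Good: K(L)^G is rational. Bad: K(L + L')^G is not, for any L'. *)
Definition good_lattice (L : glattice G) := forall T : torus_field gal L, torus_rational T.
Definition bad_lattice (L1 : glattice G) := forall (L : glattice G) (T : torus_field gal L)
  (j : {additive L1 -> L}) (pr : {additive L -> L1}), cancel j pr ->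
  {in G, forall g m, j (lact L1 m g) = lact L (j m) g} ->
  {in G, forall g m, pr (lact L m g) = lact L1 (pr m) g} -> ~ torus_rational T.

Variable L : glattice G.
Hypothesis rkL : rank L = 3.

Record frame (lat : vec3 -> Prop) (F : L -> vec3) : Prop := {
  frD : {morph F : m n / m + n};
  fr_inj : injective F;
  fr_lat : forall m, lat (F m);
  fr_surj : forall v, lat v -> exists m, F m = v;
  fr_act : {in G, forall g, exists2 c, (c.1 < 6)%N & forall m, F (lact L m g) = sperm_act c (F m)}
}.

Section Theory.
Variables (lat : vec3 -> Prop) (F : L -> vec3).
Hypothesis FP : frame lat F.
Hypothesis lat246 : lat (2, 4, 6).

Lemma fr0 : F 0 = 0. Proof. by apply: (addrI (F 0)); rewrite -(frD FP) !addr0. Qed.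
Lemma frN m : F (- m) = - F m.
Proof. by apply/eqP; rewrite -addr_eq0 -(frD FP) addNr fr0. Qed.
Lemma frMz m (n : int) : F (m *~ n) = F m *~ n.
Proof.
have h (l : nat) : F (m *+ l) = F m *+ l.
  by elim: l => [|l IH]; rewrite ?mulr0n ?fr0 // !mulrS (frD FP) IH.
by case: n => l; rewrite ?NegzE ?mulrNz ?frN -?pmulrn h.
Qed.
Lemma fr_zcomb n (w : 'I_n -> L) c : F (zcomb w c) = \sum_i F (w i) *~ c i.
Proof.
rewrite /zcomb (big_morph F (frD FP) fr0); apply: eq_bigr => i _; exact: frMz.
Qed.

Definition fr_code (g : gT) : sperm :=
  sperm_decode (F (lact L (projT1 (cid (fr_surj FP lat246))) g)).

Lemma fr_codeP : {in G, forall g, (fr_code g).1 < 6 /\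
  forall m, F (lact L m g) = sperm_act (fr_code g) (F m)}%N.
Proof.
move=> g Gg; have [c c6 cE] := fr_act FP Gg; rewrite /fr_code; case: cid => m0 /= m0E.
by rewrite cE m0E sperm_decodeK.
Qed.

Lemma fr_codeE g c : g \in G -> (c.1 < 6)%N -> (forall m, F (lact L m g) = sperm_act c (F m)) ->
  fr_code g = c.
Proof.
by move=> Gg c6 cE; rewrite /fr_code; case: cid => m0 /= m0E; rewrite cE m0E sperm_decodeK.
Qed.

Lemma fr_codeM : {in G &, forall g h, fr_code (g * h)%g = sperm_mul (fr_code g) (fr_code h)}.
Proof.
move=> g h Gg Gh; have [g6 gE] := fr_codeP Gg; have [h6 hE] := fr_codeP Gh.
apply: fr_codeE => [||m]; [exact: groupM|exact: sperm_mul_lt6|].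
by rewrite lactM // hE gE sperm_actM.
Qed.

Definition occurs (c : sperm) := exists2 g, g \in G & fr_code g = c.

Lemma occursM c e : occurs c -> occurs e -> occurs (sperm_mul c e).
Proof. by move=> [g Gg <-] [h Gh <-]; exists (g * h)%g; rewrite ?groupM // fr_codeM. Qed.

Lemma occurs1 : occurs sperm1.
Proof.
exists 1%g => //; apply: fr_codeE => // m; first by rewrite lact1 sperm_act1.
Qed.

Lemma occurs_lt6 c : occurs c -> (c.1 < 6)%N.
Proof. by move=> [g Gg <-]; case: (fr_codeP Gg). Qed.

Let frV v : lat v -> {m | F m = v}. Proof. by move=> lv; apply: cid; apply: (fr_surj FP). Qed.

Lemma fr_spans n (w : 'I_n -> L) :
  (forall v, lat v -> exists c : 'I_n -> int, v = \sum_i F (w i) *~ c i) -> spans w.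
Proof.
move=> h x; have [c cE] := h _ (fr_lat FP x); exists [ffun i => c i]; apply: (fr_inj FP).
by rewrite fr_zcomb cE; apply: eq_bigr => i _; rewrite ffunE.
Qed.

Variable span3 : vec3 -> vec3 -> vec3 -> Prop.
Hypothesis span3P : forall u1 u2 u3, span3 u1 u2 u3 -> [/\ lat u1, lat u2 & lat u3] /\
  forall v, lat v -> exists c1 c2 c3 : int, v = u1 *~ c1 + u2 *~ c2 + u3 *~ c3.

Let pick u1 u2 u3 (i : 'I_3) : vec3 := match i : nat with 0 => u1 | 1 => u2 | _ => u3 end%N.

Let pick_spans u1 u2 u3 (w : 'I_3 -> L) : span3 u1 u2 u3 ->
  (forall i, F (w i) = pick u1 u2 u3 i) -> spans w.
Proof.
move=> /span3P[_ h] wE; apply: fr_spans => v /h[c1 [c2 [c3 ->]]].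
exists (fun i : 'I_3 => match i : nat with 0 => c1 | 1 => c2 | _ => c3 end%N).
by rewrite !big_ord_recl big_ord0 !wE addr0 addrA.
Qed.

Let pick_ex u1 u2 u3 : span3 u1 u2 u3 -> exists w : 'I_3 -> L, forall i, F (w i) = pick u1 u2 u3 i.
Proof.
move=> /span3P[[l1 l2 l3] _]; have [w1 e1] := frV l1; have [w2 e2] := frV l2.
have [w3 e3] := frV l3.
by exists (fun i : 'I_3 => match i : nat with 0 => w1 | 1 => w2 | _ => w3 end%N) => -[[|[|[|//]]] hi].
Qed.

Variable s : seq sperm.
Hypothesis occurs_s : forall c, occurs c -> c \in s.

Definition signed_check (u1 u2 u3 : vec3) := all (fun c => all (fun u =>
  (sperm_act c u \in [:: u1; u2; u3]) || (- sperm_act c u \in [:: u1; u2; u3])) [:: u1; u2; u3]) s.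

Lemma good_signed u1 u2 u3 : span3 u1 u2 u3 -> signed_check u1 u2 u3 -> good_lattice L.
Proof.
move=> sp /allP ch T; have [w wE] := pick_ex sp.
apply: (@rational_signed _ _ _ _ _ _ T isoG 3 w); first by rewrite rkL.
  exact: pick_spans sp wE.
move=> g Gg i; have [c6 cE] := fr_codeP Gg.
have mem v : v \in [:: u1; u2; u3] -> exists j, F (w j) = v.
  rewrite !inE => /or3P[] /eqP->; [exists 0|exists 1|exists 2]; exact: wE.
have iin : F (w i) \in [:: u1; u2; u3].
  by rewrite wE; case: i => -[|[|[|//]]] hi; rewrite /pick !inE eqxx ?orbT.
have /ch/allP/(_ _ iin)/orP[/mem[j e]|/mem[j e]] : fr_code g \in s by apply: occurs_s; exists g.
  by exists j; left; apply: (fr_inj FP); rewrite e cE.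
by exists j; right; apply: (fr_inj FP); rewrite frN e cE opprK.
Qed.

Definition small_ints : seq int := [:: 0; 1; -1; 2; -2; 3; -3; 4; -4].
Definition signed_fixed_check (u1 u2 u3 : vec3) := all (fun c => all (fun u =>
  (sperm_act c u \in [:: u1; u2]) || (- sperm_act c u \in [:: u1; u2])) [:: u1; u2]
  && has (fun a => has (fun b => sperm_act c u3 == u3 + u1 *~ a + u2 *~ b) small_ints) small_ints) s.

Lemma good_signed_fixed u1 u2 u3 : span3 u3 u1 u2 -> signed_fixed_check u1 u2 u3 -> good_lattice L.
Proof.
move=> sp /allP ch T; have [w0 w0E] := pick_ex sp.
pose e (i : 'I_2) := w0 (lift ord0 i); pose e' := w0 ord0.
pose w (i : 'I_3) := if unlift ord_max i is Some j then e j else e'.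
have wl i : w (lift ord_max i) = e i by rewrite /w liftK.
have wm : w ord_max = e' by rewrite /w unlift_none.
have Fe (i : 'I_2) : F (e i) = if i == 0 then u1 else u2.
  by rewrite /e w0E; case: i => -[|[|//]] hi.
have Fe' : F e' = u3 by rewrite /e' w0E.
apply: (@rational_signed_fixed _ _ _ _ _ _ T isoG 2 e e' w) => //; first by rewrite rkL.
- apply: fr_spans => v /(proj2 (span3P sp))[c1 [c2 [c3 ->]]].
  exists (fun i : 'I_3 => match i : nat with 0 => c2 | 1 => c3 | _ => c1 end%N).
  rewrite big_ord_recr /= !big_ord_recl big_ord0 addr0.
  have -> : widen_ord (leqnSn 2) ord0 = lift ord_max 0 by apply: val_inj.
  have -> : widen_ord (leqnSn 2) (lift ord0 ord0) = lift ord_max 1 by apply: val_inj.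
  by rewrite !wl wm !Fe Fe' /= addrC addrA addrC addrA.
- move=> g Gg i; have [c6 cE] := fr_codeP Gg.
  have mem v : v \in [:: u1; u2] -> exists j, F (e j) = v.
    by rewrite !inE => /orP[] /eqP->; [exists 0|exists 1]; rewrite Fe.
  have iin : F (e i) \in [:: u1; u2] by rewrite Fe; case: ifP; rewrite !inE eqxx ?orbT.
  have /ch/andP[/allP/(_ _ iin)/orP[/mem[j ej]|/mem[j ej]] _] : fr_code g \in s
    by apply: occurs_s; exists g.
    by exists j; left; apply: (fr_inj FP); rewrite ej cE.
  by exists j; right; apply: (fr_inj FP); rewrite frN ej cE opprK.
move=> g Gg; have [c6 cE] := fr_codeP Gg.
have /ch/andP[_ /hasP[a _ /hasP[b _ /eqP ab]]] : fr_code g \in s by apply: occurs_s; exists g.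
exists [ffun i : 'I_2 => if i == 0 then a else b]; apply: (fr_inj FP).
by rewrite cE Fe' ab (frD FP) Fe' fr_zcomb !big_ord_recl big_ord0 addr0 !ffunE !Fe addrA.
Qed.

Definition simplex_check (u1 u2 u3 : vec3) := all (fun c =>
  has (fun u0 => all (fun u => sperm_act c u + u0 \in [:: 0; u1; u2; u3]) [:: 0; u1; u2; u3])
    [:: 0; u1; u2; u3]) s && uniq [:: 0; u1; u2; u3].

Lemma good_simplex u1 u2 u3 : span3 u1 u2 u3 -> simplex_check u1 u2 u3 -> good_lattice L.
Proof.
move=> sp /andP[/allP ch un] T; have [w wE] := pick_ex sp.
pose D (i : 'I_4) := if unlift ord0 i is Some j then w j else 0.
have D0 : D ord0 = 0 by rewrite /D unlift_none.
have Dl i : D (lift ord0 i) = w i by rewrite /D liftK.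
have FD i : F (D i) = nth 0 [:: 0; u1; u2; u3] i.
  case: (unliftP ord0 i) => [j ->|->]; last by rewrite D0 fr0.
  by rewrite Dl wE; case: j => -[|[|[|//]]] hj.
have Dmem i : F (D i) \in [:: 0; u1; u2; u3] by rewrite FD mem_nth.
have memD v : v \in [:: 0; u1; u2; u3] -> exists i, F (D i) = v.
  move=> vin; have hi : (index v [:: 0%R; u1; u2; u3] < 4)%N by rewrite index_mem.
  by exists (Ordinal hi); rewrite FD nth_index.
have Dinj : injective D.
  move=> i i' e; have := congr1 F e; rewrite !FD => /eqP; rewrite nth_uniq // => /eqP; exact: val_inj.
apply: (@rational_simplex _ _ _ _ _ _ T isoG 3 D) => //; first by rewrite rkL.
  apply: (pick_spans sp) => i; rewrite Dl; exact: wE.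
move=> g Gg; have [c6 cE] := fr_codeP Gg.
have /ch/hasP[u0 u0in /allP uP] : fr_code g \in s by apply: occurs_s; exists g.
have [i0 i0E] := memD _ u0in.
have [f fP] := choice (fun i => memD _ (uP _ (Dmem i))).
have fE i : D (f i) = lact L (D i) g + D i0.
  by apply: (fr_inj FP); rewrite fP (frD FP) cE i0E.
have finj : injective f.
  move=> i i' e; apply: Dinj.
  have [inj _] : is_action G (lact L) by case: (lact L).
  apply: (inj g); apply: (addIr (D i0)).
  by rewrite -!fE e.
exists (perm finj) => i; rewrite !permE !fE D0.
have -> : lact L 0 g = 0 by have := raddf0 (lact_add L Gg).
by rewrite add0r addrK.
Qed.

End Theory.
End Frames.

Lemma fcc246 : fcc (2, 4, 6). Proof. by exists 6. Qed.
Lemma bcc246 : bcc (2, 4, 6). Proof. by exists 3, 5. Qed.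

Definition fcc_basis (u1 u2 u3 : vec3) : bool :=
  all (fun u : vec3 => ~~ odd (absz (u.1.1 + u.1.2 + u.2))) [:: u1; u2; u3]
  && (absz (det3 u1 u2 u3) == 2%N).

Lemma fcc_basisP u1 u2 u3 : fcc_basis u1 u2 u3 -> [/\ fcc u1, fcc u2 & fcc u3] /\
  forall v, fcc v -> exists c1 c2 c3 : int, v = u1 *~ c1 + u2 *~ c2 + u3 *~ c3.
Proof.
move=> /andP[/allP h /eqP d].
have fE u : u \in [:: u1; u2; u3] -> fcc u.
  by move=> /h o; exists ((u.1.1 + u.1.2 + u.2) %/ 2)%Z; move: o; move: (_ + _) => n; lia.
have [f1 [f2 f3]] : fcc u1 /\ fcc u2 /\ fcc u3.
  by split; [|split]; apply: fE; rewrite !inE eqxx ?orbT.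
split=> // v; apply: (fcc_span (e := det3 u1 u2 u3 < 0)) => //.
by move: d; rewrite /sg; case: ifP; lia.
Qed.

Definition bcc_basis (u1 u2 u3 : vec3) : Prop :=
  [/\ u1 = (-1, 1, 1), u2 = (1, -1, 1) & u3 = (1, 1, -1)].

Lemma bcc_basisP u1 u2 u3 : bcc_basis u1 u2 u3 -> [/\ bcc u1, bcc u2 & bcc u3] /\
  forall v, bcc v -> exists c1 c2 c3 : int, v = u1 *~ c1 + u2 *~ c2 + u3 *~ c3.
Proof.
move=> [-> -> ->]; split; first by split; [exists 0, 1|exists 0, 0|exists 1, 0].
move=> [[x y] z] [c [d [/= e1 e2]]]; exists d, (c + d - y), c; rewrite !vec3Mz.
by apply: vec3_eq => /=; lia.
Qed.

Lemma fcc_act h v : fcc v -> fcc (sperm_act h v).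
Proof.
case: h => p [[a b] d]; case: v => [[x y] z] [c /= e].
have h (u v w : int) : u + v + w = c * 2 -> fcc (sg a u, sg b v, sg d w).
  move=> e'; exists (c - (if a then u else 0) - (if b then v else 0) - (if d then w else 0)).
  by rewrite /sg /=; case: a; case: b; case: d; lia.
by case: p => [|[|[|[|[|p]]]]]; apply: h; rewrite -e; ring.
Qed.

Lemma bcc_act h v : bcc v -> bcc (sperm_act h v).
Proof.
case: h => p [[a b] d]; case: v => [[x y] z] [c [c' [/= e e']]].
have h (u v w f f' : int) : u + v = f * 2 -> v + w = f' * 2 -> bcc (sg a u, sg b v, sg d w).
  move=> e1 e2; exists (f - (if a then u else 0) - (if b then v else 0)),
    (f' - (if b then v else 0) - (if d then w else 0)).
  by rewrite /sg /=; case: a; case: b; case: d; lia.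
case: p => [|[|[|[|[|p]]]]].
- exact: (h _ _ _ c c').
- by apply: (h _ _ _ c (c + c' - y)); lia.
- by apply: (h _ _ _ (c + c' - y) c'); lia.
- by apply: (h _ _ _ c' c); lia.
- by apply: (h _ _ _ c' (c + c' - y)); lia.
by apply: (h _ _ _ (c + c' - y) c); lia.
Qed.

Lemma sperm_mul1 c e : (sperm_mul c e).1 = perm3_comp c.1 e.1.
Proof. by case: c => p [[? ?] ?]; case: e => q [[? ?] ?]; case: q => [|[|[|[|[|?]]]]]. Qed.

(** * Good or bad: face-centred and body-centred frames *)

Section Dichotomy.
Variables (k : fieldType) (K : splittingFieldType k).
Variables (gT : finGroupType) (G : {group gT}).
Variables (gal : {morphism G >-> gal_of {:K}}).
Hypothesis isoG : isom G 'Gal({:K} / 1) gal.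
Variable L : glattice G.
Hypothesis rkL : rank L = 3.

Section SubFrame.
Variables (lat : vec3 -> Prop) (F : L -> vec3).
Hypotheses (FP : frame lat F) (lat246 : lat (2, 4, 6)).
Local Notation code := (fr_code FP lat246).
Variable s : seq sperm.
Hypotheses (s1 : sperm1 \in s) (sM : all (fun c => all (fun e => sperm_mul c e \in s) s) s).

Lemma coded_group_set : group_set [set g in G | code g \in s].
Proof.
apply/group_setP; split=> [|g h].
  rewrite inE group1 /=; have -> // : code 1%g = sperm1.
  by apply: fr_codeE => // m; rewrite lact1 sperm_act1.
rewrite !inE => /andP[Gg gs] /andP[Gh hs].
by rewrite groupM // fr_codeM //; move/allP: sM => /(_ _ gs)/allP/(_ _ hs).
Qed.

Definition coded_group := group coded_group_set.

Lemma coded_sub : coded_group \subset G.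
Proof. by apply/subsetP => g; rewrite inE => /andP[]. Qed.

Lemma coded_groupP : {in coded_group, forall g, [/\ g \in G, code g \in s &
  forall m, F (lact L m g) = sperm_act (code g) (F m)]}.
Proof.
by move=> g; rewrite inE => /andP[Gg gs]; have [_ h] := fr_codeP FP lat246 Gg.
Qed.

Lemma coded_occurs c : c \in s -> occurs FP lat246 c -> exists2 g, g \in coded_group & code g = c.
Proof. by move=> cs [g Gg gE]; exists g; rewrite // inE Gg gE. Qed.

End SubFrame.

Section Coordinates.
Variables (lat : vec3 -> Prop) (F : L -> vec3).
Hypothesis FP : frame lat F.

Lemma fr_coordD : [/\ {morph (fun m => (F m).1.1) : m n / m + n},
  {morph (fun m => (F m).1.2) : m n / m + n} & {morph (fun m => (F m).2) : m n / m + n}].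
Proof. by split=> m n; rewrite (frD FP). Qed.

Lemma fr_coord_inj m n : (F m).1.1 = (F n).1.1 -> (F m).1.2 = (F n).1.2 -> (F m).2 = (F n).2 -> m = n.
Proof. by move=> h1 h2 h3; apply: (fr_inj FP); apply: vec3_eq. Qed.

End Coordinates.

Section FaceCentredFrame.
Variables (F : L -> vec3).
Hypothesis FP : frame fcc F.
Local Notation occ := (occurs FP fcc246).
Local Notation code := (fr_code FP fcc246).

Let surj (p q r : int) : (exists c, p + q + r = c * 2) ->
  exists m, [/\ (F m).1.1 = p, (F m).1.2 = q & (F m).2 = r].
Proof. by move=> h; have [m mE] := fr_surj FP (v := (p, q, r)) h; exists m; rewrite mE. Qed.

Lemma fcc_signs_bad : (forall c, c \in signs_list -> occ c) -> bad_lattice gal L.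
Proof.
move=> so L0 T j pr jK jG prG.
have s1 : sperm1 \in signs_list by [].
have sM : all (fun c => all (fun e => sperm_mul c e \in signs_list) signs_list) signs_list by [].
pose H := coded_group FP fcc246 s1 sM; have HP := @coded_groupP _ _ FP fcc246 _ s1 sM.
have [xD yD zD] := fr_coordD FP.
have codeE g : g \in H -> code g = (0%N, ((code g).2.1.1, (code g).2.1.2, (code g).2.2)).
  by move=> /HP[_ + _]; rewrite mem_sperms; case: (code g) => p [[a b] d]; rewrite inE => /eqP/= ->.
apply: (@fcc_signs_nonrational _ _ _ _ _ _ T H L j pr (coded_sub _ _ _ _) jK _ _ _ _ _ xD yD zD
  (@fr_coord_inj _ _ FP) (fr_lat FP) surj (fun=> false) (fun g => (code g).2.1.1)
  (fun g => (code g).2.1.2) (fun g => (code g).2.2)).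
- by move=> g /HP[Gg _ _]; apply: jG.
- by move=> g /HP[Gg _ _]; apply: prG.
- by move=> g Hg m; have [_ _ ->] := HP g Hg; rewrite {1}(codeE g Hg); case: (F m) => [[x y] z].
- by move=> g Hg m; have [_ _ ->] := HP g Hg; rewrite {1}(codeE g Hg); case: (F m) => [[x y] z].
- by move=> g Hg m; have [_ _ ->] := HP g Hg; rewrite {1}(codeE g Hg); case: (F m) => [[x y] z].
- by [].
move=> a b d; have cs : (0%N, (a, b, d)) \in signs_list by rewrite mem_sperms.
by have [g Hg gE] := coded_occurs s1 sM cs (so _ cs); exists g; rewrite // gE.
Qed.

Lemma fcc_fourfold_bad : (forall c, c \in fourfold_list -> occ c) -> bad_lattice gal L.
Proof.
move=> so L0 T j pr jK jG prG.
have s1 : sperm1 \in fourfold_list by [].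
have sM : all (fun c => all (fun e => sperm_mul c e \in fourfold_list) fourfold_list) fourfold_list.
  by vm_compute.
pose H := coded_group FP fcc246 s1 sM; have HP := @coded_groupP _ _ FP fcc246 _ s1 sM.
have [xD yD zD] := fr_coordD FP.
have code01 g : g \in H -> (code g).1 = 0%N \/ (code g).1 = 1%N.
  by move=> /HP[_ + _]; rewrite mem_filter mem_sperms !inE => /andP[_ /orP[/eqP|/eqP]]; [left|right].
apply: (@fcc_fourfold_nonrational _ _ _ _ _ _ T H L j pr (coded_sub _ _ _ _) jK _ _ _ _ _ xD yD zD
  (@fr_coord_inj _ _ FP) (fr_lat FP) surj (fun g => Nat.eqb (code g).1 1) (fun g => (code g).2.1.1)
  (fun g => (code g).2.1.2) (fun g => (code g).2.2)).
- by move=> g /HP[Gg _ _]; apply: jG.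
- by move=> g /HP[Gg _ _]; apply: prG.
- move=> g Hg m; have [_ _ ->] := HP g Hg; case: (code g) (code01 g Hg) => p [[a b] d] /=.
  by case: (F m) => [[x y] z] [->|->].
- move=> g Hg m; have [_ _ ->] := HP g Hg; case: (code g) (code01 g Hg) => p [[a b] d] /=.
  by case: (F m) => [[x y] z] [->|->].
- move=> g Hg m; have [_ _ ->] := HP g Hg; case: (code g) (code01 g Hg) => p [[a b] d] /=.
  by case: (F m) => [[x y] z] [->|->].
- move=> g Hg; have [_ + _] := HP g Hg; rewrite mem_filter => /andP[+ _].
  by case: (code g) => p [[a b] d] /=; case: a; case: b; case: (Nat.eqb p 1).
- have cs : (1%N, (true, false, false)) \in fourfold_list by [].
  by have [g Hg gE] := coded_occurs s1 sM cs (so _ cs); exists g; rewrite // gE.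
have cs : (0%N, (false, false, true)) \in fourfold_list by [].
by have [g Hg gE] := coded_occurs s1 sM cs (so _ cs); exists g; rewrite // gE.
Qed.

(** In the coordinates x + y, x - y, z the face-centred lattice is body-centred, and the half-turns
    about z, x + y and x - y become diagonal sign changes. *)
Lemma fcc_rotations_bad : (forall c, c \in rotations_list -> occ c) -> bad_lattice gal L.
Proof.
move=> so L0 T j pr jK jG prG.
have s1 : sperm1 \in rotations_list by [].
have sM : all (fun c => all (fun e => sperm_mul c e \in rotations_list) rotations_list) rotations_list.
  by vm_compute.
pose H := coded_group FP fcc246 s1 sM; have HP := @coded_groupP _ _ FP fcc246 _ s1 sM.
have [xD yD zD] := fr_coordD FP.
have codes g : g \in H -> exists a w, code g = (nat_of_bool w, (a, a, w)).
  move=> /HP[_ + _]; rewrite !inE => /or4P[] /eqP->; [exists false, false|exists true, false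
    |exists false, true|exists true, true]; by [].
apply: (@bcc_rotations_nonrational _ _ _ _ _ _ T H L j pr (coded_sub _ _ _ _) jK _ _
  (fun m => (F m).1.1 + (F m).1.2) (fun m => (F m).1.1 - (F m).1.2) (fun m => (F m).2) _ _ zD _ _ _
  (fun g => (code g).2.1.1) (fun g => (code g).2.1.1 (+) (code g).2.2)).
- by move=> g /HP[Gg _ _]; apply: jG.
- by move=> g /HP[Gg _ _]; apply: prG.
- by move=> m n; rewrite (frD FP) /=; ring.
- by move=> m n; rewrite (frD FP) /=; ring.
- by move=> m n e1 e2 e3; apply: (fr_coord_inj FP) => //; lia.
- move=> m; have [c e] := fr_lat FP m; exists (F m).1.1, (c - (F m).1.2); lia.
- move=> p q r [c [d [e1 e2]]]; have [|m [m1 m2 m3]] := surj (p := c) (q := c - q) (r := r).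
    by exists (c + d - q); lia.
  by exists m; rewrite m1 m2 m3; split; lia.
- move=> g Hg m; have [_ _ ->] := HP g Hg; have [a [w ->]] := codes g Hg.
  by case: (F m) => [[x y] z]; case: w; case: a => /=; ring.
- move=> g Hg m; have [_ _ ->] := HP g Hg; have [a [w ->]] := codes g Hg.
  by case: (F m) => [[x y] z]; case: w; case: a => /=; ring.
- move=> g Hg m; have [_ _ ->] := HP g Hg; have [a [w ->]] := codes g Hg.
  by case: (F m) => [[x y] z]; case: w; case: a.
move=> a b; have cs : (nat_of_bool (a (+) b), (a, a, a (+) b)) \in rotations_list by case: a; case: b.
by have [g Hg gE] := coded_occurs s1 sM cs (so _ cs); exists g => //;
  rewrite gE; clear; case: a; case: b.
Qed.

Let good_by (s : seq sperm) := (forall c, occ c -> c \in s) -> good_lattice gal L.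
Let fixed_good s u1 u2 u3 : fcc_basis u3 u1 u2 -> signed_fixed_check s u1 u2 u3 -> good_by s.
Proof. by move=> b c o; apply: (good_signed_fixed isoG rkL (FP := FP) (lat246 := fcc246) fcc_basisP o b c). Qed.
Let signed_good s u1 u2 u3 : fcc_basis u1 u2 u3 -> signed_check s u1 u2 u3 -> good_by s.
Proof. by move=> b c o; apply: (good_signed isoG rkL (FP := FP) (lat246 := fcc246) fcc_basisP o b c). Qed.
Let simplex_good s u1 u2 u3 : fcc_basis u1 u2 u3 -> simplex_check s u1 u2 u3 -> good_by s.
Proof. by move=> b c o; apply: (good_simplex isoG rkL (FP := FP) (lat246 := fcc246) fcc_basisP o b c). Qed.

Lemma fcc_tetragonal : (forall c, occ c -> c \in sperms [:: 0; 1]%N) ->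
  good_lattice gal L \/ bad_lattice gal L.
Proof.
move=> tet; have [|||||[b + bo]|[e + eo]] := subgroup_searchP (Q := occ) _ tetragonal_search.
- by move=> c e; apply: occursM.
- by [].
- by move=> c; rewrite inE => /eqP->; apply: occurs1.
- by [].
- by move=> c /tet; right.
- rewrite !inE => /or3P[] /eqP bE; rewrite bE in bo; right.
  + exact: fcc_signs_bad.
  + exact: fcc_fourfold_bad.
  exact: fcc_rotations_bad.
move=> eg; left; suff gd : foldr (fun s P => good_by s /\ P) True tetragonal_good.
  elim: tetragonal_good gd eg => //= s l IH [gs /IH{IH}IH]; rewrite inE => /orP[/eqP es|//].
  by apply: gs; rewrite -es.
(* Bases in the order of [tetragonal_good]: five signed bases, five signed planes with a vector
   fixed modulo the plane, and one simplex. *)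
split; first by apply: (@signed_good _ (-1, -2, -1) (-1, 2, 1) (0, -1, -1)).
split; first by apply: (@signed_good _ (-2, -1, -1) (-2, 1, -1) (-1, 0, -1)).
split; first by apply: (@signed_good _ (-2, 1, -1) (-2, 2, -2) (-1, 2, -1)).
split; first by apply: (@signed_good _ (-2, -1, -1) (-2, -1, 1) (-1, -1, 0)).
split; first by apply: (@signed_good _ (-2, -2, -2) (-2, -1, -1) (-1, -2, -1)).
split; first by apply: (@fixed_good _ (-1, 1, 0) (0, 0, -2) (-2, 1, -1)).
split; first by apply: (@fixed_good _ (0, -1, -1) (0, -1, 1) (-1, -2, -1)).
split; first by apply: (@fixed_good _ (-1, 0, -1) (-1, 0, 1) (-2, -1, -1)).
split; first by apply: (@fixed_good _ (-1, -1, 0) (0, 0, -2) (-2, -1, -1)).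
split; first by apply: (@fixed_good _ (-1, -1, 0) (-1, 1, 0) (-2, -1, -1)).
split; first by apply: (@simplex_good _ (-1, -1, 0) (-1, 0, -1) (0, -1, -1)).
by [].
Qed.

Lemma fcc_trigonal : occ cyc -> good_lattice gal L \/ bad_lattice gal L.
Proof.
move=> oc; have [|||||[b + bo]|[e + eo]] := subgroup_searchP (Q := occ) _ trigonal_fcc_search.
- by move=> c e; apply: occursM.
- by move=> c; rewrite inE => /eqP->.
- by move=> c; rewrite !inE => /or3P[] /eqP-> //; [apply: occurs1|apply: occursM].
- by [].
- by move=> c oc'; right; rewrite mem_sperms mem_iota; apply: (occurs_lt6 oc').
- rewrite !inE => /orP[] /eqP bE; rewrite bE in bo; right.
  + exact: fcc_signs_bad.
  exact: fcc_rotations_bad.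
rewrite !inE => /orP[] /eqP eE; rewrite eE in eo; left; move: eo.
- by apply: (@simplex_good _ (-1, -1, 0) (-1, 0, -1) (0, -1, -1)).
by apply: (@signed_good _ (0, 1, 1) (1, 0, 1) (1, 1, 0)).
Qed.

End FaceCentredFrame.

Section BodyCentredFrame.
Variables (F : L -> vec3).
Hypothesis FP : frame bcc F.
Local Notation occ := (occurs FP bcc246).
Local Notation code := (fr_code FP bcc246).

Lemma bcc_rotations_bad : (forall c, c \in D2_list -> occ c) -> bad_lattice gal L.
Proof.
move=> so L0 T j pr jK jG prG.
have s1 : sperm1 \in D2_list by [].
have sM : all (fun c => all (fun e => sperm_mul c e \in D2_list) D2_list) D2_list by vm_compute.
pose H := coded_group FP bcc246 s1 sM; have HP := @coded_groupP _ _ FP bcc246 _ s1 sM.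
have [xD yD zD] := fr_coordD FP.
have codes g : g \in H -> exists a b, code g = (0%N, (a, b, a (+) b)).
  move=> /HP[_ + _]; rewrite mem_filter mem_sperms.
  case: (code g) => p [[a b] d]; rewrite inE => /andP[h /eqP/= ->]; exists a, b.
  by move: h; case: a; case: b; case: d.
apply: (@bcc_rotations_nonrational _ _ _ _ _ _ T H L j pr (coded_sub _ _ _ _) jK _ _ _ _ _ xD yD zD
  (@fr_coord_inj _ _ FP) (fr_lat FP) _ (fun g => (code g).2.1.1) (fun g => (code g).2.1.2)).
- by move=> g /HP[Gg _ _]; apply: jG.
- by move=> g /HP[Gg _ _]; apply: prG.
- by move=> p q r h; have [m mE] := fr_surj FP (v := (p, q, r)) h; exists m; rewrite mE.
- move=> g Hg m; have [_ _ ->] := HP g Hg; have [a [b ->]] := codes g Hg.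
  by case: (F m) => [[x y] z].
- move=> g Hg m; have [_ _ ->] := HP g Hg; have [a [b ->]] := codes g Hg.
  by case: (F m) => [[x y] z].
- move=> g Hg m; have [_ _ ->] := HP g Hg; have [a [b ->]] := codes g Hg.
  by case: (F m) => [[x y] z].
move=> a b; have cs : (0%N, (a, b, a (+) b)) \in D2_list by case: a; case: b.
by have [g Hg gE] := coded_occurs s1 sM cs (so _ cs); exists g; rewrite // gE.
Qed.

Lemma bcc_trigonal : occ cyc -> good_lattice gal L \/ bad_lattice gal L.
Proof.
move=> oc; have [|||||[b + bo]|[e + eo]] := subgroup_searchP (Q := occ) _ trigonal_bcc_search.
- by move=> c e; apply: occursM.
- by move=> c; rewrite inE => /eqP->.
- by move=> c; rewrite !inE => /or3P[] /eqP-> //; [apply: occurs1|apply: occursM].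
- by [].
- by move=> c oc'; right; rewrite mem_sperms mem_iota; apply: (occurs_lt6 oc').
- by rewrite !inE => /eqP bE; rewrite bE in bo; right; apply: bcc_rotations_bad.
rewrite !inE => /eqP eE; rewrite eE in eo; left.
by apply: (good_signed isoG rkL (FP := FP) (lat246 := bcc246) bcc_basisP eo (u1 := (-1, 1, 1)) (u2 := (1, -1, 1))
  (u3 := (1, 1, -1))).
Qed.

(* In the basis x + y, x - y of the plane the body-centred tetragonal lattice is face-centred. *)
Lemma bcc_tetragonal : (forall c, occ c -> c \in sperms [:: 0; 1]%N) ->
  good_lattice gal L \/ bad_lattice gal L.
Proof.
move=> tet; pose F' m : vec3 :=
  ((((F m).1.1 + (F m).1.2) %/ 2)%Z, (((F m).1.1 - (F m).1.2) %/ 2)%Z, (F m).2).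
have F'E m : F' m = ((F' m).1.1, (F m).1.1 - (F' m).1.1, (F m).2) /\
    (F m).1.1 + (F m).1.2 = (F' m).1.1 * 2.
  have [c [d [e1 e2]]] := fr_lat FP m; rewrite /F' /= e1 mulzK //; split=> //.
  by apply: vec3_eq => //=; lia.
(* In X = (x + y) / 2 and Y = (x - y) / 2, equal signs on x and y act by that sign, different signs
   exchange X and Y, and a preceding exchange of x and y negates Y. *)
pose tw (c : sperm) : sperm := let: (p, (a, b, d)) := c in
  (nat_of_bool (a (+) b), (if Nat.eqb p 1 && (a (+) b) then ~~ a else a,
    if Nat.eqb p 1 && ~~ (a (+) b) then ~~ a else a, d)).
have twE : {in G, forall g m, F' (lact L m g) = sperm_act (tw (code g)) (F' m)}.
  move=> g Gg m; have [_ cE] := fr_codeP FP bcc246 Gg.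
  have := tet (code g); rewrite mem_sperms => /(_ (ex_intro2 _ _ g Gg erefl)).
  have [-> e] := F'E m; have [-> e'] := F'E (lact L m g); move: e e'; rewrite !cE.
  move: (F' _).1.1 (F' m).1.1 => X X'; case: (F m) => [[x y] z].
  case: (code g) => p [[a b] d]; rewrite !inE => /= e e' /orP[] /eqP pE; move: e'; rewrite pE /= /sg;
    case: a; case: b => /= e'; apply: vec3_eq => //=; lia.
have F'P : frame fcc F'.
  split.
  - move=> m n; have [-> e1] := F'E (m + n); have [-> e2] := F'E m; have [-> e3] := F'E n.
    by move: e1 e2 e3; rewrite (frD FP) /= => e1 e2 e3; apply: vec3_eq => /=; lia.
  - move=> m n e; have [e1 e2] := F'E m; have [e3 e4] := F'E n; apply: (fr_inj FP).
    by move: (congr1 (fun v => v.1.2) e1) (congr1 (fun v => v.1.2) e3) (congr1 snd e1) (congr1 snd e3);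
      move: e2 e4; rewrite -e /= => *; apply: vec3_eq; lia.
  - move=> m; have [c [d [e1 e2]]] := fr_lat FP m; have [-> e] := F'E m.
    by exists (d + (F m).1.1 - (F' m).1.1) => /=; lia.
  - move=> [[x y] z] [c /= e]; have [|m mE] := fr_surj FP (v := (x + y, x - y, z)).
      by exists x, (c - y) => /=; lia.
    exists m; have [-> e'] := F'E m; move: e'; rewrite mE /= => e'.
    by apply: vec3_eq => /=; lia.
  move=> g Gg; exists (tw (code g)); last by move=> m; apply: twE.
  by case: (code g) => p [[a b] d] /=; case: (_ (+) _).
apply: (fcc_tetragonal (FP := F'P)) => c [g Gg <-].
have -> : fr_code F'P fcc246 g = tw (code g).
  apply: fr_codeE => //; last exact: twE.
  by case: (code g) => p [[a b] d] /=; case: (_ (+) _).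
by rewrite mem_sperms; case: (code g) => p [[a b] d] /=; case: (_ (+) _).
Qed.

End BodyCentredFrame.

Section Conjugation.
Variables (lat : vec3 -> Prop) (F : L -> vec3).
Hypotheses (FP : frame lat F) (lat246 : lat (2, 4, 6)).
Hypothesis lat_act : forall h v, lat v -> lat (sperm_act h v).

Lemma frame_conj h : (h.1 < 6)%N -> exists FP' : frame lat (fun m => sperm_act h (F m)),
  forall c, occurs FP' lat246 c <->
    exists2 e, occurs FP lat246 e & c = sperm_mul (sperm_mul (sperm_inv h) e) h.
Proof.
move=> h6; have hi6 := sperm_inv_lt6 h6.
have hK : cancel (sperm_act h) (sperm_act (sperm_inv h)).
  by move=> v; rewrite -sperm_actM // sperm_invK // sperm_act1.
have hKl : cancel (sperm_act (sperm_inv h)) (sperm_act h).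
  by move=> v; rewrite -sperm_actM // sperm_invKl // sperm_act1.
have actE : {in G, forall g c, (c.1 < 6)%N -> (forall m, F (lact L m g) = sperm_act c (F m)) ->
    forall m, sperm_act h (F (lact L m g)) =
      sperm_act (sperm_mul (sperm_mul (sperm_inv h) c) h) (sperm_act h (F m))}.
  move=> g Gg c c6 cE m; rewrite !sperm_actM ?sperm_mul_lt6 // hK cE //.
have FP' : frame lat (fun m => sperm_act h (F m)).
  split.
  - by move=> m n; rewrite (frD FP) sperm_actD.
  - by move=> m n /(can_inj hK)/(fr_inj FP).
  - by move=> m; apply/lat_act/(fr_lat FP).
  - move=> v lv; have [m mE] := fr_surj FP (lat_act (sperm_inv h) lv); exists m.
    by rewrite mE hKl.
  move=> g Gg; have [c c6 cE] := fr_act FP Gg.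
  by exists (sperm_mul (sperm_mul (sperm_inv h) c) h); rewrite ?sperm_mul_lt6 //; apply: actE.
exists FP' => c; have codeE g : g \in G -> fr_code FP' lat246 g =
    sperm_mul (sperm_mul (sperm_inv h) (fr_code FP lat246 g)) h.
  move=> Gg; have [g6 gE] := fr_codeP FP lat246 Gg.
  by apply: fr_codeE; rewrite ?sperm_mul_lt6 //; apply: actE.
split=> [[g Gg <-]|[_ [g Gg <-] ->]]; last by exists g; rewrite ?codeE.
by exists (fr_code FP lat246 g); [exists g|rewrite codeE].
Qed.

Hypothesis trig : forall (F' : L -> vec3) (FP' : frame lat F'), occurs FP' lat246 cyc ->
  good_lattice gal L \/ bad_lattice gal L.
Hypothesis tetr : forall (F' : L -> vec3) (FP' : frame lat F'),
  (forall c, occurs FP' lat246 c -> c \in sperms [:: 0; 1]%N) ->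
  good_lattice gal L \/ bad_lattice gal L.

Lemma frame_good_or_bad : good_lattice gal L \/ bad_lattice gal L.
Proof.
have [[c [oc c45]]|no_cyc] := pselect (exists c, occurs FP lat246 c /\ c.1 \in [:: 4; 5]%N).
  (* The cube of a signed 3-cycle is 1 or -1, so its fourth power is the 3-cycle up to sign and has
     order 3; it is then conjugate to [cyc]. *)
  pose c4 := sperm_mul (sperm_mul c c) (sperm_mul c c).
  have oc4 : occurs FP lat246 c4 by do 2!apply: occursM.
  have /hasP[h hs /eqP hE] : has (fun h => sperm_mul (sperm_mul (sperm_inv h) c4) h == cyc) all_sperms.
    have : all (fun c => has (fun h => sperm_mul (sperm_mul (sperm_inv h)
      (sperm_mul (sperm_mul c c) (sperm_mul c c))) h == cyc) all_sperms) (sperms [:: 4; 5]%N).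
      by vm_compute.
    by move/allP; apply; rewrite mem_sperms.
  have h6 : (h.1 < 6)%N by move: hs; rewrite mem_sperms mem_iota.
  have [FP' occE] := frame_conj h6; apply: (trig (FP' := FP')).
  by apply/occE; exists c4.
(* In the absence of 3-cycles only one transposition p can occur, since two different ones multiply
   to a 3-cycle; h conjugates it to the exchange of x and y. *)
have tet p h : h \in all_sperms -> (exists c, occurs FP lat246 c /\ c.1 = p) ->
    all (fun q => (q \in [:: 0; p]%N) || (perm3_comp p q \in [:: 4; 5]%N)) (iota 0 4) ->
    all (fun c => sperm_mul (sperm_mul (sperm_inv h) c) h \in sperms [:: 0; 1]%N) (sperms [:: 0; p]%N) ->
    good_lattice gal L \/ bad_lattice gal L.
  move=> hs [c [oc cp]] /allP comp /allP conj.
  have h6 : (h.1 < 6)%N by move: hs; rewrite mem_sperms mem_iota.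
  have [FP' occE] := frame_conj h6; apply: (tetr (FP' := FP')) => _ /occE[e oe ->].
  apply: conj; rewrite mem_sperms.
  have e6 := occurs_lt6 oe; have e4 : (e.1 < 4)%N.
    rewrite ltnNge; apply/negP => e4; apply: no_cyc; exists e; split=> //.
    by move: e4 e6; case: (e.1) => [|[|[|[|[|[|]]]]]].
  have /comp/orP[//|p45] : e.1 \in iota 0 4 by rewrite mem_iota.
  case: no_cyc; exists (sperm_mul c e); split; first exact: occursM.
  by rewrite sperm_mul1 cp.
have [o2|n2] := pselect (exists c, occurs FP lat246 c /\ c.1 = 2%N).
  by apply: (tet 2%N (3%N, (false, false, false))).
have [o3|n3] := pselect (exists c, occurs FP lat246 c /\ c.1 = 3%N).
  by apply: (tet 3%N (2%N, (false, false, false))).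
apply: (tetr (FP' := FP)) => c oc; rewrite mem_sperms; have := occurs_lt6 oc.
case cE: (c.1) => [|[|[|[|n]]]] // n2'; [case: n2|case: n3|case: no_cyc]; exists c => //.
by rewrite cE; split=> //; case: n {cE} n2' => [|[|]].
Qed.

End Conjugation.

Lemma fcc_good_or_bad (F : L -> vec3) : frame fcc F -> good_lattice gal L \/ bad_lattice gal L.
Proof.
move=> FP; apply: (frame_good_or_bad FP (lat246 := fcc246) fcc_act) => F' FP'.
  exact: (fcc_trigonal (FP := FP')).
exact: (fcc_tetragonal (FP := FP')).
Qed.

Lemma bcc_good_or_bad (F : L -> vec3) : frame bcc F -> good_lattice gal L \/ bad_lattice gal L.
Proof.
move=> FP; apply: (frame_good_or_bad FP (lat246 := bcc246) bcc_act) => F' FP'.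
  exact: (bcc_trigonal (FP := FP')).
exact: (bcc_tetragonal (FP := FP')).
Qed.

End Dichotomy.

(** * Obtuse superbases *)

Import Order.TTheory Num.Theory.

Section ObtuseSuperbase.
Variables (gT : finGroupType) (G : {group gT}) (L : glattice G).

(** The coordinate matrices are square and integral, so a left inverse is also a right inverse. *)
Lemma spans_inj (w : 'I_(rank L) -> L) : spans w -> injective (zcomb w).
Proof.
move=> sw; pose B : 'M[int]_(rank L) := \matrix_(i, j) lcoord (w i) j.
have rowB c : \row_j lcoord (zcomb w c) j = (\row_i c i) *m B.
  apply/rowP => j; rewrite !mxE.
  have -> : lcoord (zcomb w c) = [ffun j => \sum_i c i * lcoord (w i) j].
    apply: lcoord_uniq; rewrite /zcomb.
    under eq_bigr do rewrite ffunE mulrz_sumr.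
    rewrite exchange_big; apply: eq_bigr => i _ /=.
    transitivity (zcomb (lbasis L) (lcoord (w i)) *~ c i); last by rewrite lcoordK.
  by rewrite /zcomb mulrz_suml; apply: eq_bigr => l _; rewrite mulrC mulrzA.
  by rewrite ffunE; apply: eq_bigr => i _; rewrite !mxE.
have [c cE] := choice (fun i => sw (lbasis L i)).
have CB : (\matrix_(i, j) c i j) *m B = 1%:M.
  apply/row_matrixP => i; rewrite row_mul.
  have -> : row i (\matrix_(i, j) c i j) = \row_j c i j by apply/rowP => j; rewrite !mxE.
  by rewrite -rowB cE lcoord_basis; apply/rowP => j; rewrite !mxE ffunE eq_sym.
move=> d e de; have := congr1 (fun x => (\row_j lcoord x j) *m (\matrix_(i, j) c i j)) de.
rewrite !rowB -!mulmxA (mulmx1C CB) !mulmx1 => /rowP h.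
by apply/ffunP => i; have := h i; rewrite !mxE.
Qed.

Definition lform (x y : L) : int :=
  \sum_(g in G) \sum_i lcoord (lact L x g) i * lcoord (lact L y g) i.

Lemma lformC x y : lform x y = lform y x.
Proof. by apply: eq_bigr => g _; apply: eq_bigr => i _; rewrite mulrC. Qed.

Lemma lformD x y z : lform (x + y) z = lform x z + lform y z.
Proof.
rewrite /lform -big_split; apply: eq_bigr => g Gg; rewrite -big_split; apply: eq_bigr => i _ /=.
by rewrite -[lact L (x + y) g]/(lact_add L Gg _) raddfD lcoordD ffunE mulrDl.
Qed.

Lemma lform_act h x y : h \in G -> lform (lact L x h) (lact L y h) = lform x y.
Proof.
move=> Gh; rewrite /lform [RHS](reindex_inj (mulgI h)) /=.
apply: eq_big => [g|g Gg]; first by rewrite groupMl.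
by apply: eq_bigr => i _; rewrite !lactM.
Qed.

Lemma lform_ge0 x : 0 <= lform x x.
Proof. by apply: sumr_ge0 => g _; apply: sumr_ge0 => i _; rewrite -expr2 sqr_ge0. Qed.

Lemma lform_eq0 x : lform x x = 0 -> x = 0.
Proof.
move/eqP; rewrite psumr_eq0 => [/allP/(_ 1%g)|g _]; last first.
  by apply: sumr_ge0 => i _; rewrite -expr2 sqr_ge0.
rewrite mem_index_enum group1 => /(_ isT)/eqP; rewrite lact1 => x0.
rewrite -[x]lcoordK /zcomb big1 // => i _; move/eqP: x0.
rewrite psumr_eq0 => [/allP/(_ i)|j _]; last by rewrite -expr2 sqr_ge0.
by rewrite mem_index_enum mulf_eq0 orbb => /(_ isT)/eqP ->; rewrite mulr0z.
Qed.

Lemma lform0 z : lform 0 z = 0.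
Proof. by apply: (addrI (lform 0 z)); rewrite -lformD !addr0. Qed.
Lemma lformN x z : lform (- x) z = - lform x z.
Proof. by apply/eqP; rewrite -addr_eq0 -lformD addNr lform0. Qed.
Lemma lformMz x z (c : int) : lform (x *~ c) z = lform x z * c.
Proof.
have h (n : nat) : lform (x *+ n) z = lform x z * n%:Z.
  elim: n => [|n IH]; first by rewrite mulr0n lform0 mulr0.
  by rewrite mulrS lformD IH -add1n PoszD mulrDr mulr1.
by case: c => n; rewrite ?NegzE ?mulrNz ?lformN ?mulrN -?pmulrn h.
Qed.
Lemma lformDr x y z : lform z (x + y) = lform z x + lform z y.
Proof. by rewrite lformC lformD ![lform _ z]lformC. Qed.
Lemma lformMzr x z (c : int) : lform z (x *~ c) = lform z x * c.
Proof. by rewrite lformC lformMz lformC. Qed.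
Lemma lform_sum (I : Type) (r : seq I) (P : pred I) (f : I -> L) z :
  lform (\sum_(i <- r | P i) f i) z = \sum_(i <- r | P i) lform (f i) z.
Proof. exact: (big_morph (fun x => lform x z) (fun x y => lformD x y z) (lform0 z)). Qed.

Definition superbase n (v : 'I_n.+1 -> L) : Prop :=
  \sum_i v i = 0 /\ forall x, exists c : 'I_n.+1 -> int, x = \sum_i v i *~ c i.

Definition obtuse n (v : 'I_n.+1 -> L) := forall i j, i != j -> lform (v i) (v j) <= 0.

Lemma superbase_ex : exists v : 'I_(rank L).+1 -> L, superbase v.
Proof.
exists (fun i => if unlift ord0 i is Some j then lbasis L j else - \sum_j lbasis L j).
split=> [|x].
  rewrite big_ord_recl unlift_none; apply/eqP; rewrite addrC subr_eq0; apply/eqP/eq_bigr => i _.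
  by rewrite liftK.
exists (fun i => if unlift ord0 i is Some j then lcoord x j else 0).
rewrite big_ord_recl unlift_none mulr0z add0r -{1}[x]lcoordK.
by apply: eq_bigr => i _; rewrite liftK.
Qed.

(* Selling's reduction step: it lowers the sum of the lform (v i) (v i) as long
   as some lform (v i) (v j) is positive. *)
Lemma selling n (v : 'I_n.+1 -> L) (m : int) i j : superbase v -> m * (n%:Z - 1) = 2 ->
  0 < m -> i != j -> 0 < lform (v i) (v j) ->
  exists2 v' : 'I_n.+1 -> L, superbase v' &
    \sum_k lform (v' k) (v' k) < \sum_k lform (v k) (v k).
Proof.
move=> [v0 vs] mn m0 ij vij; have ji : j != i by rewrite eq_sym.
(* Each of the n - 1 remaining vectors receives m times [v i], so the sum stays 0 because m (n - 1)
   = 2. The sum of the norms changes by -2 m times [lform (v i) (v j)]. *)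
pose v' k := if k == i then - v i else if k == j then v j else v k + v i *~ m.
have vi : v' i = - v i by rewrite /v' eqxx.
have vj : v' j = v j by rewrite /v' (negbTE ji) eqxx.
have vk k : (k != i) && (k != j) -> v' k = v k + v i *~ m.
  by rewrite /v' => /andP[/negbTE-> /negbTE->].
have split3 (V : zmodType) (f : 'I_n.+1 -> V) :
    \sum_k f k = f i + f j + \sum_(k | (k != i) && (k != j)) f k.
  by rewrite (bigD1 i) //= (bigD1 j) //= addrA.
have cnt (V : zmodType) (x : V) : \sum_(k < n.+1 | (k != i) && (k != j)) x = x *~ (n%:Z - 1).
  have := split3 V (fun=> x); rewrite sumr_const card_ord => e.
  apply: (addrI (x + x)); rewrite -e -{2 3}[x]mulr1z -!mulrzDr pmulrn; congr (_ *~ _); lia.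
have v0' : \sum_(k | (k != i) && (k != j)) v k = - v i - v j.
  by apply: (addrI (v i + v j)); rewrite -split3 v0 -opprD subrr.
exists v'.
  split=> [|x].
    rewrite split3 vi vj (eq_bigr _ vk) big_split /= v0' cnt mulrzA_C mulrC mn.
    rewrite -[v i *~ 2]/(v i + v i); move: (v i) (v j) => a b.
    by rewrite [- a - b + _]addrC [a + a + _]addrACA subrr add0r addrACA addNr subrr addr0.
  have [c ->] := vs x.
  exists (fun k => if k == i then - c i + m * \sum_(k | (k != i) && (k != j)) c k else c k).
  rewrite !split3 eqxx (negbTE ji) vi vj mulrzDr -!addrA mulNrz mulrNz opprK; congr (_ + _).
  rewrite addrCA; congr (_ + _); rewrite mulrzA mulrz_sumr mulNrz.
  rewrite -big_split; apply: eq_bigr => k kP /=.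
  by rewrite vk //; case/andP: kP => /negbTE-> _; rewrite mulrzDl addrCA mulNrz addNr addr0.
rewrite !split3 vi vj lformN lformC lformN opprK ltrD2l.
have -> : \sum_(k | (k != i) && (k != j)) lform (v' k) (v' k) =
    \sum_(k | (k != i) && (k != j)) lform (v k) (v k)
    + (\sum_(k | (k != i) && (k != j)) lform (v k) (v i) *~ (2 * m)
    + \sum_(k < n.+1 | (k != i) && (k != j)) lform (v i) (v i) * (m * m)).
  rewrite -!big_split; apply: eq_bigr => k kP /=.
  rewrite vk // !(lformD, lformDr, lformMz, lformMzr) [lform (v i) (v k)]lformC mulrzz; ring.
rewrite gtrDl cnt -mulrz_suml -lform_sum v0' !(lformD, lformN) !mulrzz.
rewrite [lform (v j) _]lformC.
have -> : lform (v i) (v i) * (m * m) * (n%:Z - 1) = lform (v i) (v i) * m * (m * (n%:Z - 1)) by ring.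
rewrite mn; move: vij m0 mn; move: (lform _ _) (lform _ _) => a b; clear; nia.
Qed.

(** A superbase with least sum of norms admits no Selling step. The multiplier is 2 in rank 2 and 1
    in rank 3; in rank 1 a superbase consists of opposite vectors. *)
Lemma obtuse_superbase_ex : (0 < rank L <= 3)%N ->
  exists v : 'I_(rank L).+1 -> L, superbase v /\ obtuse v.
Proof.
move=> rk; pose pot (v : 'I_(rank L).+1 -> L) := \sum_k lform (v k) (v k).
have pot0 v : 0 <= pot v by apply: sumr_ge0 => k _; apply: lform_ge0.
have ex : exists p, `[< exists2 v, superbase v & pot v = p%:Z >].
  have [v vP] := superbase_ex; exists (absz (pot v)); apply/asboolP; exists v => //.
  by rewrite gez0_abs.
case: (ex_minnP ex) => p /asboolP[v vP vp] pmin; exists v; split=> // i j ij.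
rewrite leNgt; apply/negP => vij.
have desc m : 0 < m -> m * ((rank L)%:Z - 1) = 2 -> False.
  move=> m0 mn; have [v' v'P lt] := selling vP mn m0 ij vij.
  have /pmin : `[< exists2 v, superbase v & pot v = (absz (pot v'))%:Z >].
    by apply/asboolP; exists v' => //; rewrite gez0_abs.
  by move: lt; rewrite -/(pot v) -/(pot v') vp; move: (pot0 v'); move: (pot v') => q; lia.
have [r1|[r2|r3]] : rank L = 1%N \/ rank L = 2 \/ rank L = 3 by lia.
- have [v0 _] := vP; have /eqP : v i + v j = 0.
    rewrite -v0 (bigD1 i) //= (bigD1 j) ?[j == i]eq_sym //= big1 ?addr0 // => l.
    by move: ij; rewrite -!val_eqE /=; move: (ltn_ord i) (ltn_ord j) (ltn_ord l); lia.
  rewrite addr_eq0 => /eqP vE; move: vij; rewrite vE lformN oppr_gt0 lt_neqAle.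
  by have := lform_ge0 (v j); rewrite leNgt lt_neqAle => /negbTE->.
- by apply: (desc 2); rewrite // r2.
by apply: (desc 1); rewrite // r3.
Qed.

End ObtuseSuperbase.

(** * The graph of an obtuse superbase and the vectors shortest modulo 2L *)

Section VoronoiFunctionals.
Variables (gT : finGroupType) (G : {group gT}) (L : glattice G) (n : nat).
Hypothesis rkL : rank L = n.
Variable v : 'I_n.+1 -> L.
Hypotheses (vP : superbase v) (obt : obtuse v).

(** Coordinates in a superbase are unique up to a common shift, which is what makes the differences
    [vdiff] well defined and additive. *)
Lemma superbase_inj (c : 'I_n.+1 -> int) : \sum_i v i *~ c i = 0 -> forall i j, c i = c j.
Proof.
move=> c0; have [v0 vs] := vP; pose w (i : 'I_(rank L)) := v (lift ord0 (cast_ord rkL i)).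
have vlast : v ord0 = - \sum_i v (lift ord0 i) by apply/eqP; rewrite -addr_eq0 -big_ord_recl v0.
have wE (d : 'I_n.+1 -> int) : \sum_i v i *~ d i =
    zcomb w [ffun i => d (lift ord0 (cast_ord rkL i)) - d ord0].
  rewrite big_ord_recl vlast mulNrz mulrz_suml -sumrN -big_split /= /zcomb.
  rewrite (reindex (cast_ord rkL)) /=; last first.
    by exists (cast_ord (esym rkL)) => i _; apply: val_inj.
  by apply: eq_bigr => i _; rewrite ffunE mulrzBr addrC.
have sw : spans w.
  move=> x; have [d ->] := vs x; rewrite wE; by eexists.
suff c_0 i : c i = c ord0 by move=> i j; rewrite !c_0.
case: (unliftP ord0 i) => [j ->|-> //].
have : zcomb w [ffun i => c (lift ord0 (cast_ord rkL i)) - c ord0] = zcomb w [ffun=> 0].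
  by rewrite -wE c0 /zcomb big1 // => l _; rewrite ffunE mulr0z.
move=> /(spans_inj sw)/ffunP/(_ (cast_ord (esym rkL) j)); rewrite !ffunE cast_ordKV.
by move/eqP; rewrite subr_eq0 => /eqP.
Qed.

Let coord_ex x : exists c : 'I_n.+1 -> int, x = \sum_i v i *~ c i. Proof. by case: vP. Qed.
Let cx x := projT1 (cid (coord_ex x)).
Let cxE x : x = \sum_i v i *~ cx x i. Proof. exact: (projT2 (cid (coord_ex x))). Qed.

Definition vdiff i j x := cx x i - cx x j.

Lemma vdiffE (c : 'I_n.+1 -> int) i j : vdiff i j (\sum_l v l *~ c l) = c i - c j.
Proof.
have := @superbase_inj (fun l => cx (\sum_l v l *~ c l) l - c l).
set x := \sum_l v l *~ c l => /(_ _ i j); rewrite /vdiff.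
move=> h; suff : cx x i - c i = cx x j - c j by move: (cx x i) (cx x j) (c i) (c j); lia.
by apply: h; under eq_bigr do rewrite mulrzBr; rewrite sumrB -cxE subrr.
Qed.

Lemma vdiffD i j : {morph vdiff i j : x y / x + y}.
Proof.
move=> x y; rewrite [x in vdiff _ _ (x + _)]cxE [y in vdiff _ _ (_ + y)]cxE -big_split /=.
under eq_bigr do rewrite -mulrzDr; rewrite vdiffE /vdiff; ring.
Qed.

Lemma vdiff_eq0 i x : (forall j, vdiff i j x = 0) -> x = 0.
Proof.
move=> h; have [v0 _] := vP; rewrite [x]cxE.
rewrite (eq_bigr (fun l => v l *~ cx x i)); first by rewrite -mulrz_suml v0 mul0rz.
by move=> l _; congr (_ *~ _); apply/eqP; rewrite eq_sym -subr_eq0; apply/eqP/h.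
Qed.

Lemma vdiffxx i x : vdiff i i x = 0. Proof. exact: subrr. Qed.

(** Selling's formula: since the [v j] sum to 0, the diagonal terms can be traded for squares of
    differences. For an obtuse superbase all coefficients off the diagonal are nonnegative. *)
Lemma lform_vdiff x : lform x x *+ 2 = \sum_i \sum_j (- lform (v i) (v j)) * vdiff i j x ^+ 2.
Proof.
have s0 i : \sum_j lform (v i) (v j) = 0.
  by under eq_bigr do rewrite lformC; rewrite -lform_sum; case: vP => -> _; rewrite lform0.
rewrite [in LHS](cxE x) lform_sum; set c := cx x.
transitivity (\sum_i \sum_j (lform (v i) (v j) * (c i * c j) *+ 2)).
  rewrite -sumrMnl; apply: eq_bigr => i _.
  rewrite lformMz lformC lform_sum mulr_suml -sumrMnl; apply: eq_bigr => j _.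
  by rewrite lformMz [lform (v j) _]lformC; congr (_ *+ _); ring.
transitivity (\sum_i \sum_j (lform (v i) (v j) * (c i * c j) *+ 2
   - lform (v i) (v j) * c i ^+ 2 - lform (v i) (v j) * c j ^+ 2)); last first.
  by apply: eq_bigr => i _; apply: eq_bigr => j _; rewrite /vdiff -/c; ring.
under [RHS]eq_bigr do rewrite !sumrB; rewrite !sumrB.
rewrite [X in _ = _ - X - _]big1 => [|i _]; last by rewrite -mulr_suml s0 mul0r.
rewrite [X in _ = _ - X]exchange_big [X in _ = _ - _ - X]big1 ?subr0 // => i _.
by under eq_bigr do rewrite lformC; rewrite -mulr_suml s0 mul0r.
Qed.

Definition edge i j := lform (v i) (v j) < 0.

Lemma edgeC i j : edge i j = edge j i. Proof. by rewrite /edge lformC. Qed.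

(* The vectors which are shortest in their class modulo 2L. *)
Definition shortest (x : L) := forall y, lform x x <= lform (x + y *~ 2) (x + y *~ 2).

(** By Selling's formula the norm is a positive combination of squares of differences along edges,
    and adding 2y preserves their parities; values in -1, 0, 1 are least in their parity class. *)
Lemma shortestP x : shortest x <-> forall i j, edge i j -> vdiff i j x <= 1.
Proof.
have v2 i j y : vdiff i j (x + y *~ 2) = vdiff i j x + vdiff i j y * 2.
  by rewrite -[y *~ 2]/(y + y) !vdiffD; ring.
split=> [sx i j ij|h y]; last first.
  suff : lform x x *+ 2 <= lform (x + y *~ 2) (x + y *~ 2) *+ 2 by lia.
  rewrite !lform_vdiff; apply: ler_sum => i _; apply: ler_sum => j _; rewrite v2.
  have [->|ij] := eqVneq i j; first by rewrite !vdiffxx mul0r addr0.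
  have := obt ij; rewrite le_eqVlt => /orP[/eqP->|e]; first by rewrite oppr0 !mul0r.
  rewrite ler_pM2l ?oppr_gt0 //; have := h _ _ e; have := h j i; rewrite edgeC => /(_ e).
  have -> : vdiff j i x = - vdiff i j x by rewrite /vdiff opprB.
  move: (vdiff i j x) (vdiff i j y) => a b; clear; nia.
(* If c_i - c_j > 1 on an edge, lowering by 2 all coordinates that are at least c_i increases no
   square of a difference and decreases the one at (i, j). *)
rewrite leNgt; apply/negP => gt1; pose S k := cx x i <= cx x k.
pose y := - \sum_k v k *~ (S k : int); have := sx y.
suff : lform (x + y *~ 2) (x + y *~ 2) *+ 2 < lform x x *+ 2 by lia.
have yE k l : vdiff k l y = (S l : int) - (S k : int).
  by rewrite /y -sumrN; under eq_bigr do rewrite -mulrNz; rewrite vdiffE; ring.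
have term k l : - lform (v k) (v l) * (vdiff k l x + vdiff k l y * 2) ^+ 2 <=
    - lform (v k) (v l) * vdiff k l x ^+ 2.
  have [->|kl] := eqVneq k l; first by rewrite !vdiffxx mul0r addr0.
  apply: ler_wpM2l; first by rewrite oppr_ge0 obt.
  rewrite yE /S /vdiff; move: (cx x i) (cx x k) (cx x l) => a b c; clear.
  by case: (leP a b); case: (leP a c) => /= *; nia.
rewrite !lform_vdiff; under [ltLHS]eq_bigr do under eq_bigr do rewrite v2.
rewrite (bigD1 i) //= [ltRHS](bigD1 i) //=; apply: ltr_leD; last first.
  by apply: ler_sum => k _; apply: ler_sum => l _; apply: term.
rewrite (bigD1 j) //= [ltRHS](bigD1 j) //=; apply: ltr_leD; last first.
  by apply: ler_sum => l _; apply: term.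
rewrite ltr_pM2l ?oppr_gt0 // yE /S lexx; move: gt1; rewrite /vdiff.
by move: (cx x i) (cx x j) => a b; clear; case: (leP a b) => /= *; nia.
Qed.

Lemma shortest_act g x : g \in G -> shortest x -> shortest (lact L x g).
Proof.
move=> Gg sx y; pose z := lact L y g^-1%g.
have -> : y = lact L z g by rewrite /z -lactM ?groupV // mulVg lact1.
have h := raddfMz (lact_add L Gg) 2 z; rewrite /= in h.
by rewrite -h -[lact L x g + _](raddfD (lact_add L Gg)) /= !lform_act.
Qed.

(* An additive functional with values at most 1 on the shortest vectors takes
   at most one positive and one negative value on the superbase. *)
Lemma shortest_functional (f : L -> int) : {morph f : x y / x + y} -> (exists x, f x != 0) ->
  (forall x, shortest x -> f x <= 1) ->
  exists i j, edge i j /\ f =1 vdiff i j.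
Proof.
move=> fD [x0 x0P] f1; have f0 : f 0 = 0 by apply: (addrI (f 0)); rewrite -fD !addr0.
have fN x : f (- x) = - f x by apply/eqP; rewrite -addr_eq0 -fD addNr f0.
have fMz x (m : int) : f (x *~ m) = f x * m.
  have h (l : nat) : f (x *+ l) = f x * l%:Z.
    elim: l => [|l IH]; first by rewrite mulr0n f0 mulr0.
    by rewrite mulrS fD IH -add1n PoszD mulrDr mulr1.
  by case: m => l; rewrite ?NegzE ?mulrNz ?fN ?mulrN -?pmulrn h.
have fS (I : Type) (r : seq I) (P : pred I) (u : I -> L) :
    f (\sum_(i <- r | P i) u i) = \sum_(i <- r | P i) f (u i) by apply: big_morph.
have fE x : f x = \sum_i f (v i) * cx x i.
  by rewrite {1}[x]cxE fS; apply: eq_bigr => i _; rewrite fMz.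
have fv0 : \sum_i f (v i) = 0 by rewrite -fS; case: vP => -> _.
have short (c : 'I_n.+1 -> int) : (forall i j, edge i j -> c i - c j <= 1) ->
    \sum_i f (v i) * c i <= 1.
  move=> h; have := f1 (\sum_i v i *~ c i); rewrite fS.
  rewrite (eq_bigr (fun i => f (v i) * c i)) => [|i _]; last exact: fMz.
  apply; apply/shortestP => i j ij.
  by rewrite vdiffE; apply: h.
have sub (S : pred 'I_n.+1) : \sum_(i | S i) f (v i) <= 1.
  have -> : \sum_(i | S i) f (v i) = \sum_i f (v i) * (S i : int).
    by rewrite big_mkcond; apply: eq_bigr => i _; case: (S i); rewrite ?mulr1 ?mulr0.
  by apply: short => i j _; case: (S i); case: (S j).
have subN (S : pred 'I_n.+1) : -1 <= \sum_(i | S i) f (v i).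
  have := sub [pred i | ~~ S i]; move: fv0; rewrite (bigID S) /=.
  by move: (\sum_(i | S i) _) (\sum_(i | ~~ S i) _) => a b; lia.
have [i fi] : exists i, 0 < f (v i).
  apply: contrapT => no; move/eqP: x0P; apply; rewrite fE big1 // => i _.
  have /eqP := fv0; rewrite -oppr_eq0 -sumrN psumr_eq0 => [/allP/(_ i)|l _]; last first.
    by rewrite oppr_ge0 leNgt; apply/negP => h; apply: no; exists l.
  by rewrite mem_index_enum oppr_eq0 => /(_ isT)/eqP->; rewrite mul0r.
have fi1 : f (v i) = 1.
  by have := sub (pred1 i); rewrite big_pred1_eq; move: fi; lia.
have [j fj] : exists j, f (v j) < 0.
  apply: contrapT => no; have /eqP := fv0; rewrite psumr_eq0 => [/allP/(_ i)|l _]; last first.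
    by rewrite leNgt; apply/negP => h; apply: no; exists l.
  by rewrite mem_index_enum fi1 => /(_ isT).
have fj1 : f (v j) = -1.
  by have := subN (pred1 j); rewrite big_pred1_eq; move: fj; lia.
have ij : i != j by apply/eqP => e; move: fj; rewrite -e fi1.
have other l : l != i -> l != j -> f (v l) = 0.
  have s2 a b : a != b -> \sum_(m | (m == a) || (m == b)) f (v m) = f (v a) + f (v b).
    move=> ab; rewrite (bigD1 a) ?eqxx //= (bigD1 b) ?eqxx ?orbT 1?eq_sym //= big1 ?addr0 // => m.
    by move=> /andP[/andP[/orP[]->]].
  move=> li lj; have := sub [pred m | (m == i) || (m == l)].
  have := subN [pred m | (m == j) || (m == l)]; rewrite /= !s2 1?eq_sym // fi1 fj1.
  by move: (f _); lia.
have fij x : f x = vdiff i j x.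
  rewrite fE (bigD1 i) //= (bigD1 j) ?[j == i]eq_sym //= fi1 fj1 big1 => [|l /andP[li lj]].
    by rewrite /vdiff; ring.
  by rewrite other // mul0r.
exists i, j; split=> //; apply: contraT => nij.
(* If (i, j) were not an edge, the vector with coordinate 2 at i, 1 at the neighbours of i and 0
   elsewhere would be shortest, while f takes the value 2 on it. *)
pose c l : int := if l == i then 2 else if edge i l then 1 else 0.
have : \sum_l f (v l) * c l <= 1.
  apply: short => k l kl; rewrite /c.
  case: (k =P i) => [ki|_]; last by case: (l == i); case: (edge i k); case: (edge i l).
  by rewrite -ki kl; case: ifP.
rewrite (bigD1 i) //= (bigD1 j) ?[j == i]eq_sym //= fi1 fj1 big1 => [|l /andP[li lj]].
  by rewrite /c eqxx eq_sym (negbTE ij) (negbTE nij).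
by rewrite other // mul0r.
Qed.

(** [shortest_functional] recognises edge functionals from the shortest vectors, hence from the
    invariant form alone. So G permutes them, although it may move the superbase. *)
Lemma vdiff_act g i j : g \in G -> edge i j ->
  exists i' j', edge i' j' /\ forall x, vdiff i j (lact L x g) = vdiff i' j' x.
Proof.
move=> Gg ij; apply: shortest_functional => [x y||x sx].
- by rewrite -[lact L (x + y) g]/(lact_add L Gg _) raddfD vdiffD.
- exists (lact L (v i) g^-1%g); rewrite -lactM ?groupV // mulVg lact1.
  have -> : v i = \sum_l v l *~ ((l == i) : int).
    by rewrite (bigD1 i) //= eqxx big1 ?addr0 // => l /negbTE->.
  rewrite vdiffE eqxx; have [ji|//] := eqVneq j i; move: ij; rewrite ji /edge ltNge.
  by rewrite lform_ge0.
exact: (proj1 (shortestP _) (shortest_act Gg sx) i j ij).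
Qed.

(** The graph is connected: otherwise the sum of the [v k] over S would have norm 0 by Selling's
    formula, against the uniqueness of coordinates. *)
Lemma edge_cut (S : pred 'I_n.+1) i j : S i -> ~~ S j -> exists k l, [/\ S k, ~~ S l & edge k l].
Proof.
move=> Si Sj; apply: contrapT => no.
have y0 : \sum_k v k *~ (S k : int) = 0.
  apply: lform_eq0; set y := \sum_k _; suff : lform y y *+ 2 = 0 by lia.
  rewrite lform_vdiff; apply: big1 => k _; apply: big1 => l _; rewrite vdiffE.
  have [->|kl] := eqVneq k l; first by rewrite subrr mulr0.
  have := obt kl; rewrite le_eqVlt => /orP[/eqP->|e]; first by rewrite oppr0 mul0r.
  case Sk : (S k); case Sl : (S l); rewrite ?mulr0 //; case: no.
    by exists k, l; rewrite Sk Sl.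
  by exists l, k; rewrite Sk Sl edgeC.
by have := superbase_inj y0 i j; rewrite Si (negbTE Sj).
Qed.

End VoronoiFunctionals.

(** * Lattices of rank at most three *)

Section VoronoiSystem.
Variables (gT : finGroupType) (G : {group gT}) (L : glattice G).

(* An obtuse superbase with vertices numbered 0..n, seen through the functionals
   D i j (the difference of the i-th and j-th coordinates) and its graph E. *)
Record voronoi n (D : nat -> nat -> L -> int) (E : nat -> nat -> bool) : Prop := {
  voD : forall i j, {morph D i j : x y / x + y};
  vo_tri : forall i j l x, D i j x = D i l x + D l j x;
  vo_inj : forall x, (forall i, (i <= n)%N -> D 0%N i x = 0) -> x = 0;
  vo_surj : forall c : nat -> int, exists x, forall i j, (i <= n)%N -> (j <= n)%N -> D i j x = c i - c j;
  vo_sym : forall i j, E i j = E j i;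
  vo_irr : forall i, ~~ E i i;
  vo_cut : forall S : pred nat, S 0%N -> ~~ all S (iota 0 n.+1) ->
    has (fun i => has (fun j => [&& S i, ~~ S j & E i j]) (iota 0 n.+1)) (iota 0 n.+1);
  vo_act : {in G, forall g i j, (i <= n)%N -> (j <= n)%N -> E i j ->
    exists i' j', [/\ (i' <= n)%N, (j' <= n)%N, E i' j' & forall x, D i j (lact L x g) = D i' j' x]}
}.

Lemma voronoi_ex : (0 < rank L <= 3)%N -> exists D E, voronoi (rank L) D E.
Proof.
move=> rk; have [v [vP obt]] := obtuse_superbase_ex rk.
pose o i : 'I_(rank L).+1 := inord i.
have oK i : (i <= rank L)%N -> o i = i :> nat by move=> ?; rewrite inordK.
exists (fun i j => vdiff vP (o i) (o j)), (fun i j => edge v (o i) (o j)); split.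
- by move=> i j; apply: vdiffD.
- by move=> i j l x; rewrite /vdiff; ring.
- by move=> x h; apply: (@vdiff_eq0 _ _ _ _ _ vP (o 0%N)) => j; rewrite -[j]inord_val h // -ltnS.
- move=> c; exists (\sum_l v l *~ c l) => i j hi hj.
  by rewrite (vdiffE erefl vP (fun l : 'I_ _ => c l)) !oK.
- by move=> i j; rewrite edgeC.
- by move=> i; rewrite /edge ltNge lform_ge0.
- move=> S S0 /allPn[j jn Sj]; rewrite mem_iota /= ltnS in jn.
  have [||a [b [Sa Sb ab]]] := @edge_cut _ _ _ _ erefl _ vP obt (fun i => S i) (o 0%N) (o j).
  + by rewrite oK.
  + by rewrite oK.
  apply/hasP; exists (val a); first by rewrite mem_iota /=.
  by apply/hasP; exists (val b); rewrite ?mem_iota //= Sa Sb /= /o !inord_val.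
move=> g Gg i j hi hj ij; have [a [b [ab abE]]] := vdiff_act erefl vP obt Gg ij.
by exists a, b; rewrite /o !inord_val; split; rewrite // -ltnS.
Qed.

Lemma voronoi_relabel n D E (s s' : nat -> nat) : voronoi n D E ->
  (forall i, (i <= n)%N -> [/\ (s i <= n)%N, (s' i <= n)%N, s (s' i) = i & s' (s i) = i]) ->
  voronoi n (fun i j => D (s i) (s j)) (fun i j => E (s i) (s j)).
Proof.
move=> vo sP; split.
- by move=> i j; apply: (voD vo).
- by move=> i j l x; apply: (vo_tri vo).
- move=> x h; apply: (vo_inj vo) => i hi; have [_ h1 <- _] := sP _ hi.
  have [_ h0 <- _] := sP 0%N isT.
  rewrite (vo_tri vo _ _ (s 0%N)) h // addr0; have := vo_tri vo (s 0%N) (s 0%N) (s (s' 0%N)) x.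
  have e0 := vo_tri vo (s 0%N) (s 0%N) (s 0%N) x.
  by rewrite (h _ h0); move: e0; move: (D _ _ _) (D _ _ _); lia.
- move=> c; have [x xP] := vo_surj vo (c \o s'); exists x => i j hi hj.
  have [h1 _ _ e1] := sP _ hi; have [h2 _ _ e2] := sP _ hj.
  by rewrite xP //= e1 e2.
- by move=> i j; apply: (vo_sym vo).
- by move=> i; apply: (vo_irr vo).
- move=> S S0 /allPn[j jn Sj]; rewrite mem_iota /= ltnS in jn.
  have main (R : pred nat) : R (s 0%N) -> ~~ R (s j) -> exists a b,
      [/\ (a <= n)%N, (b <= n)%N, R a, ~~ R b & E a b].
    move=> R0 Rj; have [Q0|Q0] := boolP (R 0%N).
      have := vo_cut vo Q0; case: allP => [h|_ /(_ isT)/hasP[a + /hasP[b + /and3P[? ? ?]]]].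
        by case/negP: Rj; apply: h; rewrite mem_iota /= ltnS; case: (sP _ jn).
      by rewrite !mem_iota /= !ltnS => ? ?; exists a, b.
    have := @vo_cut _ _ _ vo (predC R) Q0; case: allP => [h|_ /(_ isT)/hasP[a + /hasP[b + /and3P[? Rb ?]]]].
      have /h/= : s 0%N \in iota 0 n.+1 by rewrite mem_iota /= ltnS; case: (sP 0%N).
      by rewrite R0.
    by rewrite !mem_iota /= !ltnS => ? ?; exists b, a; rewrite (vo_sym vo) -[R b]negbK.
  have [||a [b [ha hb Sa Sb ab]]] := main (fun i => S (s' i)).
  + by have [_ _ _ ->] := sP 0%N isT.
  + by have [_ _ _ ->] := sP _ jn.
  have [_ a1 a2 _] := sP _ ha; have [_ b1 b2 _] := sP _ hb.
  apply/hasP; exists (s' a); first by rewrite mem_iota /= ltnS.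
  by apply/hasP; exists (s' b); rewrite ?mem_iota /= ?ltnS // Sa Sb a2 b2.
move=> g Gg i j hi hj ij; have [h1 _ _ _] := sP _ hi; have [h2 _ _ _] := sP _ hj.
have [a [b [ha hb ab abE]]] := vo_act vo Gg h1 h2 ij.
have [_ a1 a2 _] := sP _ ha; have [_ b1 b2 _] := sP _ hb.
by exists (s' a), (s' b); rewrite a2 b2.
Qed.

End VoronoiSystem.

Definition graph_of (l : seq (nat * nat)) i j :=
  has (fun p => if Nat.eqb p.1 i then Nat.eqb p.2 j else if Nat.eqb p.1 j then Nat.eqb p.2 i else false) l.
Lemma graph_ofE l i j : graph_of l i j = ((i, j) \in l) || ((j, i) \in l).
Proof.
have eqbE (a b : nat) : Nat.eqb a b = (a == b) by elim: a b => [|a IH] [|b] //=.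
elim: l => // -[a b] l IH; rewrite /= -/(graph_of l i j) IH !inE !xpair_eqE !eqbE.
case: (_ \in l) (_ \in l) => -[]; rewrite ?orbT ?orbF //.
rewrite [i == a]eq_sym [j == a]eq_sym [i == b]eq_sym [j == b]eq_sym.
have [ai|] := eqVneq a i; have [aj|] := eqVneq a j => /=; rewrite ?orbF //.
by rewrite -ai -aj orbb.
Qed.
(* The connected graphs on three and four vertices, up to relabelling. *)
Definition star4 := [:: (0, 1); (0, 2); (0, 3)]%N.
Definition path4 := [:: (0, 1); (1, 2); (2, 3)]%N.
Definition paw := [:: (0, 1); (1, 2); (0, 2); (2, 3)]%N.
Definition square := [:: (0, 1); (1, 2); (2, 3); (0, 3)]%N.
Definition diamond := [:: (0, 1); (0, 2); (0, 3); (1, 2); (1, 3)]%N.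
Definition complete4 := [:: (0, 1); (0, 2); (0, 3); (1, 2); (1, 3); (2, 3)]%N.
Definition path3 := [:: (0, 1); (1, 2)]%N.
Definition triangle := [:: (0, 1); (1, 2); (0, 2)]%N.

Definition pairs n := [seq (i, j) | i <- iota 0 n, j <- iota 0 n].
Definition same_graph n (E E' : nat -> nat -> bool) := all (fun p => E p.1 p.2 == E' p.1 p.2) (pairs n).
Definition relabelled n (E : nat -> nat -> bool) (l : seq nat) i j := E (nth n l i) (nth n l j).
Definition connected n (E : nat -> nat -> bool) := all (fun S : pred nat => S 0%N ==>
  (all S (iota 0 n) || has (fun p => [&& S p.1, ~~ S p.2 & E p.1 p.2]) (pairs n)))
  (map (fun l i => i \in l) (foldr (fun i ls => map (cons i) ls ++ ls) [:: [::]] (iota 0 n))).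

Lemma same_graphP n E E' i j : same_graph n E E' -> (i < n)%N -> (j < n)%N -> E i j = E' i j.
Proof.
move=> /allP h hi hj; apply/eqP/(h (i, j)); apply/allpairsP; exists (i, j).
by rewrite !mem_iota.
Qed.

Lemma connected_same n E E' : same_graph n E E' -> connected n E -> connected n E'.
Proof.
move=> h /allP c; apply/allP => S Sin; have := c _ Sin; congr (_ ==> (_ || _)).
apply: eq_in_has => _ /allpairsP[[i j] [/= hi hj ->]] /=.
by rewrite !mem_iota in hi hj; rewrite (same_graphP h hi hj).
Qed.

Definition tabulate n (E : nat -> nat -> bool) := [seq p <- pairs n | (p.1 < p.2)%N && E p.1 p.2].
Lemma tabulateP n E : (forall i j, E i j = E j i) -> (forall i, ~~ E i i) ->
  same_graph n (graph_of (tabulate n E)) E.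
Proof.
move=> sy ir; apply/allP => _ /allpairsP[[i j] [/= hi hj ->]] /=; apply/eqP.
have ip i' j' : i' \in iota 0 n -> j' \in iota 0 n -> (i', j') \in pairs n.
  by move=> ? ?; apply/allpairsP; exists (i', j').
rewrite graph_ofE !mem_filter /= !ip // !andbT.
by case: ltngtP => [_|_|->] /=; rewrite ?orbF // (negbTE (ir _)).
Qed.

Definition insertions (s : seq nat) := foldr (fun x ls =>
  flatten [seq [seq take i l ++ x :: drop i l | i <- iota 0 (size l).+1] | l <- ls]) [:: [::]] s.
Lemma insertions_perm s l : l \in insertions s -> perm_eq l s.
Proof.
elim: s l => [|x s IH] l; first by rewrite inE => /eqP->.
rewrite -[insertions _]/(flatten [seq [seq take i l ++ x :: drop i l | i <- iota 0 (size l).+1]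
  | l <- insertions s]).
case/flattenP => _ /mapP[l' /IH ll' ->] /mapP[i _ ->].
by rewrite -cat1s perm_catCA cat_take_drop perm_cons.
Qed.

(** Graphs on n vertices are enumerated as sublists of the increasing pairs, and relabellings as
    lists produced by successive insertion. *)
Definition classified n (gs : seq (seq (nat * nat))) := all (fun l : seq (nat * nat) =>
  connected n (graph_of l) ==> has (fun p => has (fun g => same_graph n (relabelled n (graph_of l) p) (graph_of g)) gs)
    (insertions (iota 0 n)))
  (foldr (fun i ls => map (cons i) ls ++ ls) [:: [::]] [seq p <- pairs n | (p.1 < p.2)%N]).

Lemma classified4 : classified 4 [:: star4; path4; paw; square; diamond; complete4].
Proof. by vm_compute. Qed.
Lemma classified3 : classified 3 [:: path3; triangle].
Proof. by vm_compute. Qed.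

Lemma mem_sublists (T : eqType) (P : pred T) (s : seq T) :
  filter P s \in foldr (fun i ls => map (cons i) ls ++ ls) [:: [::]] s.
Proof.
elim: s => //= x s IH; rewrite mem_cat; case: (P x); last by rewrite IH orbT.
by rewrite map_f.
Qed.

Lemma voronoi_normal gT (G : {group gT}) (L : glattice G) n gs (D : nat -> nat -> L -> int) E :
  classified n.+1 gs -> voronoi n D E ->
  exists g (D' : nat -> nat -> L -> int) E', [/\ g \in gs, voronoi n D' E' & forall i j, (i <= n)%N -> (j <= n)%N -> E' i j = graph_of g i j].
Proof.
move=> /allP cl vo; have tE := tabulateP n.+1 (vo_sym vo) (vo_irr vo).
have conn : connected n.+1 (graph_of (tabulate n.+1 E)).
  apply: (@connected_same _ E).
    by apply/allP => p pin; rewrite eq_sym; apply: (allP tE).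
  apply/allP => S _; apply/implyP => S0; apply/orP; have [_|nS] := boolP (all S (iota 0 n.+1)); [by left|right].
  have /hasP[i hi /hasP[j hj h]] := vo_cut vo S0 nS.
  by apply/hasP; exists (i, j) => //; apply/allpairsP; exists (i, j).
have tin : tabulate n.+1 E \in foldr (fun i ls => map (cons i) ls ++ ls) [:: [::]]
    [seq p <- pairs n.+1 | (p.1 < p.2)%N].
  have -> : tabulate n.+1 E = [seq p <- [seq p <- pairs n.+1 | (p.1 < p.2)%N] | E p.1 p.2].
    by rewrite -filter_predI; apply: eq_filter => p /=; rewrite andbC.
  exact: mem_sublists.
have /implyP/(_ conn)/hasP[l + /hasP[g gin gE]] := cl _ tin.
move=> /insertions_perm pl; have sl := perm_size pl; rewrite size_iota in sl.
have ul : uniq l by rewrite (perm_uniq pl) iota_uniq.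
have meml i : (i \in l) = (i < n.+1)%N by rewrite (perm_mem pl) mem_iota.
have nl i : (i < n.+1)%N -> (nth n.+1 l i < n.+1)%N by move=> hi; rewrite -meml mem_nth ?sl.
exists g, (fun i j => D (nth n.+1 l i) (nth n.+1 l j)), (fun i j => E (nth n.+1 l i) (nth n.+1 l j)).
split=> // [|i j hi hj].
  apply: (@voronoi_relabel _ _ _ _ _ _ _ (index^~ l) vo) => i hi.
  split; [exact: nl| |by rewrite nth_index ?meml|by rewrite index_uniq ?sl].
  by rewrite -ltnS -[X in (_ < X)%N]sl index_mem meml.
rewrite -(same_graphP gE) //; symmetry; exact: (same_graphP tE (nl _ hi) (nl _ hj)).
Qed.

(** The roots of A2 as functionals on Z^2. The differences of distinct [hex_point]s are the six
    nonzero vectors on which every root takes a value in -1, 0, 1. *)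
Definition hex_roots : seq (int * int) := [:: (1, 0); (0, 1); (1, 1); (-1, 0); (0, -1); (-1, -1)].
Definition hex_ok (s1 s2 : int * int) :=
  [&& s1 \in hex_roots, s2 \in hex_roots & (s1.1 + s2.1, s1.2 + s2.2) \in hex_roots].
Definition hex_point (i : nat) : int * int := match i with O => (0, 0) | S O => (1, 0) | _ => (0, 1) end.
Definition hex_mul (s1 s2 v : int * int) : int * int := (s1.1 * v.1 + s1.2 * v.2, s2.1 * v.1 + s2.2 * v.2).
Definition hex_diff (i j : nat) : int * int :=
  ((hex_point i).1 - (hex_point j).1, (hex_point i).2 - (hex_point j).2).

Lemma hex_check : all (fun s1 => all (fun s2 => hex_ok s1 s2 ==>
  has (fun l => has (fun sw : bool => all (fun i => all (fun j => hex_mul s1 s2 (hex_diff i j) ==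
    if sw then hex_diff (nth 3%N l j) (nth 3%N l i) else hex_diff (nth 3%N l i) (nth 3%N l j))
    (iota 0 3)) (iota 0 3)) [:: true; false]) (insertions (iota 0 3))) hex_roots) hex_roots.
Proof. by vm_compute. Qed.

Lemma hex_diff_inj (i j k l : 'I_3) : i != j -> hex_diff i j = hex_diff k l -> i = k /\ j = l.
Proof.
have : all (fun i => all (fun j => all (fun k => all (fun l =>
    (i != j) ==> (hex_diff i j == hex_diff k l) ==> (i == k) && (j == l))
    (iota 0 3)) (iota 0 3)) (iota 0 3)) (iota 0 3) by vm_compute.
have io (m : 'I_3) : val m \in iota 0 3 by rewrite mem_iota /=.
move=> /allP/(_ _ (io i))/allP/(_ _ (io j))/allP/(_ _ (io k))/allP/(_ _ (io l)) h ij /eqP e.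
by move: h; rewrite -val_eqE in ij; rewrite ij e /= => /andP[/eqP/val_inj-> /eqP/val_inj->].
Qed.

(** * Hexagons and trees *)

Section Hexagonal.
Variables (k : fieldType) (K : splittingFieldType k).
Variables (gT : finGroupType) (G : {group gT}).
Variables (gal : {morphism G >-> gal_of {:K}}).
Hypothesis isoG : isom G 'Gal({:K} / 1) gal.
Variable L : glattice G.

Lemma good_hexagon n (D1 D2 : L) (e : 'I_n -> L) (w : 'I_(2 + n) -> L) : (2 + n <= rank L)%N -> spans w ->
  (forall i, w (lshift n i) = if i == 0 then D1 else D2) -> (forall i, w (rshift 2 i) = e i) ->
  (forall a b : int, D1 *~ a + D2 *~ b = 0 -> a = 0 /\ b = 0) ->
  {in G, forall g, exists s1 s2, [/\ hex_ok s1 s2, lact L D1 g = D1 *~ s1.1 + D2 *~ s2.1 &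
    lact L D2 g = D1 *~ s1.2 + D2 *~ s2.2]} -> signed e -> good_lattice gal L.
Proof.
move=> nL ws wD we Di DG eG T; pose ll (v : int * int) := D1 *~ v.1 + D2 *~ v.2.
have llB u v : ll (u.1 - v.1, u.2 - v.2) = ll u - ll v by rewrite /ll /= !mulrzBr opprD addrACA.
have ll_inj : injective ll.
  move=> [a b] [c d] /eqP; rewrite -subr_eq0 -llB => /eqP/Di[/eqP + /eqP].
  by rewrite /= !subr_eq0 => /eqP-> /eqP->.
pose D (i : 'I_3) := ll (hex_point i).
have DB i j : D i - D j = ll (hex_diff i j) by rewrite -llB.
have ex g : g \in G -> exists p : {perm 'I_3} * bool, forall i j, lact L (D i - D j) g =
    if p.2 then D (p.1 j) - D (p.1 i) else D (p.1 i) - D (p.1 j).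
  move=> Gg; have [s1 [s2 [ok e1 e2]]] := DG g Gg.
  have [h1 h2 _] := and3P ok.
  have /hasP[l /insertions_perm pl /hasP[sw _ /allP chk]] :=
    implyP (allP (allP hex_check _ h1) _ h2) ok.
  have sl : size l = 3 by rewrite (perm_size pl).
  have nl (i : 'I_3) : (nth 3%N l i < 3)%N.
    have : nth 3%N l i \in l by apply: mem_nth; rewrite sl ltn_ord.
    by rewrite (perm_mem pl) mem_iota.
  pose f (i : 'I_3) := Ordinal (nl i).
  have f_inj : injective f.
    move=> i j /(congr1 val)/eqP; rewrite /= nth_uniq ?sl ?(perm_uniq pl) // => /eqP.
    exact: val_inj.
  exists (perm f_inj, sw) => i j; rewrite /= !permE !DB.
  have io (m : 'I_3) : val m \in iota 0 3 by rewrite mem_iota /=.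
  have /eqP c := allP (chk _ (io i)) _ (io j).
  transitivity (ll (hex_mul s1 s2 (hex_diff i j))); last by rewrite c; case: (sw).
  rewrite /ll -[lact L _ g]/(lact_add L Gg _) raddfD !raddfMz /= e1 e2.
  rewrite !mulrzDl -!mulrzA addrACA -!mulrzDr ![_ * (hex_diff i j).1]mulrC.
  by [].
have [p pE] := choice_on (1%g, false) ex.
have D0 : D 0 = 0 by rewrite /D /ll /= !mulr0z addr0.
have other (i : 'I_3) : [/\ i != i + 1, i != i + 2 & i + 1 != i + 2].
  by case: i => -[|[|[|//]]] hi.
(* The permutation of the three points is determined by the action on their differences; this makes
   the chosen permutations multiplicative. *)
have uniqp (s t : {perm 'I_3}) (b c : bool) : (forall i j,
    (if b then D (s j) - D (s i) else D (s i) - D (s j)) =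
    (if c then D (t j) - D (t i) else D (t i) - D (t j))) -> s = t.
  move=> st; apply/permP => i; have [i1 i2 i3] := other i.
  have sne j : i != j -> s i != s j by rewrite (inj_eq perm_inj).
  have h1 := st i (i + 1); have h2 := st i (i + 2); move: h1 h2.
  have s1 := sne _ i1; have s2 := sne _ i2.
  rewrite !DB; case: b {st}; case: c => /ll_inj h1 /ll_inj h2.
  - by have [] := hex_diff_inj _ h1; rewrite 1?eq_sym.
  - have [|e1 e1'] := hex_diff_inj _ h1; first by rewrite eq_sym.
    have [|e2 e2'] := hex_diff_inj _ h2; first by rewrite eq_sym.
    by move: e1' i3; rewrite e2' => /perm_inj->; rewrite eqxx.
  - have [//|e1 e1'] := hex_diff_inj _ h1; have [//|e2 e2'] := hex_diff_inj _ h2.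
    by move: e1 i3; rewrite e2 => /perm_inj->; rewrite eqxx.
  by have [] := hex_diff_inj _ h1.
apply: (@rational_hexagon _ _ _ _ _ _ T isoG n D (fun g => (p g).1) (fun g => (p g).2) e w) => //.
- by move=> i; rewrite wD /D /ll; case: i => -[|[|//]] hi /=; rewrite mulr0z mulr1z ?addr0 ?add0r.
- move=> g h Gg Gh; apply: (uniqp _ _ (p (g * h)%g).2 ((p g).2 (+) (p h).2)) => i j.
  rewrite -pE ?groupM // lactM // pE // !permM.
  by case: (p g).2 => /=; rewrite pE //; case: (p h).2.
Qed.

(** Along a tree the edge functionals form, up to sign, a basis of the dual lattice that G permutes
    up to sign; so does then the dual basis [e] of L, and [rational_signed] applies. The hypothesis
    on l provides vertex potentials that jump along the l-th edge only. *)
Lemma good_tree (D : nat -> nat -> L -> int) E (t : seq (nat * nat)) : voronoi (rank L) D E ->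
  (forall i j, (i <= rank L)%N -> (j <= rank L)%N -> E i j = graph_of t i j) -> size t = rank L ->
  all (fun p => (p.1 <= rank L) && (p.2 <= rank L))%N t ->
  (forall x, (forall p, p \in t -> D p.1 p.2 x = 0) -> x = 0) ->
  (forall l, (l < rank L)%N -> exists c : nat -> int, forall m, (m < rank L)%N ->
    c (nth (0, 0)%N t m).1 - c (nth (0, 0)%N t m).2 = (l == m)) -> good_lattice gal L.
Proof.
move=> vo Et st /allP tn tinj dual T.
pose Y (m : nat) x := D (nth (0, 0)%N t m).1 (nth (0, 0)%N t m).2 x.
have Yin m : (m < rank L)%N -> nth (0, 0)%N t m \in t by move=> hm; rewrite mem_nth ?st.
have dual_ex (i : 'I_(rank L)) : exists x, forall m : 'I_(rank L), Y m x = (i == m).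
  have [c cP] := dual _ (ltn_ord i); have [x xP] := vo_surj vo c; exists x => m.
  by have /andP[h1 h2] := tn _ (Yin _ (ltn_ord m)); rewrite /Y xP // cP.
have [e eE] := choice dual_ex.
have Dxx i x : D i i x = 0 by have := vo_tri vo i i i x; move: (D _ _ _); lia.
have DN i j x : D j i x = - D i j x.
  by have := vo_tri vo i i j x; rewrite Dxx; move: (D _ _ _) (D _ _ _); lia.
have D0 i j : D i j 0 = 0 by have := voD vo i j 0 0; rewrite addr0; move: (D _ _ _); lia.
have DMn i j x (n : nat) : D i j (x *+ n) = D i j x * n%:Z.
  elim: n => [|n IH]; first by rewrite mulr0n D0 mulr0.
  by rewrite mulrS (voD vo) IH -add1n PoszD mulrDr mulr1.
have DNx i j x : D i j (- x) = - D i j x.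
  by have := voD vo i j x (- x); rewrite subrr D0; move: (D _ _ _) (D _ _ _); lia.
have DMz i j x (n : int) : D i j (x *~ n) = D i j x * n.
  by case: n => n; rewrite ?NegzE ?mulrNz ?DNx ?mulrN -?pmulrn DMn.
have Yinj x y : (forall m : 'I_(rank L), Y m x = Y m y) -> x = y.
  move=> h; apply/eqP; rewrite -subr_eq0; apply/eqP/tinj => p pt.
  have hm : (index p t < rank L)%N by rewrite -st index_mem.
  have := h (Ordinal hm); rewrite /Y /= nth_index // (voD vo) DNx => ->; exact: subrr.
have YG g (m : 'I_(rank L)) : g \in G -> exists (m' : 'I_(rank L)) (b : bool),
    forall x, Y m (lact L x g) = if b then - Y m' x else Y m' x.
  move=> Gg; have pin := Yin _ (ltn_ord m); have /andP[h1 h2] := tn _ pin.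
  have := vo_act vo Gg h1 h2; rewrite Et // graph_ofE -surjective_pairing pin.
  move=> /(_ isT)[i [j [hi hj + ijE]]]; rewrite Et // graph_ofE => /orP[ij|ij].
    have hm : (index (i, j) t < rank L)%N by rewrite -st index_mem.
    by exists (Ordinal hm), false => x; rewrite /Y ijE /= nth_index.
  have hm : (index (j, i) t < rank L)%N by rewrite -st index_mem.
  by exists (Ordinal hm), true => x; rewrite /Y ijE /= nth_index // -DN.
apply: (@rational_signed _ _ _ _ _ _ T isoG (rank L) e) => //.
  move=> x; exists [ffun i : 'I_(rank L) => Y i x]; apply: Yinj => m.
  rewrite /Y /zcomb (big_morph _ (voD vo _ _) (D0 _ _)) (bigD1 m) //= DMz -/(Y m (e m)) eE eqxx mul1r ffunE.
  by rewrite big1 ?addr0 // => i im; rewrite DMz -/(Y m (e i)) eE (negbTE im) mul0r.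
move=> g Gg i.
have [m gm] : exists m : 'I_(rank L), Y m (lact L (e i) g) != 0.
  apply: contrapT => no; have e0 : lact L (e i) g = lact L 0 g.
    apply: Yinj => m; rewrite -[lact L 0 g]/(lact_add L Gg 0) raddf0 /Y D0.
    by apply/eqP; rewrite -[_ == _]negbK; apply/negP => h; apply: no; exists m.
  have [inj _] : is_action G (lact L) by case: (lact L).
  by have := eE i i; rewrite (inj _ _ _ e0) /Y D0 eqxx.
have [m' [b bE]] := YG g m Gg.
have m'i : m' = i.
  by apply/eqP; rewrite [m' == i]eq_sym; move: gm; rewrite bE eE; case: (i == m') => //; case: (b).
have oth l : l != m -> Y l (lact L (e i) g) = 0.
  move=> lm; have [l' [c cE]] := YG g l Gg; rewrite cE eE; case: eqP => [il|_]; last by case: (c).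
  have h u : Y l u = if b (+) c then - Y m u else Y m u.
    have uE : u = lact L (lact L u g^-1%g) g by rewrite -lactM ?groupV // mulVg lact1.
    rewrite uE bE cE m'i -il; case: (b); case: (c) => //=; by rewrite opprK.
  by have := h (e l); rewrite !eE eqxx (negbTE lm); case: (_ (+) _).
exists m; have := bE (e i); rewrite m'i eE eqxx; case: (b) => gE; [right|left]; apply: Yinj => l.
  have YN : Y l (- e m) = - (m == l : int) by rewrite /Y DNx -/(Y l (e m)) eE.
  rewrite YN; have [ml|ml] := eqVneq m l; first by rewrite -ml gE.
  by rewrite oth 1?eq_sym.
by rewrite eE; have [<-|ml] := eqVneq m l; rewrite ?gE // oth // eq_sym.
Qed.

End Hexagonal.

Definition dot (u v : vec3) : int := u.1.1 * v.1.1 + u.1.2 * v.1.2 + u.2 * v.2.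
Definition vsub (u v : vec3) : vec3 := (u.1.1 - v.1.1, u.1.2 - v.1.2, u.2 - v.2).
Definition lin3 (s1 s2 s3 d : vec3) : vec3 :=
  (d.1.1 * s1.1.1 + d.1.2 * s2.1.1 + d.2 * s3.1.1, d.1.1 * s1.1.2 + d.1.2 * s2.1.2 + d.2 * s3.1.2,
   d.1.1 * s1.2 + d.1.2 * s2.2 + d.2 * s3.2).
Definition sgv (b : bool) (v : vec3) : vec3 := if b then (- v.1.1, - v.1.2, - v.2) else v.
Definition sperm_rows (c : sperm) (f : vec3 * vec3 * vec3) :=
  let: (a, b, d) := c.2 in let: (x, y, z) := permute3 c.1 f in (sgv a x, sgv b y, sgv d z).
Definition rows_at (f : vec3 * vec3 * vec3) (y : vec3) : vec3 := (dot f.1.1 y, dot f.1.2 y, dot f.2 y).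

Lemma sperm_rowsP c f y : rows_at (sperm_rows c f) y = sperm_act c (rows_at f y).
Proof.
have sd b v : dot (sgv b v) y = sg b (dot v y) by case: b => //; rewrite /dot /=; ring.
by case: c => p [[a b] d]; case: f => [[f1 f2] f3]; case: p => [|[|[|[|[|p]]]]];
  rewrite /rows_at /= !sd.
Qed.

Lemma dot_lin3 s1 s2 s3 d y : dot (lin3 s1 s2 s3 d) y = dot d (rows_at (s1, s2, s3) y).
Proof. rewrite /dot /lin3 /rows_at /dot /=; ring. Qed.

Lemma dot_inj u v : (forall y, dot u y = dot v y) -> u = v.
Proof.
move=> h; have := h (1, 0, 0); have := h (0, 1, 0); have := h (0, 0, 1); rewrite /dot /=.
by case: u {h} => [[a b] c]; case: v => [[a' b'] c'] /= *; apply: vec3_eq => /=; lia.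
Qed.

Definition e1 : vec3 := (1, 0, 0).
Definition e2 : vec3 := (0, 1, 0).
Definition e3 : vec3 := (0, 0, 1).

(** The difference of the vectors at i and j expresses the functional D i j in the basis D 0 1, D 0
    2, D 0 3 here, and D 0 1, D 1 2, D 2 3 for [co_path]. *)
Definition co_star (i : nat) : vec3 :=
  match i with O => (0, 0, 0) | S O => (-1, 0, 0) | S (S O) => (0, -1, 0) | _ => (0, 0, -1) end.
Definition co_path (i : nat) : vec3 :=
  match i with O => (0, 0, 0) | S O => (-1, 0, 0) | S (S O) => (-1, -1, 0) | _ => (-1, -1, -1) end.

Definition functionals (co : nat -> vec3) (t : seq (nat * nat)) :=
  flatten [seq [:: vsub (co p.1) (co p.2); vsub (co p.2) (co p.1)] | p <- t].
Definition permutes (S : seq vec3) (s1 s2 s3 : vec3) :=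
  let m := map (lin3 s1 s2 s3) S in if all (mem S) m then uniq m else false.
(** All linear maps that permute the edge functionals are tested; the elements of G are among
    them. *)
Definition for_permuting (S : seq vec3) (P : vec3 -> vec3 -> vec3 -> bool) :=
  all (fun s1 => all (fun s2 => all (fun s3 => if permutes S s1 s2 s3 then P s1 s2 s3 else true) S) S) S.
Definition frame_check (S : seq vec3) (f : vec3 * vec3 * vec3) := for_permuting S (fun s1 s2 s3 =>
  has (fun c => (lin3 s1 s2 s3 f.1.1, lin3 s1 s2 s3 f.1.2, lin3 s1 s2 s3 f.2) == sperm_rows c f) all_sperms).

(** * Coordinates and frames in rank three *)

Section RankThree.
Variables (gT : finGroupType) (G : {group gT}) (L : glattice G).
Variables (D : nat -> nat -> L -> int) (E : nat -> nat -> bool).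
Hypothesis vo : voronoi 3 D E.

Record coordinates (co : nat -> vec3) (Y : L -> vec3) : Prop := {
  co_D : forall i j x, (i <= 3)%N -> (j <= 3)%N -> D i j x = dot (vsub (co i) (co j)) (Y x);
  co_inj : injective Y;
  co_surj : forall y, exists x, Y x = y
}.

Lemma coordinates_of co Y (p1 p2 p3 : nat * nat) :
  (forall x, Y x = (D p1.1 p1.2 x, D p2.1 p2.2 x, D p3.1 p3.2 x)) ->
  all (fun p => (p.1 <= 3) && (p.2 <= 3))%N [:: p1; p2; p3] ->
  vsub (co p1.1) (co p1.2) = e1 -> vsub (co p2.1) (co p2.2) = e2 -> vsub (co p3.1) (co p3.2) = e3 ->
  (forall x i j, (i <= 3)%N -> (j <= 3)%N -> D i j x = dot (vsub (co i) (co j)) (Y x)) -> coordinates co Y.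
Proof.
move=> YE /and4P[/andP[a1 b1] /andP[a2 b2] /andP[a3 b3] _] h1 h2 h3 coD; split=> [i j x hi hj|x y xy|y].
- exact: coD.
- apply/eqP; rewrite -subr_eq0; apply/eqP/(vo_inj vo) => i hi.
  have D0 : D 0 i 0 = 0 by have := voD vo 0 i 0 0; rewrite addr0; move: (D _ _ _); lia.
  have := voD vo 0 i (x - y) y; rewrite subrK !(coD _ 0%N i) // xy; move: (dot _ _) (dot _ _); lia.
have [x xP] := vo_surj vo (fun i => dot (co i) y); exists x.
have dB u v : dot u y - dot v y = dot (vsub u v) y by rewrite /dot /vsub /=; ring.
rewrite YE !xP // !dB h1 h2 h3 /dot /e1 /e2 /e3 /=.
by case: y {xP dB} => [[a b] c] /=; apply: vec3_eq => /=; ring.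
Qed.

Lemma vo_diff0 i j x : D i j x = D 0 j x - D 0 i x.
Proof. by have := vo_tri vo 0 j i x; move: (D _ _ _) (D _ _ _) (D _ _ _); lia. Qed.
Lemma vo_diag i x : D i i x = 0. Proof. by rewrite vo_diff0 subrr. Qed.

Lemma star_coordinates : coordinates co_star (fun x => (D 0 1 x, D 0 2 x, D 0 3 x)).
Proof.
apply: (@coordinates_of _ _ (0, 1)%N (0, 2)%N (0, 3)%N) => // x i j.
have := vo_diag 0 x; rewrite (vo_diff0 i j) /dot.
by case: i => [|[|[|[|//]]]]; case: j => [|[|[|[|//]]]] /= d0 _ _; rewrite ?d0; ring.
Qed.

Lemma path_coordinates : coordinates co_path (fun x => (D 0 1 x, D 1 2 x, D 2 3 x)).
Proof.
apply: (@coordinates_of _ _ (0, 1)%N (1, 2)%N (2, 3)%N) => // x i j.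
have := vo_diag 0 x; rewrite (vo_diff0 i j) (vo_diff0 1 2) (vo_diff0 2 3) /dot.
by case: i => [|[|[|[|//]]]]; case: j => [|[|[|[|//]]]] /= d0 _ _; rewrite ?d0; ring.
Qed.

Section Action.
Variable t : seq (nat * nat).
Hypothesis Et : forall i j, (i <= 3)%N -> (j <= 3)%N -> E i j = graph_of t i j.
Hypothesis t3 : all (fun p => (p.1 <= 3) && (p.2 <= 3))%N t.
Variables (co : nat -> vec3) (Y : L -> vec3).
Hypothesis coP : coordinates co Y.
Local Notation S := (functionals co t).
Hypothesis S_units : all (fun e => e \in S) [:: e1; e2; e3].
Hypothesis S_uniq : uniq S.

Lemma functional_act g d : g \in G -> d \in S -> exists2 d', d' \in S &
  forall x, dot d (Y (lact L x g)) = dot d' (Y x).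
Proof.
move=> Gg /flattenP[_ /mapP[p pt ->]]; have /andP[h1 h2] := allP t3 _ pt.
have edge_act i j : (i <= 3)%N -> (j <= 3)%N -> graph_of t i j ->
    exists2 d', d' \in S & forall x, dot (vsub (co i) (co j)) (Y (lact L x g)) = dot d' (Y x).
  move=> hi hj; rewrite -Et // => ij; have [i' [j' [hi' hj' ij' ijE]]] := vo_act vo Gg hi hj ij.
  exists (vsub (co i') (co j')); last by move=> x; rewrite -!(co_D coP) // ijE.
  move: ij'; rewrite Et // graph_ofE => /orP[] q; apply/flattenP.
    by exists [:: vsub (co i') (co j'); vsub (co j') (co i')];
      rewrite ?inE ?eqxx //; apply/mapP; exists (i', j').
  by exists [:: vsub (co j') (co i'); vsub (co i') (co j')];
    rewrite ?inE ?eqxx ?orbT //; apply/mapP; exists (j', i').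
rewrite !inE => /orP[] /eqP->; apply: edge_act => //; rewrite graph_ofE -surjective_pairing pt ?orbT //.
Qed.

Lemma functional_frame g : g \in G -> exists s1 s2 s3, [/\ s1 \in S, s2 \in S, s3 \in S, permutes S s1 s2 s3 &
  forall x, Y (lact L x g) = rows_at (s1, s2, s3) (Y x)].
Proof.
move=> Gg; have /and4P[u1 u2 u3 _] := S_units.
have [s1 S1 a1] := functional_act Gg u1; have [s2 S2 a2] := functional_act Gg u2.
have [s3 S3 a3] := functional_act Gg u3.
have YE x : Y (lact L x g) = rows_at (s1, s2, s3) (Y x).
  rewrite /rows_at /= -a1 -a2 -a3; case: (Y _) => [[a b] c]; rewrite /dot /e1 /e2 /e3 /=.
  by apply: vec3_eq => /=; ring.
have linE d x : dot (lin3 s1 s2 s3 d) (Y x) = dot d (Y (lact L x g)) by rewrite dot_lin3 YE.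
exists s1, s2, s3; split=> //; rewrite /permutes ifT.
  rewrite map_inj_in_uniq // => d d' dS dS' e; apply: dot_inj => y.
  have [x <-] := co_surj coP y.
  have -> : x = lact L (lact L x g^-1%g) g by rewrite -lactM ?groupV // mulVg lact1.
  by rewrite -!linE e.
apply/allP => _ /mapP[d dS ->]; have [d' dS' dE] := functional_act Gg dS.
suff -> : lin3 s1 s2 s3 d = d' by [].
by apply: dot_inj => y; have [x <-] := co_surj coP y; rewrite linE dE.
Qed.

Lemma for_permutingP P g : for_permuting S P -> g \in G -> exists s1 s2 s3, P s1 s2 s3 /\
  forall x, Y (lact L x g) = rows_at (s1, s2, s3) (Y x).
Proof.
move=> chk Gg; have [s1 [s2 [s3 [h1 h2 h3 h e]]]] := functional_frame Gg; exists s1, s2, s3; split=> //.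
by have := allP (allP (allP chk _ h1) _ h2) _ h3; rewrite h.
Qed.

Lemma coYD : {morph Y : x y / x + y}.
Proof.
move=> x y; have /and4P[u1 u2 u3 _] := S_units.
have h d : d \in S -> dot d (Y (x + y)) = dot d (Y x) + dot d (Y y).
  move=> /flattenP[_ /mapP[p pt ->]]; have /andP[h1 h2] := allP t3 _ pt.
  by rewrite !inE => /orP[] /eqP->; rewrite -!(co_D coP) // (voD vo).
have := h _ u1; have := h _ u2; have := h _ u3; rewrite /dot /e1 /e2 /e3 /=.
by move: (Y (x + y)) (Y x) (Y y) => [[a b] c] [[a' b'] c'] [[a'' b''] c''] /= *; apply: vec3_eq => /=; lia.
Qed.

Lemma frame_of (lat : vec3 -> Prop) f : frame_check S f ->
  (forall y, lat (rows_at f y)) -> (forall v, lat v -> exists y, rows_at f y = v) ->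
  injective (rows_at f) -> frame lat (fun x => rows_at f (Y x)).
Proof.
move=> chk fl fs fi; split.
- by move=> x y; rewrite coYD; apply: vec3_eq; rewrite /rows_at /dot /=; ring.
- by move=> x y /fi/(co_inj coP).
- by move=> x.
- by move=> v /fs[y <-]; have [x <-] := co_surj coP y; exists x.
move=> g Gg; have [s1 [s2 [s3 [/hasP[c cin /eqP cE] YE]]]] := for_permutingP chk Gg.
exists c; first by move: cin; rewrite mem_sperms mem_iota.
by move=> x; rewrite -sperm_rowsP -cE /rows_at !dot_lin3 YE.
Qed.

End Action.
End RankThree.

(** The differences along the 4-cycle have sum 0; the rows are the sums of the first of them with
    each of the other three. *)
Lemma square_check : frame_check (functionals co_path square) ((1, 1, 0), (1, 0, 1), (0, -1, -1)).
Proof. by vm_compute. Qed.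
(** The rows are D 0 1, along the edge common to both triangles, and D 0 2 + D 1 2 and D 0 3 + D 1
    3, one for each triangle. *)
Lemma diamond_check : frame_check (functionals co_star diamond) ((1, 0, 0), (-1, 2, 0), (-1, 0, 2)).
Proof. by vm_compute. Qed.
(** The rows correspond to the three splittings of the vertices into pairs: the first is c_0 + c_1 -
    c_2 - c_3. *)
Lemma complete4_check : frame_check (functionals co_star complete4) ((-1, 1, 1), (1, -1, 1), (1, 1, -1)).
Proof. by vm_compute. Qed.
(** The functional of the pendant edge goes to itself or its opposite, and those of the triangle
    form a hexagon. *)
Lemma paw_check : for_permuting (functionals co_path paw) (fun s1 s2 s3 =>
  [&& s1.2 == 0, s2.2 == 0, hex_ok s1.1 s2.1 & (s3 == e3) || (s3 == (0, 0, -1))]).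
Proof. by vm_compute. Qed.

Lemma rows_at_inj f : det3 f.1.1 f.1.2 f.2 != 0 -> injective (rows_at f).
Proof.
move=> d y z e; have cof (u : vec3) : dot u y = dot u z <-> dot u (y - z) = 0.
  by rewrite /dot /=; split; lia.
have h1 : dot f.1.1 (y - z) = 0 by apply/cof; apply: (congr1 (fun v => v.1.1) e).
have h2 : dot f.1.2 (y - z) = 0 by apply/cof; apply: (congr1 (fun v => v.1.2) e).
have h3 : dot f.2 (y - z) = 0 by apply/cof; apply: (congr1 snd e).
have cramer (x : vec3 -> int) : (x = (fun v => v.1.1) \/ x = (fun v => v.1.2) \/ x = snd) -> x (y - z) = 0.
  move=> xP; suff /eqP : det3 f.1.1 f.1.2 f.2 * x (y - z) = 0 by rewrite mulf_eq0 (negbTE d) => /eqP.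
  move: h1 h2 h3 xP {d e cof}; rewrite /dot /det3; move: (y - z) => [[a b] c].
  case: f => [[[[f1 f2] f3] [[f4 f5] f6]] [[f7 f8] f9]] /= h1 h2 h3 [->|[->|->]] /=.
  - transitivity ((f1 * a + f2 * b + f3 * c) * (f5 * f9 - f6 * f8) - (f4 * a + f5 * b + f6 * c) * (f2 * f9 - f3 * f8)
      + (f7 * a + f8 * b + f9 * c) * (f2 * f6 - f3 * f5)); first by ring.
    by rewrite h1 h2 h3; ring.
  - transitivity (- (f1 * a + f2 * b + f3 * c) * (f4 * f9 - f6 * f7) + (f4 * a + f5 * b + f6 * c) * (f1 * f9 - f3 * f7)
      - (f7 * a + f8 * b + f9 * c) * (f1 * f6 - f3 * f4)); first by ring.
    by rewrite h1 h2 h3; ring.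
  transitivity ((f1 * a + f2 * b + f3 * c) * (f4 * f8 - f5 * f7) - (f4 * a + f5 * b + f6 * c) * (f1 * f8 - f2 * f7)
    + (f7 * a + f8 * b + f9 * c) * (f1 * f5 - f2 * f4)); first by ring.
  by rewrite h1 h2 h3; ring.
apply: vec3_eq; apply/eqP; rewrite -subr_eq0; apply/eqP.
- by apply: (cramer (fun v => v.1.1)); left.
- by apply: (cramer (fun v => v.1.2)); right; left.
by apply: (cramer snd); right; right.
Qed.

Section LowRank.
Variables (k : fieldType) (K : splittingFieldType k).
Variables (gT : finGroupType) (G : {group gT}).
Variables (gal : {morphism G >-> gal_of {:K}}).
Hypothesis isoG : isom G 'Gal({:K} / 1) gal.
Variable L : glattice G.

Lemma paw_good (D : nat -> nat -> L -> int) E : rank L = 3 -> voronoi 3 D E ->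
  (forall i j, (i <= 3)%N -> (j <= 3)%N -> E i j = graph_of paw i j) -> good_lattice gal L.
Proof.
move=> rkL vo Et; have t3 : all (fun p => (p.1 <= 3) && (p.2 <= 3))%N paw by [].
have coP := path_coordinates vo; set Y := (fun x => _ : vec3) in coP.
have Su : all (fun e => e \in functionals co_path paw) [:: e1; e2; e3] by [].
have Sq : uniq (functionals co_path paw) by [].
have YD : {morph Y : x y / x + y} := coYD vo t3 coP Su Sq.
have act := for_permutingP vo Et t3 coP Su Sq paw_check.
have [D1 D1E] := co_surj coP (1, 0, 0); have [D2 D2E] := co_surj coP (0, 1, 0).
have [D3 D3E] := co_surj coP (0, 0, 1).
have Y0 : Y 0 = 0 by apply: (addrI (Y 0)); rewrite -YD !addr0.
have YN x : Y (- x) = - Y x by apply/eqP; rewrite -addr_eq0 -YD addNr Y0.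
have YMz x (n : int) : Y (x *~ n) = Y x *~ n.
  have h (m : nat) : Y (x *+ m) = Y x *+ m.
    by elim: m => [|m IH]; rewrite ?mulr0n ?Y0 // !mulrS YD IH.
  by case: n => m; rewrite ?NegzE ?mulrNz ?YN -?pmulrn h.
pose w (i : 'I_(2 + 1)) := if i == 0 then D1 else if i == 1 then D2 else D3.
apply: (@good_hexagon _ _ _ _ _ isoG L 1 D1 D2 (fun=> D3) w) => //.
- by rewrite rkL.
- move=> x; exists [ffun i : 'I_(2 + 1) => if i == 0 then (Y x).1.1 else if i == 1 then (Y x).1.2 else (Y x).2].
  apply: (co_inj coP); rewrite /zcomb !big_ord_recl big_ord0 !ffunE /w /= !YD !YMz D1E D2E D3E Y0 !vec3Mz.
  by apply: vec3_eq => /=; ring.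
- by case=> -[|[|//]] hi.
- move=> a b /(congr1 Y); rewrite YD !YMz D1E D2E Y0 !vec3Mz => e.
  by move: (congr1 (fun v => v.1.1) e) (congr1 (fun v => v.1.2) e) => /=; lia.
- move=> g Gg; have [s1 [s2 [s3 [/and4P[/eqP z1 /eqP z2 ok s3E] YE]]]] := act g Gg.
  exists s1.1, s2.1; split=> //; apply: (co_inj coP); rewrite YE YD !YMz D1E D2E !vec3Mz /rows_at /dot /=.
    by case/orP: s3E => /eqP->; apply: vec3_eq => /=; ring.
  by case/orP: s3E => /eqP->; apply: vec3_eq => /=; ring.
move=> g Gg i; have [s1 [s2 [s3 [/and4P[/eqP z1 /eqP z2 ok s3E] YE]]]] := act g Gg; exists i.
case/orP: s3E YE => /eqP-> YE; [left|right]; apply: (co_inj coP);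
  rewrite YE ?YN D3E /rows_at /dot /= z1 z2; apply: vec3_eq => /=; ring.
Qed.

Lemma triangle_good (D : nat -> nat -> L -> int) E : rank L = 2%N -> voronoi 2 D E ->
  (forall i j, (i <= 2)%N -> (j <= 2)%N -> E i j = graph_of triangle i j) -> good_lattice gal L.
Proof.
move=> rkL vo Et.
have [x1 x1E] := vo_surj vo (fun i => (i == 0%N : int)).
have [x2 x2E] := vo_surj vo (fun i => ((i <= 1)%N : int)).
have Dxx i x : D i i x = 0 by have := vo_tri vo i i i x; move: (D _ _ _); lia.
have D02 x : D 0%N 2%N x = D 0%N 1%N x + D 1%N 2%N x by apply: (vo_tri vo).
have DN i j x : D j i x = - D i j x.
  by have := vo_tri vo i i j x; rewrite Dxx; move: (D _ _ _) (D _ _ _); lia.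
have D0 i j : D i j 0 = 0 by have := voD vo i j 0 0; rewrite addr0; move: (D _ _ _); lia.
have DNx i j x : D i j (- x) = - D i j x.
  by have := voD vo i j x (- x); rewrite subrr D0; move: (D _ _ _) (D _ _ _); lia.
have DMz i j x (n : int) : D i j (x *~ n) = D i j x * n.
  have h (m : nat) : D i j (x *+ m) = D i j x * m%:Z.
    elim: m => [|m IH]; first by rewrite mulr0n D0 mulr0.
    by rewrite mulrS (voD vo) IH -add1n PoszD mulrDr mulr1.
  by case: n => m; rewrite ?NegzE ?mulrNz ?DNx ?mulrN -?pmulrn h.
have inj x y : D 0%N 1%N x = D 0%N 1%N y -> D 1%N 2%N x = D 1%N 2%N y -> x = y.
  move=> e1 e2; apply/eqP; rewrite -subr_eq0; apply/eqP/(vo_inj vo) => i hi.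
  have e i' j' : D i' j' x = D i' j' y -> D i' j' (x - y) = 0.
    by move=> h; rewrite (voD vo) DNx h subrr.
  by case: i hi => [|[|[|//]]] _; rewrite ?Dxx //; apply: e => //; rewrite !D02 e1 e2.
have a1 : D 0%N 1%N x1 = 1 by rewrite x1E. have a2 : D 1%N 2%N x1 = 0 by rewrite x1E.
have b1 : D 0%N 1%N x2 = 0 by rewrite x2E. have b2 : D 1%N 2%N x2 = 1 by rewrite x2E.
pose w (i : 'I_(2 + 0)) := if i == 0 then x1 else x2.
apply: (@good_hexagon _ _ _ _ _ isoG L 0 x1 x2 (fun=> 0) w) => //.
- by rewrite rkL.
- move=> x; exists [ffun i : 'I_(2 + 0) => if i == 0 then D 0%N 1%N x else D 1%N 2%N x].
  by apply: inj; rewrite /zcomb !big_ord_recl big_ord0 !ffunE /w /= !(voD vo) !DMz ?a1 ?a2 ?b1 ?b2 D0; ring.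
- by case=> -[|[|//]] hi.
- move=> a b e; move: (congr1 (D 0%N 1%N) e) (congr1 (D 1%N 2%N) e).
  by rewrite !(voD vo) !DMz !D0 a1 a2 b1 b2; lia.
- move=> g Gg; pose v i j : int * int := (D i j x1, D i j x2).
  have vroot i j : (i <= 2)%N -> (j <= 2)%N -> E i j -> v i j \in hex_roots.
    move=> hi hj; rewrite Et // /v; have := D02 x1; have := D02 x2; rewrite a1 a2 b1 b2.
    by case: i hi => [|[|[|//]]] _; case: j hj => [|[|[|//]]] _ //= e e';
      rewrite ?[D 1%N 0%N _]DN ?[D 2%N _ _]DN ?e ?e' ?a1 ?a2 ?b1 ?b2.
  have edge i j : (i <= 2)%N -> (j <= 2)%N -> E i j -> (D i j (lact L x1 g), D i j (lact L x2 g)) \in hex_roots.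
    by move=> hi hj ij; have [i' [j' [hi' hj' ij' h]]] := vo_act vo Gg hi hj ij; rewrite !h; apply: vroot.
  exists (D 0%N 1%N (lact L x1 g), D 0%N 1%N (lact L x2 g)), (D 1%N 2%N (lact L x1 g), D 1%N 2%N (lact L x2 g)).
  split.
  + by rewrite /hex_ok !edge ?Et //= -!D02 edge ?Et.
  + by apply: inj; rewrite !(voD vo) !DMz ?a1 ?a2 ?b1 ?b2; ring.
  by apply: inj; rewrite !(voD vo) !DMz ?a1 ?a2 ?b1 ?b2; ring.
by move=> g Gg [].
Qed.

Lemma classified2 : classified 2 [:: [:: (0, 1)%N]].
Proof. by vm_compute. Qed.

(** Trees give signed bases; the triangle and the paw give a hexagon, the paw with one more signed
    vector. The square carries a face-centred frame, the diamond and the complete graph body-centred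
    ones, and only there bad groups occur. *)
Theorem low_rank_dichotomy : (0 < rank L <= 3)%N -> good_lattice gal L \/ bad_lattice gal L.
Proof.
move=> rk; have [D0 [E0 vo0]] := voronoi_ex rk.
have [r1|[r2|r3]] : rank L = 1%N \/ rank L = 2%N \/ rank L = 3%N by lia.
- left; rewrite r1 in vo0; have [t [D [E [+ vo Et]]]] := voronoi_normal classified2 vo0.
  rewrite inE => /eqP tE; rewrite {}tE in Et.
  apply: (@good_tree _ _ _ _ _ isoG L D E [:: (0, 1)%N]); rewrite ?r1 //.
    move=> x h; apply: (vo_inj vo) => -[|[|//]] _; last by apply: (h (0, 1)%N).
    by have := vo_tri vo 0 0 0 x; move: (D _ _ _); lia.
  by case=> // _; exists (fun i => (i == 0%N : int)) => -[].
- left; rewrite r2 in vo0; have [t [D [E [+ vo Et]]]] := voronoi_normal classified3 vo0.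
  rewrite !inE => /orP[] /eqP tE; rewrite {}tE in Et; last exact: (triangle_good (D := D) (E := E)).
  apply: (@good_tree _ _ _ _ _ isoG L D E path3); rewrite ?r2 //.
    move=> x h; have h1 := h (0, 1)%N isT; have h2 := h (1, 2)%N isT; rewrite /= in h1 h2.
    apply: (vo_inj vo) => -[|[|[|//]]] _ //.
      by have := vo_tri vo 0 0 0 x; move: (D _ _ _); lia.
    by rewrite (vo_tri vo _ _ 1%N) h1 h2.
  by case=> [|[|//]] _; [exists (fun i => (i == 0%N : int)) | exists (fun i => ((i <= 1)%N : int))] => -[|[|//]].
rewrite r3 in vo0; have [t [D [E [+ vo Et]]]] := voronoi_normal classified4 vo0.
have st := star_coordinates vo; have pa := path_coordinates vo.
rewrite !inE => /or4P[/eqP tE|/eqP tE|/eqP tE|/or3P[/eqP tE|/eqP tE|/eqP tE]]; rewrite {}tE in Et.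
- left; apply: (@good_tree _ _ _ _ _ isoG L D E star4); rewrite ?r3 //.
    move=> x h; apply: (vo_inj vo) => -[|[|[|[|//]]]] _.
    + exact: (vo_diag vo).
    + exact: (h (0, 1)%N isT).
    + exact: (h (0, 2)%N isT).
    exact: (h (0, 3)%N isT).
  by case=> [|[|[|//]]] _; [exists (fun i => - (i == 1%N : int)) | exists (fun i => - (i == 2%N : int))
    | exists (fun i => - (i == 3%N : int))] => -[|[|[|//]]].
- left; apply: (@good_tree _ _ _ _ _ isoG L D E path4); rewrite ?r3 //.
    move=> x h; have h1 := h (0, 1)%N isT; have h2 := h (1, 2)%N isT; have h3 := h (2, 3)%N isT.
    rewrite /= in h1 h2 h3; apply: (vo_inj vo) => -[|[|[|[|//]]]] _ //.
    + exact: (vo_diag vo).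
    + by rewrite (vo_tri vo _ _ 1%N) h1 h2.
    by rewrite (vo_tri vo _ _ 2%N) (vo_tri vo _ 2%N 1%N) h1 h2 h3.
  by case=> [|[|[|//]]] _; [exists (fun i => (i == 0%N : int)) | exists (fun i => ((i <= 1)%N : int))
    | exists (fun i => ((i <= 2)%N : int))] => -[|[|[|//]]].
- by left; apply: (paw_good (D := D) (E := E)).
- apply: (fcc_good_or_bad isoG r3 (F := fun x => rows_at ((1, 1, 0), (1, 0, 1), (0, -1, -1)) _)).
  apply: (frame_of vo Et _ pa _ _ square_check) => //.
  + by move=> [[a b] c]; exists a; rewrite /rows_at /dot /=; ring.
  + move=> [[p q] r] [c /= e]; exists (c, p - c, q - c); rewrite /rows_at /dot /=.
    by apply: vec3_eq => /=; lia.
  exact: rows_at_inj.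
- apply: (bcc_good_or_bad isoG r3 (F := fun x => rows_at ((1, 0, 0), (-1, 2, 0), (-1, 0, 2)) _)).
  apply: (frame_of vo Et _ st _ _ diamond_check) => //.
  + by move=> [[a b] c]; exists b, (b + c - a); rewrite /rows_at /dot /=; split; ring.
  + move=> [[p q] r] [c [d [/= e e']]]; exists (p, c, d - q + c); rewrite /rows_at /dot /=.
    by apply: vec3_eq => /=; lia.
  exact: rows_at_inj.
apply: (bcc_good_or_bad isoG r3 (F := fun x => rows_at ((-1, 1, 1), (1, -1, 1), (1, 1, -1)) _)).
apply: (frame_of vo Et _ st _ _ complete4_check) => //.
+ by move=> [[a b] c]; exists c, a; rewrite /rows_at /dot /=; split; ring.
+ move=> [[p q] r] [c [d [/= e e']]]; exists (d, c + d - q, c); rewrite /rows_at /dot /=.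
  by apply: vec3_eq => /=; lia.
exact: rows_at_inj.
Qed.

End LowRank.

Section LowRankSummands.
Variables (k : fieldType) (K : splittingFieldType k).
Variables (gT : finGroupType) (G : {group gT}).
Variables (gal : {morphism G >-> gal_of {:K}}).
Hypotheses (galoisK : galois 1 {:K}) (isoG : isom G 'Gal({:K} / 1) gal).
Variables M M1 M2 : glattice G.

Lemma bad_not_rational : bad_lattice gal M1 -> direct_sum M M1 M2 -> ~ rational (base gal M).
Proof.
move=> bad [f [fb fG]] /(torus_rationalP _ galoisK isoG); have [h hf fh] := fb.
have hB : zmod_morphism (fun m => (h m).1).
  move=> x y; rewrite -[x in LHS]fh -[y in LHS]fh -raddfB hf //.
pose pr : {additive M -> M1} := HB.pack (fun m => (h m).1) (GRing.isZmodMorphism.Build _ _ _ hB).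
apply: (bad M (ratfun_torus gal M) (dinl f) pr).
- by move=> m; rewrite /= /dinl hf.
- exact: dinl_act.
move=> g Gg m /=; rewrite -{1}[m]fh; by rewrite -fG // hf.
Qed.

Lemma direct_sumC : direct_sum M M1 M2 -> direct_sum M M2 M1.
Proof.
move=> [f [[h hf fh] fG]].
have fB : zmod_morphism (fun x : M2 * M1 => f (x.2, x.1)).
  by move=> x y; rewrite -raddfB.
pose f' : {additive M2 * M1 -> M} := HB.pack (fun x : M2 * M1 => f (x.2, x.1)) (GRing.isZmodMorphism.Build _ _ _ fB).
exists f'; split.
  exists (fun m => ((h m).2, (h m).1)) => [[x y]|m] /=; first by rewrite hf.
  by rewrite -[RHS]fh [h m in RHS]surjective_pairing.
by move=> g Gg [x y] /=; rewrite -(fG _ Gg).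
Qed.

End LowRankSummands.

(** A summand of rank at most 3 is good, and then rational, or bad, and then no lattice containing
    it as a summand is rational, whatever its rank. *)
Theorem rational_summands (k : fieldType) (K : splittingFieldType k)
    (gT : finGroupType) (G : {group gT}) (gal : {morphism G >-> gal_of {:K}})
    (M M1 M2 : glattice G) : galois 1 {:K} -> isom G 'Gal({:K} / 1) gal ->
  direct_sum M M1 M2 -> (rank M1 <= 3)%N -> rational (base gal M) -> rational (base gal M1).
Proof.
move=> galoisK isoG dec r1 ratM; apply/(torus_rationalP _ galoisK isoG).
have [r0|r0] := posnP (rank M1).
  apply: (@rational_signed _ _ _ _ _ _ _ isoG _ (lbasis M1)) => //.
    by move=> x; exists (lcoord x); apply: lcoordK.
  move=> g Gg i; suff : (i < 0)%N by [].
  by rewrite -[X in (_ < X)%N]r0 ltn_ord.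
have {r0}r1 : (0 < rank M1 <= 3)%N by rewrite r0.
have [good|bad] := low_rank_dichotomy isoG r1; first exact: good.
by case: (bad_not_rational galoisK isoG bad dec).
Qed.

(** * Retract rationality *)

Lemma rmorph_mmap (R : nzRingType) (S : comNzRingType) n (h : {rmorphism {mpoly R[n]} -> S}) p :
  h p = mmap (h \o @mpolyC n R) (fun i => h 'X_i) p.
Proof.
rewrite {1}[p]mpolyE rmorph_sum /mmap; apply: eq_bigr => m _.
rewrite -mul_mpolyC rmorphM; congr (_ * _).
by rewrite mpolyXE_id rmorph_prod; apply: eq_bigr => i _; rewrite rmorphXn.
Qed.

Lemma mmap_rpred (k F : fieldType) (iota : {rmorphism k -> F}) n (y : 'I_n -> F) (S : subringClosed F) p :
  (forall c, iota c \in S) -> (forall i, y i \in S) -> mmap iota y p \in S.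
Proof.
move=> iS yS; apply: rpred_sum => m _; apply: rpredM => //.
by apply: rpred_prod => i _; apply: rpredX.
Qed.

Lemma subf_div (F : fieldType) (a b c d : F) : b != 0 -> d != 0 ->
  (a * d - c * b) / (b * d) = a / b - c / d.
Proof. by move=> b0 d0; field; rewrite b0 d0. Qed.
Lemma invf_divM (F : fieldType) (a b c : F) : a != 0 -> b != 0 -> (a / b)^-1 * (c * a) = c * b.
Proof. by move=> a0 b0; field; rewrite a0 b0. Qed.

Section SubringVal.
Variables (E : fieldType) (S : subringClosed E).
Implicit Types a b : subring_of S.
Lemma subring_valM a b : val (a * b) = val a * val b. Proof. exact: rmorphM. Qed.
Lemma subring_valB a b : val (a - b) = val a - val b. Proof. exact: rmorphB. Qed.
Lemma subring_val1 : val (1 : subring_of S) = 1. Proof. exact: rmorph1. Qed.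
Lemma subring_valX a n : val (a ^+ n) = val a ^+ n. Proof. exact: rmorphXn. Qed.
End SubringVal.

(** * Retractions as homomorphisms to a local ring *)

Section LocalRetract.
Variables (k F : fieldType) (iota : {rmorphism k -> F}).

(* An embedding of F into the local ring at y of k[X], split by evaluation at y. *)
Definition splits m (y : 'I_m -> F) (Phi : F -> {fraction {mpoly k[m]}}) x := exists p q : {mpoly k[m]},
  [/\ mmap iota y q != 0, Phi x * tofrac q = tofrac p & mmap iota y p = x * mmap iota y q].
Definition local_retract : Prop := exists m (y : 'I_m -> F) (Phi : {rmorphism F -> {fraction {mpoly k[m]}}}),
  (forall c, Phi (iota c) = fracC m c) /\ forall x, splits y Phi x.

Section ToLocal.
Variables (A : subringClosed F) (m : nat) (f : {mpoly k[m]}).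
Variables (phi : {rmorphism subring_of A -> subring_of (away f)})
          (psi : {rmorphism subring_of (away f) -> subring_of A}).
Hypothesis kA : forall c, iota c \in A.
Hypothesis fracA : forall x : F, exists a b, [/\ a \in A, b \in A, b != 0 & x = a / b].
Hypothesis f0 : f != 0.
Hypothesis phiC : forall (c : k) (a : subring_of A), val a = iota c -> val (phi a) = fracC m c.
Hypothesis psiC : forall (c : k) (b : subring_of (away f)), val b = fracC m c -> val (psi b) = iota c.
Hypothesis phiK : cancel phi psi.

Let inA x (Ax : x \in A) : subring_of A := exist _ x Ax.
Let inf x (fx : x \in away f) : subring_of (away f) := exist _ x fx.

Let poly_away p : tofrac p \in away f.
Proof. by apply/awayP; exists 0, p; rewrite mulr1. Qed.
Let inc p := inf (poly_away p).

Let ev p := val (psi (inc p)).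
Let ev_zmod : zmod_morphism ev.
Proof.
move=> p q; rewrite /ev; have -> : inc (p - q) = inc p - inc q by apply: val_inj; rewrite /= rmorphB.
by rewrite rmorphB; apply: rmorphB.
Qed.
Let ev_monoid : monoid_morphism ev.
Proof.
split=> [|p q]; rewrite /ev.
  have -> : inc 1 = 1 by apply: val_inj; rewrite /= rmorph1.
  by rewrite rmorph1.
have -> : inc (p * q) = inc p * inc q by apply: val_inj; rewrite /= rmorphM.
by rewrite rmorphM; apply: rmorphM.
Qed.
Let evr : {rmorphism {mpoly k[m]} -> F} :=
  HB.pack ev (GRing.isZmodMorphism.Build _ _ _ ev_zmod) (GRing.isMonoidMorphism.Build _ _ _ ev_monoid).

Let y i := ev 'X_i.
Let evE p : ev p = mmap iota y p.
Proof.
rewrite -[LHS]/(evr p) rmorph_mmap; apply: eq_bigr => n _; congr (_ * _).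
exact: psiC.
Qed.

Let f_unit : (tofrac f)^-1 \in away f.
Proof. by apply/awayP; exists 1, 1; rewrite expr1 mulVf ?tofrac_eq0 // rmorph1. Qed.

Let evf : ev f != 0.
Proof.
apply/eqP => e; have h : psi (inc f) * psi (inf f_unit) = 1.
  rewrite -rmorphM; have -> : inc f * inf f_unit = 1 by apply: val_inj; rewrite /= divff ?tofrac_eq0.
  exact: rmorph1.
have /eqP := congr1 val h; rewrite subring_valM subring_val1 -/(ev f) e mul0r.
by rewrite eq_sym oner_eq0.
Qed.

Let ev_phi a e p : val (phi a) * tofrac f ^+ e = tofrac p -> ev p = val a * ev f ^+ e.
Proof.
move=> ap; have : inc p = phi a * inc f ^+ e.
  by apply: val_inj; rewrite subring_valM subring_valX ap.
move/(congr1 psi); rewrite rmorphM rmorphXn phiK => /(congr1 val) E.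
by rewrite /ev E subring_valM subring_valX.
Qed.

Let ex_frac x : exists ab : subring_of A * subring_of A, val ab.2 != 0 /\ x = val ab.1 / val ab.2.
Proof. by have [a [b [Aa Ab b0 ->]]] := fracA x; exists (inA Aa, inA Ab). Qed.
Let rep x := projT1 (cid (ex_frac x)).
Let repP x : val (rep x).2 != 0 /\ x = val (rep x).1 / val (rep x).2. Proof. exact: (projT2 (cid (ex_frac x))). Qed.

Let Phi x := val (phi (rep x).1) / val (phi (rep x).2).

(** Injectivity of [phi], from its left inverse [psi], is what lets it extend to fractions. *)
Let phi_eq0 b : (val (phi b) == 0) = (val b == 0).
Proof.
apply/eqP/eqP => h.
  have /(congr1 psi) : phi b = 0 by apply: val_inj.
  by rewrite phiK rmorph0 => ->.
have -> : b = 0 by apply: val_inj.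
by rewrite rmorph0.
Qed.

Let PhiE a b x : val b != 0 -> x * val b = val a -> Phi x = val (phi a) / val (phi b).
Proof.
move=> b0 xab; have [r0 rE] := repP x; apply/eqP; rewrite /Phi eqr_div ?phi_eq0 //.
have e : (rep x).1 * b = a * (rep x).2.
  have r1E : val (rep x).1 = x * val (rep x).2 by rewrite [X in X * _]rE divfK.
  by apply: val_inj; rewrite !subring_valM -xab r1E mulrAC.
have E : phi (rep x).1 * phi b = phi a * phi (rep x).2 by rewrite -!rmorphM e.
by rewrite -!subring_valM E.
Qed.

Let Phi_zmod : zmod_morphism Phi.
Proof.
move=> x z; have [x0 xE] := repP x; have [z0 zE] := repP z; rewrite {2 3}/Phi.
rewrite (@PhiE ((rep x).1 * (rep z).2 - (rep z).1 * (rep x).2) ((rep x).2 * (rep z).2)).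
- have -> : phi ((rep x).1 * (rep z).2 - (rep z).1 * (rep x).2) =
      phi (rep x).1 * phi (rep z).2 - phi (rep z).1 * phi (rep x).2 by rewrite rmorphB !rmorphM.
  rewrite [phi (_ * _)]rmorphM subring_valB !subring_valM; apply: subf_div.
    by rewrite phi_eq0.
  by rewrite phi_eq0.
- by rewrite subring_valM mulf_neq0.
rewrite {1}xE {1}zE subring_valB !subring_valM; field; by rewrite x0 z0.
Qed.

Let val_phiM a b : val (phi (a * b)) = val (phi a) * val (phi b).
Proof. by rewrite [phi _]rmorphM subring_valM. Qed.

Let Phi_monoid : monoid_morphism Phi.
Proof.
split=> [|x z].
  rewrite (@PhiE 1 1) ?oner_neq0 ?mulr1 //; first by rewrite rmorph1 divr1.
have [x0 xE] := repP x; have [z0 zE] := repP z; rewrite {2 3}/Phi.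
rewrite (@PhiE ((rep x).1 * (rep z).1) ((rep x).2 * (rep z).2)).
- by rewrite !val_phiM; symmetry; apply: mulf_div.
- by rewrite subring_valM mulf_neq0.
rewrite {1}xE {1}zE !subring_valM; field; by rewrite x0 z0.
Qed.

Lemma retract_splits : local_retract.
Proof.
pose Phir : {rmorphism F -> {fraction {mpoly k[m]}}} := HB.pack Phi
  (GRing.isZmodMorphism.Build _ _ _ Phi_zmod) (GRing.isMonoidMorphism.Build _ _ _ Phi_monoid).
exists m, y, Phir; split=> [c|x].
  rewrite -[LHS]/(Phi _) (@PhiE (inA (kA c)) 1) ?oner_neq0 ?mulr1 //.
  by rewrite rmorph1 divr1; apply: phiC.
rewrite /splits -[Phir x]/(Phi x) /Phi; have [b0 xE] := repP x.
move: (rep x).1 (rep x).2 b0 xE => a b b0 xE.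
have /awayP[e [p ap]] := valP (phi a); have /awayP[d [q bq]] := valP (phi b).
exists (p * f ^+ d), (q * f ^+ e); rewrite -!evE -![ev (_ * _)]/(evr (_ * _)) !rmorphM !rmorphXn /=.
rewrite (ev_phi ap) (ev_phi bq); split.
- by rewrite mulf_neq0 ?expf_neq0 ?mulf_neq0 ?expf_neq0 ?evf ?b0.
- rewrite -ap -bq mulrA mulrA divfK ?phi_eq0 //; by rewrite mulrAC.
by rewrite {1}xE; field.
Qed.

End ToLocal.

Lemma retract_rational_local : retract_rational iota -> local_retract.
Proof.
move=> [A [kA fracA [m [f [f0 [phi [psi [phiC psiC phiK]]]]]]]].
exact: (@retract_splits A m f phi psi).
Qed.

Section OfLocal.
Variables (m : nat) (y : 'I_m -> F) (Phi : {rmorphism F -> {fraction {mpoly k[m]}}}) (f : {mpoly k[m]}).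

Definition regular : {pred F} := fun x => Phi x \in away f.
Lemma regular_subring_closed : subring_closed regular.
Proof.
have rE x : (x \in regular) = (Phi x \in away f) by [].
split=> [|a b|a b]; rewrite !rE ?rmorph1 ?rmorphB ?rmorphM; first exact: rpred1.
  exact: rpredB.
exact: rpredM.
Qed.
HB.instance Definition _ := GRing.isSubringClosed.Build F regular regular_subring_closed.

Hypothesis PhiC : forall c, Phi (iota c) = fracC m c.
Hypothesis PhiP : forall x, splits y Phi x.
Local Notation ev := (mmap iota y).

Lemma splits_ev x p q : Phi x * tofrac q = tofrac p -> ev p = x * ev q.
Proof.
move=> e; have [p0 [q0 [q00 e0 E0]]] := PhiP x; apply: (mulIf q00).
have : p * q0 = p0 * q.
  by apply/eqP; rewrite -tofrac_eq !rmorphM /= -e -e0 mulrAC.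
by move/(congr1 ev); rewrite !rmorphM /= E0 => ->; rewrite mulrAC.
Qed.

Hypothesis evf : ev f != 0.
Hypothesis ev_regular : forall p, ev p \in regular.
Hypothesis evf_regular : (ev f)^-1 \in regular.

Let ex_away x : exists r : nat * {mpoly k[m]}, x \in away f -> x * tofrac f ^+ r.1 = tofrac r.2.
Proof.
have [/awayP[e [p E]]|_] := boolP (x \in away f); first by exists (e, p).
by exists (0%N, 0).
Qed.
Let num x := projT1 (cid (ex_away x)).
Let evl x := ev (num x).2 / ev f ^+ (num x).1.
Let evlE x e p : x * tofrac f ^+ e = tofrac p -> evl x = ev p / ev f ^+ e.
Proof.
move=> E; have xf : x \in away f by apply/awayP; exists e, p.
have := projT2 (cid (ex_away x)) xf; rewrite -/(num x) => E'.
apply/eqP; rewrite /evl eqr_div ?expf_neq0 // -!rmorphXn -!rmorphM /=; apply/eqP; congr (ev _).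
by apply/eqP; rewrite -tofrac_eq !rmorphM !rmorphXn /= -E -E' mulrAC.
Qed.

Let evl_regular x : x \in away f -> evl x \in regular.
Proof. by move=> _; rewrite /evl -exprVn rpredM ?rpredX. Qed.

Let phi0 (a : subring_of regular) : subring_of (away f) := exist _ (Phi (val a)) (valP a).
Let psi0 (b : subring_of (away f)) : subring_of regular := exist _ (evl (val b)) (evl_regular (valP b)).

Let phi_zmod : zmod_morphism phi0. Proof. by move=> a b; apply: val_inj; rewrite /= rmorphB. Qed.
Let phi_monoid : monoid_morphism phi0.
Proof. by split=> [|a b]; apply: val_inj; rewrite /= ?rmorph1 ?rmorphM. Qed.
Let psi_zmod : zmod_morphism psi0.
Proof.
move=> a b; apply: val_inj => /=; have /awayP[e [p E]] := valP a; have /awayP[d [q D]] := valP b.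
rewrite (evlE E) (evlE D) (@evlE _ (e + d) (p * f ^+ d - q * f ^+ e)).
  by rewrite rmorphB !rmorphM !rmorphXn /= exprD; field; rewrite !expf_neq0.
rewrite rmorphB !rmorphM !rmorphXn /= -E -D exprD mulrBl; congr (_ - _); first by rewrite mulrA.
by rewrite mulrA mulrAC.
Qed.
Let psi_monoid : monoid_morphism psi0.
Proof.
split=> [|a b]; apply: val_inj => /=.
  by rewrite (@evlE _ 0 1) ?rmorph1 ?mulr1 // divr1.
have /awayP[e [p E]] := valP a; have /awayP[d [q D]] := valP b.
rewrite (evlE E) (evlE D) (@evlE _ (e + d) (p * q)) ?rmorphM /=; first by rewrite exprD mulf_div.
by rewrite -E -D exprD mulrACA.
Qed.

Lemma regular_retract : retract_rational iota.
Proof.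
exists (regular : subringClosed F); split.
- move=> c; rewrite unfold_in /= PhiC; apply/awayP; exists 0, (c%:MP); by rewrite mulr1.
- move=> x; have [p [q [q0 _ E]]] := PhiP x; exists (ev p), (ev q); split=> //.
  by rewrite E mulfK.
exists m, f; split; first by apply: contraNneq evf => ->; rewrite rmorph0.
pose phi : {rmorphism subring_of regular -> subring_of (away f)} := HB.pack phi0
  (GRing.isZmodMorphism.Build _ _ _ phi_zmod) (GRing.isMonoidMorphism.Build _ _ _ phi_monoid).
pose psi : {rmorphism subring_of (away f) -> subring_of regular} := HB.pack psi0
  (GRing.isZmodMorphism.Build _ _ _ psi_zmod) (GRing.isMonoidMorphism.Build _ _ _ psi_monoid).
exists phi, psi; split=> [c a /= -> //|c b /= ->|a].
  by rewrite (@evlE _ 0 c%:MP) ?mulr1 // mmapC divr1.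
apply: val_inj => /=; have /awayP[e [p E]] : Phi (val a) \in away f := valP a.
have := E; rewrite -rmorphXn => /splits_ev E'.
by rewrite (evlE E) E' rmorphXn /= mulfK ?expf_neq0.
Qed.

End OfLocal.

(** Inverting a common denominator B of the elements Phi (y i) makes Phi (ev p) regular, but the
    inverse of Phi (ev B) = N / B^e must be regular too. Inverting N as well is enough, because ev N
    is a power of ev B. *)
Lemma local_retract_rational : local_retract -> retract_rational iota.
Proof.
move=> [m [y [Phi [PhiC PhiP]]]]; pose ev := mmap iota y.
have [a aP] := choice (fun i => PhiP (y i)); have [b bP] := choice aP.
pose B := \prod_i b i.
have evB : ev B != 0 by rewrite /ev rmorph_prod; apply/prodf_neq0 => i _; case: (bP i).
have awB p : Phi (ev p) \in away B.
  have -> : Phi (ev p) = mmap (fracC m) (Phi \o y) p.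
    rewrite /ev /mmap rmorph_sum; apply: eq_bigr => n _; rewrite rmorphM /= PhiC; congr (_ * _).
    by rewrite /mmap1 rmorph_prod; apply: eq_bigr => i _; rewrite rmorphXn.
  apply: mmap_rpred => [c|i]; first by apply/awayP; exists 0, (c%:MP); rewrite mulr1.
  have [_ e _] := bP i; apply/awayP; exists 1, (a i * \prod_(j | j != i) b j).
  by rewrite expr1 /B (bigD1 i) //= !rmorphM /= -e mulrA.
have /awayP[e [N EN]] := awB B.
have evN : ev N = ev B ^+ e.+1.
  have := EN; rewrite -rmorphXn => /(splits_ev PhiP) E'.
  by rewrite [LHS]E' rmorphXn exprS.
have N0 : tofrac N != 0.
  by rewrite tofrac_eq0; apply: contraNneq (expf_neq0 e.+1 evB) => N0; rewrite -evN N0 /ev rmorph0.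
have B0 : tofrac B != 0.
  by rewrite tofrac_eq0; apply: contraNneq evB => ->; rewrite /ev rmorph0.
apply: (@regular_retract m y Phi (B * N)) => //.
- by rewrite rmorphM /= -/ev evN mulf_neq0 ?expf_neq0.
- move=> p; rewrite unfold_in /=; have /awayP[d [q E]] := awB p.
  apply/awayP; exists d, (q * N ^+ d).
  by rewrite !rmorphM rmorphXn /= exprMn mulrA E.
rewrite rmorphM /= -/ev evN -exprS unfold_in /= fmorphV rmorphXn -exprVn.
apply: rpredX; apply/awayP; exists 1, (B ^+ e.+1).
have -> : Phi (ev B) = tofrac N / tofrac B ^+ e by rewrite -EN mulfK ?expf_neq0.
rewrite expr1 [X in _ * X]rmorphM [RHS]rmorphXn exprS.
exact: (invf_divM _ N0 (expf_neq0 _ B0)).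
Qed.

End LocalRetract.

(* u lies in the local ring at y of the polynomials h p, and has value v at y. *)
Section AtPoint.
Variables (K F H : fieldType) (io : {rmorphism K -> F}) (m : nat) (y : 'I_m -> F).
Variable h : {rmorphism {mpoly K[m]} -> H}.
Hypothesis h_inj : injective h.
Local Notation ev := (mmap io y).

Definition at_point (u : H) (v : F) := exists p q : {mpoly K[m]},
  [/\ ev q != 0, u * h q = h p & ev p = v * ev q].

Let h0 q : ev q != 0 -> h q != 0.
Proof. by apply: contraNneq => /eqP; rewrite -(rmorph0 h) (inj_eq h_inj) => /eqP->; rewrite rmorph0. Qed.

Lemma at_pointC c : at_point (h c%:MP) (io c).
Proof. by exists c%:MP, 1; rewrite !rmorph1 !mulr1 mmapC oner_neq0. Qed.

Lemma at_pointX i : at_point (h 'X_i) (y i).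
Proof. by exists 'X_i, 1; rewrite !rmorph1 !mulr1 mmapX mmap1U oner_neq0. Qed.

Lemma at_pointD u v u' v' : at_point u v -> at_point u' v' -> at_point (u + u') (v + v').
Proof.
move=> [p [q [q0 e E]]] [p' [q' [q'0 e' E']]]; exists (p * q' + p' * q), (q * q').
rewrite !rmorphM !rmorphD !rmorphM /= mulf_neq0 // E E' -e -e'; split=> //; ring.
Qed.

Lemma at_pointM u v u' v' : at_point u v -> at_point u' v' -> at_point (u * u') (v * v').
Proof.
move=> [p [q [q0 e E]]] [p' [q' [q'0 e' E']]]; exists (p * p'), (q * q').
rewrite !rmorphM /= mulf_neq0 // E E' -e -e'; split=> //; ring.
Qed.

Lemma at_pointV u v : v != 0 -> at_point u v -> at_point u^-1 v^-1.
Proof.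
move=> v0 [p [q [q0 e E]]]; have p0 : ev p != 0 by rewrite E mulf_neq0.
have u0 : u != 0 by apply: contraNneq (h0 p0) => u0; rewrite -e u0 mul0r.
exists q, p; split=> //; first by rewrite -e mulKf.
by rewrite E mulKf.
Qed.

Lemma at_point_neq0 u v : v != 0 -> at_point u v -> u != 0.
Proof.
move=> v0 [p [q [q0 e E]]]; have p0 : ev p != 0 by rewrite E mulf_neq0.
by apply: contraNneq (h0 p0) => u0; rewrite -e u0 mul0r.
Qed.

Lemma at_point0 v : at_point 0 v -> v = 0.
Proof. by move=> a; apply/eqP/negP => /negP v0; have := at_point_neq0 v0 a; rewrite eqxx. Qed.

Lemma at_point_sum (I : Type) (r : seq I) (u : I -> H) (v : I -> F) :
  (forall i, at_point (u i) (v i)) -> at_point (\sum_(i <- r) u i) (\sum_(i <- r) v i).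
Proof.
move=> uv; elim/big_ind2: _ => [|a b c d|i _]; [|exact: at_pointD|exact: uv].
by have := at_pointC 0; rewrite mpolyC0 !rmorph0.
Qed.

Lemma at_pointXn u v n : at_point u v -> at_point (u ^+ n) (v ^+ n).
Proof.
move=> uv; elim: n => [|n IH]; last by rewrite !exprS; apply: at_pointM.
by have := at_pointC 1; rewrite mpolyC1 !rmorph1.
Qed.

Lemma at_point_mmap (l : nat) (u : 'I_l -> H) (v : 'I_l -> F) p : (forall i, at_point (u i) (v i)) ->
  at_point (mmap (h \o @mpolyC m K) u p) (mmap io v p).
Proof.
move=> uv; apply: at_point_sum => n; apply: at_pointM; first exact: at_pointC.
rewrite /mmap1; elim/big_ind2: _ => [|a b c d|i _]; last exact: at_pointXn.
  by have := at_pointC 1; rewrite mpolyC1 !rmorph1.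
exact: at_pointM.
Qed.

End AtPoint.

Section TrivialLattice.
Variables (gT : finGroupType) (G : {group gT}) (m : nat).
Local Notation V := {ffun 'I_m -> int}.

Definition trivial_act (x : V) (g : gT) : V := x.
Lemma trivial_is_action : is_action G trivial_act.
Proof. by split=> [g x z|x g h]. Qed.
Lemma trivial_actD : {in G, forall g, {morph Action trivial_is_action^~ g : x z / x + z}}.
Proof. by []. Qed.
Definition trivial_basis (i : 'I_m) : V := [ffun j => (i == j)%:R].
Lemma trivial_basisP : bijective (zcomb trivial_basis).
Proof.
have zE c : zcomb trivial_basis c = c.
  apply/ffunP => j; rewrite /zcomb sum_ffunE (bigD1 j) //= big1 ?addr0 => [|i ij].
    by rewrite ffunMzE ffunE eqxx -mulrzl mulr1 intz.
  by rewrite ffunMzE ffunE (negbTE ij) mul0rz.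
by exists id => c; rewrite zE.
Qed.
(** It presents K(X_1, ..., X_m), with G acting on coefficients only, as a case of K(L), so that the
    results on [ratfun_act] apply to it. *)
Definition trivial_lattice : glattice G :=
  @GLattice gT G V (Action trivial_is_action) m trivial_basis trivial_actD trivial_basisP.

End TrivialLattice.

(** * From K(L)^G to equivariant homomorphisms on L *)

Section TorusRetract.
Variables (k : fieldType) (K : splittingFieldType k).
Variables (gT : finGroupType) (G : {group gT}).
Variables (gal : {morphism G >-> gal_of {:K}}).
Local Notation Q m := (trivial_lattice G m).

Record torus_splitting (L : glattice G) m (y : 'I_(rank (Q m)) -> {fraction {mpoly K[rank L]}})
    (w : L -> {fraction {mpoly K[rank (Q m)]}}) : Prop := {
  ts_fixed : forall i, y i \in fixed gal L;
  tsD : {morph w : x x' / x + x' >-> x * x'};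
  ts_act : {in G, forall g x, ratfun_act gal (Q m) g (w x) = w (lact L x g)};
  ts_point : forall x, at_point (fracC (rank L)) y (@tofrac _) (w x) (chi K x)
}.
Definition torus_retract L := exists m y w, @torus_splitting L m y w.

Lemma trivial_act_tofrac m g (p : {mpoly K[rank (Q m)]}) : g \in G ->
  ratfun_act gal (Q m) g (tofrac p) = tofrac (map_mpoly (gal g) p).
Proof.
move=> Gg; rewrite -(mmap_fracX p) (ract_mmap _ _ _ Gg) -[RHS]mmap_fracX.
apply: eq_bigr => n _; congr (_ * _); apply: eq_bigr => i _; congr (_ ^+ _).
by rewrite /= -(chi_basis K i) (ract_chi gal _ Gg).
Qed.

Definition incl_poly m : {mpoly k[m]} -> {fraction {mpoly K[rank (Q m)]}} :=
  @tofrac {mpoly K[m]} \o map_mpoly (in_alg K).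
HB.instance Definition _ m := GRing.RMorphism.on (@incl_poly m).

Lemma incl_poly_inj m : injective (@incl_poly m).
Proof.
apply: raddf_inj => p /eqP; rewrite /incl_poly /= tofrac_eq0 => /eqP e.
by apply/mpolyP => n; apply: (fmorph_inj (in_alg K)); rewrite mcoeff0 rmorph0 -mcoeff_map_mpoly e mcoeff0.
Qed.

Definition incl_fun m : {fraction {mpoly k[m]}} -> {fraction {mpoly K[rank (Q m)]}} := fraclift (@incl_poly m).
Definition incl m : {rmorphism {fraction {mpoly k[m]}} -> {fraction {mpoly K[rank (Q m)]}}} :=
  HB.pack (@incl_fun m)
  (GRing.isZmodMorphism.Build _ _ _ (fraclift_is_zmod_morphism (@incl_poly_inj m)))
  (GRing.isMonoidMorphism.Build _ _ _ (fraclift_is_monoid_morphism (@incl_poly_inj m))).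

Lemma incl_tofrac m p : incl m (tofrac p) = tofrac (map_mpoly (in_alg K) p).
Proof. exact: (fraclift_tofrac (@incl_poly_inj m)). Qed.

Lemma incl_C m c : incl m (fracC m c) = fracC m (c%:A).
Proof. by rewrite [LHS]incl_tofrac map_mpolyC. Qed.

Lemma map_in_alg_fixed m g (p : {mpoly k[m]}) :
  map_mpoly (gal g) (map_mpoly (in_alg K) p) = map_mpoly (in_alg K) p.
Proof. by apply/mpolyP => n; rewrite !mcoeff_map_mpoly /= linearZ /= rmorph1. Qed.

Lemma incl_fixed m g x : g \in G -> ratfun_act gal (Q m) g (incl m x) = incl m x.
Proof.
move=> Gg; apply: (@rmorph_frac_ext _ _ (ratfun_mor gal (Q m) Gg \o incl m) (incl m)) => p.
have e := incl_tofrac p; apply: etrans (congr1 _ e) _; apply: etrans _ (esym e).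
by apply: etrans (trivial_act_tofrac _ Gg) _; rewrite map_in_alg_fixed.
Qed.

Hypotheses (galoisK : galois 1 {:K}) (isoG : isom G 'Gal({:K} / 1) gal).
Variable L : glattice G.
Local Notation F := {fraction {mpoly K[rank L]}}.
Local Notation io := (fracC (rank L) : K -> F).

Lemma base_point m (y : 'I_m -> fixfield gal L) u v :
  at_point (base gal L) y (@tofrac _) u v ->
  at_point io (fun i => val (y i)) (@tofrac {mpoly K[rank (Q m)]}) (incl m u) (val v).
Proof.
move=> [p [q [q0 e E]]]; exists (map_mpoly (in_alg K) p), (map_mpoly (in_alg K) q).
have evE r : mmap io (fun i => val (y i)) (map_mpoly (in_alg K) r) = val (mmap (base gal L) y r).
  by rewrite mmap_in_alg val_mmap_base.
rewrite !evE; split.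
- by apply: contraNneq q0 => q0; apply/eqP/val_inj; rewrite q0 subfield_val0.
- apply: etrans (congr1 (fun z => incl m u * z) (esym (incl_tofrac q))) _.
  by apply: etrans (esym (rmorphM _ _ _)) _; rewrite e; apply: incl_tofrac.
by rewrite E subfield_valM.
Qed.

Section ExtendScalars.
Variables (m : nat) (Phi : {rmorphism fixfield gal L -> {fraction {mpoly k[m]}}}).
Hypothesis PhiC : forall c, Phi (base gal L c) = fracC m c.
Local Notation H := {fraction {mpoly K[rank (Q m)]}}.
Local Notation ioH := (fracC (rank (Q m)) : K -> H).

Definition tr (x : F) : fixfield gal L := in_subfield (trace_fixed gal x : _ \in (fixed gal L : divringClosed _)).
Let gi := isom_gal_inj isoG.
Let s := projT1 (cid (trace_span L gi)).
Let sP x : x = \sum_(cy <- s) io cy.1 * val (tr (io cy.2 * x)).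
Proof. exact: (projT2 (cid (trace_span L gi)) x). Qed.

(** By descent K(L) is the tensor product of K and K(L)^G over k. This is the K-linear extension of
    [Phi], written through the trace formula; [extend_CM] identifies it on products of a constant
    and an invariant. *)
Definition extend (x : F) : H := \sum_(cy <- s) ioH cy.1 * incl m (Phi (tr (io cy.2 * x))).

Let trD : {morph tr : x z / x + z}.
Proof.
move=> x z; apply: val_inj; rewrite subfield_valD /= /trace -big_split; apply: eq_bigr => g Gg.
exact: ract_add.
Qed.
Let bfix g (b : fixfield gal L) : g \in G -> ratfun_act gal L g (val b) = val b.
Proof. by move=> Gg; have /fixedP h := valP b; apply: h. Qed.
Let trM x b : tr (x * val b) = tr x * b.
Proof.
apply: val_inj; rewrite subfield_valM /= /trace mulr_suml; apply: eq_bigr => g Gg.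
by rewrite (ract_mul gal Gg) bfix.
Qed.
Let trC c : exists a : k, tr (io c) = base gal L a /\ \sum_(g in G) gal g c = a%:A.
Proof.
have [|a aE] := @gal_fixed_const _ _ _ _ gal galoisK isoG (\sum_(g in G) gal g c).
  move=> h Gh; rewrite rmorph_sum [RHS](reindex_inj (mulIg h)) /=.
  apply: eq_big => [g|g Gg]; first by rewrite groupMr.
  by rewrite morphM // galM ?memvf.
exists a; split=> //; apply: val_inj => /=; rewrite -aE rmorph_sum; apply: eq_bigr => g Gg.
exact: ratfun_actC.
Qed.

Lemma extendD : {morph extend : x z / x + z}.
Proof.
move=> x z; rewrite /extend -big_split; apply: eq_bigr => cy _.
by rewrite mulrDr trD !rmorphD mulrDr.
Qed.

Lemma extend0 : extend 0 = 0.
Proof. by apply: (addrI (extend 0)); rewrite -extendD !addr0. Qed.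

Lemma extend_CM e b : extend (io e * val b) = ioH e * incl m (Phi b).
Proof.
have [t tP] := choice trC.
have eE : e = \sum_(cy <- s) cy.1 * (t (cy.2 * e))%:A.
  apply: (fmorph_inj (fracC (rank L))); apply: etrans (sP (io e)) _; rewrite rmorph_sum.
  apply: eq_bigr => cy _; rewrite [RHS]rmorphM; congr (_ * _); rewrite -[io cy.2 * io e]rmorphM.
  by have [h _] := tP (cy.2 * e); rewrite [tr _]h.
rewrite {2}eE rmorph_sum mulr_suml; apply: eq_bigr => cy _.
rewrite rmorphM -mulrA; congr (_ * _); rewrite mulrA trM -rmorphM.
have [h _] := tP (cy.2 * e); rewrite [tr _]h !rmorphM PhiC; congr (_ * _); exact: incl_C.
Qed.

Let span_ind (P : F -> Prop) : P 0 -> (forall x z, P x -> P z -> P (x + z)) ->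
  (forall e b, P (io e * val (b : fixfield gal L))) -> forall x, P x.
Proof. by move=> P0 PD PM x; rewrite (sP x); elim/big_ind: _. Qed.

Lemma extendM : {morph extend : x z / x * z}.
Proof.
move=> x z; elim/span_ind: z => [|z z' Hz Hz'|e b]; first by rewrite mulr0 extend0 mulr0.
  by rewrite mulrDr !extendD Hz Hz' mulrDr.
elim/span_ind: x => [|x x' Hx Hx'|e' b']; first by rewrite mul0r extend0 mul0r.
  by rewrite mulrDl !extendD Hx Hx' mulrDl.
rewrite mulrACA -subfield_valM -rmorphM !extend_CM !rmorphM; exact: mulrACA.
Qed.

Lemma extend_act g x : g \in G -> ratfun_act gal (Q m) g (extend x) = extend (ratfun_act gal L g x).
Proof.
move=> Gg; elim/span_ind: x => [|x x' Hx Hx'|e b].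
- by rewrite extend0 -[ratfun_act gal L g 0]/(ratfun_mor gal L Gg 0) rmorph0 extend0
    -[ratfun_act _ _ _ 0]/(ratfun_mor gal (Q m) Gg 0) rmorph0.
- rewrite (ract_add gal Gg x x') (extendD x x') (ract_add gal Gg) Hx Hx'; symmetry; exact: extendD.
rewrite (ract_mul gal Gg (io e)) (bfix b Gg) (ratfun_actC gal L e Gg) !extend_CM.
rewrite (ract_mul gal Gg) (ratfun_actC gal (Q m) e Gg); congr (_ * _); exact: incl_fixed.
Qed.

Lemma extend_point (y : 'I_m -> fixfield gal L) : (forall x, splits (base gal L) y Phi x) ->
  forall x, at_point io (fun i => val (y i)) (@tofrac _) (extend x) x.
Proof.
move=> sp x; rewrite {2}(sP x); apply: at_point_sum => cy; apply: at_pointM; first exact: at_pointC.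
apply: base_point; exact: sp.
Qed.

End ExtendScalars.

Lemma local_retract_torus : local_retract (base gal L) -> torus_retract L.
Proof.
move=> [m [y [Phi [PhiC sp]]]].
exists m, (fun i => val (y i)), (fun x => extend Phi (chi K x)); split.
- by move=> i; apply: (valP (y i)).
- by move=> x z; rewrite chiD extendM.
- by move=> g Gg x; rewrite (extend_act PhiC _ Gg) (ract_chi gal x Gg).
by move=> x; apply: extend_point.
Qed.

End TorusRetract.

Section MultiplicativeMap.
Variables (V : zmodType) (F : fieldType) (w : V -> F).
Hypotheses (wD : {morph w : x z / x + z >-> x * z}) (w_neq0 : forall x, w x != 0).

Lemma mult0 : w 0 = 1.
Proof. by apply: (mulfI (w_neq0 0)); rewrite -wD addr0 mulr1. Qed.
Lemma multN x : w (- x) = (w x)^-1.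
Proof. by apply: (mulfI (w_neq0 x)); rewrite -wD subrr mult0 divff. Qed.
Lemma multMz x (n : int) : w (x *~ n) = w x ^ n.
Proof.
have h (l : nat) : w (x *+ l) = w x ^+ l.
  by elim: l => [|l IH]; rewrite ?mulr0n ?mult0 ?expr0 // mulrS wD IH exprS.
by case: n => l; rewrite ?NegzE ?mulrNz -pmulrn ?multN h.
Qed.
Lemma mult_zcomb n (b : 'I_n -> V) c : w (zcomb b c) = \prod_i w (b i) ^ c i.
Proof. by rewrite /zcomb (big_morph w wD mult0); apply: eq_bigr => i _; apply: multMz. Qed.

End MultiplicativeMap.

Section SplittingRetract.
Variables (k : fieldType) (K : splittingFieldType k).
Variables (gT : finGroupType) (G : {group gT}).
Variables (gal : {morphism G >-> gal_of {:K}}).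
Hypotheses (galoisK : galois 1 {:K}) (isoG : isom G 'Gal({:K} / 1) gal).
Variables (L : glattice G) (m : nat).
Local Notation Q := (trivial_lattice G m).
Local Notation F := {fraction {mpoly K[rank L]}}.
Local Notation H := {fraction {mpoly K[rank Q]}}.
Local Notation io := (fracC (rank L) : K -> F).
Local Notation ioH := (fracC (rank Q) : K -> H).

Definition wpoly (w : L -> H) : {mpoly K[rank L]} -> H := mmap (fracC (rank Q)) (fun i => w (lbasis L i)).
HB.instance Definition _ w := GRing.RMorphism.on (wpoly w).

Variables (y : 'I_(rank Q) -> F) (w : L -> H).
Hypothesis ts : torus_splitting gal y w.
Local Notation ev := (mmap (fracC (rank L)) y).
Local Notation pt := (at_point (fracC (rank L)) y (@tofrac {mpoly K[rank Q]})).

Let tofrac_injH : injective (@tofrac {mpoly K[rank Q]}).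
Proof. by move=> p q /eqP; rewrite tofrac_eq => /eqP. Qed.

Let wpoly_point p : pt (wpoly w p) (tofrac p).
Proof.
have -> : tofrac p = mmap (fracC (rank L)) (fun i => chi K (lbasis L i)) p.
  rewrite -[LHS]mmap_fracX; congr mmap; apply/funext => i; symmetry; exact: chi_basis.
apply: at_point_mmap => i; exact: (ts_point ts).
Qed.

Let wpoly_inj : injective (wpoly w).
Proof.
apply: raddf_inj => p p0; have := wpoly_point p; rewrite [wpoly w p]p0 => /(at_point0 tofrac_injH)/eqP.
by rewrite tofrac_eq0 => /eqP.
Qed.

Let Wf : F -> H := fraclift (wpoly w).
Let W : {rmorphism F -> H} := HB.pack Wf
  (GRing.isZmodMorphism.Build _ _ _ (fraclift_is_zmod_morphism wpoly_inj))
  (GRing.isMonoidMorphism.Build _ _ _ (fraclift_is_monoid_morphism wpoly_inj)).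

Let W_tofrac p : W (tofrac p) = wpoly w p. Proof. exact: (fraclift_tofrac wpoly_inj). Qed.
Let W_C c : W (fracC _ c) = fracC _ c.
Proof. by rewrite [LHS]W_tofrac /wpoly mmapC. Qed.

Let W_point a : pt (W a) a.
Proof.
have [n [d [d0 ->]]] := fracP a; rewrite fmorph_div; apply: at_pointM; first by rewrite W_tofrac; apply: wpoly_point.
rewrite W_tofrac; apply: (at_pointV tofrac_injH); [by rewrite tofrac_eq0|exact: wpoly_point].
Qed.

Let w_neq0 x : w x != 0.
Proof. exact: (at_point_neq0 tofrac_injH (chi_neq0 K x) (ts_point ts x)). Qed.
Let W_chi x : W (chi K x) = w x.
Proof.
rewrite -[in RHS](lcoordK x) (mult_zcomb (tsD ts) w_neq0) -{1}(lcoordK x) chi_zcomb rmorph_prodXz.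
apply: eq_bigr => i _; congr (_ ^ _); rewrite chi_basis [LHS]W_tofrac /wpoly mmapX mmap1U //.
Qed.

Let W_act g x : g \in G -> ratfun_act gal Q g (W x) = W (ratfun_act gal L g x).
Proof.
move=> Gg; apply: (@rmorph_ratfun_ext _ _ _ (ratfun_mor gal Q Gg \o W) (W \o ratfun_mor gal L Gg)) => [c|j].
  apply: etrans (congr1 (ratfun_act gal Q g) (W_C c)) _; apply: etrans (ratfun_actC gal Q c Gg) _.
  by symmetry; apply: etrans (congr1 W (ratfun_actC gal L c Gg)) _; apply: W_C.
rewrite -chi_basis; apply: etrans (congr1 (ratfun_act gal Q g) (W_chi _)) _.
apply: etrans (ts_act ts Gg _) _; symmetry.
by apply: etrans (congr1 W (ract_chi gal _ Gg)) _; apply: W_chi.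
Qed.

Let y' i : fixfield gal L := in_subfield (ts_fixed ts i : _ \in (fixed gal L : divringClosed _)).

Let ev_base (q : {mpoly k[m]}) : val (mmap (base gal L) y' q) = ev (map_mpoly (in_alg K) q).
Proof. by rewrite val_mmap_base mmap_in_alg. Qed.

Let ev_gal g (p : {mpoly K[rank Q]}) : g \in G -> ev (map_mpoly (gal g) p) = ratfun_act gal L g (ev p).
Proof.
move=> Gg; rewrite (ract_mmap gal _ _ Gg); congr mmap; apply/funext => i; symmetry.
by have /fixedP h := ts_fixed ts i; apply: h.
Qed.

(** The product N of the conjugates of the denominator q has fixed coefficients, and it does not
    vanish at y since y is fixed. The numerator p R over N is then fixed as well, and both descend
    to k. *)
Let descend (x : fixfield gal L) : exists v : {fraction {mpoly k[m]}},
  incl K G m v = W (val x) /\ at_point (base gal L) y' (@tofrac {mpoly k[m]}) v x.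
Proof.
have [p [q [q0 e E]]] := W_point (val x).
pose R := \prod_(g in G | g != 1%g) map_mpoly (gal g) q.
pose N := \prod_(g in G) map_mpoly (gal g) q.
have NE : N = q * R.
  rewrite /N (bigD1 1%g) ?group1 //=; congr (_ * _).
  by rewrite morph1; apply/mpolyP => n; rewrite mcoeff_map_mpoly /= gal_id.
have N0 : ev N != 0.
  rewrite rmorph_prod; apply/prodf_neq0 => g Gg; have e' := ev_gal q Gg.
  by rewrite [X in X != 0]e' (ract_eq0 gal _ Gg).
have NW : W (val x) * tofrac N = tofrac (p * R).
  by rewrite NE !rmorphM [LHS]mulrA e.
have NG h : h \in G -> map_mpoly (gal h) N = N.
  move=> Gh; rewrite /N rmorph_prod [RHS](reindex_inj (mulIg h)) /=.
  apply: eq_big => [g|g Gg]; first by rewrite groupMr.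
  by apply/mpolyP => n; rewrite !mcoeff_map_mpoly /= morphM // galM ?memvf.
have pG h : h \in G -> map_mpoly (gal h) (p * R) = p * R.
  move=> Gh; apply: tofrac_injH; rewrite -(trivial_act_tofrac gal _ Gh) -NW (ract_mul gal Gh).
  rewrite (trivial_act_tofrac gal _ Gh) (NG _ Gh); congr (_ * _).
  by rewrite (W_act _ Gh); have /fixedP hx := valP x; rewrite hx.
have [p0 p0E] := mpoly_descent galoisK isoG pG; have [q1 q1E] := mpoly_descent galoisK isoG NG.
have q10 : tofrac q1 != 0.
  rewrite tofrac_eq0; apply: contraNneq N0 => q10.
  by rewrite -q1E q10 !rmorph0.
exists (tofrac p0 / tofrac q1); split.
  rewrite fmorph_div; have i1 := incl_tofrac K G p0; have i2 := incl_tofrac K G q1.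
  rewrite [incl K G m (tofrac p0)]i1 [incl K G m (tofrac q1)]i2 p0E q1E -NW mulfK //.
  by rewrite -q1E -i2 fmorph_eq0.
exists p0, q1; split.
- by apply: contraNneq N0 => e0; rewrite -q1E -ev_base e0 subfield_val0.
- by rewrite divfK.
have e1 : ev (p * R) = ev p * ev R by exact: rmorphM.
have e2 : ev (q * R) = ev q * ev R by exact: rmorphM.
apply: val_inj; rewrite subfield_valM !ev_base p0E q1E NE e1 e2 E; exact/esym/mulrA.
Qed.

Lemma splitting_local_retract : local_retract (base gal L).
Proof.
have [P PE] := choice descend; have inj := fmorph_inj (incl K G m).
have PB : zmod_morphism P.
  move=> a b; apply: inj; apply: etrans (PE _).1 _; apply: etrans (rmorphB _ _ _) _.
  by symmetry; apply: etrans (rmorphB _ _ _) _; congr (_ - _); apply: (PE _).1.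
have PM : monoid_morphism P.
  split=> [|a b]; apply: inj; apply: etrans (PE _).1 _.
    apply: etrans (congr1 W (subfield_val1 _)) _; apply: etrans (rmorph1 W) _.
    exact: esym (rmorph1 (incl K G m)).
  apply: etrans (congr1 W (subfield_valM a b)) _; apply: etrans (rmorphM W _ _) _.
  apply: esym; apply: etrans (rmorphM (incl K G m) _ _) _.
  exact: congr2 (PE a).1 (PE b).1.
pose Pr : {rmorphism fixfield gal L -> {fraction {mpoly k[m]}}} :=
  HB.pack P (GRing.isZmodMorphism.Build _ _ _ PB) (GRing.isMonoidMorphism.Build _ _ _ PM).
exists m, y', Pr.
split=> [c|x]; last exact: (PE x).2.
apply: inj; apply: etrans (PE _).1 _; apply: etrans (W_C _) _; symmetry; exact: incl_C.
Qed.

End SplittingRetract.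

Theorem retract_torusP (k : fieldType) (K : splittingFieldType k)
    (gT : finGroupType) (G : {group gT}) (gal : {morphism G >-> gal_of {:K}}) (L : glattice G) :
  galois 1 {:K} -> isom G 'Gal({:K} / 1) gal -> retract_rational (base gal L) <-> torus_retract gal L.
Proof.
move=> galoisK isoG; split.
  by move/retract_rational_local; apply: local_retract_torus.
move=> [m [y [w ts]]]; apply: local_retract_rational; exact: (splitting_local_retract galoisK isoG ts).
Qed.

Section Renaming.
Variables (k : fieldType) (K : splittingFieldType k).
Variables (gT : finGroupType) (G : {group gT}).
Variables (gal : {morphism G >-> gal_of {:K}}).
Variables (m' m : nat) (s : 'I_m' -> 'I_m).
Hypothesis s_inj : injective s.
Local Notation Q' := (trivial_lattice G m').
Local Notation Q := (trivial_lattice G m).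

Definition rename_fun (c : Q') : Q := \sum_i lbasis Q (s i) *~ c i.
Lemma rename_zmod : zmod_morphism rename_fun.
Proof.
by move=> c d; rewrite /rename_fun -sumrB; apply: eq_bigr => i _; rewrite -mulrzBr !ffunE.
Qed.
Definition rename : {additive Q' -> Q} :=
  HB.pack rename_fun (GRing.isZmodMorphism.Build Q' Q rename_fun rename_zmod).

Lemma rename_basis i : rename (lbasis Q' i) = lbasis Q (s i).
Proof.
rewrite /= /rename_fun (bigD1 i) //= ffunE eqxx mulr1z big1 ?addr0 // => j ji.
by rewrite ffunE eq_sym (negbTE ji) mulr0z.
Qed.

Lemma rename_act : {in G, forall g x, rename (lact Q' x g) = lact Q (rename x) g}.
Proof. by []. Qed.

Lemma rename_indep : algindep (fracC (rank Q)) (fun i => chi K (rename (lbasis Q' i))).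
Proof.
have h := algindep_reindex s_inj (@ratfun_chi_algindep k K gT G Q).
by congr (algindep _ _): h; apply/funext => i; congr (chi K _); rewrite rename_basis.
Qed.

Variables (L' L : glattice G) (j : {additive L' -> L}).
Hypothesis j_indep : algindep (fracC (rank L)) (fun i => chi K (j (lbasis L' i))).
Variables (y' : 'I_(rank Q') -> {fraction {mpoly K[rank L']}}) (y : 'I_(rank Q) -> {fraction {mpoly K[rank L]}}).
Hypothesis y_s : forall i, y (s i) = emb j_indep (y' i).

Lemma rename_point u v : at_point (fracC (rank L')) y' (@tofrac _) u v ->
  at_point (fracC (rank L)) y (@tofrac _) (emb rename_indep u) (emb j_indep v).
Proof.
have tofrac_inj : injective (@tofrac {mpoly K[rank Q]}).
  by move=> p q /eqP; rewrite tofrac_eq => /eqP.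
move=> [p [q [q0 e E]]].
have pt r : at_point (fracC (rank L)) y (@tofrac _) (emb rename_indep (tofrac r)) (emb j_indep (mmap (fracC (rank L')) y' r)).
  rewrite emb_mmap [emb rename_indep (tofrac r)]emb_tofrac; apply: at_point_mmap => i.
  have b := rename_basis i; rewrite [X in chi K X]b chi_basis.
  rewrite -[(_ \o _) i]/(emb j_indep (y' i)) -y_s; exact: at_pointX.
have ev0 : emb j_indep (mmap (fracC (rank L')) y' q) != 0 by rewrite fmorph_eq0.
have uE : emb rename_indep u = emb rename_indep (tofrac p) / emb rename_indep (tofrac q).
  rewrite -e rmorphM mulfK //; exact: (at_point_neq0 tofrac_inj ev0 (pt q)).
have vE : emb j_indep v = emb j_indep (mmap (fracC (rank L')) y' p) / emb j_indep (mmap (fracC (rank L')) y' q).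
  by rewrite E rmorphM mulfK.
rewrite uE vE; apply: at_pointM (pt p) _; exact: (at_pointV tofrac_inj ev0 (pt q)).
Qed.

End Renaming.

Section RetractSum.
Variables (k : fieldType) (K : splittingFieldType k).
Variables (gT : finGroupType) (G : {group gT}).
Variables (gal : {morphism G >-> gal_of {:K}}).
Variables M M1 M2 : glattice G.

Lemma torus_retract_sum : direct_sum M M1 M2 -> torus_retract gal M1 -> torus_retract gal M2 ->
  torus_retract gal M.
Proof.
move=> [f [fb fG]] [m1 [y1 [w1 ts1]]] [m2 [y2 [w2 ts2]]]; have [h hf fh] := fb.
have a1 := dinl_algindep fb (K := K); have a2 := dinr_algindep fb (K := K).
pose e1 := emb a1; pose e2 := emb a2.
pose r1 := @rename_indep _ K _ G _ _ _ (@lshift_inj m1 m2).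
pose r2 := @rename_indep _ K _ G _ _ _ (@rshift_inj m1 m2).
pose E1 := emb r1; pose E2 := emb r2.
pose y (i : 'I_(rank (trivial_lattice G (m1 + m2)))) : {fraction {mpoly K[rank M]}} :=
  match split (i : 'I_(m1 + m2)) with inl a => e1 (y1 a) | inr b => e2 (y2 b) end.
have yl i : y (lshift m2 i) = e1 (y1 i) by rewrite /y -/(unsplit (inl _)) unsplitK.
have yr i : y (rshift m1 i) = e2 (y2 i) by rewrite /y -/(unsplit (inr _)) unsplitK.
have hD x x' : h (x + x') = h x + h x' by rewrite -[x in LHS]fh -[x' in LHS]fh -raddfD hf.
have hG g x : g \in G -> h (lact M x g) = (lact M1 (h x).1 g, lact M2 (h x).2 g).
  by move=> Gg; rewrite -{1}[x]fh -fG // hf.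
exists (m1 + m2)%N, y, (fun x => E1 (w1 (h x).1) * E2 (w2 (h x).2)); split.
- move=> i; rewrite /y; case: (split _) => a.
    exact: (emb_fixed (dinl_act fG) a1 (ts_fixed ts1 a)).
  exact: (emb_fixed (dinr_act fG) a2 (ts_fixed ts2 a)).
- move=> x x'; have -> : (h (x + x')).1 = (h x).1 + (h x').1 by rewrite hD.
  have -> : (h (x + x')).2 = (h x).2 + (h x').2 by rewrite hD.
  rewrite (tsD ts1) (tsD ts2) (rmorphM E1) (rmorphM E2); exact: mulrACA.
- move=> g Gg x; rewrite (hG _ _ Gg) /= -(ts_act ts1 Gg) -(ts_act ts2 Gg) (ract_mul gal Gg).
  congr (_ * _).
    exact: esym (emb_act gal (@rename_act gT G m1 (m1 + m2) (@lshift m1 m2)) r1 Gg _).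
  exact: esym (emb_act gal (@rename_act gT G m2 (m1 + m2) (@rshift m1 m2)) r2 Gg _).
move=> x; have -> : chi K x = e1 (chi K (h x).1) * e2 (chi K (h x).2).
  rewrite [e1 _]emb_chi [e2 _]emb_chi -chiD; congr (chi K _).
  by rewrite -{1}[x]fh dsumE.
apply: at_pointM.
  exact: (rename_point (@lshift_inj m1 m2) (j_indep := a1) yl (ts_point ts1 _)).
exact: (rename_point (@rshift_inj m1 m2) (j_indep := a2) yr (ts_point ts2 _)).
Qed.

End RetractSum.

(** * Equivariant homomorphisms from L to the units of K *)

Section EquivariantCharacters.
Variables (k : fieldType) (K : splittingFieldType k).
Variables (gT : finGroupType) (G : {group gT}).
Variables (gal : {morphism G >-> gal_of {:K}}).
Hypotheses (galoisK : galois 1 {:K}) (isoG : isom G 'Gal({:K} / 1) gal).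
Hypothesis k_inf : infinite_field k.
Variable L : glattice G.

Record equivariant_char (u : L -> K) : Prop := {
  ecD : {morph u : x z / x + z >-> x * z};
  ec_neq0 : forall x, u x != 0;
  ec_act : {in G, forall g x, u (lact L x g) = gal g (u x)}
}.

(** A primitive element of K over k. *)
Lemma free_element : exists th : K, forall g, g \in G -> gal g th = th -> g = 1%g.
Proof.
have sep : separable 1 {:K} by case/and3P: galoisK.
have gen := eq_adjoin_separable_generator sep (sub1v _).
exists (separable_generator 1 {:K}) => g Gg fx; apply: (isom_gal_inj isoG) => //.
rewrite morph1; apply/eqP/gal_eqP => z _; rewrite gal_id.
have : z \in <<1; separable_generator 1 {:K}>>%VS by rewrite -gen memvf.
move=> /Fadjoin_polyP[p /polyOverP p1 ->].
rewrite -horner_map /= fx; congr (_.[_]); apply/polyP => i; rewrite coef_map /=.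
by have /vlineP[c ->] := p1 i; rewrite linearZ /= rmorph1.
Qed.

Lemma poly_nonroot (p : {poly K}) : p != 0 -> exists c : k, p.[c%:A] != 0.
Proof.
move=> p0; have seqs n : exists s : seq k, uniq s /\ size s = n.
  elim: n => [|n [s [us ss]]]; first by exists [::].
  by have [c cs] := k_inf s; exists (c :: s); rewrite /= cs us ss.
have [s [us ss]] := seqs (size p); apply: contrapT => no.
have := max_poly_roots p0 (rs := [seq c%:A | c <- s]); rewrite size_map ss ltnn.
rewrite map_inj_uniq ?us; last exact: (fmorph_inj (in_alg K)).
suff -> : all (root p) [seq c%:A | c <- s] by move=> /(_ isT isT).
apply/allP => _ /mapP[c _ ->]; rewrite /root -[_ == _]negbK; apply/negP => h.
by apply: no; exists c.
Qed.

(** As a rational function of c the product has order n 1 at c = a 1, hence is not the constant 1.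
    It is split into numerator and denominator, and c is chosen in the infinite field k off the
    roots of their difference and of all factors. *)
Lemma product_not_const (a : gT -> K) (n : gT -> int) : {in G &, injective a} -> n 1%g != 0 ->
  exists c : k, (forall g, g \in G -> a g - c%:A != 0) /\ \prod_(g in G) (a g - c%:A) ^ n g != 1.
Proof.
move=> a_inj n1; pose pos g := if n g is Posz l then l else 0%N.
pose neg g := if n g is Negz l then l.+1 else 0%N.
pose A := \prod_(g in G) ((a g)%:P - 'X) ^+ pos g; pose B := \prod_(g in G) ((a g)%:P - 'X) ^+ neg g.
have evP e (c : K) : (\prod_(g in G) ((a g)%:P - 'X) ^+ e g).[c] = \prod_(g in G) (a g - c) ^+ e g.
  by rewrite horner_prod; apply: eq_bigr => g _; rewrite horner_exp !hornerE.
have splitn (g : gT) (x : K) : x != 0 -> x ^ n g = x ^+ pos g / x ^+ neg g.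
  move=> x0; rewrite /pos /neg; case: (n g) => l; first by rewrite expr0 divr1.
  by rewrite expr0 mul1r NegzE -exprnN.
have AB : A != B.
  apply/eqP => AB; have G1 := group1 G; have := congr1 (fun p => p.[a 1%g]) AB.
  rewrite !evP; have zero e : e 1%g != 0%N -> \prod_(g in G) (a g - a 1%g) ^+ e g = 0.
    move=> e0; rewrite (bigD1 1%g) //= subrr expr0n (negbTE e0) mul0r //.
  have nonzero e : e 1%g = 0%N -> \prod_(g in G) (a g - a 1%g) ^+ e g != 0.
    move=> e0; apply/prodf_neq0 => g Gg; have [->|g1] := eqVneq g 1%g; first by rewrite e0 expr0 oner_neq0.
    by rewrite expf_neq0 // subr_eq0; apply: contra g1 => /eqP/a_inj->.
  case n1E : (n 1%g) n1 => [l|l] n1'.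
    rewrite zero; last by rewrite /pos n1E.
    by move/esym/eqP; rewrite (negbTE (nonzero neg _)) // /neg n1E.
  by rewrite [RHS]zero ?/neg ?n1E // => /eqP; rewrite (negbTE (nonzero pos _)) // /pos n1E.
have C0 : \prod_(g in G) ((a g)%:P - 'X) != 0.
  by apply/prodf_neq0 => g _; rewrite -opprB oppr_eq0 polyXsubC_eq0.
have [c] := poly_nonroot (mulf_neq0 (etrans (congr1 negb (subr_eq0 A B)) AB) C0).
rewrite hornerM mulf_eq0 negb_or => /andP[ABc Cc]; rewrite hornerD hornerN subr_eq0 in ABc.
have ac0 g : g \in G -> a g - c%:A != 0.
  by move=> Gg; apply: contraNneq Cc => e; rewrite horner_prod (bigD1 g) //= !hornerE e mul0r.
exists c; split=> //; apply: contraNneq ABc => e; rewrite /A /B !evP.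
have Bc0 : \prod_(g in G) (a g - c%:A) ^+ neg g != 0.
  by apply/prodf_neq0 => g Gg; rewrite expf_neq0 ?ac0.
apply/eqP/(mulIf (invr_neq0 Bc0)); rewrite mulfV // -[RHS]e -prodf_div.
by apply: eq_bigr => g Gg; rewrite splitn ?ac0.
Qed.

(** The i-th coordinate functional is induced up to G: u z is the product over g of the conjugates
    of th - c by g^-1, raised to the i-th coordinate of z g. Reindexing gives equivariance, and
    [product_not_const] with exponents from x gives u x != 1. *)
Lemma separating_char x : x != 0 -> exists u, equivariant_char u /\ u x != 1.
Proof.
move=> x0; have [i xi] : exists i, lcoord x i != 0.
  apply: contrapT => no; case/eqP: x0; rewrite -[x]lcoordK /zcomb big1 // => i _.
  have -> : lcoord x i = 0 by apply/eqP; rewrite -[_ == _]negbK; apply/negP => h; apply: no; exists i.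
  exact: mulr0z.
have [th thP] := free_element.
have inj : {in G &, injective (fun g => gal g^-1%g th)}.
  move=> g h Gg Gh /= e; apply: (mulgI g^-1%g); rewrite mulVg; apply: esym.
  apply: thP; first by rewrite groupM ?groupV.
  rewrite morphM ?groupV // galM ?memvf // e.
  by have := Defs.galK gal (groupVr Gh) th; rewrite invgK.
have n1 : lcoord (lact L x 1%g) i != 0 by rewrite lact1.
have [c [c0 c1]] := product_not_const (n := fun g => lcoord (lact L x g) i) inj n1.
have gc g : g \in G -> gal g^-1%g (th - c%:A) = gal g^-1%g th - c%:A.
  by move=> Gg; rewrite rmorphB /= linearZ /= rmorph1.
pose u z := \prod_(g in G) (gal g^-1%g (th - c%:A)) ^ lcoord (lact L z g) i.
have b0 g : g \in G -> gal g^-1%g (th - c%:A) != 0 by move=> Gg; rewrite gc ?c0.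
exists u; split; last by congr (_ != _): c1; apply: eq_bigr => g Gg; rewrite gc.
split=> [z z'|z|h Gh z].
- rewrite /u -big_split; apply: eq_bigr => g Gg /=; rewrite -expfzDr ?b0 //; congr (_ ^ _).
  by rewrite -[lact L (z + z') g]/(lact_add L Gg _) raddfD lcoordD ffunE.
- by apply/prodf_neq0 => g Gg; rewrite expfz_neq0 ?b0.
rewrite /u rmorph_prod [RHS](reindex_inj (mulgI h)) /=; apply: eq_big => [g|g Gg].
  by rewrite groupMl.
rewrite fmorphXz lactM //; congr (_ ^ _).
transitivity ((gal (h * g)^-1 * gal h)%g (th - c%:A)); last by rewrite galM ?memvf.
by rewrite -morphM ?groupV ?groupM // invMg mulgKV.
Qed.

Lemma equivariant_charM u v : equivariant_char u -> equivariant_char v ->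
  equivariant_char (fun x => u x * v x).
Proof.
move=> uP vP; split=> [x z|x|g Gg x].
- by rewrite (ecD uP) (ecD vP) mulrACA.
- by rewrite mulf_neq0 ?(ec_neq0 uP) ?(ec_neq0 vP).
by rewrite (ec_act uP) // (ec_act vP) // rmorphM.
Qed.

Lemma equivariant_char1 : equivariant_char (fun=> 1).
Proof. by split=> [x z|x|g Gg x]; rewrite ?mulr1 ?oner_neq0 ?rmorph1. Qed.

Variables (F : fieldType) (io : {rmorphism K -> F}).

(* Dedekind: distinct elements of L define distinct, hence independent, characters
   of the group of equivariant homomorphisms from L to K^*. *)
Lemma char_independence (I : eqType) (r : seq I) (b : I -> L) (c : I -> F) : uniq r -> {in r &, injective b} ->
  (forall u, equivariant_char u -> \sum_(i <- r) c i * io (u (b i)) = 0) -> {in r, forall i, c i = 0}.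
Proof.
elim: r c => [|j r IH] c /= ; first by [].
move=> /andP[jr ur] b_inj sum0.
have cr : {in r, forall i, c i = 0}.
  move=> i ir; have ij : b i - b j != 0.
    rewrite subr_eq0; apply: contra jr => /eqP/b_inj <- //; rewrite !inE ?eqxx // ir orbT //.
  have [v [vP v1]] := separating_char ij.
  have /IH/(_ i ir) : forall u, equivariant_char u ->
      \sum_(i <- r) (c i * (io (v (b i)) - io (v (b j)))) * io (u (b i)) = 0.
    move=> u uP; have := sum0 _ (equivariant_charM uP vP); have := sum0 _ uP.
    rewrite !big_cons => /(congr1 ( *%R^~ (io (v (b j))))); rewrite mul0r mulrDl => e1 e2.
    have := congr2 (fun x z => x - z) e2 e1; rewrite subrr rmorphM opprD addrACA.
    rewrite mulrA subrr add0r mulr_suml -sumrB => e; rewrite -[RHS]e.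
    by apply: eq_bigr => l _; rewrite rmorphM; ring.
  move=> /(_ ur) h; have /eqP : c i * (io (v (b i)) - io (v (b j))) = 0.
    by apply: h => l l' lr l'r; apply: b_inj; rewrite inE ?lr ?l'r orbT.
  rewrite mulf_eq0 subr_eq0 (inj_eq (fmorph_inj io)) => /orP[/eqP //|/eqP e].
  case/eqP: v1; apply: (mulIf (ec_neq0 vP (b j))).
  by rewrite -(ecD vP) subrK e mul1r.
move=> i; rewrite inE => /orP[/eqP->|]; last exact: cr.
have := sum0 _ equivariant_char1; rewrite big_cons big_seq big1 ?addr0 ?rmorph1 ?mulr1 // => l lr.
by rewrite cr // mul0r.
Qed.

Lemma char_dense n (b : 'I_n -> L) (p : {mpoly F[n]}) : injective (zcomb b) -> p != 0 ->
  exists u, equivariant_char u /\ p.@[fun i => io (u (b i))] != 0.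
Proof.
move=> b_inj p0; apply: contrapT => no; case/eqP: p0.
pose e (m : 'X_{1..n}) := zcomb b [ffun i => (m i)%:Z].
have e_inj : injective e.
  by move=> m m' /b_inj/ffunP h; apply/mnmP => i; have := h i; rewrite !ffunE => -[].
have z : {in msupp p, forall m, p@_m = 0}.
  apply: (@char_independence _ _ e) => [||u uP]; first exact: msupp_uniq.
    by move=> m m' _ _; apply: e_inj.
  have : p.@[fun i => io (u (b i))] = 0.
    by apply/eqP; rewrite -[_ == _]negbK; apply/negP => h; apply: no; exists u.
  rewrite mevalE => h; rewrite -[RHS]h; apply: eq_bigr => m _; congr (_ * _).
  rewrite /e (mult_zcomb (ecD uP) (ec_neq0 uP)) rmorph_prod; apply: eq_bigr => i _.
  by rewrite ffunE -rmorphXn.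
apply/mpolyP => m; rewrite mcoeff0; have [/z //|] := boolP (m \in msupp p).
exact: memN_msupp_eq0.
Qed.

End EquivariantCharacters.

Section AtPointMore.
Variables (K F H : fieldType) (io : {rmorphism K -> F}) (m : nat) (y : 'I_m -> F).
Variable h : {rmorphism {mpoly K[m]} -> H}.
Hypothesis h_inj : injective h.
Local Notation pt := (at_point io y h).

Lemma at_pointXz u v (n : int) : v != 0 -> pt u v -> pt (u ^ n) (v ^ n).
Proof.
move=> v0 uv; case: n => n; first exact: at_pointXn.
by rewrite NegzE -!exprnN; apply: at_pointV; rewrite ?expf_neq0 //; apply: at_pointXn.
Qed.

Lemma at_point_prodXz n (u : 'I_n -> H) (v : 'I_n -> F) (c : 'I_n -> int) :
  (forall i, v i != 0) -> (forall i, pt (u i) (v i)) -> pt (\prod_i u i ^ c i) (\prod_i v i ^ c i).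
Proof.
move=> v0 uv; elim/big_ind2: _ => [|a b d e|i _]; last exact: at_pointXz.
  by have := at_pointC io y h 1; rewrite mpolyC1 !rmorph1.
exact: at_pointM.
Qed.

Lemma at_point_uniq u v v' : pt u v -> pt u v' -> v = v'.
Proof.
move=> uv uv'; have := at_pointD uv (at_pointM (at_pointC io y h (-1)) uv').
rewrite mpolyCN mpolyC1 !rmorphN1 !mulN1r subrr => /(at_point0 h_inj)/eqP.
by rewrite subr_eq0 => /eqP.
Qed.

End AtPointMore.

Lemma mmap_comp (K F1 F : fieldType) (io1 : {rmorphism K -> F1}) (e : {rmorphism F1 -> F}) n l
    (v : 'I_n -> {mpoly F1[l]}) (t : 'I_l -> F) (p : {mpoly K[n]}) :
  mmap e t (mmap (@mpolyC l F1 \o io1) v p) = mmap (e \o io1) (fun i => mmap e t (v i)) p.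
Proof.
rewrite {2}/mmap rmorph_sum; apply: eq_bigr => m _; rewrite rmorphM /= mmapC; congr (_ * _).
by rewrite /mmap1 rmorph_prod; apply: eq_bigr => i _; rewrite rmorphXn.
Qed.

(** * Specialising a splitting of a sum to a summand *)

Section Specialisation.
Variables (k : fieldType) (K : splittingFieldType k).
Variables (gT : finGroupType) (G : {group gT}).
Variables (gal : {morphism G >-> gal_of {:K}}).
Variables M M1 M2 : glattice G.
Variable f : {additive M1 * M2 -> M}.
Hypotheses (f_bij : bijective f)
  (f_act : {in G, forall g x, f (lact M1 x.1 g, lact M2 x.2 g) = lact M (f x) g}).
Local Notation F := {fraction {mpoly K[rank M]}}.
Local Notation F1 := {fraction {mpoly K[rank M1]}}.
Local Notation N := (rank M1 + rank M2)%N.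

Definition dpoly : {mpoly K[N]} -> F := mmap (fracC (rank M)) (fun i => chi K (dbasis f i)).
HB.instance Definition _ := GRing.RMorphism.on dpoly.

Lemma dpoly_inj : injective dpoly.
Proof. by apply: raddf_inj; apply: dbasis_algindep. Qed.

Definition spec (u : M2 -> K) (i : 'I_N) : F1 :=
  match split i with inl a => chi K (lbasis M1 a) | inr b => fracC _ (u (lbasis M2 b)) end.
Local Notation sp u := (at_point (fracC (rank M1)) (spec u) dpoly).

Section OneCharacter.
Variable u : M2 -> K.
Hypothesis uP : equivariant_char gal u.

Let inv x := projT1 (cid (let: Bijective h _ hK := f_bij in ex_intro (fun z => f z = x) (h x) (hK x))).
Let invP x : f (inv x) = x.
Proof. exact: (projT2 (cid (let: Bijective h _ hK := f_bij in ex_intro (fun z => f z = x) (h x) (hK x)))). Qed.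
Let invE z : inv (f z) = z. Proof. exact: (bij_inj f_bij (invP (f z))). Qed.
Let invD x z : inv (x + z) = inv x + inv z.
Proof. by rewrite -{1}[x]invP -{1}[z]invP -raddfD invE. Qed.

Definition spec_chi x : F1 := chi K (inv x).1 * fracC _ (u (inv x).2).

Lemma spec_chi_neq0 x : spec_chi x != 0.
Proof. by rewrite mulf_neq0 ?chi_neq0 // fmorph_eq0 (ec_neq0 uP). Qed.

Lemma spec_chiD : {morph spec_chi : x z / x + z >-> x * z}.
Proof.
move=> x z; rewrite /spec_chi; have -> : (inv (x + z)).1 = (inv x).1 + (inv z).1 by rewrite invD.
have -> : (inv (x + z)).2 = (inv x).2 + (inv z).2 by rewrite invD.
rewrite chiD (ecD uP) rmorphM; exact: mulrACA.
Qed.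

Lemma spec_chi_l x : spec_chi (dinl f x) = chi K x.
Proof. by rewrite /spec_chi /dinl invE (mult0 (ecD uP) (ec_neq0 uP)) rmorph1 mulr1. Qed.
Lemma spec_chi_r x : spec_chi (dinr f x) = fracC _ (u x).
Proof. by rewrite /spec_chi /dinr invE chi0 mul1r. Qed.

Lemma spec_chi_basis i : spec_chi (dbasis f i) = spec u i.
Proof. by rewrite /dbasis /spec; case: (split i) => a; rewrite ?spec_chi_l ?spec_chi_r. Qed.

Lemma spec_chi_act g x : g \in G -> ratfun_act gal M1 g (spec_chi x) = spec_chi (lact M x g).
Proof.
move=> Gg; have iG : inv (lact M x g) = (lact M1 (inv x).1 g, lact M2 (inv x).2 g).
  by rewrite -{1}[x]invP -f_act // invE.
rewrite /spec_chi iG (ract_mul gal Gg) (ract_chi gal _ Gg) (ratfun_actC gal M1 _ Gg).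
by rewrite (ec_act uP).
Qed.

Lemma sp_chi x : sp u (chi K x) (spec_chi x).
Proof.
have [c <-] := dbasis_spans f_bij x.
rewrite chi_zcomb (mult_zcomb spec_chiD spec_chi_neq0).
apply: (at_point_prodXz dpoly_inj) => i; first exact: spec_chi_neq0.
rewrite spec_chi_basis; have := at_pointX (fracC (rank M1)) (spec u) dpoly i.
by rewrite [X in at_point _ _ _ X]mmapX mmap1U.
Qed.

Lemma sp_act g a b : g \in G -> sp u a b -> sp u (ratfun_act gal M g a) (ratfun_act gal M1 g b).
Proof.
move=> Gg [p [q [q0 e E]]].
have pt r : sp u (ratfun_act gal M g (dpoly r)) (ratfun_act gal M1 g (mmap (fracC (rank M1)) (spec u) r)).
  have eM := ract_mmap gal (fun i => chi K (dbasis f i)) r Gg.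
  have -> : ratfun_act gal M g (dpoly r) = mmap (dpoly \o @mpolyC N K)
      (ratfun_act gal M g \o (fun i => chi K (dbasis f i))) (map_mpoly (gal g) r).
    apply: etrans eM _; apply: eq_bigr => n _; congr (_ * _).
    by rewrite /= /dpoly mmapC.
  rewrite (ract_mmap gal (spec u) r Gg); apply: at_point_mmap => i.
  rewrite [X in at_point _ _ _ X](ract_chi gal _ Gg).
  have e2 : ratfun_act gal M1 g (spec u i) = spec_chi (lact M (dbasis f i) g).
    by rewrite -(spec_chi_basis i); apply: spec_chi_act.
  rewrite [X in at_point _ _ _ _ X]e2; exact: sp_chi.
have q0' : ratfun_act gal M1 g (mmap (fracC (rank M1)) (spec u) q) != 0 by rewrite (ract_eq0 gal _ Gg).
have qh := at_point_neq0 dpoly_inj q0' (pt q).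
have aE : ratfun_act gal M g a = ratfun_act gal M g (dpoly p) / ratfun_act gal M g (dpoly q).
  by apply: (canRL (mulfK qh)); rewrite -(ract_mul gal Gg) e.
have bE : ratfun_act gal M1 g b = ratfun_act gal M1 g (mmap (fracC (rank M1)) (spec u) p) /
    ratfun_act gal M1 g (mmap (fracC (rank M1)) (spec u) q).
  by apply: (canRL (mulfK q0')); rewrite -(ract_mul gal Gg) E.
rewrite aE bE; apply: at_pointM (pt p) _; exact: (at_pointV dpoly_inj q0' (pt q)).
Qed.

End OneCharacter.

(** Viewed as a polynomial in the coordinates of M2 with coefficients in K(M1), p is still nonzero,
    because substituting independent characters of M gives back [dpoly p]. Hence [char_dense]
    applies over K(M1). *)
Lemma spec_dense (io_inf : infinite_field k) (p : {mpoly K[N]}) :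
  galois 1 {:K} -> isom G 'Gal({:K} / 1) gal -> p != 0 ->
  exists u, equivariant_char gal u /\ mmap (fracC (rank M1)) (spec u) p != 0.
Proof.
move=> galoisK isoG p0; pose r2 := rank M2.
pose v (i : 'I_N) : {mpoly F1[r2]} := match split i with inl a => (chi K (lbasis M1 a))%:MP | inr b => 'X_b end.
pose Pi := mmap (@mpolyC r2 F1 \o fracC (rank M1)) v.
pose e1 := emb (dinl_algindep f_bij (K := K)).
have Pi0 : Pi p != 0.
  apply: contraNneq p0 => Pi0; apply/eqP/dpoly_inj; rewrite rmorph0.
  transitivity (mmap e1 (fun b => chi K (dinr f (lbasis M2 b))) (Pi p)); last by rewrite Pi0 rmorph0.
  rewrite mmap_comp; apply: eq_bigr => n _; congr (_ * _).
    exact: esym (emb_io (dinl_algindep f_bij (K := K)) _).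
  apply: eq_bigr => i _; congr (_ ^+ _); rewrite /dbasis /v; case: (split i) => a.
    by apply: esym; apply: etrans (mmapC _ _ _) _; apply: (emb_chi (dinl_algindep f_bij (K := K))).
  by apply: esym; apply: etrans (mmapX _ _ _) _; apply: mmap1U.
have [u [uP up]] := char_dense galoisK isoG io_inf (fracC (rank M1)) (bij_inj (lbasisP M2)) Pi0.
exists u; split; first exact: uP.
suff -> : mmap (fracC (rank M1)) (spec u) p = (Pi p).@[fun b => fracC (rank M1) (u (lbasis M2 b))] by exact: up.
apply: esym; apply: etrans (mmap_comp (fracC (rank M1)) idfun _ _ _) _; apply: eq_bigr => n _; congr (_ * _).
apply: eq_bigr => i _; congr (_ ^+ _); rewrite /v /spec; case: (split i) => a; first exact: mmapC.
by apply: etrans (mmapX _ _ _) _; apply: mmap1U.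
Qed.

Lemma torus_retract_summand_aux : infinite_field k -> galois 1 {:K} -> isom G 'Gal({:K} / 1) gal ->
  torus_retract gal M -> torus_retract gal M1.
Proof.
move=> k_inf galoisK isoG [m [y [w ts]]].
have frac x : exists nd : {mpoly K[N]} * {mpoly K[N]}, dpoly nd.2 != 0 /\ x * dpoly nd.2 = dpoly nd.1.
  have [p [q [q0 xE]]] := chi_gen (dbasis_spans f_bij)
    (fun i => genfield_var (fracC (rank M)) (fun i => chi K (dbasis f i)) i) x.
  by exists (p, q); split=> //; rewrite xE; apply: divfK.
have [fr frP] := choice frac.
have [pa paP] := choice (fun a => ts_point ts (dinl f (lbasis M1 a))); have [qa qaP] := choice paP.
pose ev := mmap (fracC (rank M)) y.
(* What u must not kill: the denominators of the [y i], so that the specialised point exists, and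
   the numerators and denominators of [ev (qa a)], so that the denominators of [w] on the basis of
   M1 do not vanish there. *)
pose Pi := (\prod_i (fr (y i)).2) * \prod_a ((fr (ev (qa a))).1 * (fr (ev (qa a))).2).
have nz p : dpoly p != 0 -> p != 0 by apply: contraNneq => ->; rewrite rmorph0.
have Pi0 : Pi != 0.
  rewrite mulf_neq0 //; apply/prodf_neq0 => a _; first exact: nz (frP _).1.
  have [q0 _ _] := qaP a; have [d0 e] := frP (ev (qa a)).
  apply: mulf_neq0; last exact: (nz _ d0).
  by apply: nz; rewrite -e; exact: (mulf_neq0 q0 d0).
have [u [uP uPi]] := spec_dense k_inf galoisK isoG Pi0.
pose S := mmap (fracC (rank M1)) (spec u).
move: uPi; rewrite rmorphM mulf_eq0 negb_or !rmorph_prod => /andP[/prodf_neq0 uy /prodf_neq0 uq].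
have uqa a : S (fr (ev (qa a))).1 != 0 /\ S (fr (ev (qa a))).2 != 0.
  by have := uq a isT; rewrite rmorphM mulf_eq0 negb_or => /andP.
pose y1 i := S (fr (y i)).1 / S (fr (y i)).2.
have spy i : sp u (y i) (y1 i).
  exists (fr (y i)).1, (fr (y i)).2; split; first exact: (uy i isT).
    exact: (frP _).2.
  exact: esym (divfK (uy i isT) _).
have spev r : sp u (ev r) (mmap (fracC (rank M1)) y1 r).
  have -> : ev r = mmap (dpoly \o @mpolyC N K) y r.
    by apply: eq_bigr => n _; congr (_ * _); rewrite /= /dpoly mmapC.
  exact: at_point_mmap.
have spl x : sp u (chi K (dinl f x)) (chi K x).
  by rewrite -(spec_chi_l uP); apply: sp_chi.
exists m, y1, (fun x => w (dinl f x)); split.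
- move=> i; apply/fixedP => g Gg; apply: (at_point_uniq dpoly_inj _ (spy i)).
  by have := sp_act uP Gg (spy i); have /fixedP -> := ts_fixed ts i.
- by move=> x z; rewrite raddfD (tsD ts).
- by move=> g Gg x; rewrite (ts_act ts Gg) -(dinl_act f_act Gg).
have tofrac_inj : injective (@tofrac {mpoly K[rank (trivial_lattice G m)]}).
  by move=> p q /eqP; rewrite tofrac_eq => /eqP.
have w0 x : w x != 0 := at_point_neq0 tofrac_inj (chi_neq0 K x) (ts_point ts x).
have wlD : {morph (fun x => w (dinl f x)) : x z / x + z >-> x * z}.
  by move=> x z; rewrite raddfD (tsD ts).
(* By multiplicativity the basis of M1 suffices, which is why finitely many denominators [qa a] were
   enough in [Pi]. *)
move=> x; rewrite -[x]lcoordK chi_zcomb (mult_zcomb wlD (fun x => w0 _)).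
apply: (at_point_prodXz tofrac_inj) => a; first exact: chi_neq0.
have [q0 e E] := qaP a; exists (pa a), (qa a).
have qE : mmap (fracC (rank M1)) y1 (qa a) = S (fr (ev (qa a))).1 / S (fr (ev (qa a))).2.
  apply: (at_point_uniq dpoly_inj (spev _)).
  have [_ d0] := uqa a; exists (fr (ev (qa a))).1, (fr (ev (qa a))).2; split; first exact: d0.
    exact: (frP _).2.
  exact: esym (divfK d0 _).
split; [|exact: e|].
  have [n0 d0] := uqa a; rewrite qE; apply: (mulf_neq0 n0); rewrite invr_eq0; exact: d0.
apply: (at_point_uniq dpoly_inj (spev _)); rewrite -/ev in E; rewrite E.
exact: at_pointM (spl _) (spev _).
Qed.

End Specialisation.

Lemma torus_retract_summand (k : fieldType) (K : splittingFieldType k)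
    (gT : finGroupType) (G : {group gT}) (gal : {morphism G >-> gal_of {:K}})
    (M M1 M2 : glattice G) : infinite_field k -> galois 1 {:K} -> isom G 'Gal({:K} / 1) gal ->
  direct_sum M M1 M2 -> torus_retract gal M -> torus_retract gal M1.
Proof. by move=> k_inf galoisK isoG [f [fb fG]]; apply: (torus_retract_summand_aux fb fG). Qed.

Theorem theorem6p5 (k : fieldType) (K : splittingFieldType k)
    (gT : finGroupType) (G : {group gT}) (gal : {morphism G >-> gal_of {:K}})
    (M M1 M2 : glattice G)
    (galK : galois 1 {:K}) (isoG : isom G 'Gal({:K} / 1) gal)
    (dec : direct_sum M M1 M2) (rk : (1 <= rank M1 < rank M)%N) :
  [/\ infinite_field k ->
        (retract_rational (base gal M) <->
           retract_rational (base gal M1) /\ retract_rational (base gal M2)),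
      rational (base gal M1) -> rational (base gal M2) -> rational (base gal M) &
      (rank M1 <= 3)%N -> (rank M2 <= 3)%N ->
        (rational (base gal M) <->
           rational (base gal M1) /\ rational (base gal M2))].
Proof.
have sum_rational : rational (base gal M1) -> rational (base gal M2) -> rational (base gal M).
  by have [f [f_bij f_act]] := dec; apply: (rational_direct_sum f_bij f_act galK isoG).
have decC := direct_sumC dec; split=> // [k_inf|r1 r2].
  rewrite !(retract_torusP _ galK isoG); split=> [retr|[retr1 retr2]].
    by split; [move: dec|move: decC] => d; apply: (torus_retract_summand k_inf galK isoG d retr).
  exact: torus_retract_sum dec retr1 retr2.
split=> [ratM|[rat1 rat2]]; last exact: sum_rational.
by split; [apply: (rational_summands galK isoG dec)|apply: (rational_summands galK isoG decC)].
Qed.
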